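(* Let $1\le p,q,r<\infty$, $\beta,\beta_0\in\mathbb{R}$, and let $p',q',r'$ be the conjugate exponents. Under the pairing $(f,h)_{\beta_0}=\iint_{\mathbb{R}^{n+1}_+}f(y,t)h(y,t)t^{-\beta_0-1}\,dy\,dt$, the dual of $T^{p,r}_{q,\beta}$ is $T^{p',r'}_{q',\beta_0-\beta}$: for every $h\in T^{p',r'}_{q',\beta_0-\beta}$, $f\mapsto(f,h)_{\beta_0}$ is a bounded linear functional on $T^{p,r}_{q,\beta}$, every bounded linear functional on $T^{p,r}_{q,\beta}$ is of this form for a unique such $h$, and the functional norm is equivalent to $\|h\|_{T^{p',r'}_{q',\beta_0-\beta}}$.
   Context: Let $\mathbb{R}^{n+1}_+=\mathbb{R}^n\times(0,\infty)$; functions are complex-valued measurable, identified a.e. $B(y,t)=\{z:|z-y|<t\}$, $\Gamma(x)=\{(y,t):|y-x|<t\}$, $\widehat{B}=\{(y,t):B(y,t)\subset B\}$ for an open ball $B\subset\mathbb{R}^n$. Fix Whitney parameters $0<\alpha_1<\alpha_2^{-1}<1$, $W(y,t)=\{(z,s):|z-y|<\alpha_1t,\ \alpha_2^{-1}t<s<\alpha_2t\}$, $\mathcal{W}_r(f)(y,t)=|W(y,t)|^{-1/r}\|f\|_{L^r(W(y,t))}$ ($r<\infty$), $\mathcal{W}_\infty(f)(y,t)=\operatorname{ess\,sup}_{W(y,t)}|f|$. Tent spaces $T^p_q$: (A) $p,q<\infty$: $\|g\|=\|(\iint_{\Gamma(x)}|g|^q\,dy\,dt/t^{n+1})^{1/q}\|_{L^p(dx)}$;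 (B) $q<p=\infty$: $\|g\|=\sup_x\sup_{B\ni x}|B|^{-1/q}(\iint_{\widehat B}|g|^q\,dy\,dt/t)^{1/q}$; (C) $p<q=\infty$: $\|g\|=\|\sup_{(y,t)\in\Gamma(x)}|g(y,t)|\|_{L^p(dx)}$; (D) $T^\infty_\infty=L^\infty$. $T^{p,r}_{q,\beta}$ is the space of $f$ with $\|f\|_{T^{p,r}_{q,\beta}}=\|\mathcal{W}_r(f(z,s)s^{-\beta})\|_{T^p_q}<\infty$. *)

(* Defs.v *)
From mathcomp Require Import all_boot all_order all_algebra.
From mathcomp Require Import all_classical all_reals all_analysis.
From mathcomp Require Import complex.
Set Implicit Arguments.
Unset Strict Implicit.
Unset Printing Implicit Defensive.
Import Order.TTheory GRing.Theory Num.Theory.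
Local Open Scope classical_set_scope.
Local Open Scope ring_scope.

(* Points (y,t) of R^n x R; y is an n-tuple of reals.  R^n carries the
   product (= Borel) sigma-algebra of the tuple type, R its Borel one. *)
Definition pt (R : realType) (n : nat) := (n.-tuple R * R)%type.

Definition edist (R : realType) (n : nat) (x y : n.-tuple R) : R :=
  Num.sqrt (\sum_(i < n) (tnth x i - tnth y i) ^+ 2).

Definition ball_n (R : realType) (n : nat) (c : n.-tuple R) (rho : R)
  : set (n.-tuple R) := [set z | edist z c < rho].

(* Lebesgue integral on R^n of a nonnegative (or integrable) measurable
   function, computed as the iterated one-dimensional Lebesgue integral
   (Tonelli/Fubini). *)
Fixpoint iint (R : realType) (n : nat) : (n.-tuple R -> \bar R) -> \bar R :=
  match n return (n.-tuple R -> \bar R) -> \bar R with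
  | 0 => fun F => F [tuple]
  | k.+1 => fun F =>
      (\int[@lebesgue_measure R]_x iint (fun y : k.-tuple R => F [tuple of x :: y]))%E
  end.

Definition fint (R : realType) (n : nat) (G : pt R n -> \bar R) : \bar R :=
  (\int[@lebesgue_measure R]_t iint (fun y => G (y, t)))%E.

Definition restr (R : realType) (n : nat) (S : set (pt R n)) (G : pt R n -> \bar R)
  : pt R n -> \bar R := fun z => if `[< S z >] then G z else 0%E.

Definition sint (R : realType) (n : nat) (S : set (pt R n)) (G : pt R n -> \bar R)
  : \bar R := fint (restr S G).

Definition upper (R : realType) (n : nat) : set (pt R n) := [set z | 0 < z.2].

Definition vol (R : realType) (n : nat) (S : set (pt R n)) : \bar R :=
  sint S (fun _ => 1%E).
Definition voln (R : realType) (n : nat) (B : set (n.-tuple R)) : \bar R :=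
  iint (fun y => if `[< B y >] then 1%E else 0%E).

Definition null (R : realType) (n : nat) (A : set (pt R n)) : Prop :=
  exists B : set (pt R n), measurable B /\ A `<=` B /\ vol B = 0%E.

Definition esssup (R : realType) (n : nat) (A : set (pt R n)) (G : pt R n -> \bar R)
  : \bar R := ereal_inf [set M : \bar R | null [set z | A z /\ (M < G z)%E]].

Definition cabs (R : realType) (z : R[i]) : R :=
  Num.sqrt (complex.Re z ^+ 2 + complex.Im z ^+ 2).
Definition cmeasurable (R : realType) (n : nat) (f : pt R n -> R[i]) : Prop :=
  measurable_fun setT (fun z => complex.Re (f z)) /\
  measurable_fun setT (fun z => complex.Im (f z)).

Definition whitney (R : realType) (n : nat) (a1 a2 : R) (z : pt R n) : set (pt R n) :=
  [set w | edist w.1 z.1 < a1 * z.2 /\ a2^-1 * z.2 < w.2 < a2 * z.2].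

Definition Wr (R : realType) (n : nat) (a1 a2 : R) (r : \bar R)
  (f : pt R n -> R[i]) (z : pt R n) : \bar R :=
  match r with
  | r'%:E => (vol (whitney a1 a2 z) `^ (- r'^-1) *
             (sint (whitney a1 a2 z) (fun w => (cabs (f w))%:E `^ r')) `^ (r'^-1))%E
  | +oo%E => esssup (whitney a1 a2 z) (fun w => (cabs (f w))%:E)
  | -oo%E => +oo%E
  end.

Definition wt (R : realType) (n : nat) (beta : R) (f : pt R n -> R[i]) : pt R n -> R[i] :=
  fun w => f w * (w.2 `^ (- beta))%:C%C.

Definition cone (R : realType) (n : nat) (x : n.-tuple R) : set (pt R n) :=
  [set z | 0 < z.2 /\ edist z.1 x < z.2].
Definition tent_hat (R : realType) (n : nat) (c : n.-tuple R) (rho : R) : set (pt R n) :=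
  [set z | 0 < z.2 /\ ball_n z.1 z.2 `<=` ball_n c rho].

Definition tnorm (R : realType) (n : nat) (P Q : \bar R) (g : pt R n -> \bar R) : \bar R :=
  match P, Q with
  | p%:E, q%:E =>
      (iint (fun x => (sint (cone x) (fun z => g z `^ q * ((z.2 ^+ n.+1)^-1)%R%:E))
                        `^ (q^-1) `^ p)) `^ (p^-1)
  | +oo, q%:E =>
      ereal_sup [set v | exists (x c : n.-tuple R) (rho : R),
                   (0 < rho)%R /\ ball_n c rho x /\
                   v = voln (ball_n c rho) `^ (- q^-1) *
                       (sint (tent_hat c rho) (fun z => g z `^ q * (z.2^-1)%R%:E)) `^ (q^-1)]
  | p%:E, +oo => (iint (fun x => (ereal_sup [set g z | z in cone x]) `^ p)) `^ (p^-1)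
  | +oo, +oo => esssup (@upper R n) g
  | _, _ => +oo
  end%E.

Definition tent_norm (R : realType) (n : nat) (a1 a2 : R) (P Q Rr : \bar R) (beta : R)
  (f : pt R n -> R[i]) : \bar R := tnorm P Q (Wr a1 a2 Rr (wt beta f)).
Definition inTent (R : realType) (n : nat) (a1 a2 : R) (P Q Rr : \bar R) (beta : R)
  (f : pt R n -> R[i]) : Prop :=
  cmeasurable f /\ (tent_norm a1 a2 P Q Rr beta f < +oo)%E.

Definition hintegrable (R : realType) (n : nat) (F : pt R n -> R[i]) : Prop :=
  cmeasurable F /\ (sint (@upper R n) (fun z => (cabs (F z))%:E) < +oo)%E.
Definition hint_c (R : realType) (n : nat) (F : pt R n -> R[i]) : R[i] :=
  (fine (sint (@upper R n) (fun z => (complex.Re (F z))%:E)) +i*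
   fine (sint (@upper R n) (fun z => (complex.Im (F z))%:E)))%C.

Definition pair_integrand (R : realType) (n : nat) (beta0 : R) (f h : pt R n -> R[i])
  : pt R n -> R[i] := fun z => f z * h z * (z.2 `^ (- beta0 - 1))%:C%C.
Definition pairing (R : realType) (n : nat) (beta0 : R) (f h : pt R n -> R[i]) : R[i] :=
  hint_c (pair_integrand beta0 f h).

Definition conj_exp (R : realType) (p : R) : \bar R :=
  if p == 1 then +oo%E else (p / (p - 1))%:E.

(* Main.v *)
(* Write [F = |f| t^-beta] and [H = |h| t^(beta-beta0)], so that [|f h| t^(-beta0-1) = F H / t].
   Cutting the half space into slabs [t ~ a2^i s0] and each slab into boxes of a grid whose
   mesh is proportional to the height, Whitney averages are comparable, up to a change of
   aperture, with the L^r averages of F over the boxes, and the tent norms with discrete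
   square-function or Carleson norms of these averages.  On the discrete side the changes of
   aperture are bounded by Doob-type inequalities for the self-adjoint averaging operators,
   and the Hoelder inequality and its converse (every H of finite dual norm is normed by
   bounded F of compact support) come from explicit extremal sequences: powers of partial
   sums when p, q > 1, increments of running maxima when q = 1, and sequences supported in
   a single cell when p = 1.  Monotone convergence removes the
   compact supports and gives [<F, H> <= C |F| |H|] and [|H| <= C sup <F, H> / |F|].

   A bounded functional L evaluated on [1_A t^beta], with A inside a fixed compact box, is a
   complex measure absolutely continuous with respect to Lebesgue measure; the
   Radon-Nikodym densities glue to a function h, and the norming inequality shows that h
   lies in the dual tent space.  Since [|f 1_(B_j)| -> 0] in norm whenever the sets [B_j]
   decrease to the empty set, truncations of f are dense and L is the pairing with h. *)
From HB Require Import structures.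
Require Import Defs.
From mathcomp Require Import all_boot all_order all_algebra.
From mathcomp Require Import all_classical all_reals all_analysis.
From mathcomp Require Import measurable_realfun complex.
From mathcomp Require Import ring lra.
Import Order.TTheory GRing.Theory Num.Theory.
Local Open Scope classical_set_scope.
Local Open Scope ring_scope.
Set Implicit Arguments.
Unset Strict Implicit.
Unset Printing Implicit Defensive.

(** * Iterated integrals as integrals over product measures *)

Local Notation edist := Defs.edist.

(** Two grids are needed at each height. The fine grid [G] has boxes lying in the Whitney region of
    each of their points, which gives lower bounds for tent norms. For upper bounds a Whitney region
    seen from the cone at x must fit in a single cell around x; no single grid does this, but one of
    the 2^n translates [D b] by half cells does. Half-cell translates stay nested from level to
    level when the ratios of meshes are odd, so meshes are powers of 3. Passing from cells of [G] to
    cells of [D b] is the change of aperture; for exponents p/q < 1 it comes not from convexity but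
    from a factorisation through partial sums.

    The discretisation constants are independent of the top height [s0] and of the number of levels,
    so a grid may be fitted to the support of each function. Bounds are mostly stated with positive
    real majorants of norms, which keeps infinite values and division by zero out of the estimates.
    Since integrals are given as iterated integrals, they are identified with integrals over
    sigma-finite measures, at once for nonnegative functions and later for integrable ones. *)

Lemma le_int0 d (T : measurableType d) (R : realType) (mu : {measure set T -> \bar R})
  (f g : T -> \bar R) : (forall x, 0 <= f x)%E -> (forall x, f x <= g x)%E ->
  (\int[mu]_x f x <= \int[mu]_x g x)%E.
Proof.
move=> f0 fg; have g0 x : (0 <= g x)%E by apply: le_trans (fg x).
rewrite !ge0_integralTE//; apply: ereal_sup_le => y [h hf <-].
exists h => // x; exact: le_trans (hf x) (fg x).
Qed.

Section pushforward_iso.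
Context d1 d2 (T1 : measurableType d1) (T2 : measurableType d2) (R : realType).
Variables (m : {sigma_finite_measure set T1 -> \bar R}) (f : T1 -> T2) (g : T2 -> T1).
Hypotheses (mf : measurable_fun setT f) (mg : measurable_fun setT g) (fK : cancel f g).

Let pf := pushforward m f.
HB.instance Definition _ := Measure.copy pf
  (measure_function_pushforward__canonical__measure_function_Measure m mf).

Let pushforward_sigma_finite : sigma_finite setT pf.
Proof.
have [F TF Foo] := sigma_finiteT m.
exists (fun k => g @^-1` (F k)); first by rewrite -preimage_bigcup -TF preimage_setT.
move=> k; have [mF Fk] := Foo k; split.
  by rewrite -[X in measurable X]setTI; exact: mg.
rewrite /pf /pushforward (_ : f @^-1` _ = F k)//.
by apply/seteqP; split => z /=; rewrite fK.
Qed.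

HB.instance Definition _ := Measure_isSigmaFinite.Build _ _ _ pf pushforward_sigma_finite.

(** The measurable left inverse [g] carries an exhausting sequence of sets of finite measure to the
    target, so the image measure is again sigma-finite. *)
Lemma pushforward_iso : {m' : {sigma_finite_measure set T2 -> \bar R} |
  forall F : T2 -> \bar R, measurable_fun setT F -> (forall x, 0 <= F x)%E ->
    (\int[m']_x F x = \int[m]_x F (f x))%E}.
Proof.
exists [the {sigma_finite_measure set T2 -> \bar R} of pf] => F mF F0.
have := @ge0_integral_pushforward _ _ _ _ _ f mf m setT F measurableT mF.
by rewrite preimage_setT; apply=> x _.
Qed.

End pushforward_iso.

Section prodm.
Context d1 d2 (T1 : measurableType d1) (T2 : measurableType d2) (R : realType).
Variables (m1 : {sigma_finite_measure set T1 -> \bar R})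
  (m2 : {sigma_finite_measure set T2 -> \bar R}).

(** A named copy of the product measure that can carry a sigma-finite structure, so that it can
    itself be pushed forward or serve as a factor. *)
Definition prodm : set (T1 * T2) -> \bar R := (m1 \x m2)%E.
HB.instance Definition _ := Measure.copy prodm [the measure _ _ of (m1 \x m2)%E].

Let prodm_sigma_finite : sigma_finite setT prodm.
Proof.
have /sigma_finiteP[F [TF ndF Foo]] := sigma_finiteT m1.
have /sigma_finiteP[G [TG ndG Goo]] := sigma_finiteT m2.
exists (fun k => F k `*` G k).
  rewrite -setXTT TF TG predeqE => -[x y]; split.
    move=> [/= [i _ Fx] [k _ Gy]]; exists (maxn i k) => //; split.
      by move: x Fx; exact/subsetPset/ndF/leq_maxl.
    by move: y Gy; exact/subsetPset/ndG/leq_maxr.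
  by move=> [i _ []/= ? ?]; split; exists i.
move=> k; have [? ?] := Foo k; have [? ?] := Goo k.
split; first exact: measurableX.
by rewrite /prodm product_measure1E// lte_mul_pinfty// ge0_fin_numE.
Qed.

HB.instance Definition _ := Measure_isSigmaFinite.Build _ _ _ prodm prodm_sigma_finite.

Lemma integral_prodm1 (F : T1 * T2 -> \bar R) : measurable_fun setT F ->
  (forall x, 0 <= F x)%E -> (\int[prodm]_z F z = \int[m1]_x \int[m2]_y F (x, y))%E.
Proof. exact: fubini_tonelli1. Qed.

Lemma integral_prodm2 (F : T1 * T2 -> \bar R) : measurable_fun setT F ->
  (forall x, 0 <= F x)%E -> (\int[prodm]_z F z = \int[m2]_y \int[m1]_x F (x, y))%E.
Proof. exact: fubini_tonelli2. Qed.

Lemma measurable_int1 (F : T1 * T2 -> \bar R) : measurable_fun setT F ->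
  (forall x, 0 <= F x)%E -> measurable_fun setT (fun x => \int[m2]_y F (x, y))%E.
Proof. exact: measurable_fun_fubini_tonelli_F. Qed.

Lemma measurable_int2 (F : T1 * T2 -> \bar R) : measurable_fun setT F ->
  (forall x, 0 <= F x)%E -> measurable_fun setT (fun y => \int[m1]_x F (x, y))%E.
Proof. exact: measurable_fun_fubini_tonelli_G. Qed.

End prodm.

Section cons_measure.
Context (R : realType) (n : nat).

Definition tcons (z : R * n.-tuple R) : n.+1.-tuple R := [tuple of z.1 :: z.2].
Definition tuncons (x : n.+1.-tuple R) : R * n.-tuple R := (thead x, [tuple of behead x]).

Lemma tconsK : cancel tcons tuncons.
Proof. by move=> [a x]; rewrite /tuncons/tcons/= theadE; congr pair; exact: val_inj. Qed.

Lemma measurable_tcons : measurable_fun setT tcons.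
Proof.
by apply: (@measurable_cons _ _ _ _ fst n snd); [exact: measurable_fst|exact: measurable_snd].
Qed.

Lemma measurable_tuncons : measurable_fun setT tuncons.
Proof.
apply/measurable_fun_pairP; split.
  exact: (measurable_tnth ord0).
exact: measurable_behead.
Qed.

End cons_measure.

Lemma lam_measure (R : realType) : {m' : {sigma_finite_measure set R -> \bar R} |
  forall F : R -> \bar R, measurable_fun setT F -> (forall x, 0 <= F x)%E ->
    (\int[m']_x F x = \int[@lebesgue_measure R]_x F x)%E}.
Proof.
have m1 : @measurable_fun _ _ (measurableTypeR R) R setT (fun x => x).
  by move=> _ A mA; rewrite setTI.
have m2 : @measurable_fun _ _ R (measurableTypeR R) setT (fun x => x).
  by move=> _ A mA; rewrite setTI.
exact: (@pushforward_iso _ _ (measurableTypeR R) R R (@lebesgue_measure R)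
  (fun x => x) (fun x => x) m1 m2 (fun x => erefl)).
Qed.

(* The Lebesgue measure of the library lives on another display of the Borel sigma-algebra. *)
Definition lam (R : realType) : {sigma_finite_measure set R -> \bar R} := sval (lam_measure R).

Lemma integral_lam (R : realType) (F : R -> \bar R) : measurable_fun setT F ->
  (forall x, 0 <= F x)%E -> (\int[@lebesgue_measure R]_x F x = \int[lam R]_x F x)%E.
Proof. by move=> mF F0; rewrite -(svalP (lam_measure R)). Qed.

(** The measure behind the iterated integral is built by recursion: a Dirac mass at the empty tuple,
    then the image under [tcons] of the product of [lam] with the previous measure. Tonelli
    identifies the integrals. A sigma type is used because this formula is all that is needed of the
    measure. *)
Lemma iint_measure (R : realType) n :
  {m : {sigma_finite_measure set (n.-tuple R) -> \bar R} | forall F : n.-tuple R -> \bar R,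
    measurable_fun setT F -> (forall x, 0 <= F x)%E -> iint F = (\int[m]_x F x)%E}.
Proof.
elim: n => [|n [m IH]].
  exists (dirac ([tuple] : 0.-tuple R)) => F mF F0 /=.
  by rewrite integral_dirac// diracT mul1e.
have [m' Hm'] := pushforward_iso (prodm (lam R) m) (@measurable_tcons R n)
  (@measurable_tuncons R n) (@tconsK R n).
exists m' => F mF F0.
have mFc : measurable_fun setT (F \o @tcons R n).
  exact: (measurableT_comp mF (@measurable_tcons R n)).
rewrite Hm'// integral_prodm1//= -integral_lam//.
- apply: eq_integral => a _; rewrite IH//.
  exact: (measurableT_comp mFc (measurable_pair1 a)).
- by apply: (@measurable_int1 _ _ _ _ _ m (F \o @tcons R n) mFc) => x; exact: F0.
- by move=> a; apply: integral_ge0.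
Qed.

Definition leb (R : realType) n : {sigma_finite_measure set (n.-tuple R) -> \bar R} :=
  sval (iint_measure R n).

Definition leb1 (R : realType) n : {sigma_finite_measure set (pt R n) -> \bar R} :=
  prodm (leb R n) (lam R).

Lemma iintE (R : realType) n (F : n.-tuple R -> \bar R) : measurable_fun setT F ->
  (forall x, 0 <= F x)%E -> iint F = (\int[leb R n]_x F x)%E.
Proof. exact: (svalP (iint_measure R n)). Qed.

Lemma iint_ge0 (R : realType) n (F : n.-tuple R -> \bar R) :
  (forall x, 0 <= F x)%E -> (0 <= iint F)%E.
Proof.
elim: n F => [|n IH] F F0 //=; apply: integral_ge0 => a _.
exact: IH.
Qed.

(** The integral of a nonnegative function is a supremum over the simple functions below it, so
    monotonicity passes through every stage of the iteration for arbitrary nonnegative functions. *)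
Lemma le_iint (R : realType) n (F G : n.-tuple R -> \bar R) :
  (forall x, 0 <= F x)%E -> (forall x, F x <= G x)%E -> (iint F <= iint G)%E.
Proof.
elim: n F G => [|n IH] F G F0 FG //=; apply: le_int0 => a; first exact: iint_ge0.
exact: IH.
Qed.

Lemma le_fint (R : realType) n (F G : pt R n -> \bar R) :
  (forall x, 0 <= F x)%E -> (forall x, F x <= G x)%E -> (fint F <= fint G)%E.
Proof.
move=> F0 FG; apply: le_int0 => t; first exact: iint_ge0.
exact: le_iint.
Qed.

Lemma fintE (R : realType) n (F : pt R n -> \bar R) : measurable_fun setT F ->
  (forall x, 0 <= F x)%E -> fint F = (\int[leb1 R n]_x F x)%E.
Proof.
move=> mF F0; rewrite /leb1 integral_prodm2// -integral_lam//; last 2 first.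
- exact: (@measurable_int2 _ _ _ _ _ (leb R n) F).
- by move=> t; apply: integral_ge0.
apply: eq_integral => t _.
rewrite iintE//; exact: (measurableT_comp mF (measurable_pair2 t)).
Qed.

(** * Inequalities for real powers *)

Section powR_inequalities.
Variable R : realType.
Implicit Types (a b d k p q t w x y A : R).

(** Young's inequality for the product of x^t and 1, with exponents 1/t and 1/(1 - t). It is the
    tangent line of a concave power at 1. *)
Lemma powR_affine t x : 0 <= x -> 0 <= t <= 1 -> x `^ t <= t * x + (1 - t).
Proof.
move=> x0 /andP[]; rewrite le_eqVlt => /predU1P[<- _|t0].
  by rewrite powRr0 mul0r add0r subr0.
rewrite le_eqVlt => /predU1P[->|t1]; first by rewrite powRr1// mul1r subrr addr0.
have := @conjugate_powR R (x `^ t) 1 t^-1 (1 - t)^-1 (powR_ge0 _ _) ler01.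
rewrite !invrK !invr_gt0 subr_gt0 addrC subrK => /(_ t0 t1 erefl).
by rewrite -powRrM mulfV ?gt_eqF// powRr1// powR1 mulr1 mul1r mulrC.
Qed.

(** For k <= 1 simply w <= w^k on [0,1]; for k > 1 the affine bound is applied to w^k with exponent
    1/k. *)
Lemma sub1_powR_ub k w : 0 < k -> 0 <= w <= 1 -> 1 - w `^ k <= Num.max 1 k * (1 - w).
Proof.
move=> k0 /andP[w0 w1]; have [k1|k1] := leP k 1.
  rewrite mul1r lerD2l lerN2.
  move: w0; rewrite le_eqVlt => /predU1P[<-|w0]; first exact: powR_ge0.
  by apply: ger1_powR => //; rewrite w0.
have := @powR_affine k^-1 (w `^ k) (powR_ge0 _ _).
rewrite -powRrM mulfV ?gt_eqF// powRr1// invr_ge0 (ltW k0) invf_le1// (ltW k1).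
move=> /(_ isT) h; have := ler_wpM2l (ltW k0) h.
rewrite mulrDr mulrA mulfV ?gt_eqF// mul1r mulrBr mulr1 mulfV ?gt_eqF//; lra.
Qed.

Lemma sub1_powR_lb k w : 0 < k -> 0 <= w <= 1 -> 1 - w <= Num.max 1 k^-1 * (1 - w `^ k).
Proof.
move=> k0 /andP[w0 w1]; have [k1|k1] := leP k^-1 1.
  rewrite mul1r lerD2l lerN2.
  move: w0; rewrite le_eqVlt => /predU1P[<-|w0]; first by rewrite powR0// gt_eqF.
  apply: ge1r_powR; first by rewrite w0.
  by move: k1; rewrite invf_le1.
have k1' : k <= 1 by move: k1; rewrite invf_gt1// => /ltW.
have := @powR_affine k w w0; rewrite (ltW k0) k1' => /(_ isT) h.
rewrite ler_pdivlMl//; lra.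
Qed.

(** By homogeneity an increment of A^k depends only on the ratio w = (A - d)/A in [0,1], so both
    increment estimates reduce to comparing 1 - w^k with 1 - w. *)
Lemma powR_incr_rescale k d A : 0 < k -> 0 < A -> 0 <= d <= A ->
  let w := (A - d) / A in
  [/\ 0 <= w <= 1, d * A `^ (k - 1) = (1 - w) * A `^ k
    & A `^ k - (A - d) `^ k = (1 - w `^ k) * A `^ k].
Proof.
move=> k0 A0 /andP[d0 dA] w.
have wd : (A - d) = w * A by rewrite /w divfK// gt_eqF.
have dE : d = (1 - w) * A by rewrite mulrBl mul1r -wd; lra.
split.
- by rewrite /w divr_ge0 ?subr_ge0 ?(ltW A0)//= ler_pdivrMr// mul1r gerBl.
- by rewrite {1}dE -mulrA mulr_powRB1// ltW.
- rewrite wd powRM ?(ltW A0)//; last by rewrite /w divr_ge0 ?subr_ge0 ?(ltW A0).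
  by rewrite mulrBl mul1r.
Qed.

Lemma powR_incr_ub k d A : 0 < k -> 0 <= d <= A ->
  d * A `^ (k - 1) <= Num.max 1 k^-1 * (A `^ k - (A - d) `^ k).
Proof.
move=> k0 /andP[d0 dA]; move: (le_trans d0 dA); rewrite le_eqVlt => /predU1P[A0|A0].
  have -> : d = 0 by lra.
  by rewrite mul0r subr0 subrr mulr0.
have [w01 -> ->] := powR_incr_rescale k0 A0 (introT andP (conj d0 dA)).
rewrite mulrA; apply: ler_wpM2r; first exact: powR_ge0.
exact: sub1_powR_lb.
Qed.

Lemma powR_incr_lb k d A : 0 < k -> 0 <= d <= A ->
  A `^ k - (A - d) `^ k <= Num.max 1 k * (d * A `^ (k - 1)).
Proof.
move=> k0 /andP[d0 dA]; move: (le_trans d0 dA); rewrite le_eqVlt => /predU1P[A0|A0].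
  have -> : d = 0 by lra.
  by rewrite mul0r subr0 subrr mulr0.
have [w01 -> ->] := powR_incr_rescale k0 A0 (introT andP (conj d0 dA)).
rewrite mulrA; apply: ler_wpM2r; first exact: powR_ge0.
exact: sub1_powR_ub.
Qed.

(** The term of index [i] is included. Hence d_i is at most [psum d i], and a negative power of the
    partial sum is always compensated by the factor d_i. *)
Definition psum (d : nat -> R) i := \sum_(j < i.+1) d j.

Lemma psum_ge0 (d : nat -> R) i : (forall j, 0 <= d j) -> 0 <= psum d i.
Proof. by move=> d0; apply: sumr_ge0. Qed.

Lemma psumS (d : nat -> R) i : psum d i = \sum_(j < i) d j + d i.
Proof. by rewrite /psum big_ord_recr. Qed.

Lemma sum_le_psum (d : nat -> R) i N : (forall j, 0 <= d j) -> (i < N)%N ->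
  psum d i <= \sum_(j < N) d j.
Proof.
move=> d0 iN; rewrite -(subnK iN) addnC big_split_ord/= /psum lerDl.
exact: sumr_ge0.
Qed.

(** Discrete form of integrating S^(k-1) dS to S^k/k: each term is bounded by an increment of the
    k-th power of the partial sums, and these telescope. With the converse below, power sums can be
    handled for every exponent k > 0. *)
Lemma sum_powR_incr_ub k (d : nat -> R) N : 0 < k -> (forall i, 0 <= d i) ->
  \sum_(i < N) d i * psum d i `^ (k - 1) <=
  Num.max 1 k^-1 * (\sum_(i < N) d i) `^ k.
Proof.
move=> k0 d0; elim: N => [|N IH].
  by rewrite !big_ord0 powR0 ?gt_eqF// mulr0.
rewrite big_ord_recr/= (big_ord_recr N)/=.
have := @powR_incr_ub k (d N) (psum d N) k0.
have s0 : 0 <= \sum_(i < N) d i by apply: sumr_ge0.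
rewrite d0 psumS lerDr s0 => /(_ isT).
rewrite addrK mulrBr; lra.
Qed.

Lemma sum_powR_incr_lb k (d : nat -> R) N : 0 < k -> (forall i, 0 <= d i) ->
  (\sum_(i < N) d i) `^ k <=
  Num.max 1 k * \sum_(i < N) d i * psum d i `^ (k - 1).
Proof.
move=> k0 d0; elim: N => [|N IH].
  by rewrite !big_ord0 powR0 ?gt_eqF// mulr0.
rewrite big_ord_recr/= (big_ord_recr N)/= mulrDr.
have := @powR_incr_lb k (d N) (psum d N) k0.
have s0 : 0 <= \sum_(i < N) d i by apply: sumr_ge0.
rewrite d0 psumS lerDr s0 => /(_ isT).
rewrite addrK; lra.
Qed.

(** Each term is at most the q-th root of the sum of the q-th powers; the resulting constant is
    crude but serves all q > 0 at once. *)
Lemma powR_sum_le (I : Type) (s : seq I) (x : I -> R) q : 0 < q ->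
  (forall i, 0 <= x i) ->
  (\sum_(i <- s) x i) `^ q <= (size s)%:R `^ q * \sum_(i <- s) x i `^ q.
Proof.
move=> q0 x0; set S := \sum_(i <- s) _ `^ q.
have S0 : 0 <= S by apply: sumr_ge0 => i _; exact: powR_ge0.
have xS : {in predT, forall i, True} by [].
suff h : \sum_(i <- s) x i <= (size s)%:R * S `^ q^-1.
  have := ge0_ler_powR (ltW q0) _ _ h; rewrite !nnegrE => /(_ _ _)/le_trans; apply.
  - exact: sumr_ge0.
  - by rewrite mulr_ge0// powR_ge0.
  - by rewrite powRM ?powR_ge0// -powRrM mulVf ?gt_eqF// powRr1.
rewrite /S {xS S S0}; elim: s => [|i s IH]; first by rewrite !big_nil mul0r.
rewrite !big_cons/= -natr1 mulrDl mul1r addrC; apply: lerD.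
  apply: (le_trans IH); apply: ler_wpM2l => //.
  apply: ge0_ler_powR; rewrite ?invr_ge0 ?(ltW q0)// ?nnegrE ?addr_ge0 ?powR_ge0//.
  - by apply: sumr_ge0 => j _; exact: powR_ge0.
  - by apply: sumr_ge0 => j _; exact: powR_ge0.
  - by rewrite lerDr powR_ge0.
have -> : x i = (x i `^ q) `^ q^-1 by rewrite -powRrM mulfV ?gt_eqF// powRr1.
apply: ge0_ler_powR; rewrite ?invr_ge0 ?(ltW q0)// ?nnegrE ?addr_ge0 ?powR_ge0//.
- by apply: sumr_ge0 => j _; exact: powR_ge0.
- by rewrite -powRrM mulVf ?gt_eqF// powRr1 ?powR_ge0// lerDl; apply: sumr_ge0 => j _; exact: powR_ge0.
Qed.

Lemma powRdiv x y r : 0 <= x -> 0 < y -> (x / y) `^ r = x `^ r / y `^ r.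
Proof.
move=> x0 y0; rewrite powRM ?invr_ge0 ?(ltW y0)// -(powR_inv1 (ltW y0)).
by rewrite -powRrM mulN1r powRN.
Qed.

(** Allows a Hoelder-type inequality to be proved with strictly positive majorants of the two norms,
    by which one may divide, before letting the excess tend to 0. *)
Lemma le_mul_eps x y z : 0 <= x -> 0 <= y ->
  (forall e, 0 < e -> z <= (x + e) * (y + e)) -> z <= x * y.
Proof.
move=> x0 y0 h; apply/ler_addgt0Pr => e e0.
pose f := Num.min 1 (e / (1 + x + y)).
have xy0 : 0 < 1 + x + y by rewrite -addrA ltr_pwDl ?addr_ge0.
have f0 : 0 < f by rewrite lt_min ltr01 divr_gt0.
apply: (le_trans (h f f0)).
have f1 : f <= 1 by rewrite ge_min lexx.
have f2 : f * (1 + x + y) <= e by rewrite -ler_pdivlMr// ge_min lexx orbT.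
have : f * f <= f * 1 by rewrite ler_wpM2l// ltW.
move: f1 f2; clearbody f; clear -R; lra.
Qed.

Lemma hoelder_sum (I : Type) (s : seq I) (a b : I -> R) p q :
  0 < p -> 0 < q -> p^-1 + q^-1 = 1 -> (forall i, 0 <= a i) -> (forall i, 0 <= b i) ->
  \sum_(i <- s) a i * b i <=
  (\sum_(i <- s) a i `^ p) `^ p^-1 * (\sum_(i <- s) b i `^ q) `^ q^-1.
Proof.
move=> p0 q0 pq a0 b0.
suff main (c e : R) : 0 < c -> 0 < e -> \sum_(i <- s) a i `^ p <= c `^ p ->
    \sum_(i <- s) b i `^ q <= e `^ q -> \sum_(i <- s) a i * b i <= c * e.
  set S := \sum_(i <- s) a i `^ p; set U := \sum_(i <- s) b i `^ q.
  have S0 : 0 <= S by apply: sumr_ge0 => i _; exact: powR_ge0.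
  have U0 : 0 <= U by apply: sumr_ge0 => i _; exact: powR_ge0.
  have S1 : 0 <= S `^ p^-1 by exact: powR_ge0.
  have U1 : 0 <= U `^ q^-1 by exact: powR_ge0.
  have aux (r x e : R) : 0 < r -> 0 <= x -> 0 < e -> x <= (x `^ r^-1 + e) `^ r.
    move=> r0 x0 e0; rewrite -[X in X <= _]powRr1// -[X in x `^ X](mulVf (lt0r_neq0 r0)) powRrM.
    by apply: ge0_ler_powR; rewrite ?(ltW r0)// ?nnegrE ?addr_ge0 ?powR_ge0 ?(ltW e0)// lerDl ltW.
  apply: le_mul_eps => // e e0.
  exact: (main _ _ (ltr_wpDl S1 e0) (ltr_wpDl U1 e0) (aux _ _ _ p0 S0 e0) (aux _ _ _ q0 U0 e0)).
move=> c0 e0 hc he.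
have h i : a i * b i <= (c * e) * (a i `^ p / c `^ p / p + b i `^ q / e `^ q / q).
  have := @conjugate_powR R (a i / c) (b i / e) p q.
  move=> /(_ (divr_ge0 (a0 i) (ltW c0)) (divr_ge0 (b0 i) (ltW e0)) p0 q0 pq).
  rewrite !powRdiv// => h; rewrite [X in X <= _](_ : _ = c * e * (a i / c * (b i / e))).
    by apply: ler_wpM2l => //; rewrite mulr_ge0 ?ltW.
  by rewrite mulrACA (mulrC c) (mulrC e) !divfK ?gt_eqF.
apply: (le_trans (ler_sum _ (fun i _ => h i))).
rewrite -mulr_sumr -[X in _ <= X]mulr1; apply: ler_wpM2l; first by rewrite mulr_ge0// ltW.
rewrite big_split/= -!mulr_suml -pq; apply: lerD.
  by rewrite ler_piMl ?invr_ge0 ?(ltW p0)// ler_pdivrMr ?powR_gt0// mul1r.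
by rewrite ler_piMl ?invr_ge0 ?(ltW q0)// ler_pdivrMr ?powR_gt0// mul1r.
Qed.

End powR_inequalities.

(** * Averages over nested grids *)

Section grid.
Context d (T : measurableType d) (R : realType) (mu : {sigma_finite_measure set T -> \bar R}).
Variable I : countType.
Implicit Types (ix jx : T -> I) (u f g : T -> R) (x y : T).

Definition cell ix x : set T := [set y | ix y = ix x].
Definition adapted (S : Type) ix (u : T -> S) := forall x y, ix x = ix y -> u x = u y.
(** A grid is coded by its index map, whose fibres are the cells; refinement of grids then becomes
    an implication between equalities of indices. All cells have the same measure [v], so averaging
    has a constant normalisation. *)
Definition grid ix (v : R) := [/\ 0 < v, forall k, measurable (ix @^-1` [set k])
  & forall x, mu (cell ix x) = v%:E].
(** For such functions the integral over a cell is finite, and averages can be real-valued without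
    loss. *)
Definition bnd u := measurable_fun setT u /\ exists c, forall x, 0 <= u x <= c.
(** This is the conditional expectation on the partition into cells. *)
Definition avg ix (v : R) u x : R := v^-1 * fine (\int[mu]_(y in cell ix x) (u y)%:E)%E.
Definition intR u : \bar R := (\int[mu]_x (u x)%:E)%E.
Local Notation Int := intR.

Lemma bnd_m u : bnd u -> measurable_fun setT u. Proof. by case. Qed.
Lemma bnd_ge0 u x : bnd u -> 0 <= u x.
Proof. by move=> [_ [c /(_ x)/andP[]]]. Qed.

Lemma bnd_cst c : 0 <= c -> bnd (fun=> c).
Proof. by move=> c0; split; [exact: measurable_cst|exists c => x; rewrite c0/=]. Qed.

Lemma bnd_add u w : bnd u -> bnd w -> bnd (fun x => u x + w x).
Proof.
move=> [mu_ [a ha]] [mw [b hb]]; split; first exact: measurable_funD.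
exists (a + b) => x; move: (ha x) (hb x) => /andP[a0 a1] /andP[b0 b1].
by rewrite addr_ge0// lerD.
Qed.

Lemma bnd_mul u w : bnd u -> bnd w -> bnd (fun x => u x * w x).
Proof.
move=> [mu_ [a ha]] [mw [b hb]]; split; first exact: measurable_funM.
exists (a * b) => x; move: (ha x) (hb x) => /andP[a0 a1] /andP[b0 b1].
by rewrite mulr_ge0// ler_pM.
Qed.

Lemma bnd_scale c u : 0 <= c -> bnd u -> bnd (fun x => c * u x).
Proof. by move=> c0; apply: bnd_mul; exact: bnd_cst. Qed.

Lemma bnd_pow (r : R) u : 0 <= r -> bnd u -> bnd (fun x => u x `^ r).
Proof.
move=> r0 [mu_ [a ha]]; split; first exact: (measurableT_comp (measurable_powR r)).
exists (a `^ r) => x; move: (ha x) => /andP[a0 a1].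
by rewrite powR_ge0/= ge0_ler_powR// nnegrE// (le_trans a0).
Qed.

Lemma bnd_sum N (u : nat -> T -> R) : (forall i, bnd (u i)) ->
  bnd (fun x => \sum_(i < N) u i x).
Proof.
move=> bu; elim: N => [|N IH].
  by under eq_fun do rewrite big_ord0; exact: bnd_cst.
by under eq_fun do rewrite big_ord_recr/=; exact: bnd_add.
Qed.

Lemma bnd_psum i (u : nat -> T -> R) : (forall j, bnd (u j)) -> bnd (fun x => psum (u ^~ x) i).
Proof. exact: bnd_sum. Qed.

Lemma le_Int u w : (forall x, 0 <= u x) -> (forall x, u x <= w x) -> (Int u <= Int w)%E.
Proof. by move=> u0 uw; apply: le_int0 => x; rewrite lee_fin. Qed.

Lemma Int_ge0 u : (forall x, 0 <= u x) -> (0 <= Int u)%E.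
Proof. by move=> u0; apply: integral_ge0 => x _; rewrite lee_fin. Qed.

Lemma Int_add u w : bnd u -> bnd w -> Int (fun x => u x + w x) = (Int u + Int w)%E.
Proof.
move=> bu bw; rewrite /intR -ge0_integralD//.
- by move=> x _; rewrite lee_fin bnd_ge0.
- exact/measurable_EFinP/(bnd_m bu).
- by move=> x _; rewrite lee_fin bnd_ge0.
- exact/measurable_EFinP/(bnd_m bw).
Qed.

Lemma Int_scale (c : R) u : 0 <= c -> bnd u -> Int (fun x => c * u x) = (c%:E * Int u)%E.
Proof.
move=> c0 bu; rewrite /intR -ge0_integralZl//.
- exact/measurable_EFinP/(bnd_m bu).
- by move=> x _; rewrite lee_fin bnd_ge0.
Qed.

Lemma Int_sum N (u : nat -> T -> R) : (forall i, bnd (u i)) ->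
  Int (fun x => \sum_(i < N) u i x) = (\sum_(i < N) Int (u i))%E.
Proof.
move=> bu; elim: N => [|N IH].
  rewrite big_ord0 /intR; apply: integral0_eq => x _; by rewrite big_ord0.
rewrite big_ord_recr/= -IH -Int_add//; last exact: bnd_sum.
by congr Int; apply/funext => x; rewrite big_ord_recr.
Qed.

(** The preimage of any set is a union of cells, and there are only countably many cells. *)
Lemma adapted_measurable d' (U : measurableType d') ix (u : T -> U) :
  (forall k, measurable (ix @^-1` [set k])) -> adapted ix u -> measurable_fun setT u.
Proof.
move=> mix au _ A mA; rewrite setTI.
have -> : u @^-1` A = \bigcup_(k in [set k | exists2 x, ix x = k & A (u x)]) ix @^-1` [set k].
  apply/seteqP; split => [x /= Ax|x /= [k [y <- Ay] /= /esym/au <-//]].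
  by exists (ix x) => //; exists x.
rewrite bigcup_mkcond; apply: countable_bigcupT_measurable => // k.
by case: ifP => _; [exact: mix|exact: measurable0].
Qed.

Lemma cell_measurable ix v x : grid ix v -> measurable (cell ix x).
Proof. by move=> [_ m _]; exact: (m (ix x)). Qed.

Section one_grid.
Variables (ix : T -> I) (v : R).
Hypothesis gi : grid ix v.
Let v0 : 0 < v. Proof. by case: gi. Qed.

Lemma int_cell_cst c x : (\int[mu]_(y in cell ix x) c%:E)%E = (c * v)%:E.
Proof.
transitivity (\int[mu]_(y in cell ix x) (cst c%:E y))%E => //.
rewrite integral_cst; last exact: cell_measurable gi.
by rewrite EFinM; congr (_ * _)%E; case: gi => _ _; exact.
Qed.

Lemma int_cell_fin u x : bnd u -> (\int[mu]_(y in cell ix x) (u y)%:E)%E \is a fin_num.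
Proof.
move=> [mu_ [c hc]]; rewrite ge0_fin_numE; last first.
  by apply: integral_ge0 => y _; rewrite lee_fin; case/andP: (hc y).
apply: (@le_lt_trans _ _ (\int[mu]_(y in cell ix x) c%:E)%E).
  apply: ge0_le_integral => //.
  - exact: cell_measurable gi.
  - by move=> y _; rewrite lee_fin; case/andP: (hc y).
  - exact/measurable_EFinP/measurable_funTS.
  - by move=> y _; rewrite lee_fin; case/andP: (hc y).
by rewrite int_cell_cst ltry.
Qed.

Lemma avgE u x : bnd u -> (avg ix v u x)%:E = (v^-1%:E * \int[mu]_(y in cell ix x) (u y)%:E)%E.
Proof. by move=> bu; rewrite /avg EFinM fineK//; exact: int_cell_fin. Qed.

Lemma avg_adapted u : adapted ix (avg ix v u).
Proof. by move=> x y xy; rewrite /avg /cell xy. Qed.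

Lemma avg_ge0 u x : (forall x, 0 <= u x) -> 0 <= avg ix v u x.
Proof.
move=> u0; rewrite /avg mulr_ge0// ?invr_ge0 ?(ltW v0)// fine_ge0// integral_ge0// => y _.
by rewrite lee_fin.
Qed.

Lemma avg_le f g (c : R) x : 0 <= c -> bnd f -> bnd g -> (forall y, ix y = ix x -> f y <= c * g y) ->
  avg ix v f x <= c * avg ix v g x.
Proof.
move=> c0 bf bg fg; rewrite -lee_fin (EFinM c) !avgE// muleCA; apply: lee_wpmul2l.
  by rewrite lee_fin invr_ge0 ltW.
rewrite -ge0_integralZl//; last 3 first.
- exact: cell_measurable gi.
- exact/measurable_EFinP/measurable_funTS/(bnd_m bg).
- by move=> y _; rewrite lee_fin bnd_ge0.
apply: ge0_le_integral => //.
- exact: cell_measurable gi.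
- by move=> y _; rewrite lee_fin bnd_ge0.
- exact/measurable_EFinP/measurable_funTS/(bnd_m bf).
- apply/measurable_EFinP/measurable_funTS/measurable_funM => //; exact: bnd_m.
Qed.

Lemma avg_cst (c : R) x : 0 <= c -> avg ix v (fun=> c) x = c.
Proof.
move=> c0; apply: EFin_inj; rewrite avgE; last exact: bnd_cst.
by rewrite int_cell_cst -EFinM mulrCA mulVf ?gt_eqF// mulr1.
Qed.

(** Serves to average the tangent-line bound of a concave power, which replaces Jensen's
    inequality. *)
Lemma avg_affine (a b : R) u x : 0 <= a -> 0 <= b -> bnd u ->
  avg ix v (fun x => a * u x + b) x = a * avg ix v u x + b.
Proof.
move=> a0 b0 bu.
have bH : bnd (fun x => a * u x + b) by apply: bnd_add; [exact: bnd_scale|exact: bnd_cst].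
have mD := cell_measurable x gi.
have mu1 : measurable_fun (cell ix x) (EFin \o u).
  exact/measurable_EFinP/measurable_funTS/(bnd_m bu).
have u0 y : cell ix x y -> (0 <= (u y)%:E)%E by move=> _; rewrite lee_fin bnd_ge0.
have a0' : (0 <= a%:E)%E by rewrite lee_fin.
have p1 y : cell ix x y -> (0 <= a%:E * (u y)%:E)%E by move=> /u0; exact: mule_ge0.
have m1 : measurable_fun (cell ix x) (fun y => a%:E * (u y)%:E)%E.
  exact: (emeasurable_funM (measurable_cst _) mu1).
have p2 y : cell ix x y -> (0 <= b%:E)%E by rewrite lee_fin.
have h1 := @ge0_integralD _ _ _ mu _ mD _ (fun=> b%:E) p1 m1 p2 (measurable_cst _).
have h2 : (\int[mu]_(y in cell ix x) (a%:E * (u y)%:E) =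
    a%:E * \int[mu]_(y in cell ix x) (u y)%:E)%E.
  exact: (@ge0_integralZl _ _ _ mu _ mD _ mu1 a%:E u0 a0').
apply: EFin_inj; rewrite (avgE _ bH).
under eq_integral do rewrite EFinD EFinM.
rewrite h1 h2 int_cell_cst -(fineK (int_cell_fin x bu)).
transitivity (v^-1 * (a * fine (\int[mu]_(y in cell ix x) (u y)%:E)%E + b * v))%:E => //.
congr EFin; rewrite /avg; field; by rewrite gt_eqF.
Qed.

Lemma bnd_avg u : bnd u -> bnd (avg ix v u).
Proof.
move=> bu; split.
  by apply: (@adapted_measurable _ _ ix) => //; [case: gi|exact: avg_adapted].
have [mu_ [c hc]] := bu; exists `|c| => x; rewrite avg_ge0/=; last first.
  by move=> y; exact: bnd_ge0.
rewrite -[leRHS]mulr1 -(avg_cst x ler01); apply: avg_le => //; first exact: bnd_cst.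
by move=> y _; rewrite mulr1 (le_trans _ (ler_norm _))//; case/andP: (hc y).
Qed.

Lemma measurable_same_cell : measurable [set z : T * T | ix z.2 = ix z.1].
Proof.
have -> : [set z : T * T | ix z.2 = ix z.1] =
    \bigcup_k ((ix @^-1` [set k]) `*` (ix @^-1` [set k])).
  apply/seteqP; split => [[x y]/= xy|[x y] [k _ [/= -> ->//]]].
  by exists (ix x).
apply: countable_bigcupT_measurable => // k.
by apply: measurableX; case: gi.
Qed.

(** Averaging is integration against a symmetric kernel, equal to 1/v on pairs of points in a common
    cell. Tonelli moves it onto [w], on which it acts as the identity because [w] is constant on
    cells. *)
Lemma Int_avgM u w : bnd u -> bnd w -> adapted ix w ->
  Int (fun x => avg ix v u x * w x) = Int (fun x => u x * w x).
Proof.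
move=> bu bw aw.
pose E := [set z : T * T | ix z.2 = ix z.1].
pose k (z : T * T) : \bar R := ((\1_E z : R) * (v^-1 * (u z.2 * w z.1)))%:E.
have mk : measurable_fun setT k.
  apply/measurable_EFinP; apply: measurable_funM.
    by apply: measurable_indic; exact: measurable_same_cell.
  apply: measurable_funM => //; apply: measurable_funM.
    exact: (measurableT_comp (bnd_m bu) measurable_snd).
  exact: (measurableT_comp (bnd_m bw) measurable_fst).
have k0 z : (0 <= k z)%E.
  rewrite lee_fin !mulr_ge0// ?invr_ge0 ?(ltW v0)//; exact: bnd_ge0.
transitivity (\int[mu]_x \int[mu]_y k (x, y))%E.
  apply: eq_integral => x _; rewrite EFinM avgE//.
  transitivity (\int[mu]_(y in cell ix x) ((v^-1 * w x)%:E * (u y)%:E))%E.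
    rewrite ge0_integralZl//; last 4 first.
    - exact: cell_measurable gi.
    - exact/measurable_EFinP/measurable_funTS/(bnd_m bu).
    - by move=> y _; rewrite lee_fin bnd_ge0.
    - by rewrite lee_fin mulr_ge0 ?invr_ge0 ?(ltW v0)// bnd_ge0.
    by rewrite EFinM muleAC.
  rewrite integral_mkcond; apply: eq_integral => y _.
  rewrite patchE /k indicE; have [yx|yx] := boolP (y \in cell ix x).
    have -> : (x, y) \in E by rewrite inE /E/=; rewrite inE in yx.
    by rewrite mul1r -EFinM/=; congr EFin; ring.
  have -> : (x, y) \in E = false.
    by apply/negbTE; apply: contra yx; rewrite !inE.
  by rewrite mul0r.
rewrite -integral_prodm1// integral_prodm2//.
apply: eq_integral => y _.
transitivity (\int[mu]_(x in cell ix y) (v^-1 * (u y * w y))%:E)%E.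
  rewrite [RHS]integral_mkcond; apply: eq_integral => x _.
  rewrite patchE /k indicE; have [yx|yx] := boolP (x \in cell ix y).
    have yx' : ix x = ix y by rewrite inE in yx.
    have -> : (x, y) \in E by rewrite inE /E/=.
    by rewrite mul1r/= (aw _ _ yx').
  have -> : (x, y) \in E = false.
    by apply/negbTE; apply: contra yx; rewrite !inE.
  by rewrite mul0r.
by rewrite int_cell_cst mulrAC mulVf ?gt_eqF// mul1r.
Qed.

Lemma Int_avg u : bnd u -> Int (avg ix v u) = Int u.
Proof.
move=> bu; have := @Int_avgM u (fun=> 1) bu (bnd_cst ler01) (fun _ _ _ => erefl).
by under eq_fun do rewrite mulr1; under [in X in _ = X -> _]eq_fun do rewrite mulr1.
Qed.

End one_grid.

(** The function is constant on the fine cell of y, and this cell alone makes up at least the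
    fraction 1/K of the coarse one. *)
Lemma le_avg_subcell ix v jx (w K : R) u x y : grid ix v -> grid jx w ->
  (forall x y, ix x = ix y -> jx x = jx y) ->
  w <= K * v -> bnd u -> adapted ix u -> jx y = jx x -> u y <= K * avg jx w u x.
Proof.
move=> gi gj r vK bu au yx.
have w0 : 0 < w by case: gj.
rewrite (_ : avg jx w u x = avg jx w u y); last exact: avg_adapted.
have h : ((u y * v)%:E <= \int[mu]_(z in cell jx y) (u z)%:E)%E.
  have <- : (\int[mu]_(z in cell ix y) (u z)%:E = (u y * v)%:E)%E.
    rewrite -(int_cell_cst gi _ y).
    by apply: eq_integral => z; rewrite inE => zy/=; rewrite (au _ _ zy).
  apply: ge0_subset_integral.
  - exact: cell_measurable gi.
  - exact: cell_measurable gj.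
  - exact/measurable_EFinP/measurable_funTS/(bnd_m bu).
  - by move=> z _; rewrite lee_fin bnd_ge0.
  - by move=> z zy; exact: r.
move: h; rewrite -(fineK (int_cell_fin gj y bu)) lee_fin => h.
have v0 : 0 < v by case: gi.
have K0 : 0 < K by rewrite -(pmulr_lgt0 _ v0) (lt_le_trans w0).
rewrite /avg mulrA -ler_pdivrMl ?divr_gt0// invf_div mulrC.
apply: le_trans h; rewrite ler_wpM2l ?bnd_ge0//.
by rewrite ler_pdivrMr// mulrC.
Qed.

(** Finiteness of X permits its multiple to be moved to the left; multiplying by t then turns
    t^(t-1) into t^t. *)
Lemma young_absorb (t : R) (X Y : \bar R) : 1 < t -> (0 <= X)%E -> (0 <= Y)%E -> (X < +oo)%E ->
  (X <= (1 - t^-1)%:E * X + (t `^ (t - 1))%:E * Y)%E -> (X <= (t `^ t)%:E * Y)%E.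
Proof.
move=> t1; have t0 : 0 < t by rewrite (lt_trans ltr01).
case: X => [X| |]// X0; case: Y => [Y| |]// Y0 _; last first.
  by move=> _; rewrite gt0_muley ?leey// lte_fin powR_gt0.
rewrite -!EFinM -EFinD !lee_fin => h.
have h2 : X / t <= t `^ (t - 1) * Y by rewrite mulrBl mul1r mulrC in h; lra.
by rewrite -(mulr_powRB1 (ltW t0) t0) -mulrA mulrC -ler_pdivrMr.
Qed.

(** * Doob-type inequalities along nested grids *)

Section filtration.
Variables (ix : nat -> T -> I) (v : nat -> R).
Hypothesis gi : forall i, grid (ix i) (v i).
Hypothesis nest : forall i x y, ix i.+1 x = ix i.+1 y -> ix i x = ix i y.

Lemma nest_le i j x y : (i <= j)%N -> ix j x = ix j y -> ix i x = ix i y.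
Proof.
move=> ij; rewrite -(subnK ij); elim: (j - i)%N => [//|k IH].
by rewrite addSn => /nest/IH.
Qed.

Lemma adapted_psum (u : nat -> T -> R) i : (forall j, adapted (ix j) (u j)) ->
  adapted (ix i) (fun x => psum (u ^~ x) i).
Proof.
move=> au x y xy; apply: eq_bigr => j _; apply: au.
by apply: (nest_le _ xy); rewrite -ltnS.
Qed.

(** Provides the finiteness required for absorbing a term: a bounded integrable function has all
    powers of exponent at least 1 integrable. *)
Lemma Int_bnd_fin (u : T -> R) (t : R) : 1 <= t -> bnd u -> (Int u < +oo)%E ->
  (Int (fun x => (u x `^ t)%R) < +oo)%E.
Proof.
move=> t1 bu fu; have [mu_ [c hc]] := bu.
have t0 : 0 < t by rewrite (lt_le_trans ltr01).
apply: (@le_lt_trans _ _ (Int (fun x => c `^ (t - 1) * u x)%R)).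
  apply: le_Int => x; first exact: powR_ge0.
  case/andP: (hc x) => u0 uc; rewrite -(mulr_powRB1 u0 t0) mulrC.
  apply: ler_wpM2r => //; apply: ge0_ler_powR => //; first by rewrite subr_ge0.
  by rewrite nnegrE (le_trans u0).
rewrite Int_scale ?powR_ge0//.
by rewrite lte_mul_pinfty// ?lee_fin ?powR_ge0//.
Qed.

(* Telescoping [F^t <= t * sum_i e_i F_i^(t-1)], self-adjointness of the averages and
   Young's inequality. *)
Lemma dual_doob (t : R) N (u : nat -> T -> R) : 1 <= t -> (forall i, bnd (u i)) ->
  (forall i, Int (u i) < +oo)%E ->
  (Int (fun x => (\sum_(i < N) avg (ix i) (v i) (u i) x)%R `^ t)%R <=
   (t `^ t)%:E * Int (fun x => (\sum_(i < N) u i x)%R `^ t)%R)%E.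
Proof.
move=> t1 bu fu; have t0 : 0 < t by rewrite (lt_le_trans ltr01).
pose e i := avg (ix i) (v i) (u i).
have be i : bnd (e i) by exact: bnd_avg.
pose F x := \sum_(i < N) e i x; pose B x := \sum_(i < N) u i x.
have bF : bnd F by exact: bnd_sum.
have bB : bnd B by exact: bnd_sum.
have F0 x : 0 <= F x by exact: bnd_ge0.
have B0 x : 0 <= B x by exact: bnd_ge0.
have IF : Int F = Int B.
  by rewrite !Int_sum//; apply: eq_bigr => i _; exact: Int_avg.
move: t1; rewrite le_eqVlt => /predU1P[t1|t1].
  rewrite -t1 powR1 mul1e -[leLHS]/(Int (fun x => F x `^ 1)) -[leRHS]/(Int (fun x => B x `^ 1)).
  under eq_fun do rewrite powRr1//; under [in leRHS]eq_fun do rewrite powRr1//.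
  by rewrite IF.
pose Fi i x := psum (e ^~ x) i.
have bFi i : bnd (fun x => Fi i x `^ (t - 1)).
  by apply: bnd_pow; [rewrite subr_ge0 ltW|exact: bnd_psum].
have FiF i x : (i < N)%N -> Fi i x <= F x.
  by move=> iN; apply: sum_le_psum => // j; exact: bnd_ge0.
pose X := Int (fun x => F x `^ t); pose Y := Int (fun x => B x `^ t).
have bFt : bnd (fun x => F x `^ t) by apply: bnd_pow => //; exact: ltW.
have bBt : bnd (fun x => B x `^ t) by apply: bnd_pow => //; exact: ltW.
have s1 : (X <= Int (fun x => t * \sum_(i < N) e i x * Fi i x `^ (t - 1))%R)%E.
  apply: le_Int => x; first exact: powR_ge0.
  have := @sum_powR_incr_lb R t (e ^~ x) N t0 (fun i => bnd_ge0 x (be i)).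
  by rewrite max_r// ltW.
(* The weight is a power of a partial sum of terms of levels at most i, hence constant on the cells
   of level i; self-adjointness therefore removes the average from u_i. *)
have s2 : Int (fun x => t * \sum_(i < N) e i x * Fi i x `^ (t - 1)) =
    Int (fun x => t * \sum_(i < N) u i x * Fi i x `^ (t - 1)).
  rewrite !Int_scale ?(ltW t0)//; last 2 first.
  - by apply: (@bnd_sum N (fun i x => u i x * Fi i x `^ (t - 1))) => i; exact: bnd_mul.
  - by apply: (@bnd_sum N (fun i x => e i x * Fi i x `^ (t - 1))) => i; exact: bnd_mul.
  congr (_ * _)%E.
  rewrite (@Int_sum N (fun i x => e i x * Fi i x `^ (t - 1))); last by move=> i; exact: bnd_mul.
  rewrite (@Int_sum N (fun i x => u i x * Fi i x `^ (t - 1))); last by move=> i; exact: bnd_mul.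
  apply: eq_bigr => i _.
  apply: (@Int_avgM (ix i) (v i) (gi i) (u i) (fun x => Fi i x `^ (t - 1)) (bu i) (bFi i)).
  move=> x y xy; congr (_ `^ _); apply: (adapted_psum _ xy) => j.
  exact: avg_adapted.
have s3 : (Int (fun x => (t * \sum_(i < N) u i x * Fi i x `^ (t - 1))%R)
    <= Int (fun x => (1 - t^-1) * F x `^ t + t `^ (t - 1) * B x `^ t)%R)%E.
  apply: le_Int => x.
    rewrite mulr_ge0 ?(ltW t0)//; apply: sumr_ge0 => i _.
    by rewrite mulr_ge0 ?powR_ge0// bnd_ge0.
  have h : t * \sum_(i < N) u i x * Fi i x `^ (t - 1) <= F x `^ (t - 1) * (t * B x).
    rewrite mulrCA; apply: ler_wpM2l; first exact: ltW.
    rewrite mulr_sumr; apply: ler_sum => i _; rewrite mulrC; apply: ler_wpM2r.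
      exact: bnd_ge0.
    apply: ge0_ler_powR; rewrite ?subr_ge0 ?(ltW t1)// ?nnegrE//.
      by apply: psum_ge0 => j; exact: bnd_ge0.
    exact: FiF.
  apply: (le_trans h).
  have := @conjugate_powR R (F x `^ (t - 1)) (t * B x) (t / (t - 1)) t.
  rewrite invf_div mulrBl mulfV ?gt_eqF// mul1r subrK.
  move=> /(_ (powR_ge0 _ _) (mulr_ge0 (ltW t0) (B0 x)) _ t0 erefl).
  rewrite divr_gt0 ?subr_gt0// => /(_ isT)/le_trans; apply.
  rewrite -powRrM mulrCA mulfV ?subr_eq0 ?gt_eqF// mulr1 mulrC lerD2l.
  rewrite powRM ?(ltW t0)// powRB ?powRr1 ?(ltW t0) ?(gt_eqF t0) ?implybT//.
  by rewrite mulrAC.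
have fX : (X < +oo)%E.
  apply: Int_bnd_fin => //; first exact: ltW.
  rewrite IF Int_sum//; apply: lte_sum_pinfty => i _; exact: fu.
have : (X <= (1 - t^-1)%:E * X + (t `^ (t - 1))%:E * Y)%E.
  apply: (le_trans s1); rewrite s2; apply: (le_trans s3).
  rewrite Int_add ?Int_scale ?subr_ge0 ?powR_ge0 ?invf_le1 ?(ltW t1)//; apply: bnd_scale => //.
  - by rewrite subr_ge0 invf_le1 ?(ltW t1).
  - exact: powR_ge0.
have X0 : (0 <= X)%E by apply: Int_ge0 => x; exact: powR_ge0.
have Y0 : (0 <= Y)%E by apply: Int_ge0 => x; exact: powR_ge0.
move=> h; exact: (young_absorb t1 X0 Y0 fX h).
Qed.

End filtration.

(** * Change of aperture: from fine cells to coarse cells *)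

Section aperture.
Variables (ix jx : nat -> T -> I) (v w : nat -> R) (K : R).
Hypothesis gi : forall i, grid (ix i) (v i).
Hypothesis gj : forall i, grid (jx i) (w i).
Hypothesis nesti : forall i x y, ix i.+1 x = ix i.+1 y -> ix i x = ix i y.
Hypothesis nestj : forall i x y, jx i.+1 x = jx i.+1 y -> jx i x = jx i y.
Hypothesis refine : forall i x y, ix i x = ix i y -> jx i x = jx i y.
Hypothesis vK : forall i, w i <= K * v i.

Lemma K_gt0 : 0 < K.
Proof.
have [v0 _ _] := gi 0; have [w0 _ _] := gj 0.
by rewrite -(pmulr_lgt0 _ v0) (lt_le_trans w0).
Qed.

(** Each term is compared with its own coarse average at its own level k <= i; since coarse grids
    are nested, x and y still share a cell at these earlier levels. The bound is thus uniform over
    the coarse cell. *)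
Lemma incr_le_avg (h : nat -> T -> R) N i x y : (forall k, bnd (h k)) ->
  (forall k, adapted (ix k) (h k)) -> (i < N)%N -> jx i y = jx i x ->
  psum (h ^~ y) i <= K * \sum_(k < N) avg (jx k) (w k) (h k) x.
Proof.
move=> bh ah iN yx.
apply: (@le_trans _ _ (K * psum (fun k => avg (jx k) (w k) (h k) x) i)).
  rewrite mulr_sumr; apply: ler_sum => k _.
  apply: (le_avg_subcell (gi k) (gj k)) => //; first exact: refine.
  by apply: (nest_le nestj _ yx); rewrite -ltnS.
apply: ler_wpM2l; first exact/ltW/K_gt0.
by apply: sum_le_psum => // k; apply: avg_ge0 => // z; exact: bnd_ge0.
Qed.

(** The increments of the t-th powers of the partial sums are nonnegative and adapted, and their
    plain sum is the t-th power. They make a nonlinear quantity accessible to averaging level by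
    level. *)
Definition pincr (t : R) (u : nat -> T -> R) k x :=
  (\sum_(j < k.+1) u j x) `^ t - (\sum_(j < k) u j x) `^ t.

Lemma pincr_bnd (t : R) (u : nat -> T -> R) k : 0 < t -> (forall i, bnd (u i)) -> bnd (pincr t u k).
Proof.
move=> t0 bu.
have [m1 [c hc]] : bnd (fun x => (\sum_(j < k.+1) u j x) `^ t).
  by apply: bnd_pow; [exact: ltW|exact: bnd_sum].
have [m2 _] : bnd (fun x => (\sum_(j < k) u j x) `^ t).
  by apply: bnd_pow; [exact: ltW|exact: bnd_sum].
split; first exact: measurable_funB.
exists c => x; rewrite /pincr subr_ge0; apply/andP; split.
  apply: ge0_ler_powR; rewrite ?nnegrE ?(ltW t0)//.
  - by apply: sumr_ge0 => j _; exact: bnd_ge0.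
  - by apply: sumr_ge0 => j _; exact: bnd_ge0.
  - by rewrite big_ord_recr/= lerDl bnd_ge0.
by case/andP: (hc x) => _; apply: le_trans; rewrite gerBl powR_ge0.
Qed.

Lemma pincr_adapted (t : R) (u : nat -> T -> R) k : (forall i, adapted (ix i) (u i)) -> adapted (ix k) (pincr t u k).
Proof.
move=> au x y xy; rewrite /pincr; congr (_ `^ _ - _ `^ _).
  exact: (adapted_psum nesti au xy).
apply: eq_bigr => j _; apply: au; apply: (nest_le nesti _ xy); exact: ltnW.
Qed.

Lemma sum_pincr (t : R) (u : nat -> T -> R) N x : 0 < t -> \sum_(k < N) pincr t u k x = (\sum_(k < N) u k x) `^ t.
Proof.
move=> t0; elim: N => [|N IH]; first by rewrite !big_ord0 powR0 ?gt_eqF.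
by rewrite big_ord_recr/= IH /pincr addrC subrK.
Qed.

Lemma aperture_lt1 (t : R) N (u : nat -> T -> R) : 0 < t < 1 -> (forall i, bnd (u i)) ->
  (forall i, adapted (ix i) (u i)) ->
  (Int (fun x => (\sum_(i < N) avg (jx i) (w i) (u i) x)%R `^ t)%R <=
   (K + t^-1)%:E * Int (fun x => (\sum_(i < N) u i x)%R `^ t)%R)%E.
Proof.
move=> /andP[t0 t1] bu au.
pose h k := pincr t u k.
have bh k : bnd (h k) by exact: pincr_bnd.
pose Z x := K * \sum_(k < N) avg (jx k) (w k) (h k) x.
pose g k x := u k x * psum (u ^~ x) k `^ (t - 1).
have bg k : bnd (g k).
  split.
    apply: measurable_funM; first exact: bnd_m.
    apply: (measurableT_comp (measurable_powR _)); apply: bnd_m; exact: bnd_sum.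
  have [_ [c hc]] : bnd (fun x => psum (u ^~ x) k `^ t).
    by apply: bnd_pow; [exact: ltW|exact: bnd_sum].
  exists c => x; rewrite mulr_ge0 ?powR_ge0 ?bnd_ge0//=.
  case/andP: (hc x) => _; apply: le_trans.
  have P0 : 0 <= psum (u ^~ x) k by apply: psum_ge0 => j; exact: bnd_ge0.
  rewrite -(mulr_powRB1 P0 t0); apply: ler_wpM2r; first exact: powR_ge0.
  by rewrite psumS lerDr; apply: sumr_ge0 => j _; exact: bnd_ge0.
pose V x := \sum_(k < N) avg (jx k) (w k) (g k) x.
have K0 := K_gt0.
have bEh : bnd (fun x => \sum_(k < N) avg (jx k) (w k) (h k) x).
  by apply: (@bnd_sum N (fun k => avg (jx k) (w k) (h k))) => k; exact: bnd_avg.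
have bZ : bnd Z by apply: bnd_scale => //; exact: ltW.
have bV : bnd V.
  by apply: (@bnd_sum N (fun k => avg (jx k) (w k) (g k))) => k; exact: bnd_avg.
have Z0 x : 0 <= Z x by exact: bnd_ge0.
have V0 x : 0 <= V x by exact: bnd_ge0.
have FZV x : \sum_(i < N) avg (jx i) (w i) (u i) x <= Z x `^ ((1 - t) / t) * V x.
  rewrite mulr_sumr; apply: ler_sum => i _.
  apply: avg_le => //; first exact: powR_ge0.
  move=> y yx.
  have P0 : 0 <= psum (u ^~ y) i by apply: psum_ge0 => j; exact: bnd_ge0.
  have uP : u i y <= psum (u ^~ y) i.
    by rewrite psumS lerDr; apply: sumr_ge0 => j _; exact: bnd_ge0.
  have PZ : psum (u ^~ y) i `^ t <= Z x.
    have := @incr_le_avg h N i x y bh (fun k => @pincr_adapted t u k au) (ltn_ord i) yx.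
    by rewrite /psum (@sum_pincr t u i.+1).
  move: P0; rewrite le_eqVlt => /predU1P[P0|P0].
    rewrite -P0 in uP; apply: (le_trans uP).
    by rewrite mulr_ge0 ?powR_ge0// bnd_ge0.
  have -> : u i y = psum (u ^~ y) i `^ (1 - t) * g i y.
    rewrite /g mulrCA -powRD; last by rewrite (gt_eqF P0) implybT.
    by rewrite (_ : 1 - t + (t - 1) = 0) ?powRr0 ?mulr1//; ring.
  apply: ler_wpM2r; first exact: bnd_ge0.
  have te : 1 - t = t * ((1 - t) / t) by rewrite mulrC divfK ?gt_eqF.
  rewrite {1}te powRrM; apply: ge0_ler_powR; rewrite ?nnegrE ?powR_ge0//.
  by apply: divr_ge0; [rewrite subr_ge0 ltW|exact: ltW].
have FtZV x : (\sum_(i < N) avg (jx i) (w i) (u i) x) `^ t <= Z x + V x.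
  apply: (@le_trans _ _ (Z x `^ (1 - t) * V x `^ t)).
    have te : 1 - t = ((1 - t) / t) * t by rewrite divfK ?gt_eqF.
    rewrite [X in _ <= _ `^ X * _]te powRrM -powRM ?powR_ge0//; apply: ge0_ler_powR; rewrite ?nnegrE ?(ltW t0)//.
    - by apply: sumr_ge0 => i _; apply: avg_ge0 => // y; exact: bnd_ge0.
    - by rewrite mulr_ge0 ?powR_ge0.
  have := @conjugate_powR R (Z x `^ (1 - t)) (V x `^ t) (1 - t)^-1 t^-1.
  rewrite !invr_gt0 subr_gt0 !invrK subrK.
  move=> /(_ (powR_ge0 _ _) (powR_ge0 _ _) t1 t0 erefl)/le_trans; apply.
  rewrite -!powRrM !mulfV ?gt_eqF ?subr_gt0// !powRr1//.
  by apply: lerD; rewrite ler_piMr// ?gerBl ltW.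
apply: (@le_trans _ _ (Int (fun x => Z x + V x)%R)).
  by apply: le_Int => x; [exact: powR_ge0|exact: FtZV].
rewrite Int_add// EFinD ge0_muleDl; last 2 first.
- by rewrite lee_fin ltW.
- by rewrite lee_fin invr_ge0 ltW.
apply: leeD.
  rewrite /Z Int_scale ?(ltW K0)//.
  rewrite (@Int_sum N (fun k => avg (jx k) (w k) (h k))); last by move=> k; exact: bnd_avg.
  apply: lee_wpmul2l; first by rewrite lee_fin ltW.
  rewrite (eq_bigr (fun k : 'I_N => Int (h k))); last by move=> k _; exact: Int_avg.
  rewrite -Int_sum//; apply: le_Int => x; first by apply: sumr_ge0 => k _; exact: bnd_ge0.
  by rewrite sum_pincr.
rewrite /V (@Int_sum N (fun k => avg (jx k) (w k) (g k))); last by move=> k; exact: bnd_avg.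
rewrite (eq_bigr (fun k : 'I_N => Int (g k))); last by move=> k _; exact: Int_avg.
rewrite -Int_sum// -Int_scale; last 2 first.
- by rewrite invr_ge0 ltW.
- by apply: bnd_pow; [exact: ltW|exact: bnd_sum].
apply: le_Int => x; first by apply: sumr_ge0 => k _; exact: bnd_ge0.
have := @sum_powR_incr_ub R t (u ^~ x) N t0 (fun i => bnd_ge0 x (bu i)).
by rewrite max_r// invf_ge1// ltW.
Qed.

Definition aperture_cst (t : R) := if 1 <= t then t `^ t else K + t^-1.

Lemma aperture_cst_gt0 t : 0 < t -> 0 < aperture_cst t.
Proof.
move=> t0; rewrite /aperture_cst; case: ifP => _; first exact: powR_gt0.
by rewrite addr_gt0 ?K_gt0 ?invr_gt0.
Qed.

Lemma aperture (t : R) N (u : nat -> T -> R) : 0 < t -> (forall i, bnd (u i)) ->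
  (forall i, adapted (ix i) (u i)) -> (forall i, Int (u i) < +oo)%E ->
  (Int (fun x => (\sum_(i < N) avg (jx i) (w i) (u i) x)%R `^ t)%R <=
   (aperture_cst t)%:E * Int (fun x => (\sum_(i < N) u i x)%R `^ t)%R)%E.
Proof.
move=> t0 bu au fu; rewrite /aperture_cst; have [t1|t1] := leP 1 t.
  exact: dual_doob.
by apply: aperture_lt1; rewrite ?t0.
Qed.

End aperture.
End grid.

(** * Discrete duality *)

Section discrete.
Context d (T : measurableType d) (R : realType) (mu : {sigma_finite_measure set T -> \bar R}).
Variable I : countType.
Local Notation Int := (intR mu).

(** A support of finite measure makes all positive powers integrable, which the absorption arguments
    rely on. *)
Definition fins (u : T -> R) := bnd u /\
  exists S, [/\ measurable S, (mu S < +oo)%E & forall x, u x != 0 -> S x].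

Lemma fins_bnd u : fins u -> bnd u. Proof. by case. Qed.

Lemma fins_Int u : fins u -> (Int u < +oo)%E.
Proof.
move=> [[mu_ [c hc]] [S [mS fS uS]]].
have c0 : 0 <= c by have /andP[h] := hc point; exact: le_trans.
apply: (@le_lt_trans _ _ (c%:E * \int[mu]_x (\1_S x)%:E)%E).
  have -> : (c%:E * \int[mu]_x (\1_S x)%:E = \int[mu]_x (c%:E * (\1_S x)%:E))%E.
    by rewrite ge0_integralZl//; apply/measurable_EFinP; exact: measurable_indic.
  apply: le_int0 => x; first by rewrite lee_fin; case/andP: (hc x).
  rewrite -EFinM lee_fin indicE; have [xS|xS] := boolP (x \in S).
    by rewrite mulr1; case/andP: (hc x).
  have [->|/uS Sx] := eqVneq (u x) 0; first by rewrite mulr_ge0.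
  by move: xS; rewrite notin_setE.
rewrite integral_indic// setIT.
by rewrite lte_mul_pinfty.
Qed.

Lemma fins_le (u w : T -> R) : bnd u -> (forall x, w x = 0 -> u x = 0) -> fins w -> fins u.
Proof.
move=> bu h [_ [S [mS fS wS]]]; split => //; exists S; split => // x ux.
by apply: wS; apply: contra_neq ux; exact: h.
Qed.

Lemma fins_pow (r : R) (u : T -> R) : 0 < r -> fins u -> fins (fun x => u x `^ r).
Proof.
move=> r0 fu; apply: (fins_le _ _ fu); first by apply: bnd_pow; [exact: ltW|exact: fins_bnd].
by move=> x ->; rewrite powR0// gt_eqF.
Qed.

Lemma fins_mulr (u w : T -> R) : bnd u -> fins w -> fins (fun x => u x * w x).
Proof.
move=> bu fw; apply: (fins_le _ _ fw); first exact: bnd_mul (fins_bnd fw).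
by move=> x ->; rewrite mulr0.
Qed.

Lemma fins_add (u w : T -> R) : fins u -> fins w -> fins (fun x => u x + w x).
Proof.
move=> [bu [S [mS fS uS]]] [bw [S' [mS' fS' wS']]]; split; first exact: bnd_add.
exists (S `|` S'); split.
- exact: measurableU.
- by rewrite (le_lt_trans (measureU2 _ _ _))// lte_add_pinfty.
- move=> x; have [u0|/uS] := eqVneq (u x) 0; last by left.
  have [w0|/wS'] := eqVneq (w x) 0; last by right.
  by rewrite u0 w0 addr0 eqxx.
Qed.

Lemma fins0 : fins (fun _ => 0).
Proof.
split; first exact: bnd_cst.
by exists set0; split; rewrite ?measure0// => x; rewrite eqxx.
Qed.

Lemma fins_sum N (u : nat -> T -> R) : (forall i, fins (u i)) ->
  fins (fun x => \sum_(i < N) u i x).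
Proof.
move=> fu; elim: N => [|N IH].
  by under eq_fun do rewrite big_ord0; exact: fins0.
by under eq_fun do rewrite big_ord_recr/=; exact: fins_add.
Qed.

Lemma fins_indic (A : set T) : measurable A -> (mu A < +oo)%E -> fins (\1_A : T -> R).
Proof.
move=> mA fA; split.
  by split; [exact: measurable_indic|exists 1 => x; rewrite indicE; case: (x \in A); rewrite ?lexx ?ler01].
exists A; split => // x; rewrite indicE.
by have [|] := boolP (x \in A); rewrite ?eqxx// inE.
Qed.

(** The maximum runs over the indices strictly below [i], so it is [rmax b i.+1] that is adapted to
    level [i]. *)
Fixpoint rmax (b : nat -> T -> R) i x : R :=
  if i is k.+1 then Num.max (rmax b k x) (b k x) else 0.

Lemma rmaxS b i x : rmax b i.+1 x = Num.max (rmax b i x) (b i x).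
Proof. by []. Qed.

Lemma rmax_ge0 b i x : 0 <= rmax b i x.
Proof. by elim: i => [|i IH] //=; rewrite le_max IH. Qed.

Lemma le_rmax b i N x : (i < N)%N -> b i x <= rmax b N x.
Proof.
elim: N => // N IH; rewrite ltnS leq_eqVlt rmaxS le_max => /predU1P[->|/IH ->//].
by rewrite lexx orbT.
Qed.

Lemma rmax_le b N x c : 0 <= c -> (forall i, (i < N)%N -> b i x <= c) -> rmax b N x <= c.
Proof.
move=> c0; elim: N => [|N IH] h //.
by rewrite rmaxS ge_max IH ?h// => i iN; apply: h; rewrite ltnW.
Qed.

Lemma fins_max (u w : T -> R) : fins u -> fins w -> fins (fun x => Num.max (u x) (w x)).
Proof.
move=> fu fw; apply: (@fins_le _ (fun x => u x + w x)); last exact: fins_add.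
  have [[mu_ [a ha]] [mw [b hb]]] := (fins_bnd fu, fins_bnd fw).
  split; first exact: measurable_maxr.
  exists (Num.max a b) => x; case/andP: (ha x) => u0 ua; case/andP: (hb x) => w0 wb.
  by rewrite le_max u0/= ge_max !le_max ua wb orbT.
move=> x /eqP; rewrite paddr_eq0 ?(bnd_ge0 x (fins_bnd fu)) ?(bnd_ge0 x (fins_bnd fw))//.
by case/andP => /eqP -> /eqP ->; rewrite maxxx.
Qed.

Lemma fins_rmax b i : (forall i, fins (b i)) -> fins (rmax b i).
Proof.
move=> fb; elim: i => [|i IH]; first exact: fins0.
exact: fins_max.
Qed.

(** The pointwise Young inequality for X/A and Y/B, integrated. The weights [c] and [e] add up to
    exactly A B because the exponents are conjugate. *)
Lemma Int_hoelder (p q A B : R) (X Y : T -> R) : 0 < p -> 0 < q -> p^-1 + q^-1 = 1 ->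
  0 < A -> 0 < B -> bnd X -> bnd Y ->
  (Int (fun x => (X x `^ p)%R) <= (A `^ p)%:E)%E -> (Int (fun x => (Y x `^ q)%R) <= (B `^ q)%:E)%E ->
  (Int (fun x => (X x * Y x)%R) <= (A * B)%:E)%E.
Proof.
move=> p0 q0 pq A0 B0 bX bY hX hY.
pose c := A * B / A `^ p / p; pose e := A * B / B `^ q / q.
have c0 : 0 <= c by rewrite /c !divr_ge0 ?powR_ge0 ?mulr_ge0 ?ltW.
have e0 : 0 <= e by rewrite /e !divr_ge0 ?powR_ge0 ?mulr_ge0 ?ltW.
have bXp : bnd (fun x => X x `^ p) by apply: bnd_pow => //; exact: ltW.
have bYq : bnd (fun x => Y x `^ q) by apply: bnd_pow => //; exact: ltW.
apply: (@le_trans _ _ (Int (fun x => c * X x `^ p + e * Y x `^ q)%R)).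
  apply: le_Int => x; first by rewrite mulr_ge0 ?bnd_ge0.
  have := @conjugate_powR R (X x / A) (Y x / B) p q.
  move=> /(_ (divr_ge0 (bnd_ge0 x bX) (ltW A0)) (divr_ge0 (bnd_ge0 x bY) (ltW B0)) p0 q0 pq) h.
  have := ler_wpM2l (ltW (mulr_gt0 A0 B0)) h; rewrite mulrACA (mulrC A) (mulrC B) !divfK ?gt_eqF//.
  move/le_trans; apply; rewrite !powRdiv ?bnd_ge0// mulrDr /c /e.
  by rewrite le_eqVlt; apply/orP; left; apply/eqP; ring.
rewrite Int_add ?Int_scale//; last 2 first.
- exact: bnd_scale.
- exact: bnd_scale.
have -> : (A * B)%:E = (c%:E * (A `^ p)%:E + e%:E * (B `^ q)%:E)%E.
  rewrite -!EFinM -EFinD; congr EFin.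
  have Ap : A `^ p != 0 by rewrite gt_eqF// powR_gt0.
  have Bq : B `^ q != 0 by rewrite gt_eqF// powR_gt0.
  rewrite -[LHS]mulr1 -pq /c /e mulrDr; field.
  by rewrite Ap Bq !gt_eqF.
by apply: leeD; apply: lee_wpmul2l => //; rewrite lee_fin.
Qed.

Definition conj_fin (p : R) := p / (p - 1).

Lemma conj_expE (p : R) : 1 < p -> conj_exp p = (conj_fin p)%:E.
Proof. by move=> p1; rewrite /conj_exp gt_eqF. Qed.

Lemma conj_exp1 : @conj_exp R 1 = +oo%E.
Proof. by rewrite /conj_exp eqxx. Qed.

Lemma conj_fin_gt1 p : 1 < p -> 1 < conj_fin p.
Proof. by move=> p1; rewrite /conj_fin ltr_pdivlMr ?subr_gt0// mul1r gtrBl. Qed.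

Lemma conj_fin_inv p : 1 < p -> p^-1 + (conj_fin p)^-1 = 1.
Proof.
move=> p1; rewrite /conj_fin invf_div; field.
by rewrite gt_eqF// (lt_trans ltr01).
Qed.

Lemma conj_fin_sub1 p : 1 < p -> (conj_fin p - 1) * p = conj_fin p.
Proof. by move=> p1; rewrite /conj_fin; field; rewrite subr_eq0 gt_eqF. Qed.

(** * Discrete norms and their Hoelder inequality *)

Section levels.
Variables (ix : nat -> T -> I) (v : nat -> R) (N : nat).
Hypothesis gi : forall i, grid mu (ix i) (v i).
Hypothesis nest : forall i x y, ix i.+1 x = ix i.+1 y -> ix i x = ix i y.
Implicit Types (a b s : nat -> T -> R).

Definition dseq a := (forall i, fins (a i)) /\ (forall i, adapted (ix i) (a i)).

Definition tailsum (q : R) b i0 x := \sum_(i < N) (if (i0 <= i)%N then b i x `^ q else 0).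

(** A bound instead of a norm, so that only real numbers occur. The four cases are the
    square-function, maximal, Carleson and uniform norms; in the Carleson case the grid cells take
    the place of balls. *)
Definition dnorm_le (P Q : \bar R) b (B : R) : Prop :=
  match P, Q with
  | p%:E, q%:E => (Int (fun x => ((\sum_(i < N) b i x `^ q) `^ (p / q))%R) <= (B `^ p)%:E)%E
  | p%:E, +oo%E => (Int (fun x => (rmax b N x `^ p)%R) <= (B `^ p)%:E)%E
  | +oo%E, q%:E => forall i x, (i < N)%N -> avg mu (ix i) (v i) (tailsum q b i) x <= B `^ q
  | +oo%E, +oo%E => forall i x, (i < N)%N -> b i x <= B
  | _, _ => False
  end.

Lemma adapted_rmax b i : dseq b -> adapted (ix i) (rmax b i.+1).
Proof.
move=> [_ ab] x y xy.
suff h k : (k <= i.+1)%N -> rmax b k x = rmax b k y by exact: h.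
elim: k => //= k IH ki; rewrite IH ?(ltnW ki)//; congr Num.max; apply: ab.
by apply: (nest_le nest _ xy); rewrite -ltnS.
Qed.

Lemma fins_tailsum q b i : 0 < q -> (forall i, fins (b i)) -> fins (tailsum q b i).
Proof.
move=> q0 fb; apply: (@fins_sum N (fun j x => if (i <= j)%N then b j x `^ q else 0)) => j.
by case: (i <= j)%N; [exact: fins_pow|exact: fins0].
Qed.

Lemma sum_psum_exchange (c e : nat -> R) :
  \sum_(i < N) c i * psum e i = \sum_(k < N) e k * \sum_(i < N) (if (k <= i)%N then c i else 0).
Proof.
under eq_bigr => i _.
  rewrite /psum (big_ord_widen N (fun k => e k))// mulr_sumr big_mkcond/=.
  over.
rewrite exchange_big/=; apply: eq_bigr => k _; rewrite mulr_sumr; apply: eq_bigr => i _.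
by rewrite ltnS; case: ifP => _; rewrite ?mulr0// mulrC.
Qed.

(* Carleson's embedding, by summation over the increments of [(sum_(k <= i) a_k^q)^(1/q)]. *)
Lemma carleson_embedding (t q' A B : R) (u b : nat -> T -> R) : 0 < t -> 0 < q' ->
  dseq u -> dseq b -> (forall i x, (i < N)%N -> avg mu (ix i) (v i) (tailsum q' b i) x <= B) ->
  (Int (fun x => (\sum_(i < N) u i x) `^ t)%R <= A%:E)%E -> 0 <= B ->
  (Int (fun x => \sum_(i < N) b i x `^ q' * psum (u ^~ x) i `^ t)%R <= (B * A)%:E)%E.
Proof.
move=> t0 q0 [fu au] [fb ab] hB hA B0.
have bu i := fins_bnd (fu i).
pose h k := pincr t u k.
have bh k : bnd (h k) by exact: pincr_bnd.
have -> : (fun x => \sum_(i < N) b i x `^ q' * psum (u ^~ x) i `^ t) =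
    (fun x => \sum_(k < N) tailsum q' b k x * h k x).
  apply/funext => x; rewrite [RHS](eq_bigr (fun k : 'I_N => h k x * tailsum q' b k x)).
    rewrite -(@sum_psum_exchange (fun i => b i x `^ q') (h ^~ x)).
    by apply: eq_bigr => i _; rewrite {2}/psum /h sum_pincr.
  by move=> k _; rewrite mulrC.
rewrite (@Int_sum _ _ _ mu N (fun k x => tailsum q' b k x * h k x)); last first.
  by move=> k; apply: bnd_mul => //; exact: fins_bnd (fins_tailsum k q0 fb).
apply: (@le_trans _ _ (\sum_(k < N) B%:E * Int (h k))%E).
  apply: lee_sum => k _.
  have bt := fins_bnd (fins_tailsum k q0 fb).
  have ah : adapted (ix k) (h k) by exact: (pincr_adapted nest).
  rewrite -(Int_avgM (gi k) bt (bh k) ah).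
  rewrite -Int_scale//; apply: le_Int => x.
    by rewrite mulr_ge0 ?bnd_ge0//; exact: bnd_avg.
  by apply: ler_wpM2r; rewrite ?bnd_ge0//; exact: hB.
rewrite -ge0_sume_distrr; last by move=> k _; apply: Int_ge0 => x; exact: bnd_ge0.
rewrite EFinM; apply: lee_wpmul2l; first by rewrite lee_fin.
rewrite -Int_sum//; apply: le_trans hA; apply: le_Int => x.
  by apply: sumr_ge0 => k _; exact: bnd_ge0.
by rewrite sum_pincr.
Qed.

Lemma dseq_pow a q : 0 < q -> dseq a -> dseq (fun i x => a i x `^ q).
Proof. by move=> q0 [fa aa]; split => i; [exact: fins_pow|move=> x y xy; rewrite (aa i x y)]. Qed.

(** Only p = 1 < q goes beyond Hoelder's inequality and suprema. There Young's inequality is applied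
    to a_i b_i with a power of the partial sum P_i of the a_j^q as weight: one part telescopes to
    the 1/q-th power of the full sum, the other is a Carleson embedding. These two parts account for
    the factor 2. *)
Lemma discrete_hoelder (p q : R) a b (A B : R) : 1 <= p -> 1 <= q -> 0 < A -> 0 < B ->
  dseq a -> dseq b ->
  dnorm_le p%:E q%:E a A -> dnorm_le (conj_exp p) (conj_exp q) b B ->
  (Int (fun x => \sum_(i < N) a i x * b i x)%R <= (2 * (A * B))%:E)%E.
Proof.
move=> p1 q1 A0 B0 da db; have [fa aa] := da; have [fb ab] := db.
have p0 : 0 < p by rewrite (lt_le_trans ltr01).
have q0 : 0 < q by rewrite (lt_le_trans ltr01).
have a0 i x : 0 <= a i x by exact/bnd_ge0/fins_bnd.
have b0 i x : 0 <= b i x by exact/bnd_ge0/fins_bnd.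
have AB2 : ((A * B)%:E <= (2 * (A * B))%:E)%E.
  by rewrite lee_fin ler_peMl ?mulr_ge0 ?ltW// ltr1n.
have fS r c : 0 < r -> dseq c -> fins (fun x => \sum_(i < N) c i x `^ r).
  by move=> r0 [fc _]; apply: (@fins_sum N (fun i x => c i x `^ r)) => i; exact: fins_pow.
have bab : bnd (fun x => \sum_(i < N) a i x * b i x).
  apply: (@bnd_sum _ _ _ N (fun i x => a i x * b i x)) => i.
  exact: bnd_mul (fins_bnd (fa i)) (fins_bnd (fb i)).
have le1 (r : R) : 1 <= r -> 1 = r \/ 1 < r by rewrite le_eqVlt => /predU1P.
have [pE|pgt] := le1 p p1; have [qE|qgt] := le1 q q1.
- rewrite -pE -qE conj_exp1/= => ha hb.
  apply: le_trans AB2.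
  apply: (@le_trans _ _ (Int (fun x => B * (\sum_(i < N) a i x `^ 1) `^ (1 / 1))%R)).
    apply: le_Int => x; first by apply: sumr_ge0 => i _; rewrite mulr_ge0.
    rewrite divr1 powRr1; last by apply: sumr_ge0 => i _; exact: powR_ge0.
    rewrite mulr_sumr; apply: ler_sum => i _; rewrite powRr1// mulrC ler_wpM2r//.
    exact: hb.
  rewrite Int_scale ?(ltW B0)//; last first.
    by apply: bnd_pow; [rewrite divr_ge0|exact: fins_bnd (fS _ _ _ _)].
  rewrite (mulrC A) EFinM; apply: lee_wpmul2l; first by rewrite lee_fin ltW.
  by move: ha; rewrite (powRr1 (ltW A0)).
- rewrite -pE conj_exp1 (conj_expE qgt)/= => ha hb.
  set q' := conj_fin q in hb *.
  have q'1 : 1 < q' by exact: conj_fin_gt1.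
  have q'0 : 0 < q' by rewrite (lt_trans ltr01).
  pose u i x := a i x `^ q; have du : dseq u by exact: dseq_pow.
  have bu i := fins_bnd (du.1 i).
  have hu : (Int (fun x => ((\sum_(i < N) u i x) `^ q^-1)%R) <= A%:E)%E.
    by move: ha; rewrite div1r (powRr1 (ltW A0)).
  pose E1 x := \sum_(i < N) u i x * psum (u ^~ x) i `^ (q^-1 - 1).
  pose E2 x := \sum_(i < N) b i x `^ q' * psum (u ^~ x) i `^ q^-1.
  have u0 i x : 0 <= u i x by exact: powR_ge0.
  have P0 i x : 0 <= psum (u ^~ x) i by exact: psum_ge0.
  have qi0 : 0 < q^-1 by rewrite invr_gt0.
  have hE1 x : E1 x <= q * (\sum_(i < N) u i x) `^ q^-1.
    have := @sum_powR_incr_ub R q^-1 (u ^~ x) N qi0 (fun i => u0 i x).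
    by rewrite invrK max_r.
  have e10 x : 0 <= E1 x by apply: sumr_ge0 => i _; rewrite mulr_ge0// powR_ge0.
  have e20 x : 0 <= E2 x by apply: sumr_ge0 => i _; rewrite mulr_ge0// powR_ge0.
  have hE2 : (Int E2 <= (B `^ q' * A)%:E)%E.
    by apply: carleson_embedding => //; exact: powR_ge0.
  have bE2 : bnd E2.
    apply: (@bnd_sum _ _ _ N (fun i x => b i x `^ q' * psum (u ^~ x) i `^ q^-1)) => i.
    apply: bnd_mul; first exact: bnd_pow (ltW q'0) (fins_bnd (fb i)).
    by apply: bnd_pow; [exact: ltW|exact: bnd_psum].
  have bU : bnd (fun x => (\sum_(i < N) u i x) `^ q^-1).
    by apply: bnd_pow; [exact: ltW|exact: bnd_sum].
  have key x : \sum_(i < N) a i x * b i x <=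
      B * (\sum_(i < N) u i x) `^ q^-1 + (B * B `^ (- q')) * E2 x.
    apply: (@le_trans _ _ (B * q^-1 * E1 x + B * B `^ (- q') * E2 x)); last first.
      rewrite lerD2r -mulrA; apply: ler_wpM2l; first exact: ltW.
      by rewrite mulrC ler_pdivrMr// mulrC.
    rewrite /E1 /E2 !mulr_sumr -big_split/=; apply: ler_sum => i _.
    have [ai0|ai0] := eqVneq (a i x) 0.
      rewrite ai0 mul0r addr_ge0//; rewrite !mulr_ge0 ?powR_ge0 ?(ltW B0) ?(ltW qi0)//.
    have ai : 0 < a i x by rewrite lt_def ai0 a0.
    set P := psum (u ^~ x) i.
    have Pgt0 : 0 < P.
      rewrite /P psumS ltr_wpDl ?powR_gt0//; exact: sumr_ge0.
    (* The weights cancel in the product. In the powers they turn a_i^q into a_i^q P^(1/q - 1) and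
       b_i^q' into b_i^q' P^(1/q), the summands of [E1] and [E2]. *)
    have := @conjugate_powR R (a i x * P `^ (- (q * q')^-1)) (b i x / B * P `^ (q * q')^-1) q q'.
    have g1 : 0 <= a i x * P `^ (- (q * q')^-1) by rewrite mulr_ge0 ?powR_ge0.
    have g2 : 0 <= b i x / B * P `^ (q * q')^-1.
      by apply: mulr_ge0; [apply: divr_ge0 => //; exact: ltW|exact: powR_ge0].
    have g3 : 0 <= b i x / B by apply: divr_ge0 => //; exact: ltW.
    move=> /(_ g1 g2 q0 q'0 (conj_fin_inv qgt)).
    rewrite mulrACA -powRD ?addNr ?powRr0 ?mulr1 ?eqxx ?(gt_eqF Pgt0) ?implybT//.
    rewrite (powRM _ (a0 i x) (powR_ge0 _ _)) (powRM _ g3 (powR_ge0 _ _)) -!powRrM.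
    have -> : - (q * q')^-1 * q = q^-1 - 1.
      have := conj_fin_inv qgt; rewrite -/q' => h.
      rewrite invfM mulNr mulrAC mulVf ?gt_eqF// mul1r; lra.
    have -> : (q * q')^-1 * q' = q^-1.
      by rewrite invfM -mulrA mulVf ?gt_eqF// mulr1.
    rewrite powRdiv// => h.
    have := ler_wpM2l (ltW B0) h.
    rewrite (_ : B * (a i x * (b i x / B)) = a i x * b i x); last first.
      by rewrite mulrCA (mulrC B) divfK ?gt_eqF.
    move/le_trans; apply.
    rewrite mulrDr; apply: lerD; first by rewrite /u -/P; rewrite le_eqVlt; apply/orP; left; apply/eqP; ring.
    rewrite powRN -/P.
    rewrite [leRHS](_ : _ = B * (b i x `^ q' / B `^ q' * P `^ q^-1)); last by ring.
    apply: ler_wpM2l; first exact: ltW.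
    rewrite ler_piMr// ?invf_le1// ?(ltW q'1)//.
    by rewrite mulr_ge0 ?powR_ge0// divr_ge0 ?powR_ge0.
  apply: (le_trans (le_Int mu _ key)) => [x|].
    by apply: sumr_ge0 => i _; rewrite mulr_ge0.
  rewrite Int_add ?Int_scale ?mulr_ge0 ?powR_ge0 ?(ltW B0)//; last 2 first.
  - by apply: bnd_scale => //; exact: ltW.
  - by apply: bnd_scale; rewrite ?mulr_ge0 ?powR_ge0 ?(ltW B0).
  apply: (@le_trans _ _ (B%:E * A%:E + (B * B `^ (- q'))%:E * (B `^ q' * A)%:E)%E).
    by apply: leeD; apply: lee_wpmul2l; rewrite ?lee_fin ?mulr_ge0 ?powR_ge0 ?(ltW B0).
  rewrite -!EFinM -EFinD lee_fin powRN; rewrite le_eqVlt; apply/orP; left; apply/eqP.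
  by field; rewrite gt_eqF// powR_gt0.
- rewrite -qE conj_exp1 (conj_expE pgt)/= => ha hb.
  apply: le_trans AB2.
  pose X x := \sum_(i < N) a i x `^ 1.
  have bX : bnd X by exact: fins_bnd (fS _ _ _ _).
  apply: (@le_trans _ _ (Int (fun x => X x * rmax b N x)%R)).
    apply: le_Int => x; first by apply: sumr_ge0 => i _; rewrite mulr_ge0.
    rewrite mulr_suml; apply: ler_sum => i _; rewrite powRr1// ler_wpM2l//.
    exact: le_rmax.
  have p'0 : 0 < conj_fin p by rewrite (lt_trans ltr01)// conj_fin_gt1.
  have br := fins_bnd (fins_rmax N fb).
  apply: (@Int_hoelder p _ A B X _ p0 p'0 (conj_fin_inv pgt) A0 B0 bX br _ hb).
  by move: ha; rewrite divr1.
- rewrite (conj_expE qgt) (conj_expE pgt)/= => ha hb.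
  set q' := conj_fin q in hb *; set p' := conj_fin p in hb *.
  have q'0 : 0 < q' by rewrite (lt_trans ltr01)// conj_fin_gt1.
  have p'0 : 0 < p' by rewrite (lt_trans ltr01)// conj_fin_gt1.
  apply: le_trans AB2.
  pose X x := (\sum_(i < N) a i x `^ q) `^ q^-1.
  pose Y x := (\sum_(i < N) b i x `^ q') `^ q'^-1.
  have bX : bnd X by apply: bnd_pow; [rewrite invr_ge0 ltW|exact: fins_bnd (fS _ _ _ _)].
  have bY : bnd Y by apply: bnd_pow; [rewrite invr_ge0 ltW|exact: fins_bnd (fS _ _ _ _)].
  apply: (@le_trans _ _ (Int (fun x => X x * Y x)%R)).
    apply: le_Int => x; first by apply: sumr_ge0 => i _; rewrite mulr_ge0.
    by apply: (hoelder_sum _ q0 q'0 (conj_fin_inv qgt)).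
  apply: (@Int_hoelder p p' A B X Y p0 p'0 (conj_fin_inv pgt) A0 B0 bX bY).
  - by under eq_fun do rewrite -powRrM mulrC.
  - by under eq_fun do rewrite -powRrM mulrC.
Qed.

(** For p, q > 1 it collects the two power-sum comparisons, of exponents t = p'/q' and q(t - 1) + 1.
    For q = 1 the factor p comes from the increment bound for p-th powers. *)
Definition norming_cst (p q : R) : R :=
  if p == 1 then 1 else if q == 1 then p else
  let t := conj_fin p / conj_fin q in
  Num.max 1 t * (Num.max 1 (q * (t - 1) + 1)^-1 `^ (p / q)) `^ p^-1.

Lemma norming_cst_gt0 p q : 1 <= p -> 0 < norming_cst p q.
Proof.
move=> p1; rewrite /norming_cst; case: ifP => // _; case: ifP => _; first by rewrite (lt_le_trans ltr01).
by rewrite mulr_gt0 ?powR_gt0 ?lt_max ?ltr01.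
Qed.

(** Solves X <= c M (c1 X)^(1/p) for X by dividing by X^(1/p); this is the self-improvement obtained
    on testing with an extremal sequence. *)
Lemma absorb_powR (p c M c1 X : R) : 1 < p -> 0 < c -> 0 < M -> 0 < c1 -> 0 <= X ->
  (0 < X -> X <= c * (M * (c1 * X) `^ p^-1)) -> X <= (c * c1 `^ p^-1 * M) `^ conj_fin p.
Proof.
move=> p1 c0 M0 c10 X0 h; have p0 : 0 < p by rewrite (lt_trans ltr01).
have p'0 : 0 < conj_fin p by rewrite (lt_trans ltr01)// conj_fin_gt1.
move: X0; rewrite le_eqVlt => /predU1P[<-|X0]; first exact: powR_ge0.
have {}h := h X0.
have hX : X = X `^ (conj_fin p)^-1 * X `^ p^-1.
  by rewrite -powRD ?(gt_eqF X0) ?implybT// addrC conj_fin_inv// powRr1 ?ltW.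
have h1 : X `^ (conj_fin p)^-1 <= c * c1 `^ p^-1 * M.
  rewrite -(ler_pM2r (powR_gt0 p^-1 X0)) -hX; apply: (le_trans h).
  by rewrite powRM ?(ltW c10) ?(ltW X0)// le_eqVlt; apply/orP; left; apply/eqP; ring.
have := ge0_ler_powR (ltW p'0) _ _ h1; rewrite -powRrM mulVf ?gt_eqF// powRr1 ?(ltW X0)//.
by apply; rewrite nnegrE ?powR_ge0// !mulr_ge0 ?powR_ge0 ?ltW.
Qed.

(** The scheme common to the cases p > 1: X is the dual power density to be bounded, S the p-th
    power density of the norm of the extremal sequence, E its pairing with b. As X has finite
    integral r, one may test with A^p = c1 r. *)
Lemma norming_finish (p c M c1 : R) (X : T -> R) (S E : T -> R) : 1 < p -> 0 < c -> 0 < M -> 0 < c1 ->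
  fins X -> bnd S -> bnd E ->
  (forall x, X x <= c * E x) -> (forall x, S x <= c1 * X x) ->
  (forall A : R, 0 < A -> (Int S <= (A `^ p)%:E)%E -> (Int E <= (M * A)%:E)%E) ->
  (Int X <= ((c * c1 `^ p^-1 * M) `^ conj_fin p)%:E)%E.
Proof.
move=> p1 c0 M0 c10 fX bS bE hE hS h.
have p0 : 0 < p by rewrite (lt_trans ltr01).
have bX := fins_bnd fX; have X0 x : 0 <= X x by exact: bnd_ge0.
have I0 := Int_ge0 mu X0; have := fins_Int fX.
have h1 : (Int X <= c%:E * Int E)%E.
  by rewrite -Int_scale ?(ltW c0)//; exact: le_Int.
have h2 : (Int S <= c1%:E * Int X)%E.
  by rewrite -Int_scale ?(ltW c10)//; apply: le_Int => // x; exact: bnd_ge0.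
move: I0 h1 h2; case: (Int X) => [r| |]//; rewrite lee_fin => r0 h1 h2 _.
rewrite lee_fin; apply: absorb_powR => // rgt.
have cr : 0 < c1 * r by rewrite mulr_gt0.
have := h ((c1 * r) `^ p^-1) (powR_gt0 _ cr).
rewrite -powRrM mulVf ?gt_eqF// powRr1 ?(ltW cr)// => /(_ h2) h3.
rewrite -lee_fin EFinM; apply: (le_trans h1); apply: lee_wpmul2l => //.
by rewrite lee_fin ltW.
Qed.

(** * Converse of the Hoelder inequality *)

Section norming.
Variables (p q M : R) (b : nat -> T -> R).
Hypotheses (p1 : 1 <= p) (q1 : 1 <= q) (M0 : 0 < M) (db : dseq b).
Hypothesis h : forall s (A : R), 0 < A -> dseq s -> dnorm_le p%:E q%:E s A ->
  (Int (fun x => \sum_(i < N) s i x * b i x)%R <= (M * A)%:E)%E.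

Let fb : forall i, fins (b i). Proof. exact: db.1. Qed.
Let ab : forall i, adapted (ix i) (b i). Proof. exact: db.2. Qed.
Let p0 : 0 < p. Proof. by rewrite (lt_le_trans ltr01). Qed.
Let q0 : 0 < q. Proof. by rewrite (lt_le_trans ltr01). Qed.
Let b0 i x : 0 <= b i x. Proof. exact/bnd_ge0/fins_bnd. Qed.
Let mcell i y : measurable (cell (ix i) y). Proof. exact: cell_measurable (gi i). Qed.
Let vcell i y : mu (cell (ix i) y) = (v i)%:E. Proof. by have [_ _] := gi i; exact. Qed.
Let v0 i : 0 < v i. Proof. by have [] := gi i. Qed.
Let find i y : fins (\1_(cell (ix i) y) : T -> R).
Proof. by apply: fins_indic => //; rewrite vcell ltry. Qed.
Let aind i j y : (i <= j)%N -> adapted (ix j) (\1_(cell (ix i) y) : T -> R).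
Proof.
move=> ij x z xz; rewrite !indicE; congr (_%:R); congr nat_of_bool.
by apply/idP/idP; rewrite !inE /cell/= (nest_le nest ij xz).
Qed.
Let Iind (c : R) i y : 0 <= c -> Int (fun x => c * \1_(cell (ix i) y) x) = (c * v i)%:E.
Proof.
move=> c0; rewrite Int_scale//; last exact: fins_bnd (find i y).
by rewrite /intR integral_indic// setIT EFinM; congr (_ * _)%E; exact: vcell.
Qed.

(** The indicator of one cell at one level has norm [v i], and its pairing with the adapted b is
    [v i] times the value of b_i on the cell. *)
Let norming_11 : 1 = p -> 1 = q ->
  dnorm_le (conj_exp p) (conj_exp q) b (norming_cst p q * M).
Proof.
move=> pE qE.
rewrite /norming_cst -pE -qE eqxx conj_exp1/= => i y iN.
rewrite mul1r.
pose s k := if k == i then (\1_(cell (ix i) y) : T -> R) else fun=> 0.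
have ds : dseq s.
  by split => k; rewrite /s; have [ki|_] := eqVneq k i; [exact: find|exact: fins0|apply: aind; rewrite ki|].
have sumE (f : nat -> T -> R) x : \sum_(k < N) (if (k : nat) == i then f k x else 0) = f i x.
  rewrite (bigD1 (Ordinal iN))//= eqxx big1 ?addr0// => k kN.
  by case: eqP => // ki; case/eqP: kN; exact: val_inj.
have := h (v0 i) ds; rewrite -pE -qE /= divr1.
have -> : (fun x => (\sum_(i0 < N) s i0 x `^ 1) `^ 1) = (\1_(cell (ix i) y) : T -> R).
  apply/funext => x; rewrite (eq_bigr (fun k : 'I_N => if (k : nat) == i then \1_(cell (ix i) y) x `^ 1 else 0)).
    by rewrite (sumE (fun=> fun x => \1_(cell (ix i) y) x `^ 1)) !powRr1 ?powR_ge0.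
  by move=> k _; rewrite /s; case: eqP => // _; rewrite powR0 ?oner_eq0.
have -> : (fun x => \sum_(i0 < N) s i0 x * b i0 x) = (fun x => b i y * \1_(cell (ix i) y) x).
  apply/funext => x; rewrite (eq_bigr (fun k : 'I_N => if (k : nat) == i then \1_(cell (ix i) y) x * b k x else 0)).
    rewrite (sumE (fun k x => \1_(cell (ix i) y) x * b k x)) mulrC indicE.
    by have [|_] := boolP (x \in _); rewrite ?mulr0// inE => /ab ->.
  by move=> k _; rewrite /s; case: eqP => // _; rewrite mul0r.
rewrite Iind// powRr1 ?(ltW (v0 i))//.
have := Iind i y ler01; under eq_fun do rewrite mul1r; move=> ->.
by rewrite mul1r lexx => /(_ isT); rewrite lee_fin ler_pM2r.
Qed.

(** With G the tail of the b_k^q' from level i and c its average over the cell, the sequence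
    b_k^(q'-1) restricted to the cell and to levels k >= i pairs with b to c v. By concavity its
    norm is at most v c^(1/q), whence c^(1/q') <= M. *)
Let norming_1q : 1 = p -> 1 < q ->
  dnorm_le (conj_exp p) (conj_exp q) b (norming_cst p q * M).
Proof.
move=> pE qgt.
rewrite /norming_cst -pE eqxx conj_exp1 (conj_expE qgt)/= => i y iN.
rewrite mul1r; set q' := conj_fin q.
have q'1 : 1 < q' by exact: conj_fin_gt1.
have q'0 : 0 < q' by rewrite (lt_trans ltr01).
set G := tailsum q' b i; have bG : bnd G by exact: fins_bnd (fins_tailsum i q'0 fb).
set c := avg mu (ix i) (v i) G y.
have G0 x : 0 <= G x by exact: bnd_ge0.
have c0 : 0 <= c by exact: (avg_ge0 (gi i)).
move: c0; rewrite le_eqVlt => /predU1P[<-|c0]; first exact: powR_ge0.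
pose chi : T -> R := \1_(cell (ix i) y).
have bchi : bnd chi by exact: fins_bnd (find i y).
have chi01 x : chi x = 0 \/ chi x = 1.
  by rewrite /chi indicE; case: (x \in _); [right|left].
pose s k := if (i <= k)%N && (k < N)%N then (fun x => b k x `^ (q' - 1) * chi x) else fun=> 0.
have ds : dseq s.
  split => k; rewrite /s; case: ifP => [/andP[ik kN]|_].
  - by apply: fins_mulr; [apply: bnd_pow; [rewrite subr_ge0 ltW|exact: fins_bnd]|exact: find].
  - exact: fins0.
  - by move=> x z xz; rewrite (ab xz) /chi (aind y ik xz).
  - by [].
have := h (mulr_gt0 (v0 i) (powR_gt0 q^-1 c0)) ds; rewrite -pE/=.
have -> : (fun x => (\sum_(i0 < N) s i0 x `^ q) `^ (1 / q)) = (fun x => G x `^ q^-1 * chi x).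
  apply/funext => x; rewrite div1r; have [chi0|chi1] := chi01 x.
    rewrite chi0 mulr0 big1 ?powR0 ?invr_eq0 ?gt_eqF// => k _.
    by rewrite /s; case: ifP => _; rewrite ?chi0 ?mulr0 powR0 ?gt_eqF.
  rewrite chi1 mulr1; congr (_ `^ _); apply: eq_bigr => k _; rewrite /s ltn_ord andbT.
  case: ifP => _; last by rewrite powR0 ?gt_eqF.
  by rewrite chi1 mulr1 -powRrM conj_fin_sub1.
have -> : (fun x => \sum_(i0 < N) s i0 x * b i0 x) = (fun x => G x * chi x).
  apply/funext => x; rewrite mulr_suml; apply: eq_bigr => k _; rewrite /s ltn_ord andbT.
  case: ifP => _; last by rewrite !mul0r.
  by rewrite mulrAC (mulrC (_ `^ _)) mulr_powRB1.
have -> : Int (fun x => G x * chi x) = (c * v i)%:E.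
  have achi : adapted (ix i) chi by exact: aind.
  rewrite -(Int_avgM (gi i) bG bchi achi) -(Iind i y (ltW c0)).
  congr intR; apply/funext => x; rewrite /chi indicE.
  have [|_] := boolP (x \in _); rewrite ?mulr0// inE => xy.
  by rewrite (avg_adapted _ _ _ xy).
have -> : (Int (fun x => (G x `^ q^-1 * chi x)%R) <= ((v i * c `^ q^-1) `^ 1)%:E)%E.
  have qi : 0 < q^-1 by rewrite invr_gt0.
  have bGq : bnd (fun x => G x `^ q^-1) by apply: bnd_pow => //; exact: ltW.
  rewrite -(Int_avgM (gi i) bGq bchi); last exact: aind.
  rewrite powRr1 ?mulr_ge0 ?powR_ge0 ?(ltW (v0 i))// mulrC -(Iind i y (powR_ge0 c (q^-1))).
  apply: le_Int => x.
      exact: (mulr_ge0 (bnd_ge0 x (bnd_avg (gi i) bGq)) (bnd_ge0 x bchi)).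
  rewrite /chi indicE; have [|_] := boolP (x \in _); rewrite ?mulr0// inE => xy.
  rewrite !mulr1 (avg_adapted mu (v i) (fun x => G x `^ q^-1) xy).
  (* The tangent to the concave power at c, divided by c^(1/q). Its average is exactly 1 because c
     is the average of G. *)
  pose H x := c^-1 * q^-1 * G x + (1 - q^-1).
  have q1' : 0 <= 1 - q^-1 by rewrite subr_ge0 invf_le1.
  have bH : bnd H.
    apply: bnd_add; last exact: bnd_cst.
    by apply: bnd_scale => //; rewrite mulr_ge0 ?invr_ge0 ?ltW.
  apply: (@le_trans _ _ (c `^ q^-1 * avg mu (ix i) (v i) H y)).
    apply: (avg_le (gi i)) => //; first exact: powR_ge0.
    move=> z _; rewrite -[X in X `^ _ <= _](divfK (lt0r_neq0 c0)) mulrC.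
    rewrite powRM ?(ltW c0) ?divr_ge0 ?(ltW c0)//; apply: ler_wpM2l; first exact: powR_ge0.
    have := @powR_affine R q^-1 (G z / c) (divr_ge0 (G0 z) (ltW c0)).
    rewrite (ltW qi) invf_le1// q1 => /(_ isT)/le_trans; apply.
    by rewrite /H le_eqVlt; apply/orP; left; apply/eqP; ring.
  rewrite -[leRHS]mulr1; apply: ler_wpM2l; first exact: powR_ge0.
  rewrite /H avg_affine ?mulr_ge0 ?invr_ge0 ?(ltW c0) ?(ltW q0)//.
  rewrite -/c mulrAC mulVf ?gt_eqF// mul1r addrC subrK//.
move=> /(_ isT); rewrite lee_fin mulrCA (mulrC c) ler_pM2l// => hc.
have hcc : c = c `^ q'^-1 * c `^ q^-1.
  by rewrite -powRD ?(gt_eqF c0) ?implybT// addrC conj_fin_inv// powRr1 ?ltW.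
have : c `^ q'^-1 <= M by rewrite -(ler_pM2r (powR_gt0 q^-1 c0)) -hcc.
move=> h1; have := ge0_ler_powR (ltW q'0) _ _ h1; rewrite !nnegrE powR_ge0 (ltW M0).
by rewrite -powRrM mulVf ?gt_eqF// powRr1 ?(ltW c0)//; apply.
Qed.

(** The increments of the running maximum to the power p' - 1 telescope, so the p-th power of their
    sum is the p'-th power of the final maximum. An increment is nonzero only where b_i is itself
    the new maximum, and there the pairing recovers an increment of the p'-th power up to the factor
    p. *)
Let norming_p1 : 1 < p -> 1 = q ->
  dnorm_le (conj_exp p) (conj_exp q) b (norming_cst p q * M).
Proof.
move=> pgt qE.
rewrite /norming_cst -qE eqxx gt_eqF// conj_exp1 (conj_expE pgt)/=.
set p' := conj_fin p; have p'1 : 1 < p' by exact: conj_fin_gt1.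
have p'0 : 0 < p' by rewrite (lt_trans ltr01).
have m0 : 0 < p' - 1 by rewrite subr_gt0.
pose s i x := rmax b i.+1 x `^ (p' - 1) - rmax b i x `^ (p' - 1).
have r0 i x : 0 <= rmax b i x by exact: rmax_ge0.
have rS i x : rmax b i x <= rmax b i.+1 x by rewrite rmaxS le_max lexx.
have s0 i x : 0 <= s i x.
  by rewrite subr_ge0 ge0_ler_powR ?nnegrE ?(ltW m0).
have ds : dseq s.
  split => i.
    apply: (@fins_le _ (fun x => rmax b i.+1 x `^ (p' - 1))); last first.
      by apply: fins_pow => //; exact: fins_rmax.
    + move=> x hx; apply/eqP; rewrite eq_le s0 andbT /s hx sub0r oppr_le0 powR_ge0//.
    + have [m1 [c hc]] : bnd (fun x => rmax b i.+1 x `^ (p' - 1)).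
        by apply: bnd_pow; [exact: ltW|exact/fins_bnd/fins_rmax].
      have [m2 _] : bnd (fun x => rmax b i x `^ (p' - 1)).
        by apply: bnd_pow; [exact: ltW|exact/fins_bnd/fins_rmax].
      split; first exact: measurable_funB.
      exists c => x; rewrite s0/=; case/andP: (hc x) => _; apply: le_trans.
      by rewrite /s gerBl powR_ge0.
  move=> x y xy; rewrite /s (adapted_rmax db xy); congr (_ - _ `^ _).
  case: i xy => // i xy; exact: (adapted_rmax db (nest xy)).
have sumS (n : nat) x : \sum_(i < n) s i x = rmax b n x `^ (p' - 1).
  elim: n => [|n IH]; first by rewrite big_ord0 powR0// gt_eqF.
  by rewrite big_ord_recr/= IH /s addrC subrK.
have := @norming_finish p p M 1 (fun x => rmax b N x `^ p') (fun x => rmax b N x `^ p')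
  (fun x => \sum_(i < N) s i x * b i x) pgt p0 M0 ltr01.
rewrite powR1 mulr1; apply.
+ by apply: fins_pow => //; exact: fins_rmax.
+ by apply: fins_bnd; apply: fins_pow => //; exact: fins_rmax.
+ apply: (@bnd_sum _ _ _ N (fun i x => s i x * b i x)) => i.
  by apply: bnd_mul; [exact: fins_bnd (ds.1 i)|exact: fins_bnd].
+ move=> x; elim: N => [|n IH]; first by rewrite big_ord0 /= powR0 ?mulr0// gt_eqF.
  rewrite big_ord_recr/= -/(rmax b n.+1 x) mulrDr.
  suff : rmax b n.+1 x `^ p' - rmax b n x `^ p' <= p * (s n x * b n x) by move: IH; lra.
  have [le_b|lt_b] := leP (b n x) (rmax b n x).
    have -> : rmax b n.+1 x = rmax b n x by rewrite rmaxS max_l.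
    by rewrite subrr !mulr_ge0// ltW.
  have rb : rmax b n.+1 x = b n x by rewrite rmaxS max_r ?ltW.
  have := @powR_incr_lb R p (s n x) (rmax b n.+1 x `^ (p' - 1)) p0.
  rewrite s0 /s gerBl powR_ge0 => /(_ isT).
  rewrite subKr.
  rewrite -!powRrM (mulrC (p' - 1) p) (mulrC p) conj_fin_sub1// max_r ?(ltW pgt)//.
  have -> : (p' - 1) * (p - 1) = 1.
    rewrite mulrBr mulr1 conj_fin_sub1// -/p'; ring.
  by rewrite powRr1// rb.
+ by move=> x; rewrite mul1r.
+ move=> A A0 hA; apply: (h A0 ds); rewrite -qE/= divr1.
  rewrite (_ : (fun x => _) = (fun x => rmax b N x `^ p'))//; apply/funext => x.
  rewrite (eq_bigr (fun i : 'I_N => s i x)); last by move=> i _; rewrite powRr1.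
  by rewrite sumS -powRrM conj_fin_sub1.
Qed.

(** The usual extremal sequence would carry a power of the full sum of the b_j^q', which is not
    adapted; the partial sum P_i replaces it. With u_i = b_i^q', t = p'/q' and k = q(t - 1) + 1, the
    pairing is the sum of u_i P_i^(t-1) and the q-th power sum that of u_i P_i^(k-1). They are
    comparable to U^t and U^k, and k p/q = t. *)
Let norming_pq : 1 < p -> 1 < q ->
  dnorm_le (conj_exp p) (conj_exp q) b (norming_cst p q * M).
Proof.
move=> pgt qgt.
rewrite /norming_cst !gt_eqF// (conj_expE pgt) (conj_expE qgt)/=.
set p' := conj_fin p; set q' := conj_fin q; set t := p' / q'.
have p'1 : 1 < p' by exact: conj_fin_gt1.
have p'0 : 0 < p' by rewrite (lt_trans ltr01).
have q'1 : 1 < q' by exact: conj_fin_gt1.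
have q'0 : 0 < q' by rewrite (lt_trans ltr01).
have t0 : 0 < t by rewrite divr_gt0.
set k := q * (t - 1) + 1.
have kE : k = q * (p' - 1) / q'.
  rewrite /k /t /q' /conj_fin; field; rewrite subr_eq0 !gt_eqF//.
have k0 : 0 < k by rewrite kE; apply: divr_gt0 => //; apply: mulr_gt0 => //; rewrite subr_gt0.
pose u i x := b i x `^ q'.
have du : dseq u by exact: dseq_pow.
have u0 i x : 0 <= u i x by exact: powR_ge0.
have P0 i x : 0 <= psum (u ^~ x) i by exact: psum_ge0.
pose s i x := b i x `^ (q' - 1) * psum (u ^~ x) i `^ (t - 1).
have s0 i x : 0 <= s i x by rewrite mulr_ge0 ?powR_ge0.
have bu i := fins_bnd (du.1 i).
have bP i : bnd (fun x => psum (u ^~ x) i) by exact: bnd_psum.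
have bP0 i x : psum (u ^~ x) i = 0 -> b i x = 0.
  rewrite psumS => /eqP; rewrite paddr_eq0 ?sumr_ge0// => /andP[_ /eqP].
  by move/powR_eq0_eq0.
(* For t < 1 the weight P_i^(t-1) alone is unbounded. Since b_i^q' <= P_i, the product is bounded by
   P_i^(t - 1/q'), whose exponent (p' - 1)/q' is positive. *)
have sle i x : s i x <= psum (u ^~ x) i `^ (t - q'^-1).
  have [Pz|Pz] := eqVneq (psum (u ^~ x) i) 0.
    by rewrite /s bP0// powR0 ?mul0r ?powR_ge0// subr_eq0 gt_eqF.
  have -> : t - q'^-1 = (q' - 1) / q' + (t - 1) by field; rewrite gt_eqF.
  rewrite powRD ?Pz ?implybT//; apply: ler_wpM2r; first exact: powR_ge0.
  have bE : b i x = u i x `^ q'^-1 by rewrite /u -powRrM mulfV ?gt_eqF// powRr1.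
  rewrite bE -powRrM (mulrC q'^-1); apply: ge0_ler_powR; rewrite ?nnegrE//.
    by apply: divr_ge0; [rewrite subr_ge0 ltW|exact: ltW].
  by rewrite psumS lerDr; exact: sumr_ge0.
have ds : dseq s.
  split => i.
    apply: (@fins_le _ (b i)) => //.
      have [_ [c hc]] : bnd (fun x => psum (u ^~ x) i `^ (t - q'^-1)).
        rewrite (_ : t - q'^-1 = (p' - 1) / q'); last by rewrite mulrBl mul1r.
        by apply: bnd_pow => //; apply: divr_ge0; [rewrite subr_ge0 ltW|exact: ltW].
      split; last first.
        by exists c => x; rewrite s0/= (le_trans (sle i x))//; case/andP: (hc x).
      apply: measurable_funM.
          exact: (measurableT_comp (measurable_powR (q' - 1)) (bnd_m (fins_bnd (fb i)))).
        exact: (measurableT_comp (measurable_powR (t - 1)) (bnd_m (bP i))).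
    by move=> x hx; rewrite /s hx powR0 ?mul0r// subr_eq0 gt_eqF.
  move=> x y xy; rewrite /s (ab xy); congr (_ * _ `^ _).
  by apply: (adapted_psum nest _ xy) => j; exact: du.2.
pose U x := \sum_(i < N) u i x.
have fU : fins U by exact: (@fins_sum N u du.1).
have U0 x : 0 <= U x by exact: sumr_ge0.
have SbE x : \sum_(i < N) s i x * b i x = \sum_(i < N) u i x * psum (u ^~ x) i `^ (t - 1).
  apply: eq_bigr => i _; rewrite /s mulrAC (mulrC (_ `^ _)) mulr_powRB1//.
have SqE x : \sum_(i < N) s i x `^ q = \sum_(i < N) u i x * psum (u ^~ x) i `^ (k - 1).
  apply: eq_bigr => i _; rewrite /s powRM ?powR_ge0// -!powRrM conj_fin_sub1// -/q'.
  by rewrite /k addrK (mulrC q).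
set m := Num.max 1 k^-1.
have m0 : 0 < m by rewrite lt_max ltr01.
have bSq : bnd (fun x => \sum_(i < N) s i x `^ q).
  by apply: (@bnd_sum _ _ _ N (fun i x => s i x `^ q)) => i; apply: bnd_pow; [exact: ltW|exact: fins_bnd (ds.1 i)].
apply: (@norming_finish p (Num.max 1 t) M (m `^ (p / q)) (fun x => U x `^ t)
  (fun x => (\sum_(i < N) s i x `^ q) `^ (p / q)) (fun x => \sum_(i < N) s i x * b i x)) => //.
+ by rewrite lt_max ltr01.
+ by rewrite powR_gt0.
+ exact: fins_pow.
+ by apply: bnd_pow => //; rewrite divr_ge0 ?ltW.
+ apply: (@bnd_sum _ _ _ N (fun i x => s i x * b i x)) => i.
  by apply: bnd_mul; [exact: fins_bnd (ds.1 i)|exact: fins_bnd].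
+ by move=> x; rewrite SbE; exact: sum_powR_incr_lb.
+ move=> x; rewrite SqE.
  have h1 := @sum_powR_incr_ub R k (u ^~ x) N k0 (fun i => u0 i x).
  have h2 := ge0_ler_powR (divr_ge0 (ltW p0) (ltW q0)) _ _ h1.
  have -> : U x `^ t = (U x `^ k) `^ (p / q).
    rewrite -powRrM kE; congr (_ `^ _).
    have : (p' - 1) * p = p' by exact: conj_fin_sub1.
    rewrite /t => e; rewrite -{1}e; field; rewrite !gt_eqF//.
  rewrite -powRM ?powR_ge0 ?(ltW m0)//; apply: h2; rewrite nnegrE.
    by apply: sumr_ge0 => i _; rewrite mulr_ge0 ?powR_ge0.
  by rewrite mulr_ge0 ?powR_ge0 ?(ltW m0).
+ by move=> A A0 hA; exact: (h A0 ds).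
Qed.

Lemma discrete_norming : dnorm_le (conj_exp p) (conj_exp q) b (norming_cst p q * M).
Proof.
have le1 (r : R) : 1 <= r -> 1 = r \/ 1 < r by rewrite le_eqVlt => /predU1P.
have [pE|pgt] := le1 p p1; have [qE|qgt] := le1 q q1.
- exact: norming_11.
- exact: norming_1q.
- exact: norming_p1.
- exact: norming_pq.
Qed.

End norming.

End levels.
End discrete.

(** * Grids of cubes *)

Section measurable_sets.
Context d (T : measurableType d) (R : realType).

Lemma mset_lt (f g : T -> R) : measurable_fun setT f -> measurable_fun setT g ->
  measurable [set x | f x < g x].
Proof.
move=> mf mg; have /(_ measurableT [set true] I) := measurable_fun_ltr mf mg.
rewrite setTI; congr measurable.
Qed.

Lemma mset_le (f g : T -> R) : measurable_fun setT f -> measurable_fun setT g ->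
  measurable [set x | f x <= g x].
Proof.
move=> mf mg; have /(_ measurableT [set true] I) := measurable_fun_ler mf mg.
rewrite setTI; congr measurable.
Qed.

Lemma mset_forall (I : finType) (P : I -> set T) : (forall i, measurable (P i)) ->
  measurable [set x | forall i, P i x].
Proof.
move=> mP; have -> : [set x | forall i, P i x] = ~` \bigcup_i ~` P i.
  apply/seteqP; split => [x Px [i _]|x nP i]; first exact.
  by apply: contrapT => nPi; apply: nP; exists i.
by apply: measurableC; apply: countable_bigcupT_measurable => // i; exact: measurableC.
Qed.

End measurable_sets.

Section boxes.
Variable R : realType.

Lemma lamE (A : set R) : measurable A -> lam R A = @lebesgue_measure R A.
Proof.
move=> mA; have mI : measurable_fun setT (EFin \o (\1_A : R -> R)).
  by apply/measurable_EFinP; exact: measurable_indic.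
have := @integral_lam R _ mI (fun x => _); rewrite !integral_indic// !setIT => ->// x.
by rewrite lee_fin.
Qed.

Lemma lam_itvoo (a b : R) : a <= b -> lam R [set t | a < t < b] = (b - a)%:E.
Proof.
move=> ab; have -> : [set t | a < t < b] = `]a, b[%classic.
  by apply/seteqP; split => t; rewrite /= in_itv.
rewrite lamE// lebesgue_measure_itv/= lte_fin; case: ltP => // ba.
by rewrite (_ : b = a) ?subrr//; apply/eqP; rewrite eq_le ba.
Qed.

Lemma lam_itvco (a b : R) : a <= b -> lam R [set t | a <= t < b] = (b - a)%:E.
Proof.
move=> ab; have -> : [set t | a <= t < b] = `[a, b[%classic.
  by apply/seteqP; split => t; rewrite /= in_itv.
rewrite lamE// lebesgue_measure_itv/= lte_fin; case: ltP => // ba.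
by rewrite (_ : b = a) ?subrr//; apply/eqP; rewrite eq_le ba.
Qed.

Lemma measurable_prod_set n (A : nat -> set R) : (forall j, measurable (A j)) ->
  measurable [set x : n.-tuple R | forall j : 'I_n, A j (tnth x j)].
Proof.
move=> mA.
apply: (@mset_forall _ _ 'I_n (fun j => [set x : n.-tuple R | A j (tnth x j)])) => j.
rewrite -[X in measurable X]setTI; exact: (measurable_tnth j).
Qed.

Lemma iint0 n : iint (fun _ : n.-tuple R => 0%E) = 0%E.
Proof. by elim: n => //= n IH; under eq_integral do rewrite IH; rewrite integral0. Qed.

(** The sides form a family indexed by all naturals, so that the induction on the dimension is a
    shift of the family. *)
Lemma iint_prod_set n (A : nat -> set R) : (forall j, measurable (A j)) ->
  iint (fun x : n.-tuple R => (\1_[set x : n.-tuple R | forall j : 'I_n, A j (tnth x j)] x)%:E)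
  = (\prod_(j < n) lam R (A j))%E.
Proof.
elim: n A => [|n IH] A mA /=.
  rewrite big_ord0 indicE mem_set//= => -[]//.
under eq_integral => a _.
  rewrite (_ : iint _ = ((\1_(A 0%N) a)%:E * \prod_(j < n) lam R (A j.+1))%E).
    over.
  rewrite -(IH (fun j => A j.+1)); last by move=> j; exact: mA.
  have [aA|aA] := boolP (a \in A 0%N).
    rewrite indicE aA mul1e; congr iint; apply/funext => y.
    rewrite !indicE; congr (_%:R%:E); congr nat_of_bool.
    apply/idP/idP; rewrite !inE/= => h j.
      by have := h (lift ord0 j); rewrite tnthS.
    case: (unliftP ord0 j) => [k ->|->]; first by rewrite tnthS; exact: h.
    by rewrite inE in aA; rewrite tnth0.
  rewrite indicE (negbTE aA) mul0e -[RHS](iint0 n); congr iint; apply/funext => y.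
  rewrite indicE memNset//= => /(_ ord0); rewrite tnth0 => h.
  by move: aA; rewrite notin_setE.
have p0 : (0 <= \prod_(j < n) lam R (A j.+1))%E by apply: prode_ge0 => j _.
rewrite integral_lam//; last 2 first.
- apply: emeasurable_funM; last exact: measurable_cst.
  by apply/measurable_EFinP; exact: measurable_indic.
- by move=> a; rewrite mule_ge0// lee_fin.
rewrite ge0_integralZr//; last by apply/measurable_EFinP; exact: measurable_indic.
by rewrite integral_indic// setIT big_ord_recl.
Qed.

Lemma leb_prod_set n (A : nat -> set R) : (forall j, measurable (A j)) ->
  leb R n [set x : n.-tuple R | forall j : 'I_n, A j (tnth x j)] = (\prod_(j < n) lam R (A j))%E.
Proof.
move=> mA; rewrite -iint_prod_set// iintE//.
- by rewrite integral_indic ?setIT//; exact: measurable_prod_set.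
- by apply/measurable_EFinP/measurable_indic; exact: measurable_prod_set.
Qed.

Definition cube n (c : n.-tuple R) (r : R) : set (n.-tuple R) :=
  [set x | forall j : 'I_n, `|tnth x j - tnth c j| < r].

Let cube_sides n (c : n.-tuple R) (r : R) (j : nat) : set R :=
  [set t | nth 0 c j - r < t < nth 0 c j + r].

Let cubeE n (c : n.-tuple R) r :
  cube c r = [set x : n.-tuple R | forall j : 'I_n, cube_sides c r j (tnth x j)].
Proof.
by apply/seteqP; split => x h j; have := h j;
  rewrite /cube_sides/= -tnth_nth ltr_distl.
Qed.

Let measurable_cube_sides n (c : n.-tuple R) r j : measurable (cube_sides c r j).
Proof.
rewrite /cube_sides (_ : [set _ | _] = `]nth 0 c j - r, nth 0 c j + r[%classic)//.
Qed.

Lemma measurable_cube n (c : n.-tuple R) r : measurable (cube c r).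
Proof. by rewrite cubeE; apply: measurable_prod_set => j; exact: measurable_cube_sides. Qed.

Lemma prode_cst n (x : R) : (\prod_(j < n) x%:E)%E = (x ^+ n)%:E.
Proof. by elim: n => [|n IH]; rewrite ?big_ord0// big_ord_recl IH -EFinM exprS. Qed.

Lemma leb_cube n (c : n.-tuple R) (r : R) : 0 <= r -> leb R n (cube c r) = ((2 * r) ^+ n)%:E.
Proof.
move=> r0; rewrite cubeE leb_prod_set; last by move=> j; exact: measurable_cube_sides.
rewrite -prode_cst; apply: eq_bigr => j _.
rewrite /cube_sides lam_itvoo; last by lra.
by congr EFin; lra.
Qed.

(** Cells are cubes of side [l]; the offset [o] is measured in units of the side, coordinate by
    coordinate. *)
Definition gix n (l : R) (o : nat -> R) (x : n.-tuple R) : n.-tuple int :=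
  [tuple Num.floor (tnth x k / l + o k) | k < n].

Lemma gixP n l o (x y : n.-tuple R) : gix l o x = gix l o y <->
  forall j : 'I_n, Num.floor (tnth x j / l + o j) = Num.floor (tnth y j / l + o j).
Proof.
split => [h j|h]; last by apply: eq_from_tnth => j; rewrite !tnth_mktuple.
by move/(congr1 (fun t => tnth t j)) : h; rewrite !tnth_mktuple.
Qed.

Lemma gix_grid n l o : 0 < l -> grid (leb R n) (@gix n l o) (l ^+ n).
Proof.
move=> l0.
pose A (m : nat -> int) j := [set t : R | (m j)%:~R <= t / l + o j < (m j + 1)%:~R].
have AE m j : A m j = [set t : R | l * ((m j)%:~R - o j) <= t < l * ((m j + 1)%:~R - o j)].
  apply/seteqP; split => t; rewrite /A/= -lerBlDr -ltrBrDr (ler_pdivlMr _ _ l0) (ltr_pdivrMr _ _ l0).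
    by rewrite ![_ * l]mulrC.
  by rewrite ![_ * l]mulrC.
have mA m j : measurable (A m j).
  rewrite AE (_ : [set _ | _] = `[l * ((m j)%:~R - o j), l * ((m j + 1)%:~R - o j)[%classic)//.
have fE (k : n.-tuple int) : @gix n l o @^-1` [set k] =
    [set x : n.-tuple R | forall j : 'I_n, A (nth 0 k) j (tnth x j)].
  apply/seteqP; split => x /= h.
    by move=> j; rewrite /A/= -floor_eq -tnth_nth -h tnth_mktuple.
  apply: eq_from_tnth => j; rewrite tnth_mktuple; apply/eqP.
  by rewrite floor_eq; have := h j; rewrite /A/= -tnth_nth.
split; first exact: exprn_gt0.
  by move=> k; rewrite fE; exact: measurable_prod_set.
move=> x; rewrite -[cell _ _]/(@gix n l o @^-1` [set gix l o x]) fE leb_prod_set//.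
rewrite -prode_cst; apply: eq_bigr => j _; rewrite AE lam_itvco.
  by congr EFin; rewrite intrD; ring.
by rewrite ler_pM2l// intrD; lra.
Qed.

(** Under the two arithmetic conditions the coarse coordinate is (u + m)/c, with u the fine
    coordinate and m an integer; its floor depends only on the floor of u. *)
Lemma gix_refine n (l l' : R) (o o' : nat -> R) (c : nat) (x y : n.-tuple R) : (0 < c)%N ->
  0 < l -> l' = c%:R * l -> (forall j, exists m : int, c%:R * o' j - o j = m%:~R) ->
  gix l o x = gix l o y -> gix l' o' x = gix l' o' y.
Proof.
move=> c0 l0 -> hz /gixP h; apply/gixP => j; have [m hm] := hz j.
have cR : 0 < c%:R :> R by rewrite ltr0n.
have e (t : R) : t / (c%:R * l) + o' j = ((t / l + o j) + m%:~R) / c%:R.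
  rewrite -hm; field; by rewrite !gt_eqF.
rewrite !e; apply/eqP; rewrite floor_eq.
have k (u : R) (z : int) : (z%:~R <= (u + m%:~R) / c%:R) = (z * c - m <= Num.floor u).
  by rewrite ler_pdivlMr// -lerBlDr floor_ge_int intrD intrM mulrNz.
have := floor_itv ((tnth y j / l + o j + m%:~R) / c%:R).
by rewrite k ltNge k -h -!k -ltNge.
Qed.

(** An open interval of length 1/2 contains at most one multiple of 1/2, so the interval or its
    translate by 1/2 avoids the integers where the floor would jump. *)
Lemma floor_half (u : R) : exists b : bool, forall w, `|w - u| < 4^-1 ->
  Num.floor (w + b%:R / 2) = Num.floor (u + b%:R / 2).
Proof.
have /andP[f1 f2] := floor_itv u; rewrite intrD in f2.
have bt : (true%:R : R) = 1 by []; have bf : (false%:R : R) = 0 by [].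
have [h1|h1] := leP (u - (Num.floor u)%:~R) (4^-1).
  exists true => w; rewrite bt ltr_distl => /andP[w1 w2].
  by transitivity (Num.floor u); [|symmetry]; apply: floor_def; rewrite intrD; lra.
have [h2|h2] := ltP (u - (Num.floor u)%:~R) (3 / 4).
  exists false => w; rewrite bf ltr_distl => /andP[w1 w2].
  by transitivity (Num.floor u); [|symmetry]; apply: floor_def; rewrite intrD; lra.
exists true => w; rewrite bt ltr_distl => /andP[w1 w2].
by transitivity (Num.floor u + 1); [|symmetry]; apply: floor_def; rewrite !intrD; lra.
Qed.

Definition shift n (i : n.-tuple bool) (j : nat) : R := (nth false i j)%:R / 2.

(** The shift is chosen separately in each coordinate, so 2^n shifts serve all points: every cube of
    radius a quarter of the mesh lies in one cell of one of the shifted grids. *)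
Lemma gix_shift n l (x : n.-tuple R) : 0 < l -> exists i : n.-tuple bool, forall y,
  cube x (l / 4) y -> gix l (shift i) y = gix l (shift i) x.
Proof.
move=> l0; pose b j := projT1 (cid (floor_half (tnth x j / l))).
exists [tuple b j | j < n] => y xy; apply/gixP => j.
rewrite /shift -tnth_nth tnth_mktuple /b; case: cid => /= c; apply.
rewrite -mulrBl normrM normfV (gtr0_norm l0) ltr_pdivrMr// mulrC.
by have := xy j; rewrite mulrC.
Qed.

Lemma gix_dist n l o (x y : n.-tuple R) : 0 < l -> gix l o x = gix l o y -> cube x l y.
Proof.
move=> l0 /gixP h j; have := h j => e.
have := floor_itv (tnth x j / l + o j); have := floor_itv (tnth y j / l + o j).
rewrite e; set m := Num.floor _; rewrite intrD => /andP[h1 h2] /andP[h3 h4].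
have : `|tnth y j / l - tnth x j / l| < 1 by rewrite ltr_distl; lra.
by rewrite -mulrBl normrM normfV (gtr0_norm l0) ltr_pdivrMr// mul1r.
Qed.

End boxes.

Section euclid.
Variables (R : realType) (n : nat).
Implicit Types (x y : n.-tuple R).

Lemma edist_ge x y (j : 'I_n) : `|tnth x j - tnth y j| <= edist x y.
Proof.
rewrite /edist -sqrtr_sqr ler_wsqrtr// (bigD1 j)//= lerDl.
by apply: sumr_ge0 => i _; exact: sqr_ge0.
Qed.

Lemma edist_lt x y (r : R) : (0 < n)%N -> (forall j, `|tnth x j - tnth y j| < r) ->
  edist x y < n%:R * r.
Proof.
move=> n0 h; have j0 : 'I_n := Ordinal n0.
have r0 : 0 < r by apply: le_lt_trans (h j0).
have nr0 : 0 < n%:R * r by rewrite mulr_gt0// ltr0n.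
rewrite /edist -[ltRHS](gtr0_norm nr0) -sqrtr_sqr ltr_sqrt; last by rewrite exprn_gt0.
have h2 j : (tnth x j - tnth y j) ^+ 2 < r ^+ 2.
  by rewrite -real_normK ?num_real// ltr_pXn2r// ?nnegrE// ltW.
apply: (@lt_le_trans _ _ (\sum_(j < n) r ^+ 2)).
  apply: ltr_sum => [|j _]; last exact: h2.
  by apply/hasP; exists j0; rewrite ?mem_index_enum.
rewrite sumr_const card_ord exprMn -[leLHS]mulr_natl; apply: ler_wpM2r; first exact: sqr_ge0.
by rewrite expr2 ler_peMl// ?ler1n.
Qed.

Lemma edistxx x : edist x x = 0.
Proof. by rewrite /edist big1 ?sqrtr0// => i _; rewrite subrr expr0n. Qed.

Lemma measurable_edist d (T : measurableType d) (f g : T -> n.-tuple R) :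
  measurable_fun setT f -> measurable_fun setT g ->
  measurable_fun setT (fun z => edist (f z) (g z)).
Proof.
move=> mf mg; rewrite /edist.
rewrite (_ : (fun z => _) = (fun z => (\sum_(i < n) (tnth (f z) i - tnth (g z) i) ^+ 2) `^ 2^-1)).
  apply: (measurableT_comp (measurable_powR _)); apply: measurable_sum => i.
  apply: measurable_funX; apply: measurable_funB.
  - exact: (measurableT_comp (measurable_tnth i) mf).
  - exact: (measurableT_comp (measurable_tnth i) mg).
apply/funext => z; rewrite powR12_sqrt//; apply: sumr_ge0 => i _; exact: sqr_ge0.
Qed.

End euclid.

(** * Integrals over sets, null sets and essential suprema *)

Section sint_lemmas.
Variables (R : realType) (n : nat).
Local Notation P := (pt R n).
Local Notation nu := (leb1 R n).

Lemma restr_indic (S : set P) (g : P -> R) z :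
  restr S (fun z => (g z)%:E) z = ((\1_S z : R) * g z)%:E.
Proof.
rewrite /restr indicE; case: asboolP => Sz.
  by rewrite mem_set// mul1r.
by rewrite memNset// mul0r.
Qed.

Lemma sint_real (S : set P) (g : P -> R) : measurable S -> measurable_fun setT g ->
  (forall z, 0 <= g z) ->
  sint S (fun z => (g z)%:E) = intR nu (fun z => (\1_S z : R) * g z).
Proof.
move=> mS mg g0; rewrite /sint (_ : restr S _ = fun z => ((\1_S z : R) * g z)%:E); last first.
  by apply/funext => z; exact: restr_indic.
rewrite fintE//.
- by apply/measurable_EFinP/measurable_funM => //; exact: measurable_indic.
- by move=> z; rewrite lee_fin mulr_ge0.
Qed.

Lemma volE (S : set P) : measurable S -> vol S = nu S.
Proof.
move=> mS; rewrite /vol (@sint_real S (fun=> 1) mS (measurable_cst _) (fun _ => ler01)).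
by rewrite /intR; under eq_integral do rewrite mulr1; rewrite integral_indic// setIT.
Qed.

Lemma measurable_prodset (A : set (n.-tuple R)) (B : set R) : measurable A -> measurable B ->
  measurable [set z : P | A z.1 /\ B z.2].
Proof. exact: measurableX. Qed.

Lemma nu_prodset (A : set (n.-tuple R)) (B : set R) : measurable A -> measurable B ->
  nu [set z : P | A z.1 /\ B z.2] = (leb R n A * lam R B)%E.
Proof. by move=> mA mB; rewrite [LHS]product_measure1E. Qed.

Lemma null_measurable (A : set P) : measurable A -> null A <-> nu A = 0%E.
Proof.
move=> mA; split => [[B [mB [AB vB]]]|A0]; last first.
  by exists A; split => //; split => //; rewrite volE.
apply/eqP; rewrite eq_le measure_ge0 andbT -vB volE//.
by apply: le_measure; rewrite ?inE.
Qed.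

Lemma nullS (A B : set P) : A `<=` B -> null B -> null A.
Proof. by move=> AB [C [mC [BC vC]]]; exists C; split => //; split => // z /AB/BC. Qed.

Lemma null_bigcup (A : nat -> set P) : (forall k, null (A k)) -> null (\bigcup_k A k).
Proof.
move=> nA; pose B k := projT1 (cid (nA k)).
have hB k : measurable (B k) /\ A k `<=` B k /\ nu (B k) = 0%E.
  by rewrite /B; case: cid => /= C [mC [AC]]; rewrite volE.
have mU : measurable (\bigcup_k B k) by apply: bigcup_measurable => k _; have [] := hB k.
exists (\bigcup_k B k); split => //; split.
  by apply: subset_bigcup => k _; have [_ []] := hB k.
rewrite volE//; apply: measure_negligible => //; apply: negligible_bigcup => k.
by have [mB [_ B0]] := hB k; exact/negligibleP.
Qed.

(** Positive measure of A matters: over a null set every value is an essential bound, and the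
    infimum is [-oo]. *)
Lemma esssup_ge0 (A : set P) (g : P -> \bar R) : measurable A -> (0 < nu A)%E ->
  (forall z, 0 <= g z)%E -> (0 <= esssup A g)%E.
Proof.
move=> mA A0 g0; apply: le_ereal_inf_tmp => M hM; rewrite leNgt; apply/negP => M0.
suff h0 : nu A = 0%E by rewrite h0 ltxx in A0.
apply/(null_measurable mA).
by apply: nullS hM => z Az; split => //; exact: lt_le_trans (g0 z).
Qed.

Lemma esssup_le (A : set P) (g : P -> \bar R) (M : \bar R) :
  null [set z | A z /\ (M < g z)%E] -> (esssup A g <= M)%E.
Proof. by move=> h; apply: ereal_inf_lbound. Qed.

Lemma esssup_le_sup (A : set P) (g : P -> \bar R) (M : \bar R) :
  (forall z, A z -> (g z <= M)%E) -> (esssup A g <= M)%E.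
Proof.
move=> h; apply: esssup_le; exists set0; split => //; split; last by rewrite volE// measure0.
by move=> z [/h]; rewrite leNgt => /negP.
Qed.

Lemma esssupP (A : set P) (g : P -> \bar R) (M : \bar R) :
  (esssup A g < M)%E -> null [set z | A z /\ (M < g z)%E].
Proof.
move=> h; have [M' nM' MM'] := ereal_inf_lt h.
by apply: nullS nM' => z [Az Mg]; split => //; exact: lt_trans Mg.
Qed.

Lemma esssup_null (A : set P) (g : P -> R) (e : R) : (esssup A (EFin \o g) <= e%:E)%E ->
  null [set z | A z /\ e < g z].
Proof.
move=> h; apply: (@nullS _ (\bigcup_k [set z | A z /\ ((e + k.+1%:R^-1)%:E < (EFin \o g) z)%E])).
  move=> z [Az]; rewrite -subr_gt0 => gz.
  have [k _ hk] := near_infty_natSinv_lt (PosNum gz).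
  exists k => //=; split => //; rewrite lte_fin -ltrBrDl.
  by have := hk k (leqnn _).
apply: null_bigcup => k; apply: esssupP; apply: (le_lt_trans h).
by rewrite lte_fin ltrDl invr_gt0.
Qed.

Lemma esssup_mono (A B : set P) (g h : P -> \bar R) : A `<=` B ->
  (forall z, A z -> (g z <= h z)%E) -> (esssup A g <= esssup B h)%E.
Proof.
move=> AB gh; apply: le_ereal_inf_tmp => M hM; apply: esssup_le.
by apply: nullS hM => z [Az Mg]; split; [exact: AB|exact: lt_le_trans (gh _ Az)].
Qed.

End sint_lemmas.

(** The functional [Wr] with the modulus already taken: by conversion, [Wr] of f is [WR] of its
    modulus. It allows nonnegative functions to be treated apart from complex numbers. *)
Definition WR (R : realType) n (a1 a2 : R) (r : \bar R) (F : pt R n -> \bar R) (z : pt R n) : \bar R :=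
  match r with
  | r'%:E => (vol (whitney a1 a2 z) `^ (- r'^-1) *
             (sint (whitney a1 a2 z) (fun w => F w `^ r')) `^ (r'^-1))%E
  | +oo%E => esssup (whitney a1 a2 z) F
  | -oo%E => +oo%E
  end.

(** * Whitney regions and grid boxes *)

Section scales.
Variable R : realType.

(** Meshes are rounded down to powers of 3: their ratios are odd, which keeps grids displaced by
    half a cell nested. *)
Lemma ex_pow3 (x : R) : exists k : int, 0 < x -> 3 `^ k%:~R <= x < 3 * 3 `^ k%:~R.
Proof.
have l3 : 0 < ln (3 : R) by rewrite ln_gt0// ltr1n.
exists (Num.floor (ln x / ln 3)) => x0.
have /andP[h1 h2] := floor_itv (ln x / ln 3).
set k := Num.floor _ in h1 h2 *; rewrite intrD in h2.
have p0 (z : R) : 0 < 3 `^ z by apply: powR_gt0.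
have E (z : R) : ln (3 `^ z) = z * ln 3 by rewrite ln_powR.
apply/andP; split.
  rewrite -ler_ln ?posrE// E -ler_pdivlMr//.
have -> : 3 * 3 `^ k%:~R = 3 `^ (k%:~R + 1) :> R.
  by rewrite powRD ?powRr1 ?(pnatr_eq0 _ 3) ?implybT// mulrC.
by rewrite -ltr_ln ?posrE// E -ltr_pdivrMr.
Qed.

Definition lev (x : R) : int := projT1 (cid (ex_pow3 x)).

Lemma levP x : 0 < x -> 3 `^ (lev x)%:~R <= x < 3 * 3 `^ (lev x)%:~R.
Proof. by rewrite /lev; case: cid. Qed.

Lemma pow3S (k : int) : 3 * 3 `^ k%:~R = 3 `^ (k + 1)%:~R :> R.
Proof. by rewrite intrD powRD ?powRr1 ?(pnatr_eq0 _ 3) ?implybT// mulrC. Qed.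

Lemma lev_le x y : 0 < x -> x <= y -> lev x <= lev y.
Proof.
move=> x0 xy; have /andP[h1 _] := levP x0; have /andP[_ h2] := levP (lt_le_trans x0 xy).
rewrite -ltzD1 ltNge; apply/negP => h.
have : 3 `^ (lev x)%:~R < 3 `^ (lev y + 1)%:~R :> R.
  by rewrite -pow3S; exact: le_lt_trans (le_trans h1 xy) h2.
by rewrite ltNge ler_powR ?ler1n// ler_int.
Qed.

Lemma pow3_ratio (k l : int) : k <= l ->
  3 `^ l%:~R = (3 ^ `|l - k|)%N%:R * 3 `^ k%:~R :> R.
Proof.
move=> kl; rewrite natrX -powR_mulrn// -powRD ?(pnatr_eq0 _ 3) ?implybT//.
congr (_ `^ _); rewrite -[X in X + _]mulrz_nat natz gez0_abs ?subr_ge0// -intrD.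
by rewrite subrK.
Qed.

End scales.

(** A constant C >= 1 survives the r-th root, so the Whitney comparisons hold with constants
    independent of r and agree with the case r = oo. *)
Lemma root_le (R : realType) (C r u w : R) : 1 <= C -> 1 <= r -> 0 <= u -> 0 <= w -> u <= C * w ->
  u `^ r^-1 <= C * w `^ r^-1.
Proof.
move=> C1 r1 u0 w0 h; have r0 : 0 < r by rewrite (lt_le_trans ltr01).
have C0 : 0 <= C by rewrite (le_trans ler01).
apply: (@le_trans _ _ ((C * w) `^ r^-1)).
  by rewrite ge0_ler_powR ?nnegrE ?invr_ge0 ?(ltW r0)// mulr_ge0.
rewrite powRM//; apply: ler_wpM2r; first exact: powR_ge0.
by rewrite -[leRHS]powRr1// ler_powR// invf_le1.
Qed.

Lemma bnd_indic d (T : measurableType d) (R : realType) (A : set T) :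
  measurable A -> bnd (\1_A : T -> R).
Proof.
move=> mA; split; first exact: measurable_indic.
by exists 1 => y; rewrite indicE; case: (_ \in _); rewrite ?lexx ?ler01.
Qed.

Lemma Int_indic d (T : measurableType d) (R : realType) (m : {sigma_finite_measure set T -> \bar R})
  (A : set T) : measurable A -> intR m (\1_A : T -> R) = m A.
Proof. by move=> mA; rewrite /intR integral_indic// setIT. Qed.

Lemma le_indic T (R : realType) (A B : set T) (u : T) : (A u -> B u) -> \1_A u <= \1_B u :> R.
Proof.
move=> AB; rewrite !indicE; case: (boolP (u \in A)) => [/set_mem/AB h|_]; last exact: ler0n.
by rewrite mem_set.
Qed.

Section slices.
Variables (R : realType) (n : nat).

Lemma measurable_slice (g : pt R n -> R) (y : n.-tuple R) :
  measurable_fun setT g -> measurable_fun setT (fun t => g (y, t)).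
Proof. by move=> mg; exact: (measurableT_comp mg (measurable_pair1 y)). Qed.

Lemma measurable_sliceE (g : pt R n -> R) (y : n.-tuple R) :
  measurable_fun setT g -> measurable_fun setT (fun t => (g (y, t))%:E).
Proof.
by move=> mg; apply/(@measurable_EFinP _ _ _ _ (fun t => g (y, t))); exact: measurable_slice.
Qed.

Lemma measurable_comp_fst (f : n.-tuple R -> R) :
  measurable_fun setT f -> measurable_fun setT (fun z : pt R n => f z.1).
Proof. by move=> mf; exact: (measurableT_comp mf measurable_fst). Qed.

Lemma measurable_comp_snd (f : R -> R) :
  measurable_fun setT f -> measurable_fun setT (fun z : pt R n => f z.2).
Proof. by move=> mf; exact: (measurableT_comp mf measurable_snd). Qed.

End slices.

Section whitney_grid.
Variables (R : realType) (n : nat) (a1 a2 : R).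
Hypotheses (n0 : (0 < n)%N) (a10 : 0 < a1) (a12 : a1 < a2^-1) (a21 : a2^-1 < 1).
Variables (s0 : R).
Hypothesis s00 : 0 < s0.
Local Notation T := (n.-tuple R).
Local Notation P := (pt R n).
Local Notation nu := (leb1 R n).
Local Notation mu := (leb R n).

Lemma a2_gt1 : 1 < a2.
Proof.
have h : 0 < a2^-1 by rewrite (lt_trans a10).
by move: a21; rewrite invf_lt1// -invr_gt0.
Qed.
Let a2gt1 := a2_gt1.
Let a20 : 0 < a2. Proof. exact: lt_trans ltr01 a2gt1. Qed.
Lemma a1_lt1 : a1 < 1. Proof. exact: lt_trans a12 a21. Qed.
Let nR : 0 < n%:R :> R. Proof. by rewrite ltr0n. Qed.

(** Levels descend from the top height [s0], so that the grids become finer as the index increases,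
    as in a filtration. *)
Definition scale i : R := s0 / a2 ^+ i.

Lemma scale_gt0 i : 0 < scale i.
Proof. by rewrite divr_gt0 ?exprn_gt0. Qed.

Lemma scaleS i : a2 * scale i.+1 = scale i.
Proof. by rewrite /scale exprS; field; rewrite !gt_eqF ?exprn_gt0. Qed.

Lemma scaleS_le i : scale i.+1 <= scale i.
Proof. by rewrite -[leRHS]scaleS ler_peMl// ltW// scale_gt0. Qed.

(** A cube of sup-norm radius a1/n lies in the Euclidean ball of radius a1. *)
Definition eps : R := a1 / n%:R.
Lemma eps_gt0 : 0 < eps. Proof. by rewrite divr_gt0. Qed.

Definition rho i : R := 3 `^ (lev (eps * scale i))%:~R.

Let es i : 0 < eps * scale i. Proof. by rewrite mulr_gt0 ?eps_gt0 ?scale_gt0. Qed.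

Lemma rho_gt0 i : 0 < rho i. Proof. exact: powR_gt0. Qed.
Lemma rho_le i : rho i <= eps * scale i. Proof. by case/andP: (levP (es i)). Qed.
Lemma rho_gt i : eps * scale i < 3 * rho i. Proof. by case/andP: (levP (es i)). Qed.

(** The number 24 is 4 * 2 * 3: a quarter of a cell of [D] must contain a cube of radius 2 a2^2
    times the height, and rounding the mesh to a power of 3 may lose a factor 3. *)
Definition Kx : nat := Num.bound (24 * a2 ^+ 2 / eps).

Lemma Kx_ge : 24 * a2 ^+ 2 / eps <= (3 ^ Kx)%N%:R.
Proof.
have h0 : 0 <= 24 * a2 ^+ 2 / eps by apply: divr_ge0; [rewrite mulr_ge0// exprn_ge0// ltW|exact/ltW/eps_gt0].
apply: (le_trans (ltW (archi_boundP h0))); rewrite ler_nat; apply: ltnW; exact: ltn_expl.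
Qed.

Definition KK : R := (3 ^ Kx)%N%:R.
Lemma KK_gt0 : 0 < KK. Proof. by rewrite ltr0n expn_gt0. Qed.

(** Half of [rho], so that the single grid [G] refines all the grids [D b], whose offsets are
    multiples of half a cell. *)
Definition Gl i := rho i / 2.
Definition Dl i := KK * rho i.
Definition G i : T -> n.-tuple int := gix (Gl i) (fun=> 0).
Definition D (b : n.-tuple bool) i : T -> n.-tuple int := gix (Dl i) (shift R b).

Lemma Gl_gt0 i : 0 < Gl i. Proof. by rewrite divr_gt0 ?rho_gt0. Qed.
Lemma Dl_gt0 i : 0 < Dl i. Proof. by rewrite mulr_gt0 ?rho_gt0 ?KK_gt0. Qed.

Definition vG i := Gl i ^+ n.
Definition vD i := Dl i ^+ n.

Lemma gridG i : grid mu (G i) (vG i). Proof. exact/gix_grid/Gl_gt0. Qed.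
Lemma gridD b i : grid mu (D b i) (vD i). Proof. exact/gix_grid/Dl_gt0. Qed.

Let c3 i := (3 ^ `|lev (eps * scale i) - lev (eps * scale i.+1)|)%N.

Let rhoS i : rho i = (c3 i)%:R * rho i.+1.
Proof.
rewrite /rho /c3; apply: pow3_ratio; apply: lev_le => //.
by rewrite ler_pM2l ?eps_gt0// scaleS_le.
Qed.

Lemma nestG i x y : G i.+1 x = G i.+1 y -> G i x = G i y.
Proof.
apply: (@gix_refine R n _ _ _ _ (c3 i)); rewrite ?expn_gt0 ?Gl_gt0//.
  by rewrite /Gl rhoS mulrA.
by move=> j; exists 0; rewrite mulr0 subr0.
Qed.

(** Here the odd ratio of the meshes enters: for c odd, c/2 - 1/2 is an integer, as [gix_refine]
    demands of the offsets. *)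
Lemma nestD b i x y : D b i.+1 x = D b i.+1 y -> D b i x = D b i y.
Proof.
apply: (@gix_refine R n _ _ _ _ (c3 i)); rewrite ?expn_gt0 ?Dl_gt0//.
  by rewrite /Dl rhoS mulrCA.
move=> j; exists (((c3 i)./2 * nth false b j)%N : int).
have : odd (c3 i) by rewrite /c3 oddX orbT.
move=> odd_c; rewrite -[X in X%:R * _ - _ = _](odd_double_half (c3 i)) odd_c.
have bt : (nat_of_bool true)%:R = 1 :> R by [].
by rewrite /shift -muln2 natrD natrM bt -[RHS]/(((c3 i)./2 * nth false b j)%N%:R) natrM; field.
Qed.

Lemma refineGD b i x y : G i x = G i y -> D b i x = D b i y.
Proof.
apply: (@gix_refine R n _ _ _ _ (2 * 3 ^ Kx)); rewrite ?muln_gt0 ?expn_gt0 ?Gl_gt0//.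
  by rewrite /Dl /Gl /KK natrM; field.
move=> j; exists ((3 ^ Kx * nth false b j)%N : int).
by rewrite /shift -[RHS]/((3 ^ Kx * nth false b j)%N%:R) !natrM; field.
Qed.

Definition KD : R := (2 * KK) ^+ n.
Lemma KD_gt0 : 0 < KD. Proof. by rewrite exprn_gt0// mulr_gt0 ?KK_gt0. Qed.

Lemma vD_le i : vD i <= KD * vG i.
Proof.
rewrite /vD /vG /KD -exprMn le_eqVlt; apply/orP; left; apply/eqP; congr (_ ^+ _).
by rewrite /Dl /Gl; field.
Qed.

Lemma vG_gt0 i : 0 < vG i. Proof. by rewrite exprn_gt0 ?Gl_gt0. Qed.

Lemma G_dist i x y : G i x = G i y -> edist y x < a1 * scale i.
Proof.
move=> h; apply: (@lt_le_trans _ _ (n%:R * Gl i)).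
  by apply: edist_lt => // j; exact: (gix_dist (Gl_gt0 i) h).
rewrite /Gl; have := rho_le i; rewrite /eps mulrAC ler_pdivlMr// mulrC => h2.
apply: le_trans h2; rewrite ler_pM2l// ler_pdivrMr// ler_peMr ?(ltW (rho_gt0 i))//.
by rewrite ler1n.
Qed.

Lemma D_shift i (x : T) : exists b, forall y, cube x (2 * a2 ^+ 2 * scale i) y -> D b i y = D b i x.
Proof.
have [b hb] := gix_shift x (Dl_gt0 i); exists b => y hy; apply: hb => j.
apply: lt_le_trans (hy j) _; rewrite ler_pdivlMr// /Dl.
have h := rho_gt i; have hK := Kx_ge; rewrite ler_pdivrMr ?eps_gt0// -/KK in hK.
have h1 : KK * (eps * scale i) <= KK * (3 * rho i) by rewrite ler_pM2l ?KK_gt0// ltW.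
have h2 : 24 * a2 ^+ 2 * scale i <= KK * eps * scale i by rewrite ler_pM2r ?scale_gt0.
by lra.
Qed.

Lemma D_dist b i x y : D b i x = D b i y -> cube x (KK * eps * scale i) y.
Proof.
move=> /(gix_dist (Dl_gt0 i)) h j; apply: lt_le_trans (h j) _.
by rewrite -mulrA ler_pM2l ?KK_gt0// rho_le.
Qed.

Definition slab i : set R := [set t | scale i <= t < a2 * scale i].
Definition len i := (a2 - 1) * scale i.
Lemma len_gt0 i : 0 < len i. Proof. by rewrite mulr_gt0 ?subr_gt0 ?scale_gt0. Qed.
Lemma measurable_slab i : measurable (slab i).
Proof.
rewrite /slab (_ : [set _ | _] = `[scale i, a2 * scale i[%classic)//.
Qed.
Lemma lam_slab i : lam R (slab i) = (len i)%:E.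
Proof.
rewrite lam_itvco; first by congr EFin; rewrite /len mulrBl mul1r.
by rewrite ler_peMl ?(ltW (scale_gt0 _)) ?ltW.
Qed.

Lemma slab_disj i j t : slab i t -> slab j t -> i = j.
Proof.
have mono k l : (k <= l)%N -> scale l <= scale k.
  move=> kl; rewrite -(subnK kl); elim: (l - k)%N => [//|m IH].
  by rewrite addSn; exact: le_trans (scaleS_le _) IH.
suff h k l : (k < l)%N -> slab k t -> slab l t -> False.
  by move=> hi hj; have [/h/(_ hi hj)|/h/(_ hj hi)|] := ltngtP i j.
move=> kl /andP[h1 _] /andP[_ h2].
have hle : a2 * scale l <= scale k by case: l kl {h2} => // l kl; rewrite scaleS mono.
by have := lt_le_trans h2 hle; rewrite ltNge h1.
Qed.

Definition box i x : set P := [set z | G i z.1 = G i x /\ slab i z.2].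

Lemma measurable_box i x : measurable (box i x).
Proof.
have [_ h _] := gridG i.
exact: (measurable_prodset (h (G i x)) (measurable_slab i)).
Qed.

Lemma nu_box i x : nu (box i x) = (vG i * len i)%:E.
Proof.
have [_ h hv] := gridG i.
by rewrite [LHS](nu_prodset (h (G i x)) (measurable_slab i)) hv lam_slab.
Qed.

Definition SM i (g : P -> R) (y : T) : R :=
  (len i)^-1 * fine (\int[lam R]_(t in slab i) (g (y, t))%:E)%E.

Lemma slab_int_fin i (g : P -> R) y : bnd g ->
  (\int[lam R]_(t in slab i) (g (y, t))%:E)%E \is a fin_num.
Proof.
move=> [mg [c hc]]; rewrite ge0_fin_numE; last first.
  by apply: integral_ge0 => t _; rewrite lee_fin; case/andP: (hc (y, t)).
apply: (@le_lt_trans _ _ (\int[lam R]_(t in slab i) (cst c%:E t))%E).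
  apply: ge0_le_integral => //.
  - exact: measurable_slab.
  - by move=> t _; rewrite lee_fin; case/andP: (hc (y, t)).
  - by apply: measurable_funTS; exact: (measurable_sliceE y mg).
  - by move=> t _; rewrite lee_fin; case/andP: (hc (y, t)).
rewrite integral_cst; last exact: measurable_slab.
by rewrite [X in (_ * X)%E]lam_slab -EFinM ltry.
Qed.

Lemma SME i g y : bnd g ->
  (\int[lam R]_(t in slab i) (g (y, t))%:E = (len i * SM i g y)%:E)%E.
Proof.
move=> bg; rewrite /SM mulrA mulfV ?mul1r ?gt_eqF ?len_gt0//.
by rewrite fineK//; exact: slab_int_fin.
Qed.

Lemma SM_le i g h y : bnd g -> bnd h -> (forall t, slab i t -> g (y, t) <= h (y, t)) ->
  SM i g y <= SM i h y.
Proof.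
move=> bg bh gh; rewrite -(ler_pM2l (len_gt0 i)) -lee_fin -!SME//.
apply: ge0_le_integral => //.
- exact: measurable_slab.
- by move=> t _; rewrite lee_fin bnd_ge0.
- by apply: measurable_funTS; exact: (measurable_sliceE y (bnd_m bg)).
- by apply: measurable_funTS; exact: (measurable_sliceE y (bnd_m bh)).
Qed.

Lemma SM_cst i c y : 0 <= c -> SM i (fun=> c) y = c.
Proof.
move=> c0; have b : bnd (fun _ : P => c) by exact: bnd_cst.
apply: (mulfI (lt0r_neq0 (len_gt0 i))); apply: EFin_inj; rewrite -SME//.
transitivity (\int[lam R]_(t in slab i) (cst c%:E t))%E => //.
rewrite integral_cst; last exact: measurable_slab.
by rewrite [X in (_ * X)%E]lam_slab -EFinM mulrC.
Qed.

(* Fubini in the form used throughout: integrals over product sets reduce to averages over slabs. *)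
Lemma int_slab i (chi : T -> R) (g : P -> R) : bnd chi -> bnd g ->
  intR nu (fun z => chi z.1 * ((\1_(slab i) z.2 : R) * g z)) =
  ((len i)%:E * intR mu (fun y => chi y * SM i g y)%R)%E /\ bnd (SM i g).
Proof.
move=> bc bg.
have ms := measurable_slab i.
pose f z : R := (\1_(slab i) z.2 : R) * g z.
have mf : measurable_fun setT f.
  apply: measurable_funM; last exact: bnd_m.
  by apply: measurable_comp_snd; exact: measurable_indic.
have f0 z : 0 <= f z by rewrite mulr_ge0// bnd_ge0.
have fS y : (\int[lam R]_t (f (y, t))%:E = (len i * SM i g y)%:E)%E.
  rewrite -SME// [RHS]integral_mkcond; apply: eq_integral => t _.
  rewrite patchE /f indicE; by case: (t \in slab i); rewrite ?mul1r ?mul0r.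
have mS : measurable_fun setT (SM i g).
  have h := @measurable_int1 _ _ _ _ _ (lam R) (fun z => (f z)%:E) (_ : measurable_fun setT _) _.
  have := h (proj2 (measurable_EFinP _ _) mf) (fun x => f0 x).
  under eq_fun do rewrite fS; move/measurable_EFinP => h1.
  rewrite (_ : SM i g = fun y => (len i)^-1 * (len i * SM i g y)).
    by apply: measurable_funM.
  by apply/funext => y; rewrite mulKf// gt_eqF ?len_gt0.
have bS : bnd (SM i g).
  split => //; have [_ [c hc]] := bg; exists c => y; apply/andP; split.
    rewrite mulr_ge0 ?invr_ge0 ?(ltW (len_gt0 i))// fine_ge0// integral_ge0// => t _.
    by rewrite lee_fin bnd_ge0.
  have c0 : 0 <= c by have /andP[h1 h2] := hc (y, 0); exact: le_trans h2.
  rewrite -[leRHS](SM_cst i y c0); apply: SM_le => //; first exact: bnd_cst.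
  by move=> t _; case/andP: (hc (y, t)).
split => //.
rewrite /intR (@integral_prodm1 _ _ _ _ _ mu (lam R)).
- transitivity (\int[mu]_y ((len i)%:E * (chi y * SM i g y)%:E))%E.
    apply: eq_integral => y _.
    transitivity (\int[lam R]_t ((chi y)%:E * (f (y, t))%:E))%E.
      by apply: eq_integral => t _; rewrite -EFinM.
    rewrite ge0_integralZl//.
    + by rewrite fS -!EFinM; congr EFin; ring.
    + exact: (measurable_sliceE y mf).
    + by move=> t _; rewrite lee_fin.
    + by rewrite lee_fin bnd_ge0.
  rewrite ge0_integralZl//.
  + apply/(@measurable_EFinP _ _ _ _ (fun x => chi x * SM i g x)).
    by apply: measurable_funM => //; exact: bnd_m.
  + by move=> y _; rewrite lee_fin mulr_ge0 ?bnd_ge0.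
  + by rewrite lee_fin ltW ?len_gt0.
- apply/measurable_EFinP/measurable_funM => //.
  exact: (measurable_comp_fst (bnd_m bc)).
- by move=> z; rewrite lee_fin; apply: mulr_ge0; [exact: bnd_ge0|exact: f0].
Qed.

Lemma SM_scale i c g y : 0 <= c -> bnd g -> SM i (fun z => c * g z) y = c * SM i g y.
Proof.
move=> c0 bg; have bcg : bnd (fun z => c * g z) by exact: bnd_scale.
apply: (mulfI (lt0r_neq0 (len_gt0 i))); apply: EFin_inj; rewrite -SME//.
rewrite mulrCA EFinM -SME// -ge0_integralZl//.
- exact: measurable_slab.
- by apply: measurable_funTS; exact: (measurable_sliceE y (bnd_m bg)).
- by move=> t _; rewrite lee_fin bnd_ge0.
Qed.

Lemma bnd_SM i g : bnd g -> bnd (SM i g).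
Proof. by move=> bg; have [] := int_slab i (bnd_cst T ler01) bg. Qed.

(** The average over [box i x], taken first vertically and then over the horizontal cell, which
    brings it within reach of the results on adapted averages in R^n. *)
Definition BA i g x := avg mu (G i) (vG i) (SM i g) x.

Lemma bnd_BA i g : bnd g -> bnd (BA i g).
Proof. by move=> bg; exact/(bnd_avg (gridG i))/bnd_SM. Qed.

Lemma adapted_BA i g : adapted (G i) (BA i g).
Proof. exact: avg_adapted. Qed.

Lemma BA_le i g h c x : 0 <= c -> bnd g -> bnd h -> (forall z, box i x z -> g z <= c * h z) ->
  BA i g x <= c * BA i h x.
Proof.
move=> c0 bg bh gh; apply: (avg_le (gridG i)) => //; [exact: bnd_SM|exact: bnd_SM|].
move=> y yx; rewrite -SM_scale//; apply: SM_le => //; first exact: bnd_scale.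
by move=> t st; apply: gh.
Qed.

Lemma BA_cst i c x : 0 <= c -> BA i (fun=> c) x = c.
Proof.
move=> c0; rewrite /BA (_ : SM i _ = fun=> c); last by apply/funext => y; rewrite SM_cst.
by rewrite (avg_cst (gridG i)).
Qed.

Lemma int_box i x g : bnd g ->
  intR nu (fun z => (\1_(box i x) z : R) * g z) = (len i * vG i * BA i g x)%:E.
Proof.
move=> bg.
have [v0 hm _] := gridG i.
have mc := cell_measurable x (gridG i).
have bc : bnd (\1_(cell (G i) x) : T -> R).
  split; first exact: measurable_indic.
  by exists 1 => y; rewrite indicE; case: (_ \in _); rewrite ?lexx ?ler01.
transitivity (intR nu (fun z => (\1_(cell (G i) x) z.1 : R) * ((\1_(slab i) z.2 : R) * g z))).
  congr (intR nu); apply/funext => z; rewrite mulrA; congr (_ * _).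
  rewrite !indicE -natrM mulnb; congr (_%:R); congr nat_of_bool.
  apply/idP/andP => [/set_mem[h1 h2]|[/set_mem h1 /set_mem h2]].
    by split; apply: mem_set.
  by apply: mem_set; split.
rewrite (int_slab i bc bg).1.
transitivity ((len i)%:E * (vG i * BA i g x)%:E)%E; last by rewrite -EFinM mulrA.
congr (_ * _)%E.
rewrite EFinM [X in (_ * X)%E](avgE (gridG i) x (bnd_SM i bg)) muleA -EFinM mulfV ?gt_eqF// mul1e.
rewrite /intR [RHS]integral_mkcond; apply: eq_integral => y _.
by rewrite patchE indicE; case: (y \in _); rewrite ?mul1r ?mul0r.
Qed.

Lemma int_slab_BA i g : bnd g ->
  intR nu (fun z => (\1_(slab i) z.2 : R) * g z) = ((len i)%:E * intR mu (BA i g))%E.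
Proof.
move=> bg; rewrite (Int_avg (gridG i) (bnd_SM i bg)).
have := (int_slab i (bnd_cst T ler01) bg).1.
by under eq_fun do rewrite mul1r; move=> ->; congr (_ * intR mu _)%E; apply/funext => y; rewrite mul1r.
Qed.

Lemma edist_le_cube (x y : T) c : edist x y < c -> cube y c x.
Proof. by move=> h j; exact: le_lt_trans (edist_ge x y j) h. Qed.

Lemma measurable_whitney (z : P) : measurable (whitney a1 a2 z).
Proof.
rewrite /whitney (_ : [set _ | _] = [set w | edist w.1 z.1 < a1 * z.2] `&`
   ([set w : P | a2^-1 * z.2 < w.2] `&` [set w : P | w.2 < a2 * z.2])); last first.
  by apply/seteqP; split => w /=; [case=> ? /andP[]|case=> ? [? ?]; split=> //; apply/andP].
have ms : measurable_fun setT (snd : P -> R) by exact: measurable_snd.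
apply: measurableI; first by apply: mset_lt => //; exact: measurable_edist.
by apply: measurableI; apply: mset_lt.
Qed.

Let slice_w (z : P) : 0 < z.2 ->
  lam R [set t | a2^-1 * z.2 < t < a2 * z.2] = ((a2 - a2^-1) * z.2)%:E.
Proof.
move=> z0; rewrite lam_itvoo -?mulrBl// ler_pM2r// (le_trans (ltW a21))//; exact: ltW.
Qed.

Let measurable_oo (a b : R) : measurable [set t : R | a < t < b].
Proof. by rewrite (_ : [set _ | _] = `]a, b[%classic). Qed.

Lemma nu_whitney_le (z : P) : 0 < z.2 ->
  (nu (whitney a1 a2 z) <= ((2 * (a1 * z.2)) ^+ n * ((a2 - a2^-1) * z.2))%:E)%E.
Proof.
move=> z0; pose B : set P := [set w | cube z.1 (a1 * z.2) w.1 /\ a2^-1 * z.2 < w.2 < a2 * z.2].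
have mB : measurable B.
  exact: (measurable_prodset (measurable_cube _ _) (measurable_oo _ _)).
have -> : ((2 * (a1 * z.2)) ^+ n * ((a2 - a2^-1) * z.2))%:E = nu B.
  rewrite EFinM -(slice_w z0).
  rewrite [RHS](nu_prodset (measurable_cube _ _) (measurable_oo _ _)).
  by rewrite leb_cube// mulr_ge0// ltW.
apply: le_measure; rewrite ?inE//; first exact: measurable_whitney.
by move=> w [h1 h2]; split => //; exact: edist_le_cube.
Qed.

Lemma nu_whitney_ge (z : P) : 0 < z.2 ->
  (((2 * (eps * z.2)) ^+ n * ((a2 - a2^-1) * z.2))%:E <= nu (whitney a1 a2 z))%E.
Proof.
move=> z0; pose B : set P := [set w | cube z.1 (eps * z.2) w.1 /\ a2^-1 * z.2 < w.2 < a2 * z.2].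
have mB : measurable B.
  exact: (measurable_prodset (measurable_cube _ _) (measurable_oo _ _)).
have e0 := eps_gt0.
have -> : ((2 * (eps * z.2)) ^+ n * ((a2 - a2^-1) * z.2))%:E = nu B.
  rewrite EFinM -(slice_w z0).
  rewrite [RHS](nu_prodset (measurable_cube _ _) (measurable_oo _ _)).
  by rewrite leb_cube// mulr_ge0// ltW.
apply: le_measure; rewrite ?inE//; first exact: measurable_whitney.
move=> w [h1 h2]; split => //.
rewrite (_ : a1 * z.2 = n%:R * (eps * z.2)); first exact: edist_lt.
by rewrite /eps mulrA mulrCA mulfV ?mulr1// gt_eqF.
Qed.

Lemma box_whitney i x z : box i x z -> box i x `<=` whitney a1 a2 z.
Proof.
move=> [z1 /andP[z2 z3]] w [w1 /andP[w2 w3]]; split.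
  by apply: lt_le_trans (@G_dist i z.1 w.1 _) _; [rewrite z1 w1|rewrite ler_pM2l].
apply/andP; split.
  by rewrite mulrC ltr_pdivrMr// (lt_le_trans z3)// mulrC ler_pM2r.
by rewrite (lt_le_trans w3)// ler_pM2l.
Qed.

Lemma bavP_infty (F : P -> R) i x : bnd F ->
  esssup (box i x) (EFin \o F) = (fine (esssup (box i x) (EFin \o F)))%:E.
Proof.
move=> bF; have [mF [c hc]] := bF; rewrite fineK//.
have h0 : (0 <= esssup (box i x) (EFin \o F))%E.
  apply: esssup_ge0; first exact: measurable_box.
  - by rewrite nu_box lte_fin mulr_gt0 ?vG_gt0 ?len_gt0.
  - by move=> z; rewrite lee_fin; case/andP: (hc z).
rewrite ge0_fin_numE//; apply: le_lt_trans (ltry c).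
by apply: esssup_le_sup => z _; rewrite lee_fin; case/andP: (hc z).
Qed.

Definition bav (r : \bar R) (F : P -> R) i x : R :=
  match r with
  | r'%:E => (BA i (fun z => F z `^ r') x) `^ r'^-1
  | _ => fine (esssup (box i x) (EFin \o F))
  end.

Lemma bav_adapted r F i : adapted (G i) (bav r F i).
Proof.
have hb x y : G i x = G i y -> box i x = box i y.
  by move=> xy; apply/seteqP; split => z [h1 h2]; split; rewrite ?h1.
move=> x y xy; have bxy := hb _ _ xy.
case: r => [r'||] /=; [|by rewrite bxy..].
by congr (_ `^ _); exact: adapted_BA.
Qed.

Section fixed_r.
Variable (r : \bar R).
Hypothesis r1 : (1 <= r)%E.

Lemma ge1_case (Q : \bar R -> Prop) : (forall r' : R, 1 <= r' -> Q r'%:E) -> Q +oo%E -> Q r.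
Proof. by move=> h1 h2; case: r r1 => // r'; rewrite lee_fin => /h1. Qed.

Lemma bav_ge0 F i x : bnd F -> 0 <= bav r F i x.
Proof.
move=> bF; apply: (ge1_case (Q := fun r => 0 <= bav r F i x)) => [r' r'1|]; first exact: powR_ge0.
rewrite -lee_fin /bav -bavP_infty//; apply: esssup_ge0; first exact: measurable_box.
- by rewrite nu_box lte_fin mulr_gt0 ?vG_gt0 ?len_gt0.
- by move=> z; rewrite lee_fin bnd_ge0.
Qed.

Lemma bav_le_cst F i x c : bnd F -> 0 <= c -> (forall z, box i x z -> F z <= c) -> bav r F i x <= c.
Proof.
move=> bF c0 Fc; apply: (ge1_case (Q := fun r => bav r F i x <= c)) => [r' r'1|].
  have r'0 : 0 < r' by rewrite (lt_le_trans ltr01).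
  rewrite -[leRHS](powRr1 c0) -(mulfV (lt0r_neq0 r'0)) powRrM ge0_ler_powR ?nnegrE ?invr_ge0 ?powR_ge0 ?(ltW r'0)//.
    by apply: bnd_ge0; apply: bnd_BA; exact: bnd_pow (ltW r'0) bF.
  have cr0 := powR_ge0 c r'.
  have -> : c `^ r' = 1 * BA i (fun=> c `^ r') x by rewrite mul1r (BA_cst i x cr0).
  apply: BA_le ler01 (bnd_pow (le_trans ler01 r'1) bF) (bnd_cst _ cr0) _ => z bz.
  by rewrite mul1r ge0_ler_powR ?nnegrE ?(ltW r'0)// ?bnd_ge0// Fc.
rewrite -lee_fin /bav -bavP_infty//; apply: esssup_le_sup => z bz.
by rewrite lee_fin Fc.
Qed.

Lemma bnd_bav F i : bnd F -> bnd (bav r F i).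
Proof.
move=> bF; split; last first.
  have [_ [c hc]] := bF; exists c => x; rewrite bav_ge0//=.
  apply: bav_le_cst => //; last by move=> z _; case/andP: (hc z).
  by have /andP[h1 h2] := hc (x, 0); exact: le_trans h2.
by have [_ h _] := gridG i; apply: adapted_measurable h _; exact: bav_adapted.
Qed.

Lemma cube_trans (x y z : T) a b : cube x a y -> cube y b z -> cube x (a + b) z.
Proof.
move=> h1 h2 j; rewrite -(subrK (tnth y j) (tnth z j)) -addrA addrC.
by rewrite (le_lt_trans (ler_normD _ _))// ltrD.
Qed.

Lemma fins_bav F i L : bnd F -> (forall z, F z != 0 -> cube [tuple of nseq n 0] L z.1) ->
  fins mu (bav r F i).
Proof.
move=> bF FL; split; first exact: bnd_bav.
exists (cube [tuple of nseq n 0] (Num.max L 0 + Gl i)); split.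
- exact: measurable_cube.
- by rewrite leb_cube ?ltry// addr_ge0 ?(ltW (Gl_gt0 i))// le_max lexx orbT.
move=> x; have [h _|h] := pselect (exists2 z, box i x z & F z != 0).
  have [z [zx _] /FL Fz] := h.
  apply: cube_trans (gix_dist (Gl_gt0 i) zx) => j.
  by rewrite (lt_le_trans (Fz j))// le_max lexx.
apply: contraNP => _; rewrite eq_le bav_ge0// andbT; apply: bav_le_cst => // z bz.
by rewrite leNgt; apply/negP => Fz; apply: h; exists z; rewrite ?gt_eqF.
Qed.

End fixed_r.

Lemma WR_real (r : R) (F : P -> R) z : 1 <= r -> bnd F -> 0 < z.2 ->
  exists v w : R, [/\ 0 < v, nu (whitney a1 a2 z) = v%:E, 0 <= w,
    intR nu (fun u => (\1_(whitney a1 a2 z) u : R) * F u `^ r) = w%:E &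
    WR a1 a2 r%:E (EFin \o F) z = ((w / v) `^ r^-1)%:E].
Proof.
move=> r1 bF z0; have r0 : 0 < r by rewrite (lt_le_trans ltr01).
have mW := measurable_whitney z.
have bFr : bnd (fun u => F u `^ r) by exact: bnd_pow (ltW r0) bF.
have h1 := nu_whitney_le z0; have h2 := nu_whitney_ge z0.
set W := whitney a1 a2 z in mW h1 h2 *.
have vfin : nu W \is a fin_num by rewrite ge0_fin_numE// (le_lt_trans h1)// ltry.
have vE := fineK vfin; set v := fine _ in vE; symmetry in vE.
have v0 : 0 < v.
  rewrite vE lee_fin in h2; apply: lt_le_trans h2; apply: mulr_gt0; last first.
    by apply: mulr_gt0 => //; rewrite subr_gt0 (lt_trans a21).
  by apply: exprn_gt0; do 2?[apply: mulr_gt0 => //]; exact: eps_gt0.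
have [_ [c hc]] := bFr.
have If : (intR nu (fun u => (\1_W u : R) * F u `^ r)%R <= (c * v)%:E)%E.
  have c0 : 0 <= c by have /andP[e1 e2] := hc z; exact: le_trans e2.
  have -> : (c * v)%:E = intR nu (fun u => c * (\1_W u : R)).
    rewrite EFinM -vE -(Int_indic nu mW); apply: esym; apply: Int_scale => //.
    exact: bnd_indic.
  apply: le_Int => u; first by rewrite mulr_ge0 ?powR_ge0// indicE.
  by rewrite mulrC ler_wpM2r// ?indicE//; case/andP: (hc u).
have I0 : (0 <= intR nu (fun u => (\1_W u : R) * F u `^ r)%R)%E.
  by apply: Int_ge0 => u; rewrite mulr_ge0 ?powR_ge0// indicE.
have wfin : intR nu (fun u => (\1_W u : R) * F u `^ r) \is a fin_num.
  by rewrite ge0_fin_numE// (le_lt_trans If)// ltry.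
have wE := fineK wfin; set w := fine _ in wE; symmetry in wE.
have w0 : 0 <= w by rewrite -lee_fin -wE.
exists v, w; split => //.
rewrite /WR -/W volE// vE.
have -> : sint W (fun u => ((EFin \o F) u `^ r)%E) = w%:E.
  rewrite -wE -(sint_real mW (bnd_m bFr) (fun u => powR_ge0 _ _)); congr (sint W); exact/funext.
rewrite !poweR_EFin -EFinM powRdiv//; congr EFin.
by rewrite powRN mulrC.
Qed.

(** Bounds the volume of a Whitney region divided by that of a box containing its centre. In 12 n
    a2, the factor 12 is the product of the 2 from a radius to a side, the 2 in [Gl] and the 3 from
    rounding the mesh. *)
Definition CV : R := (12 * a2 * n%:R) ^+ n * (a2 + 1).

Lemma CV_ge1 : 1 <= CV.
Proof.
have n1 : 1 <= n%:R :> R by rewrite ler1n.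
have h1 : 1 <= 12 * a2 * n%:R.
  rewrite -[leLHS]mulr1; apply: ler_pM => //; rewrite -[leLHS]mulr1; apply: ler_pM => //; last exact: ltW.
  by rewrite ler1n.
rewrite -[leLHS]mulr1; apply: ler_pM => //; first exact: exprn_ege1.
by rewrite lerDr ltW.
Qed.

Lemma vol_whitney_box i x z : box i x z ->
  (nu (whitney a1 a2 z) <= (CV * (vG i * len i))%:E)%E.
Proof.
move=> [_ /andP[z2 z3]]; have z0 : 0 < z.2 := lt_le_trans (scale_gt0 i) z2.
apply: le_trans (nu_whitney_le z0) _; rewrite lee_fin.
have -> : CV * (vG i * len i) = (12 * a2 * n%:R * Gl i) ^+ n * ((a2 + 1) * len i).
  by rewrite /CV /vG [in RHS]exprMn; ring.
have h0 : 0 <= a2 - a2^-1 by rewrite subr_ge0 (le_trans (ltW a21))// ltW.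
apply: ler_pM.
- by rewrite exprn_ge0// !mulr_ge0// ltW.
- by rewrite mulr_ge0// ltW.
- apply: lerXn2r; rewrite ?nnegrE.
    by rewrite !mulr_ge0// ltW.
    by rewrite !mulr_ge0 ?(ltW a20) ?(ltW nR) ?invr_ge0 ?(ltW (rho_gt0 i)).
  rewrite /Gl; have := rho_gt i; rewrite /eps mulrAC ltr_pdivrMr// => h.
  have : 4 * a2 * (a1 * scale i) <= 4 * a2 * (3 * rho i * n%:R).
    by rewrite ler_pM2l ?mulr_gt0// ltW.
  rewrite (_ : 12 * a2 * n%:R * (rho i / 2) = 4 * a2 * (3 * rho i * n%:R) / 2); last by field.
  move=> h4; apply: (@le_trans _ _ (4 * a2 * (a1 * scale i) / 2)); last by rewrite ler_pM2r.
  apply: (@le_trans _ _ (2 * (a1 * (a2 * scale i)))).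
    by rewrite ler_pM2l// ler_pM2l// ltW.
  by rewrite le_eqVlt; apply/orP; left; apply/eqP; field.
- apply: (@le_trans _ _ ((a2 - a2^-1) * (a2 * scale i))); first by rewrite ler_wpM2l// ltW.
  by rewrite /len le_eqVlt; apply/orP; left; apply/eqP; field; rewrite gt_eqF.
Qed.

(** The box lies in the Whitney region of each of its points and fills a fixed share of it. *)
Lemma bav_le_WR (F : P -> R) i x z r : (1 <= r)%E -> bnd F -> box i x z ->
  ((bav r F i x)%:E <= CV%:E * WR a1 a2 r (EFin \o F) z)%E.
Proof.
move=> r1 bF bz; have z0 : 0 < z.2 by case: bz => _ /andP[z2 _]; exact: lt_le_trans (scale_gt0 i) z2.
apply: (ge1_case r1 (Q := fun r => ((bav r F i x)%:E <= CV%:E * WR a1 a2 r (EFin \o F) z)%E)).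
  move=> r' r'1; have [v [w [v0 vE w0 wE ->]]] := WR_real r'1 bF z0.
  have bFr : bnd (fun u => F u `^ r') by exact: bnd_pow (le_trans ler01 r'1) bF.
  rewrite -EFinM lee_fin /=; apply: root_le; rewrite ?CV_ge1//.
  - by apply: bnd_ge0; exact: bnd_BA.
  - by rewrite divr_ge0// ltW.
  - have h1 := vol_whitney_box bz; rewrite vE lee_fin in h1.
    have h2 : len i * vG i * BA i (fun u => F u `^ r') x <= w.
      rewrite -lee_fin -(int_box i x bFr) -wE; apply: le_Int => u.
        by rewrite mulr_ge0 ?powR_ge0// indicE.
      by apply: ler_wpM2r; [exact: powR_ge0|apply: le_indic; exact: box_whitney].
    have B0 : 0 <= BA i (fun u => F u `^ r') x by apply: bnd_ge0; exact: bnd_BA.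
    rewrite mulrA ler_pdivlMr//.
    apply: (@le_trans _ _ (BA i (fun u => F u `^ r') x * (CV * (vG i * len i)))).
      by rewrite ler_wpM2l.
    rewrite mulrCA ler_wpM2l// ?(le_trans ler01 CV_ge1)//.
    by apply: le_trans h2; rewrite le_eqVlt; apply/orP; left; apply/eqP; ring.
rewrite /= -bavP_infty//.
have h : (esssup (box i x) (EFin \o F) <= esssup (whitney a1 a2 z) (EFin \o F))%E.
  by apply: esssup_mono => // u; exact: box_whitney.
apply: le_trans h _; rewrite -[leLHS]mul1e; apply: lee_wpmul2r; last by rewrite lee_fin CV_ge1.
apply: le_trans (esssup_mono (box_whitney bz) (fun u _ => lexx _)).
by rewrite bavP_infty// lee_fin; apply: (@bav_ge0 +oo%E _ F i x bF); rewrite leey.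
Qed.

Definition near_level t i := (scale i < a2 * t) && (t < a2 ^+ 2 * scale i).

Lemma slab_near_level t i (z : P) : 0 < t -> slab i z.2 -> a2^-1 * t < z.2 < a2 * t -> near_level t i.
Proof.
move=> t0 /andP[h1 h2] /andP[h3 h4]; apply/andP; split; first exact: le_lt_trans h1 h4.
have := lt_trans h3 h2; rewrite mulrC ltr_pdivrMr// => h; apply: lt_le_trans h _.
by rewrite le_eqVlt; apply/orP; left; apply/eqP; ring.
Qed.

(** Since [len i] is a2 times the difference of two consecutive scales, the sum telescopes, with a
    bound independent of the number of levels. *)
Lemma sum_len_le N tau : 0 <= tau ->
  \sum_(i < N) (if scale i < tau then len i else 0) <= a2 * tau.
Proof.
move=> tau0; suff h : \sum_(i < N) (if scale i < tau then len i else 0) <=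
    Num.max 0 (a2 * tau - a2 * scale N).
  apply: le_trans h _; rewrite ge_max mulr_ge0 ?(ltW a20)//= gerBl mulr_ge0 ?(ltW a20)//.
  exact/ltW/scale_gt0.
elim: N => [|N IH]; first by rewrite big_ord0 le_max lexx.
have s1 := scaleS_le N; have s2 := scale_gt0 N; have s3 := scaleS N.
rewrite big_ord_recr /= le_max; case: (ltP (scale N) tau) => sN; last first.
  rewrite addr0; apply/orP; left; apply: le_trans IH _.
  by rewrite ge_max lexx subr_le0 ler_pM2l.
apply/orP; right; rewrite s3.
have : \sum_(i < N) (if scale i < tau then len i else 0) <= a2 * tau - a2 * scale N.
  by apply: le_trans IH _; rewrite ge_max lexx andbT subr_ge0 ler_pM2l// ltW.
by rewrite /len; lra.
Qed.

Lemma vD_le_near t i : 0 < t -> scale i < a2 * t -> vD i <= (KK * eps * (a2 * t)) ^+ n.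
Proof.
move=> t0 st; have h0 := KK_gt0; have h1 := eps_gt0; have h2 := rho_gt0 i; have h3 := scale_gt0 i.
apply: lerXn2r; rewrite ?nnegrE /Dl.
- by rewrite mulr_ge0// ltW.
- by rewrite !mulr_ge0// ltW.
rewrite -mulrA ler_pM2l//; apply: le_trans (rho_le i) _.
by rewrite ler_pM2l// ltW.
Qed.

(** The volume of the coarse cells times the near slabs that cover a Whitney region, divided by the
    lower bound for the volume of the region; 1 is added so that its roots are harmless. *)
Definition CU : R := 1 + (KK * a2 / 2) ^+ n * (a2 ^+ 2 / (a2 - a2^-1)).

Lemma CU_ge1 : 1 <= CU.
Proof.
rewrite lerDl mulr_ge0// ?exprn_ge0// ?divr_ge0 ?mulr_ge0 ?(ltW a20) ?(ltW KK_gt0)//.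
by rewrite subr_ge0 (le_trans (ltW a21))// ltW.
Qed.

(** In each coordinate z is within (1 + a1) t < 2 t of x, and t < a2^2 [scale i] at a near level;
    this is the radius allowed by [D_shift]. *)
Lemma near_in_D (x y : T) t i b (z : P) : 0 < t -> edist y x < t -> near_level t i ->
  (forall y', cube x (2 * a2 ^+ 2 * scale i) y' -> D b i y' = D b i x) ->
  whitney a1 a2 (y, t) z -> D b i z.1 = D b i x.
Proof.
move=> t0 yx /andP[_ ti] hb [zy _]; apply: hb.
have h1 := edist_le_cube yx; have h2 := edist_le_cube zy.
have h := cube_trans h1 h2; move=> j; apply: lt_le_trans (h j) _ => /=.
have : a1 * t <= t by rewrite -[leRHS]mul1r ler_pM2r// ltW// a1_lt1.
by move: ti; set u := a2 ^+ 2 * scale i; rewrite -mulrA -/u; lra.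
Qed.

Lemma int_cell_SM b i x g c : bnd g -> 0 <= c ->
  (forall z, D b i z = D b i x -> BA i g z <= c) ->
  (intR nu (fun z => (\1_(cell (D b i) x) z.1 : R) * ((\1_(slab i) z.2 : R) * g z))%R <=
   (len i * (c * vD i))%:E)%E.
Proof.
move=> bg c0 hc; have mD := cell_measurable x (gridD b i).
rewrite (int_slab i (bnd_indic R mD) bg).1 [leRHS]EFinM.
apply: lee_wpmul2l; first by rewrite lee_fin ltW// len_gt0.
have aD : adapted (G i) (\1_(cell (D b i) x) : T -> R).
  move=> y y' yy'; rewrite !indicE; congr (nat_of_bool _)%:R.
  by apply/idP/idP => /set_mem h; apply/mem_set; rewrite /cell/= -h; apply: refineGD.
have E : intR mu (fun y => (\1_(cell (D b i) x) y : R) * SM i g y) =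
         intR mu (fun y => BA i g y * (\1_(cell (D b i) x) y : R)).
  rewrite (Int_avgM (gridG i) (bnd_SM i bg) (bnd_indic R mD) aD).
  by congr (intR mu); apply/funext => y; rewrite mulrC.
rewrite E; apply: (@le_trans _ _ (intR mu (fun y => c * (\1_(cell (D b i) x) y : R)))).
  apply: le_Int => y.
    by apply: mulr_ge0; [apply: bnd_ge0; exact: bnd_BA|rewrite indicE].
  rewrite indicE; case: (boolP (y \in _)) => [/set_mem h|_]; last by rewrite !mulr0.
  by rewrite !mulr1; exact: hc.
rewrite Int_scale//; last exact: bnd_indic.
rewrite Int_indic//; have [_ _ ->] := gridD b i.
by rewrite EFinM.
Qed.

(** At each near level one shifted cell around x contains the whole section of the Whitney region.
    The products of these cells with their slabs cover the part of the region where F is nonzero,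
    and on each the integral of F^r is at most S^r times the volume. The good shift may change with
    the level. *)
Lemma WR_le_bav_fin (F : P -> R) N r y t (x : T) S : 1 <= r -> bnd F ->
  (forall z, F z != 0 -> exists2 i, (i < N)%N & slab i z.2) ->
  0 <= S -> 0 < t -> edist y x < t ->
  (forall i b z, (i < N)%N -> near_level t i -> D b i z = D b i x -> bav r%:E F i z <= S) ->
  (WR a1 a2 r%:E (EFin \o F) (y, t) <= (CU * S)%:E)%E.
Proof.
move=> r1 bF FN S0 t0 yx hS; have r0 : 0 < r by rewrite (lt_le_trans ltr01).
have bFr : bnd (fun u => F u `^ r) by exact: bnd_pow (ltW r0) bF.
have [v [w [v0 vE w0 wE ->]]] := @WR_real r F (y, t) r1 bF t0.
rewrite lee_fin.
have -> : S = (S `^ r) `^ r^-1 by rewrite -powRrM mulfV ?gt_eqF// powRr1.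
apply: root_le; rewrite ?CU_ge1 ?powR_ge0 ?divr_ge0 ?(ltW v0)//.
rewrite ler_pdivrMr//.
have X0 : 0 <= KK * eps * (a2 * t).
  exact: mulr_ge0 (mulr_ge0 (ltW KK_gt0) (ltW eps_gt0)) (mulr_ge0 (ltW a20) (ltW t0)).
have /choice[b hb] : forall i, exists b, forall y', cube x (2 * a2 ^+ 2 * scale i) y' -> D b i y' = D b i x.
  by move=> i; exact: D_shift.
pose E i (z : P) := (if near_level t i then 1 else 0) *
  ((\1_(cell (D (b i) i) x) z.1 : R) * ((\1_(slab i) z.2 : R) * F z `^ r)).
have mD i := cell_measurable x (gridD (b i) i).
have be i : bnd (fun z : P => (\1_(cell (D (b i) i) x) z.1 : R) * ((\1_(slab i) z.2 : R) * F z `^ r)).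
  apply: bnd_mul; last apply: bnd_mul => //.
    split; first exact: (measurable_comp_fst (measurable_indic (mD i))).
    by exists 1 => z; rewrite indicE; case: (_ \in _); rewrite ?lexx ?ler01.
  split; first exact: (measurable_comp_snd (measurable_indic (measurable_slab i))).
  by exists 1 => z; rewrite indicE; case: (_ \in _); rewrite ?lexx ?ler01.
have c0 i : 0 <= (if near_level t i then 1 else 0 : R) by case: near_level.
have bE i : bnd (E i) by apply: bnd_scale.
have le1 : (w%:E <= \sum_(i < N) intR nu (E i))%E.
  rewrite -wE -Int_sum//; apply: le_Int => z; first by rewrite mulr_ge0 ?powR_ge0// indicE.
  have sum0 : 0 <= \sum_(i < N) E i z by apply: sumr_ge0 => i _; exact: bnd_ge0.
  rewrite indicE; case: (boolP (z \in _)) => [/set_mem Wz|_]; last by rewrite mul0r.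
  have [Fz|/FN[i iN zi]] := eqVneq (F z) 0; first by rewrite Fz powR0 ?gt_eqF// mulr0.
  have ni := slab_near_level t0 zi (proj2 Wz).
  rewrite (bigD1 (Ordinal iN))//= -[leLHS]addr0; apply: lerD; last first.
    by apply: sumr_ge0 => j _; exact: bnd_ge0.
  rewrite /E ni !indicE mem_set; last exact: (near_in_D t0 yx ni (hb i) Wz).
  by rewrite mem_set// !mul1r.
rewrite -lee_fin; apply: le_trans le1 _.
apply: (@le_trans _ _ (\sum_(i < N) ((if scale i < a2 * t then len i else 0) *
    (S `^ r * (KK * eps * (a2 * t)) ^+ n))%:E)%E).
  apply: lee_sum => i _; rewrite Int_scale//.
  have [/[dup] ni /andP[st _]|_] := boolP (near_level t i); last first.
    rewrite mul0e lee_fin mulr_ge0//; first by case: ifP => // _; exact/ltW/len_gt0.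
    by rewrite mulr_ge0 ?powR_ge0// exprn_ge0.
  rewrite mul1e st; apply: le_trans (@int_cell_SM (b i) i x _ (S `^ r) bFr (powR_ge0 _ _) _) _.
    move=> z hz; have h := hS i (b i) z (ltn_ord i) ni hz.
    have B0 : 0 <= BA i (fun u => F u `^ r) z by apply: bnd_ge0; exact: bnd_BA.
    rewrite -[leLHS](powRr1 B0) -(mulVf (lt0r_neq0 r0)) powRrM.
    by apply: ge0_ler_powR => //; rewrite ?nnegrE ?powR_ge0// ltW.
  rewrite lee_fin; apply: ler_wpM2l; first exact/ltW/len_gt0.
  by apply: ler_wpM2l; [exact: powR_ge0|exact: vD_le_near].
rewrite sumEFin lee_fin -mulr_suml.
have hn := sum_len_le N (mulr_ge0 (ltW a20) (ltW t0)).
have hv : (2 * (eps * t)) ^+ n * ((a2 - a2^-1) * t) <= v by rewrite -lee_fin -vE; exact: (@nu_whitney_ge (y, t)).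
apply: (@le_trans _ _ (a2 * (a2 * t) * (S `^ r * (KK * eps * (a2 * t)) ^+ n))).
  apply: ler_wpM2r => //; by rewrite mulr_ge0 ?powR_ge0// exprn_ge0.
apply: (@le_trans _ _ (CU * S `^ r * ((2 * (eps * t)) ^+ n * ((a2 - a2^-1) * t)))); last first.
  by apply: ler_wpM2l => //; rewrite mulr_ge0 ?powR_ge0// (le_trans ler01 CU_ge1).
have d0 : 0 < a2 - a2^-1 by rewrite subr_gt0 (lt_trans a21).
have -> : KK * eps * (a2 * t) = (KK * a2 / 2) * (2 * (eps * t)) by field.
rewrite exprMn /CU; set A := _ ^+ n; set B := _ ^+ n.
have B0 : 0 <= B by rewrite exprn_ge0// !mulr_ge0// ltW// eps_gt0.
have -> : a2 * (a2 * t) * (S `^ r * (A * B)) = (A * (a2 ^+ 2 / (a2 - a2^-1))) * S `^ r * (B * ((a2 - a2^-1) * t)).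
  by move: (lt0r_neq0 d0); move: (a2 - a2^-1) => D' dn; field.
apply: ler_wpM2r; first by rewrite !mulr_ge0// ltW.
by apply: ler_wpM2r; [exact: powR_ge0|rewrite lerDr].
Qed.

(** On each box the essential supremum is exceeded on a null set only; the boxes of a level are
    countable and are enumerated by the [pickle] codes of their indices. *)
Lemma null_bav (F : P -> R) i : bnd F -> null [set z | slab i z.2 /\ bav +oo%E F i z.1 < F z].
Proof.
move=> bF; apply: (@nullS _ _ _ (\bigcup_k [set z | slab i z.2 /\ bav +oo%E F i z.1 < F z /\ pickle (G i z.1) = k])).
  by move=> z [h1 h2]; exists (pickle (G i z.1)).
apply: null_bigcup => k.
have [[x hx]|h] := pselect (exists x, pickle (G i x) = k); last first.
  by apply: (@nullS _ _ _ set0); [move=> z [_ [_ hz]]; apply: h; exists z.1|exact/null_measurable/measure0].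
apply: (@nullS _ _ _ [set z | box i x z /\ bav +oo%E F i x < F z]).
  move=> z [h1 [h2]]; rewrite -hx => /(pcan_inj pickleK) h3; split; first by split.
  by rewrite (bav_adapted +oo%E F (esym h3)).
by apply: esssup_null; rewrite bavP_infty.
Qed.

Lemma WR_le_bav (F : P -> R) N r y t (x : T) S : (1 <= r)%E -> bnd F ->
  (forall z, F z != 0 -> exists2 i, (i < N)%N & slab i z.2) ->
  0 <= S -> 0 < t -> edist y x < t ->
  (forall i b z, (i < N)%N -> near_level t i -> D b i z = D b i x -> bav r F i z <= S) ->
  (WR a1 a2 r (EFin \o F) (y, t) <= (CU * S)%:E)%E.
Proof.
move=> r1 bF FN S0 t0 yx; apply: (ge1_case r1 (Q := fun r => (forall i b z, (i < N)%N -> near_level t i -> D b i z = D b i x -> bav r F i z <= S) ->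
  (WR a1 a2 r (EFin \o F) (y, t) <= (CU * S)%:E)%E)).
  by move=> r' r'1; exact: WR_le_bav_fin.
move=> hS; apply: (@le_trans _ _ S%:E); last by rewrite lee_fin ler_peMl// CU_ge1.
apply: esssup_le; apply: (@nullS _ _ _ (\bigcup_i [set z | slab i z.2 /\ bav +oo%E F i z.1 < F z])).
  move=> z [Wz /=]; rewrite lte_fin => SF.
  have [i iN zi] : exists2 i, (i < N)%N & slab i z.2 by apply: FN; rewrite gt_eqF// (le_lt_trans S0).
  exists i => //; split => //; apply: le_lt_trans SF.
  have ni := slab_near_level t0 zi (proj2 Wz).
  have [b hb] := D_shift i x.
  exact: (hS i b z.1 iN ni (near_in_D t0 yx ni hb Wz)).
by apply: null_bigcup => i; exact: null_bav.
Qed.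

End whitney_grid.

(** * Tent norms dominate discrete norms *)

Section extended_powers.
Variable R : realType.
Implicit Types (X Y : \bar R) (B p : R).

Lemma le_poweR p X Y : 0 <= p -> (0 <= X)%E -> (X <= Y)%E -> (X `^ p <= Y `^ p)%E.
Proof.
move=> p0 X0 XY; apply: gt0_ler_poweR => //; rewrite in_itv/= leey andbT//.
exact: le_trans XY.
Qed.

Lemma poweRVK p X : 0 < p -> (0 <= X)%E -> ((X `^ p^-1) `^ p = X)%E.
Proof. by move=> p0 X0; rewrite -poweRrM mulVf ?gt_eqF// poweRe1. Qed.

Lemma poweRKV p X : 0 < p -> (0 <= X)%E -> ((X `^ p) `^ p^-1 = X)%E.
Proof. by move=> p0 X0; rewrite -poweRrM mulfV ?gt_eqF// poweRe1. Qed.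

Lemma root_le_powR p X B : 0 < p -> (0 <= X)%E -> (X `^ p^-1 <= B%:E)%E -> (X <= (B `^ p)%:E)%E.
Proof.
move=> p0 X0 h; rewrite -(poweRVK p0 X0) -poweR_EFin.
by apply: le_poweR => //; [exact: ltW|exact: poweR_ge0].
Qed.

Lemma le_powR_root p X B : 0 < p -> 0 <= B -> (0 <= X)%E -> (X <= (B `^ p)%:E)%E -> (X `^ p^-1 <= B%:E)%E.
Proof.
move=> p0 B0 X0 h; rewrite -(poweRKV p0 (_ : (0 <= B%:E)%E)) ?lee_fin// poweR_EFin.
by apply: le_poweR => //; rewrite invr_ge0 ltW.
Qed.

End extended_powers.

Section slab_sums.
Variables (R : realType) (n : nat).
Local Notation T := (n.-tuple R).
Local Notation mu := (leb R n).

Lemma fint_slabs N (B : nat -> set R) (l : nat -> R) (u : nat -> T -> R) :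
  (forall i, measurable (B i)) -> (forall i, lam R (B i) = (l i)%:E) -> (forall i, bnd (u i)) ->
  fint (fun z : pt R n => (\sum_(i < N) (\1_(B i) z.2 : R) * u i z.1)%:E) =
  (\sum_(i < N) ((l i)%:E * intR mu (u i)))%E.
Proof.
move=> mB lB bu.
pose w i (z : pt R n) := (\1_(B i) z.2 : R) * u i z.1.
have bw i : bnd (w i).
  apply: bnd_mul; split.
  - exact: (measurable_comp_snd (measurable_indic (mB i))).
  - by exists 1 => z; rewrite indicE; case: (_ \in _); rewrite ?lexx ?ler01.
  - exact: (measurable_comp_fst (bnd_m (bu i))).
  - by have [_ [c hc]] := bu i; exists c.
rewrite fintE; last 2 first.
- apply/(@measurable_EFinP _ _ _ _ (fun z => \sum_(i < N) w i z)).
  exact: (bnd_m (@bnd_sum _ _ _ N w bw)).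
- by move=> z; rewrite lee_fin; apply: sumr_ge0 => i _; exact: (bnd_ge0 _ (bw i)).
rewrite -[LHS]/(intR (leb1 R n) (fun z => \sum_(i < N) w i z)) (@Int_sum _ _ _ _ N w)//.
apply: eq_bigr => i _; rewrite /intR (@integral_prodm1 _ _ _ _ _ mu (lam R)).
- transitivity (\int[mu]_y ((l i)%:E * (u i y)%:E))%E.
    apply: eq_integral => y _; rewrite /w.
    transitivity (\int[lam R]_t ((u i y)%:E * (\1_(B i) t : R)%:E))%E.
      by apply: eq_integral => t _; rewrite -EFinM mulrC.
    rewrite ge0_integralZl//.
    + by rewrite integral_indic// setIT muleC; congr (_ * _)%E; exact: lB.
    + exact/measurable_EFinP/measurable_indic.
    + by rewrite lee_fin bnd_ge0.
  rewrite ge0_integralZl//.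
  + exact/measurable_EFinP/bnd_m.
  + by move=> y _; rewrite lee_fin bnd_ge0.
  + by rewrite -lB measure_ge0.
- exact/measurable_EFinP/bnd_m.
- by move=> z; rewrite lee_fin (bnd_ge0 _ (bw i)).
Qed.

Lemma single_term N (f : nat -> R) i : (i < N)%N -> (forall j, j != i -> f j = 0) ->
  \sum_(j < N) f j = f i.
Proof.
move=> iN h; rewrite (bigD1 (Ordinal iN))//= big1 ?addr0// => j ji.
by apply: h; apply: contraNneq ji => ji; apply/eqP/val_inj.
Qed.

Lemma measurable_ball_n (c : T) r : measurable (ball_n c r).
Proof. by apply: mset_lt => //; apply: measurable_edist. Qed.

Lemma volnE (A : set T) : measurable A -> voln A = mu A.
Proof.
move=> mA; rewrite /voln.
have -> : (fun y => if `[< A y >] then 1%E else 0%E) = fun y => (\1_A y : R)%:E.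
  apply/funext => y; rewrite indicE; case: asboolP => h; first by rewrite mem_set.
  by rewrite memNset.
rewrite iintE; first by rewrite integral_indic// setIT.
  exact/measurable_EFinP/measurable_indic.
by move=> x; rewrite lee_fin indicE.
Qed.

Lemma mu_ball_le (c : T) r : 0 <= r -> (mu (ball_n c r) <= ((2 * r) ^+ n)%:E)%E.
Proof.
move=> r0; rewrite -(leb_cube c r0); apply: le_measure; rewrite ?inE//.
- exact: measurable_ball_n.
- exact: measurable_cube.
- by move=> y; exact: edist_le_cube.
Qed.

Lemma mu_ball_ge (c : T) r : (0 < n)%N -> 0 <= r ->
  (((2 * r / n%:R) ^+ n)%:E <= mu (ball_n c r))%E.
Proof.
move=> n0 r0; rewrite -mulrA -(leb_cube c) ?divr_ge0//; apply: le_measure; rewrite ?inE//.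
- exact: measurable_cube.
- exact: measurable_ball_n.
- move=> y hy; rewrite /ball_n /= (_ : r = n%:R * (r / n%:R)); first exact: edist_lt.
  by rewrite mulrCA mulfV ?mulr1// pnatr_eq0 -lt0n.
Qed.

End slab_sums.

Section lower.
Variables (R : realType) (n : nat) (a1 a2 : R).
Hypotheses (n0 : (0 < n)%N) (a10 : 0 < a1) (a12 : a1 < a2^-1) (a21 : a2^-1 < 1).
Variables (s0 : R).
Hypothesis s00 : 0 < s0.
Local Notation T := (n.-tuple R).
Local Notation P := (pt R n).
Local Notation nu := (leb1 R n).
Local Notation mu := (leb R n).
Local Notation scale := (scale a2 s0).
Local Notation slab := (slab a2 s0).
Local Notation len := (len a2 s0).
Local Notation G := (@G R n a1 a2 s0).
Local Notation vG := (vG n a1 a2 s0).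
Local Notation box := (@box R n a1 a2 s0).
Local Notation bav := (@bav R n a1 a2 s0).
Local Notation CV := (CV n a2).
Let a2gt1 : 1 < a2 := a2_gt1 a10 a12 a21.
Let a20 : 0 < a2 := lt_trans ltr01 a2gt1.
Let sgt i : 0 < scale i := scale_gt0 a10 a12 a21 s00 i.
Let CV1 : 1 <= CV := CV_ge1 n0 a10 a12 a21.
Let CV0 : 0 < CV := lt_le_trans ltr01 CV1.
Let gG i := gridG n a1 a2 s0 i.
Let vg i : 0 < vG i := vG_gt0 n a1 a2 s0 i.
Let lg i : 0 < len i := len_gt0 a10 a12 a21 s00 i.
Variables (r : \bar R) (F : P -> R) (N : nat).
Hypotheses (r1 : (1 <= r)%E) (bF : bnd F).
Local Notation g := (WR a1 a2 r (EFin \o F)).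
Local Notation b := (bav r F).
Let bb i : bnd (b i) := bnd_bav a10 a12 a21 s00 r1 i bF.
Let b0 i x : 0 <= b i x := bav_ge0 a10 a12 a21 s00 r1 i x bF.

Let bg i x z : box i x z -> ((b i x / CV)%:E <= g z)%E.
Proof.
move=> bz; have := bav_le_WR n0 a10 a12 a21 s00 r1 bF bz; set Y := WR _ _ _ _ _ => h.
by rewrite mulrC EFinM lee_pdivrMl.
Qed.

Let vG_ge i : (eps n a1 * scale i / 6) ^+ n <= vG i.
Proof.
have h := rho_gt n0 a10 a12 a21 s00 i; have e0 := eps_gt0 n0 a10; have si := sgt i.
apply: lerXn2r; rewrite ?nnegrE.
- by rewrite divr_ge0// mulr_ge0// ltW.
- exact/ltW/(Gl_gt0 n a1 a2 s0 i).
- by rewrite /Gl; move: h; set e := _ * scale i; set o := rho _ _ _ _ _; lra.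
Qed.

Definition lower_cst (q : R) := (eps n a1 / 6) ^+ n * (a2 - 1) / a2 ^+ n.+1 / CV `^ q.

Lemma lower_cst_gt0 q : 0 < lower_cst q.
Proof.
rewrite /lower_cst; apply: divr_gt0; last exact: powR_gt0.
apply: divr_gt0; last exact: exprn_gt0.
apply: mulr_gt0; last by rewrite subr_gt0.
by apply: exprn_gt0; apply: divr_gt0 => //; exact: eps_gt0.
Qed.

(** The cone at x contains the boxes over x, because the cells have diameter below a1 times the
    height and a1 < 1. In each box the Whitney average dominates the box average up to [CV], and the
    weight t^-(n+1) compensates the volume of the box. *)
Lemma cone_lower q (x : T) : 0 < q ->
  ((lower_cst q * \sum_(i < N) b i x `^ q)%:E <=
   sint (cone x) (fun z => g z `^ q * ((z.2 ^+ n.+1)^-1)%R%:E))%E.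
Proof.
move=> q0.
have mc i := cell_measurable x (gG i).
pose c i : R := (b i x / CV) `^ q * ((a2 * scale i) ^+ n.+1)^-1.
have c0 i : 0 <= c i.
  by rewrite mulr_ge0 ?powR_ge0// invr_ge0 exprn_ge0// mulr_ge0// ltW.
pose u i y := c i * (\1_(cell (G i) x) y : R).
have bu i : bnd (u i) by apply: bnd_scale => //; exact: bnd_indic.
apply: (@le_trans _ _ (fint (fun z : P => (\sum_(i < N) (\1_(slab i) z.2 : R) * u i z.1)%:E))).
  rewrite (@fint_slabs R n N slab len u (fun i => measurable_slab a2 s0 i) (fun i => lam_slab a10 a12 a21 s00 i) bu).
  rewrite mulr_sumr -sumEFin; apply: lee_sum => i _.
  rewrite /u Int_scale//; last exact: bnd_indic.
  rewrite Int_indic//; have [_ _ ->] := gG i; rewrite -!EFinM lee_fin.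
  rewrite /lower_cst /c powRdiv//.
  have -> : (eps n a1 / 6) ^+ n * (a2 - 1) / a2 ^+ n.+1 / CV `^ q * b i x `^ q =
     len i * (b i x `^ q / CV `^ q * ((a2 * scale i) ^+ n.+1)^-1 * (eps n a1 * scale i / 6) ^+ n).
    have -> : eps n a1 * scale i / 6 = eps n a1 / 6 * scale i by rewrite mulrAC.
    rewrite /len; move: (sgt i) (powR_gt0 q CV0) => sp cp.
    move: (eps n a1 / 6) (scale i) (CV `^ q) (b i x `^ q) sp cp => e s c' b' sp cp.
    rewrite !exprMn !(exprS _ n); field.
    by rewrite !expf_neq0 ?gt_eqF.
  apply: ler_wpM2l; first exact/ltW.
  apply: ler_wpM2l; last exact: vG_ge.
  by have := c0 i; rewrite /c powRdiv.
apply: le_fint => z.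
  by rewrite lee_fin; apply: sumr_ge0 => i _; rewrite mulr_ge0 ?indicE// /u mulr_ge0.
rewrite /restr; case: asboolP => [[z0 zx]|nz]; last first.
  rewrite lee_fin big1// => i _; rewrite /u !indicE.
  case: (boolP (z.2 \in _)) => [/set_mem h1|_]; last by rewrite mul0r.
  case: (boolP (z.1 \in _)) => [/set_mem h2|_]; last by rewrite !mulr0.
  exfalso; apply: nz; split; first by case/andP: h1 => [h _]; exact: lt_le_trans h.
  apply: lt_le_trans (G_dist n0 a10 a12 a21 s00 (esym h2)) _.
  case/andP: h1 => [h _]; apply: le_trans h.
  by rewrite ler_piMl ?(ltW (sgt i))// ltW// (lt_trans a12).
have RHS0 : (0 <= g z `^ q * ((z.2 ^+ n.+1)^-1)%:E)%E.
  by apply: mule_ge0; rewrite ?poweR_ge0// lee_fin invr_ge0 exprn_ge0// ltW.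
have [[i iN [h1 h2]]|h] := pselect (exists2 i, (i < N)%N & slab i z.2 /\ G i z.1 = G i x); last first.
  rewrite big1// => i _; rewrite /u !indicE.
  case: (boolP (z.2 \in _)) => [/set_mem h1|_]; last by rewrite mul0r.
  case: (boolP (z.1 \in _)) => [/set_mem h2|_]; last by rewrite !mulr0.
  by exfalso; apply: h; exists i.
rewrite (@single_term R N (fun i => (\1_(slab i) z.2 : R) * u i z.1) i)//; last first.
  move=> j ji; rewrite indicE memNset ?mul0r// => h3.
  by move: ji; rewrite (slab_disj a10 a12 a21 s00 h1 h3) eqxx.
rewrite /u !indicE !mem_set// mul1r mulr1 /c EFinM.
apply: lee_pmul.
- by rewrite lee_fin powR_ge0.
- by rewrite lee_fin invr_ge0 exprn_ge0// mulr_ge0// ltW.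
- rewrite -poweR_EFin; apply: le_poweR; [exact: ltW|by rewrite lee_fin divr_ge0// ltW|exact: bg].
- have ta : 0 < a2 * scale i by rewrite mulr_gt0.
  rewrite lee_fin lef_pV2 ?posrE; [|exact: exprn_gt0|exact: exprn_gt0].
  apply: lerXn2r; rewrite ?nnegrE; [exact: ltW|by rewrite mulr_ge0// ltW|].
  by case/andP: h1 => _ /ltW.
Qed.

Let bsum q : 0 < q -> bnd (fun x => \sum_(i < N) b i x `^ q).
Proof. by move=> q0; apply: (@bnd_sum _ _ _ N (fun i x => b i x `^ q)) => i; exact: bnd_pow (ltW q0) (bb i). Qed.

Lemma lower_fin_fin p q B : 0 < p -> 0 < q -> 0 <= B -> (tnorm p%:E q%:E g <= B%:E)%E ->
  dnorm_le mu G vG N p%:E q%:E b (lower_cst q `^ (- q^-1) * B).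
Proof.
move=> p0 q0 B0 /(root_le_powR p0) h; have c0 := lower_cst_gt0 q.
have S0 x : 0 <= \sum_(i < N) b i x `^ q by apply: sumr_ge0 => i _; exact: powR_ge0.
have pq0 : 0 <= p / q by rewrite divr_ge0// ltW.
have h1 : (iint (fun x => ((lower_cst q * \sum_(i < N) b i x `^ q) `^ (p / q))%:E) <= (B `^ p)%:E)%E.
  apply: le_trans (h _); last by apply: iint_ge0 => x; exact: poweR_ge0.
  apply: le_iint => x; first by rewrite lee_fin powR_ge0.
  rewrite -poweR_EFin (mulrC p) poweRrM; apply: le_poweR; [exact: ltW|exact: poweR_ge0|].
  apply: le_poweR; [by rewrite invr_ge0 ltW|by rewrite lee_fin mulr_ge0// ltW|].
  exact: cone_lower.
have bS := bnd_pow pq0 (bsum q0).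
rewrite /dnorm_le; move: h1; rewrite iintE; last 2 first.
- apply/(@measurable_EFinP _ _ _ _ (fun x => (lower_cst q * \sum_(i < N) b i x `^ q) `^ (p / q))).
  by apply: bnd_m; apply: bnd_pow pq0 (bnd_scale (ltW c0) (bsum q0)).
- by move=> x; rewrite lee_fin powR_ge0.
under eq_integral do rewrite powRM ?(ltW c0)//.
rewrite -[X in (X <= _)%E]/(intR mu (fun x => lower_cst q `^ (p / q) * (\sum_(i < N) b i x `^ q) `^ (p / q))).
rewrite Int_scale ?powR_ge0// => h1.
rewrite powRM ?powR_ge0// -powRrM mulNr powRN (mulrC q^-1 p) EFinM.
by rewrite lee_pdivlMl// powR_gt0.
Qed.

(** At each level the point (x, [scale i]) lies both in the cone at x and in the box over x, so the
    supremum over the cone dominates every term of the running maximum. *)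
Lemma lower_fin_infty p B : 0 < p -> 0 <= B -> (tnorm p%:E +oo g <= B%:E)%E ->
  dnorm_le mu G vG N p%:E +oo b (CV * B).
Proof.
move=> p0 B0 /(root_le_powR p0) h.
have br : bnd (rmax b N).
  elim: N => [|k IH]; first exact: bnd_cst.
  split.
    by apply: measurable_maxr; exact: bnd_m.
  have [_ [c hc]] := IH; have [_ [c' hc']] := bb k; exists (Num.max c c') => x /=.
  have /andP[e1 e2] := hc x; have /andP[e3 e4] := hc' x; apply/andP; split; first by rewrite le_max e1.
  by rewrite ge_max !le_max e2 e4 orbT.
have h1 : (iint (fun x => ((CV^-1 * rmax b N x) `^ p)%:E) <= (B `^ p)%:E)%E.
  apply: le_trans (h _); last by apply: iint_ge0 => x; exact: poweR_ge0.
  apply: le_iint => x; first by rewrite lee_fin powR_ge0.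
  have hs i : (i < N)%N -> ((CV^-1 * b i x)%:E <= ereal_sup [set g z | z in cone x])%E.
    move=> iN; have bz : box i x (x, scale i) by split => //=; apply/andP; split; [exact: lexx|rewrite ltr_pMl].
    rewrite mulrC; apply: le_trans (bg bz) _; apply: ereal_sup_ubound; exists (x, scale i) => //.
    by split => //=; rewrite edistxx.
  have hs0 : (0 <= ereal_sup [set g z | z in cone x])%E.
    have bz : box 0%N x (x, scale 0%N) by split => //=; apply/andP; split; [exact: lexx|rewrite ltr_pMl].
    apply: le_trans (le_trans (bg bz) _); first by rewrite lee_fin divr_ge0// ltW.
    apply: ereal_sup_ubound; exists (x, scale 0%N) => //.
    by split => //=; rewrite edistxx.
  rewrite -poweR_EFin; apply: le_poweR; [exact: ltW|by rewrite lee_fin mulr_ge0 ?rmax_ge0// invr_ge0 ltW|].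
  case: (ereal_sup _) hs hs0 => [s| |] hs hs0; last by [].
    rewrite lee_fin ler_pdivrMl//; apply: rmax_le; first by rewrite mulr_ge0// ltW.
    by move=> i /hs; rewrite lee_fin ler_pdivrMl.
  by rewrite leey.
rewrite /dnorm_le; move: h1; rewrite iintE; last 2 first.
- apply/(@measurable_EFinP _ _ _ _ (fun x => (CV^-1 * rmax b N x) `^ p)).
  by apply: bnd_m; apply: bnd_pow (ltW p0) (bnd_scale _ br); rewrite invr_ge0 ltW.
- by move=> x; rewrite lee_fin powR_ge0.
under eq_integral do rewrite powRM ?rmax_ge0 ?invr_ge0 ?(ltW CV0)//.
rewrite -[X in (X <= _)%E]/(intR mu (fun x => CV^-1 `^ p * rmax b N x `^ p)).
rewrite Int_scale ?powR_ge0//; last exact: bnd_pow (ltW p0) br.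
have -> : CV^-1 `^ p = (CV `^ p)^-1 by rewrite -[CV^-1]powR_inv1 ?(ltW CV0)// -powRrM mulN1r powRN.
by rewrite powRM ?(ltW CV0)// EFinM lee_pdivrMl// powR_gt0.
Qed.

Lemma lower_infty_infty B : (tnorm +oo%E +oo%E g <= B%:E)%E -> dnorm_le mu G vG N +oo%E +oo%E b (CV * B).
Proof.
move=> h i x iN; rewrite -ler_pdivrMl// -lee_fin; apply: le_trans h.
apply: le_ereal_inf_tmp => M hM; rewrite leNgt; apply/negP => hlt.
have hb : null (box i x).
  apply: nullS hM => z bz; split; first by case: bz => _ /andP[h _]; exact: lt_le_trans (sgt i) h.
  by apply: lt_le_trans hlt _; rewrite mulrC; exact: bg.
have mbx := @measurable_box R n a1 a2 s0 i x.
move/(null_measurable mbx): hb; rewrite (@nu_box R n a1 a2 a10 a12 a21 s0 s00 i x) => -[].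
by apply/eqP; rewrite gt_eqF// mulr_gt0.
Qed.

Definition lower_cst' (q : R) :=
  (12 * n%:R * (a2 + 1) / eps n a1) ^+ n / ((a2 - 1) / a2 / CV `^ q).

Lemma lower_cst'_gt0 q : 0 < lower_cst' q.
Proof.
have e0 := eps_gt0 n0 a10; have cq := powR_gt0 q CV0.
apply: divr_gt0; last by rewrite !divr_gt0// subr_gt0.
by apply: exprn_gt0; rewrite divr_gt0// mulr_gt0 ?addr_gt0// mulr_gt0 ?ltr0n.
Qed.

(** The boxes of levels k >= i over the cell of x lie in the tent: their points have horizontal
    distance below [scale i] and height below a2 [scale i], which add up to (a2 + 1) [scale i]. The
    factor n passes from the sup norm to the Euclidean one. *)
Lemma hat_lower q i (x : T) rad : 0 < q -> rad = n%:R * ((a2 + 1) * scale i) ->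
  (((a2 - 1) / a2 / CV `^ q)%:E * intR mu (fun y => (\1_(cell (G i) x) y : R) * tailsum N q b i y)%R <=
   sint (tent_hat x rad) (fun z => g z `^ q * (z.2^-1)%R%:E))%E.
Proof.
move=> q0 ->; have mc := cell_measurable x (gG i).
have bbq k : bnd (fun y => b k y `^ q) by exact: bnd_pow (ltW q0) (bb k).
pose c k : R := (if (i <= k)%N then 1 else 0) * (CV `^ q)^-1 * (a2 * scale k)^-1.
have ta k : 0 < a2 * scale k by rewrite mulr_gt0.
have c0 k : 0 <= c k.
  by rewrite !mulr_ge0// ?invr_ge0 ?powR_ge0 ?(ltW (ta k))//; case: leqP.
pose u k y := c k * ((\1_(cell (G i) x) y : R) * b k y `^ q).
have bu k : bnd (u k) by apply: bnd_scale => //; apply: bnd_mul => //; exact: bnd_indic.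
apply: (@le_trans _ _ (fint (fun z : P => (\sum_(k < N) (\1_(slab k) z.2 : R) * u k z.1)%:E))).
  rewrite (@fint_slabs R n N slab len u (fun i => measurable_slab a2 s0 i) (fun i => lam_slab a10 a12 a21 s00 i) bu).
  pose w k y : R := (\1_(cell (G i) x) y : R) * (if (i <= k)%N then b k y `^ q else 0).
  have bw k : bnd (w k).
    by apply: bnd_mul; [exact: bnd_indic|case: leqP => // _; exact: bnd_cst].
  rewrite (_ : (fun y => (\1_(cell (G i) x) y : R) * tailsum N q b i y) = fun y => \sum_(k < N) w k y); last first.
    by apply/funext => y; rewrite mulr_sumr.
  have cc0 : 0 <= (a2 - 1) / a2 / CV `^ q.
    by rewrite !divr_ge0 ?powR_ge0 ?(ltW a20)// subr_ge0 ltW.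
  rewrite (@Int_sum _ _ _ _ N w)// ge0_sume_distrr; last first.
    by move=> k _; apply: Int_ge0 => y; exact: bnd_ge0.
  apply: lee_sum => k _.
  rewrite -(@Int_scale _ _ _ mu _ (w k) cc0 (bw k)) -(@Int_scale _ _ _ mu _ (u k) (ltW (lg k)) (bu k)).
  apply: le_Int => y; first by rewrite mulr_ge0// bnd_ge0.
  rewrite /w /u /c /len; case: leqP => _; last by rewrite !(mulr0,mul0r).
  have sk := sgt k; have cq := powR_gt0 q CV0; rewrite le_eqVlt; apply/orP; left; apply/eqP.
  move: sk cq; move: (scale k) (CV `^ q) (\1_(cell (G i) x) y : R) (b k y `^ q) => s c1 c2 c3 sk cq.
  by field; rewrite !gt_eqF.
apply: le_fint => z.
  by rewrite lee_fin; apply: sumr_ge0 => k _; rewrite mulr_ge0 ?indicE// bnd_ge0.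
rewrite /restr; case: asboolP => [[z0 zx]|nz]; last first.
  rewrite lee_fin big1// => k _; rewrite /u /c !indicE.
  case: leqP => ik; last by rewrite !(mul0r,mulr0).
  case: (boolP (z.2 \in _)) => [/set_mem h1|_]; last by rewrite mul0r.
  case: (boolP (z.1 \in _)) => [/set_mem h2|_]; last by rewrite !(mul0r,mulr0).
  exfalso; apply: nz; case/andP: h1 => [h1 h1']; split; first exact: lt_le_trans h1.
  have zi : z.2 < a2 * scale i.
    have si : scale k <= scale i.
      by rewrite -(subnK ik); elim: (k - i)%N => [//|m IH]; rewrite addSn; exact: le_trans (scaleS_le a10 a12 a21 s00 _) IH.
    by apply: lt_le_trans h1' _; rewrite ler_pM2l.
  move=> w hw; apply: edist_lt => // j.
  have e1 := edist_le_cube hw j; have := edist_le_cube (G_dist n0 a10 a12 a21 s00 (esym h2)) j.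
  move: e1; set d1 := tnth w j; set d2 := tnth z.1 j; set d3 := tnth x j => e1 e2.
  rewrite (_ : d1 - d3 = (d1 - d2) + (d2 - d3)); last by ring.
  apply: le_lt_trans (ler_normD _ _) _; rewrite mulrDl mul1r; apply: ltrD; first exact: lt_trans zi.
  apply: lt_le_trans e2 _; rewrite ler_piMl ?(ltW (sgt i))// ltW//.
  exact: lt_trans a12 a21.
have RHS0 : (0 <= g z `^ q * (z.2^-1)%:E)%E.
  by apply: mule_ge0; rewrite ?poweR_ge0// lee_fin invr_ge0 ltW.
have [[k kN h1]|h] := pselect (exists2 k, (k < N)%N & slab k z.2); last first.
  rewrite big1// => k _; rewrite !indicE.
  case: (boolP (z.2 \in _)) => [/set_mem h1|_]; last by rewrite mul0r.
  by exfalso; apply: h; exists k.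
rewrite (@single_term R N (fun k => (\1_(slab k) z.2 : R) * u k z.1) k)//; last first.
  move=> j jk; rewrite indicE memNset ?mul0r// => h3.
  by move: jk; rewrite (slab_disj a10 a12 a21 s00 h1 h3) eqxx.
rewrite indicE mem_set// mul1r.
apply: (@le_trans _ _ (((b k z.1 / CV) `^ q)%:E * ((a2 * scale k)^-1)%:E)%E).
  rewrite -EFinM lee_fin /u /c powRdiv// mulrC.
  have cq := powR_gt0 q CV0; have bq := powR_ge0 (b k z.1) q; have tk := ta k.
  have X0 : 0 <= b k z.1 `^ q / CV `^ q / (a2 * scale k) by rewrite !divr_ge0// ltW.
  rewrite indicE; case: leqP => _; last by rewrite !(mul0r,mulr0).
  case: (z.1 \in _); last by rewrite !(mul0r,mulr0).
  by rewrite mul1r mul1r mulrA.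
apply: lee_pmul.
- by rewrite lee_fin powR_ge0.
- by rewrite lee_fin invr_ge0 ltW.
- by rewrite -poweR_EFin; apply: le_poweR; [exact: ltW|by rewrite lee_fin divr_ge0// ltW|exact: bg].
- by rewrite lee_fin lef_pV2 ?posrE// ltW//; case/andP: h1.
Qed.

Lemma lower_infty_fin q B : 0 < q -> 0 <= B -> (tnorm +oo%E q%:E g <= B%:E)%E ->
  dnorm_le mu G vG N +oo%E q%:E b (lower_cst' q `^ q^-1 * B).
Proof.
move=> q0 B0 h i x iN; have si := sgt i; have e0 := eps_gt0 n0 a10.
pose rad := n%:R * ((a2 + 1) * scale i).
have rad0 : 0 < rad by rewrite mulr_gt0 ?ltr0n// mulr_gt0// addr_gt0.
have vol_le := mu_ball_le x (ltW rad0); have vol_ge := mu_ball_ge x n0 (ltW rad0).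
have vfin : mu (ball_n x rad) \is a fin_num by rewrite ge0_fin_numE// (le_lt_trans vol_le)// ltry.
have vE := fineK vfin; set v := fine _ in vE; rewrite -vE lee_fin in vol_le; rewrite -vE lee_fin in vol_ge.
have v0 : 0 < v by apply: lt_le_trans vol_ge; apply: exprn_gt0; apply: divr_gt0; [exact: mulr_gt0|rewrite ltr0n].
set S := sint (tent_hat x rad) (fun z => g z `^ q * (z.2^-1)%R%:E)%E.
have S0 : (0 <= S)%E.
  apply: integral_ge0 => t _; apply: iint_ge0 => y; rewrite /restr; case: asboolP => // -[/= t0 _].
  by apply: mule_ge0; rewrite ?poweR_ge0// lee_fin invr_ge0 ltW.
have hS : (S <= (B `^ q * v)%:E)%E.
  have : (v%:E `^ (- q^-1) * S `^ q^-1 <= B%:E)%E.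
    apply: le_trans h; apply: ereal_sup_ubound; exists x, x, rad; split=> //; split.
      by rewrite /ball_n /= edistxx.
    by rewrite volnE; [rewrite -vE|exact: measurable_ball_n].
  rewrite poweR_EFin powRN muleC lee_pdivrMr ?powR_gt0// -EFinM => /(root_le_powR q0 S0).
  by rewrite powRM ?powR_ge0// -powRrM mulVf ?gt_eqF// powRr1// ltW.
have := le_trans (@hat_lower q i x rad q0 erefl) hS.
have bt : bnd (tailsum N q b i).
  apply: (@bnd_sum _ _ _ N (fun k x => if (i <= k)%N then b k x `^ q else 0)) => k.
  by case: leqP => // _; [exact: bnd_pow (ltW q0) (bb k)|exact: bnd_cst].
have -> : intR mu (fun y => (\1_(cell (G i) x) y : R) * tailsum N q b i y) = (vG i * avg mu (G i) (vG i) (tailsum N q b i) x)%:E.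
  rewrite EFinM [X in (_ * X)%E](avgE (gG i) x bt) muleA -EFinM mulfV ?gt_eqF// mul1e.
  rewrite /intR [RHS]integral_mkcond; apply: eq_integral => y _.
  by rewrite patchE indicE; case: (y \in _); rewrite ?mul1r ?mul0r.
rewrite -EFinM lee_fin; set A := avg _ _ _ _ _ => hA.
rewrite powRM ?powR_ge0// -powRrM mulVf ?gt_eqF// powRr1 ?(ltW (lower_cst'_gt0 q))//.
have cc0 : 0 < (a2 - 1) / a2 / CV `^ q by rewrite !divr_gt0 ?powR_gt0// subr_gt0.
rewrite /lower_cst' mulrAC ler_pdivlMr// -(ler_pM2r (vg i)) [leLHS]mulrAC.
apply: (@le_trans _ _ (B `^ q * v)); first by rewrite mulrC (mulrC A).
set X0 := _ ^+ n; rewrite (mulrC X0) -mulrA; apply: ler_wpM2l; first exact: powR_ge0.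
apply: le_trans vol_le _; apply: (@le_trans _ _ ((12 * n%:R * (a2 + 1) / eps n a1) ^+ n * (eps n a1 * scale i / 6) ^+ n)).
  rewrite -exprMn le_eqVlt; apply/orP; left; apply/eqP; congr (_ ^+ _); rewrite /rad.
  by move: e0; move: (eps n a1) (scale i) => e s e0; field; rewrite gt_eqF.
apply: ler_wpM2l; last exact: vG_ge.
by apply: exprn_ge0; apply: divr_ge0; [rewrite !mulr_ge0// addr_ge0// ltW|exact: ltW].
Qed.

End lower.

(** * Discrete norms dominate tent norms *)

Section upper_bounds.
Variables (R : realType) (n : nat) (a1 a2 : R).
Hypotheses (n0 : (0 < n)%N) (a10 : 0 < a1) (a12 : a1 < a2^-1) (a21 : a2^-1 < 1).
Variables (s0 : R).
Hypothesis s00 : 0 < s0.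
Local Notation T := (n.-tuple R).
Local Notation P := (pt R n).
Local Notation nu := (leb1 R n).
Local Notation mu := (leb R n).
Local Notation scale := (scale a2 s0).
Local Notation slab := (slab a2 s0).
Local Notation near_level := (near_level a2 s0).
Local Notation G := (@G R n a1 a2 s0).
Local Notation vG := (vG n a1 a2 s0).
Local Notation D := (@D R n a1 a2 s0).
Local Notation vD := (vD n a1 a2 s0).
Local Notation KD := (KD n a1 a2).
Local Notation KK := (KK n a1 a2).
Local Notation eps := (eps n a1).
Local Notation bav := (@bav R n a1 a2 s0).
Local Notation CU := (CU n a1 a2).
Let a2gt1 : 1 < a2 := a2_gt1 a10 a12 a21.
Let a20 : 0 < a2 := lt_trans ltr01 a2gt1.
Let sgt i : 0 < scale i := scale_gt0 a10 a12 a21 s00 i.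
Let CU1 : 1 <= CU := CU_ge1 n a10 a12 a21.
Let CU0 : 0 < CU := lt_le_trans ltr01 CU1.
Let KD0 : 0 < KD := KD_gt0 n a1 a2.
Let KK0 : 0 < KK := KK_gt0 n a1 a2.
Let e0 : 0 < eps := eps_gt0 n0 a10.
Lemma WR_ge0 (r : \bar R) (F : P -> \bar R) z : (1 <= r)%E -> (forall z, (0 <= F z)%E) -> 0 < z.2 ->
  (0 <= WR a1 a2 r F z)%E.
Proof.
move=> r1 F0 z0; apply: (ge1_case r1 (Q := fun r => (0 <= WR a1 a2 r F z)%E)) => [r' _|].
  by apply: mule_ge0; exact: poweR_ge0.
apply: esssup_ge0 => //; first exact: measurable_whitney.
apply: lt_le_trans (nu_whitney_ge n0 a10 a12 a21 z0); rewrite lte_fin; apply: mulr_gt0.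
  by apply: exprn_gt0; apply: mulr_gt0 => //; exact: mulr_gt0.
by apply: mulr_gt0 => //; rewrite subr_gt0 (lt_trans a21).
Qed.

Let gG i := gridG n a1 a2 s0 i.
Let gD b i : grid mu (D b i) (vD i) := gridD a1 a2 s0 b i.
Let nG i x y := @nestG R n a1 a2 n0 a10 a12 a21 s0 s00 i x y.
Let nD b i x y := @nestD R n a1 a2 n0 a10 a12 a21 s0 s00 b i x y.
Let rGD b i x y := @refineGD R n a1 a2 s0 b i x y.
Let vDG i := vD_le n a1 a2 s0 i.
Variables (r : \bar R) (F : P -> R) (N : nat) (s : nat -> T -> R) (A : R).
Hypotheses (r1 : (1 <= r)%E) (bF : bnd F).
Hypothesis FN : forall z, F z != 0 -> exists2 i, (i < N)%N & slab i z.2.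
Hypothesis ds : dseq mu G s.
Hypothesis bs : forall i x, (i < N)%N -> bav r F i x <= s i x.
Hypothesis A0 : 0 <= A.
Local Notation g := (WR a1 a2 r (EFin \o F)).
Let bds i : bnd (s i) := fins_bnd (ds.1 i).
Let si0 i x : 0 <= s i x := bnd_ge0 x (bds i).

Let g_le y t (x : T) S : 0 <= S -> 0 < t -> edist y x < t ->
  (forall i b z, (i < N)%N -> near_level t i -> D b i z = D b i x -> s i z <= S) ->
  (g (y, t) <= (CU * S)%:E)%E.
Proof.
move=> S0 t0 yx h; apply: (WR_le_bav n0 a10 a12 a21 s00 r1 bF FN S0 t0 yx) => i b z iN ni zx.
by apply: le_trans (bs z iN) _; exact: h zx.
Qed.

(** The shifts are numbered so that the results on sums over initial segments of the naturals apply
    to sums over shifts. *)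
Definition shifts : seq (n.-tuple bool) := enum {: n.-tuple bool}.
Definition shift_nth k := nth [tuple of nseq n false] shifts k.
Local Notation M := (size shifts).
Local Notation B_ := shift_nth.

Lemma shift_nthP b : exists2 k, (k < M)%N & B_ k = b.
Proof. by exists (index b shifts); rewrite ?index_mem ?mem_enum// /shift_nth nth_index ?mem_enum. Qed.

Let le_shift_sum (X : n.-tuple bool -> R) b : (forall b, 0 <= X b) -> X b <= \sum_(k < M) X (B_ k).
Proof.
move=> X0; have [k kM <-] := shift_nthP b.
by rewrite (bigD1 (Ordinal kM))//= lerDl sumr_ge0.
Qed.

(** Summing over all shifts removes the dependence of the good shift on the point and on the
    level. *)
Definition dav q i x : R := KD * \sum_(k < M) avg mu (D (B_ k) i) (vD i) (fun y => s i y `^ q) x.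

Let bq q i : 0 < q -> bnd (fun y => s i y `^ q).
Proof. by move=> q0; exact: bnd_pow (ltW q0) (bds i). Qed.

Let avg0 q k i x : 0 <= avg mu (D (B_ k) i) (vD i) (fun y => s i y `^ q) x.
Proof. by apply: (avg_ge0 (gD _ _)) => y; exact: powR_ge0. Qed.

Lemma dav_ge0 q i x : 0 <= dav q i x.
Proof. by apply: mulr_ge0; [exact: ltW|apply: sumr_ge0 => k _; exact: avg0]. Qed.

Lemma bnd_dav q i : 0 < q -> bnd (dav q i).
Proof.
move=> q0; apply: bnd_scale; first exact: ltW.
apply: (@bnd_sum _ _ _ M (fun k x => avg mu (D (B_ k) i) (vD i) (fun y => s i y `^ q) x)) => k.
exact: (bnd_avg (gD _ _) (bq i q0)).
Qed.

Lemma pow_le_dav q b i z x : 0 < q -> D b i z = D b i x -> s i z `^ q <= dav q i x.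
Proof.
move=> q0 zx.
have aq : adapted (G i) (fun y => s i y `^ q) by move=> y y' yy'; rewrite (ds.2 i y y').
apply: le_trans (le_avg_subcell (gG i) (gD b i) (@rGD b i) (vDG i) (bq i q0) aq zx) _.
rewrite /dav ler_pM2l//.
apply: (le_shift_sum (X := fun b => avg mu (D b i) (vD i) (fun y => s i y `^ q) x)) => b'.
by apply: (avg_ge0 (gD _ _)) => y; exact: powR_ge0.
Qed.

Let near_sum q t x := \sum_(i < N) (if near_level t i then dav q i x else 0).

Let near_sum_ge0 q t x : 0 <= near_sum q t x.
Proof. by apply: sumr_ge0 => i _; case: ifP => // _; exact: dav_ge0. Qed.

Lemma g_pow_le q y t x : 0 < q -> 0 < t -> edist y x < t ->
  (g (y, t) `^ q <= (CU `^ q * near_sum q t x)%:E)%E.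
Proof.
move=> q0 t0 yx; have ns0 := near_sum_ge0 q t x.
have -> : CU `^ q * near_sum q t x = (CU * near_sum q t x `^ q^-1) `^ q.
  by rewrite powRM ?powR_ge0 ?(ltW CU0)// -powRrM mulVf ?gt_eqF// powRr1.
have h : (0 <= g (y, t))%E.
  by apply: WR_ge0 => // z; rewrite lee_fin bnd_ge0.
rewrite -poweR_EFin.
apply: le_poweR; [exact: ltW|exact: h|].
apply: (g_le (x := x)) => //; first exact: powR_ge0.
move=> i b z iN ni zx; rewrite -[leLHS](powRr1 (si0 i z)) -(mulfV (lt0r_neq0 q0)) powRrM.
apply: ge0_ler_powR; rewrite ?nnegrE ?invr_ge0 ?powR_ge0 ?(ltW q0)//.
apply: le_trans (pow_le_dav q0 zx) _.
rewrite /near_sum (bigD1 (Ordinal iN))//= ni lerDl sumr_ge0// => j _.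
by case: ifP => // _; exact: dav_ge0.
Qed.

Let B i : set R := [set t | scale i / a2 < t < a2 ^+ 2 * scale i].
Let lB i : R := a2 ^+ 2 * scale i - scale i / a2.
Let mB i : measurable (B i).
Proof. by rewrite /B (_ : [set _ | _] = `]scale i / a2, a2 ^+ 2 * scale i[%classic). Qed.
Let lamB i : lam R (B i) = (lB i)%:E.
Proof.
rewrite lam_itvoo// ler_pdivrMr// mulrAC ler_peMl ?(ltW (sgt i))//.
by rewrite -exprSr exprn_ege1// ltW.
Qed.
Let lB_ge0 i : 0 <= lB i.
Proof. by rewrite -lee_fin -lamB measure_ge0. Qed.
Let lB_le i : lB i <= a2 ^+ 2 * scale i.
Proof. by rewrite gerBl divr_ge0// ltW. Qed.
Let nearB t i : near_level t i -> B i t.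
Proof. by case/andP=> h1 h2; apply/andP; split => //; rewrite ltr_pdivrMr// mulrC. Qed.

Definition upper_cst q := CU `^ q * 2 ^+ n * a2 ^+ (3 * n + 3).

(** At heights near level i the section of the cone lies in a cube of radius a2^2 [scale i]. The
    weight t^-(n+1) balances the volume of this cube times the length of [B i]; 2^n and the power 3n
    + 3 of a2 are what remains. *)
Lemma cone_upper q x : 0 < q ->
  (sint (cone x) (fun z => g z `^ q * ((z.2 ^+ n.+1)^-1)%R%:E) <=
   (upper_cst q * \sum_(i < N) dav q i x)%:E)%E.
Proof.
move=> q0.
pose c i : R := CU `^ q * dav q i x * ((scale i / a2) ^+ n.+1)^-1.
have sa i : 0 < scale i / a2 by rewrite divr_gt0.
have c0 i : 0 <= c i.
  apply: mulr_ge0; first by apply: mulr_ge0; [exact: powR_ge0|exact: dav_ge0].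
  by rewrite invr_ge0 exprn_ge0// ltW.
pose u i y := c i * (\1_(cube x (a2 ^+ 2 * scale i)) y : R).
have bu i : bnd (u i) by apply: bnd_scale => //; apply: bnd_indic; exact: measurable_cube.
apply: (@le_trans _ _ (fint (fun z : P => (\sum_(i < N) (\1_(B i) z.2 : R) * u i z.1)%:E))); last first.
  rewrite (@fint_slabs R n N B lB u mB lamB bu) mulr_sumr -sumEFin; apply: lee_sum => i _.
  have q2 : 0 <= a2 ^+ 2 * scale i by rewrite mulr_ge0 ?exprn_ge0// ltW.
  rewrite /u Int_scale//; last by apply: bnd_indic; exact: measurable_cube.
  rewrite Int_indic; last exact: measurable_cube.
  rewrite leb_cube// -!EFinM lee_fin.
  apply: (@le_trans _ _ (a2 ^+ 2 * scale i * (c i * (2 * (a2 ^+ 2 * scale i)) ^+ n))).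
    by apply: ler_wpM2r => //; rewrite mulr_ge0// exprn_ge0// mulr_ge0.
  rewrite le_eqVlt; apply/orP; left; apply/eqP; rewrite /c /upper_cst.
  have := sgt i; move: (scale i) (CU `^ q) (dav q i x) => s' c1 c2 s'0.
  have -> : a2 ^+ (3 * n + 3) = (a2 ^+ n) ^+ 3 * a2 ^+ 3 by rewrite exprD mulnC exprM.
  have -> : (2 * (a2 ^+ 2 * s')) ^+ n = 2 ^+ n * (a2 ^+ n) ^+ 2 * s' ^+ n.
    by rewrite exprMn exprMn -(exprM a2 2) mulnC exprM mulrA.
  rewrite [(s' / a2) ^+ _]exprSr exprMn exprVn; field.
  by rewrite !expf_neq0 ?gt_eqF.
apply: le_fint => z.
  rewrite /restr; case: asboolP => // -[z0 _]; apply: mule_ge0; first exact: poweR_ge0.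
  by rewrite lee_fin invr_ge0 exprn_ge0// ltW.
have m0 : 0 <= \sum_(i < N) (\1_(B i) z.2 : R) * u i z.1.
  by apply: sumr_ge0 => i _; rewrite mulr_ge0 ?indicE// bnd_ge0.
rewrite /restr; case: asboolP => // -[z0 zx].
have h := @g_pow_le q z.1 z.2 x q0 z0 zx; rewrite -surjective_pairing in h.
have z20 : (0 <= (z.2 ^- n.+1)%:E)%E by rewrite lee_fin invr_ge0 exprn_ge0// ltW.
apply: le_trans (lee_wpmul2r z20 h) _; rewrite -EFinM lee_fin.
rewrite /near_sum mulr_sumr mulr_suml; apply: ler_sum => i _.
have [ni|_] := boolP (near_level z.2 i); last first.
  by rewrite mulr0 mul0r mulr_ge0 ?indicE// bnd_ge0.
rewrite indicE mem_set ?mul1r; last exact: nearB.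
rewrite /u indicE mem_set ?mulr1; last first.
  by case/andP: ni => _ h2; apply: edist_le_cube; exact: lt_trans zx h2.
rewrite /c; apply: ler_wpM2l; first by rewrite mulr_ge0 ?powR_ge0 ?dav_ge0.
rewrite lef_pV2 ?posrE; [|exact: exprn_gt0|exact: exprn_gt0].
apply: lerXn2r; rewrite ?nnegrE ?(ltW (sa i)) ?(ltW z0)//.
by case/andP: (nearB ni) => /ltW.
Qed.

Let theta_cst q p := (upper_cst q * KD) `^ (p / q) * ((size (index_enum 'I_M))%:R `^ (p / q) * (M%:R * aperture_cst KD (p / q))).

Let upper_cst_ge0 q : 0 <= upper_cst q.
Proof. by rewrite !mulr_ge0 ?powR_ge0 ?exprn_ge0// ltW. Qed.

Let theta_cst_ge0 q p : 0 < q -> 0 < p -> 0 <= theta_cst q p.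
Proof.
move=> q0 p0; have ac := aperture_cst_gt0 gG (gD (B_ 0)) vDG (divr_gt0 p0 q0).
by rewrite mulr_ge0 ?powR_ge0// mulr_ge0 ?powR_ge0// mulr_ge0// ltW.
Qed.

(** What is left after [cone_upper] is the integral of the p/q-th power of sums of coarse averages
    of s_i^q; each shift is an instance of [aperture] with t = p/q, a number that may well be below
    1. *)
Lemma upper_fin_fin p q : 0 < p -> 0 < q -> dnorm_le mu G vG N p%:E q%:E s A ->
  (tnorm p%:E q%:E g <= (theta_cst q p `^ p^-1 * A)%:E)%E.
Proof.
move=> p0 q0 hs; have th0 := divr_gt0 p0 q0; have tc0 := theta_cst_ge0 q0 p0.
apply: le_powR_root => //.
- by rewrite mulr_ge0 ?powR_ge0.
- by apply: iint_ge0 => x; exact: poweR_ge0.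
pose av k i x := avg mu (D (B_ k) i) (vD i) (fun y => s i y `^ q) x.
have bav' k i : bnd (av k i) by exact: (bnd_avg (gD _ _) (bq i q0)).
pose X k x := \sum_(i < N) av k i x.
have bX k : bnd (X k) by exact: (@bnd_sum _ _ _ N (av k) (bav' k)).
pose Y x := \sum_(k < M) X k x.
have bY : bnd Y by exact: (@bnd_sum _ _ _ M X bX).
have YE x : \sum_(i < N) dav q i x = KD * Y x.
  by rewrite /dav -mulr_sumr exchange_big.
have c0 : 0 <= upper_cst q * KD by rewrite mulr_ge0// ltW.
apply: (@le_trans _ _ (iint (fun x => ((upper_cst q * KD * Y x) `^ (p / q))%:E))).
  apply: le_iint => x; first exact: poweR_ge0.
  rewrite -poweR_EFin [in leRHS](mulrC p) poweRrM; apply: le_poweR; [exact: ltW|exact: poweR_ge0|].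
  apply: le_poweR; first by rewrite invr_ge0 ltW.
    apply: integral_ge0 => t _; apply: iint_ge0 => y; rewrite /restr; case: asboolP => // -[/= t0 _].
    by apply: mule_ge0; rewrite ?poweR_ge0// lee_fin invr_ge0 exprn_ge0// ltW.
  by apply: le_trans (cone_upper x q0) _; rewrite YE mulrA.
rewrite iintE; last 2 first.
- apply/(@measurable_EFinP _ _ _ _ (fun x => (upper_cst q * KD * Y x) `^ (p / q))).
  by apply: bnd_m; apply: bnd_pow (ltW th0) (bnd_scale c0 bY).
- by move=> x; rewrite lee_fin powR_ge0.
rewrite (@eq_integral _ _ _ _ _ (fun x => ((upper_cst q * KD) `^ (p / q) * Y x `^ (p / q))%:E)); last first.
  by move=> x _; rewrite powRM// bnd_ge0.
rewrite -[X in (X <= _)%E]/(intR mu (fun x => (upper_cst q * KD) `^ (p / q) * Y x `^ (p / q))).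
rewrite (Int_scale mu (powR_ge0 _ _) (bnd_pow (ltW th0) bY)).
have -> : (theta_cst q p `^ p^-1 * A) `^ p = theta_cst q p * A `^ p.
  by rewrite powRM ?powR_ge0// -powRrM mulVf ?gt_eqF// powRr1.
rewrite /theta_cst -mulrA EFinM; apply: lee_wpmul2l; first by rewrite lee_fin powR_ge0.
set m := (size (index_enum 'I_M))%:R.
have bXp k : bnd (fun x => X k x `^ (p / q)) by exact: bnd_pow (ltW th0) (bX k).
apply: (@le_trans _ _ (intR mu (fun x => m `^ (p / q) * \sum_(k < M) X k x `^ (p / q)))).
  apply: le_Int => x; first exact: powR_ge0.
  by apply: powR_sum_le => // k; exact: bnd_ge0.
rewrite Int_scale ?powR_ge0//; last exact: (@bnd_sum _ _ _ M (fun k x => X k x `^ (p / q)) bXp).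
rewrite -mulrA EFinM; apply: lee_wpmul2l; first by rewrite lee_fin powR_ge0.
rewrite (@Int_sum _ _ _ _ M (fun k x => X k x `^ (p / q)) bXp).
have -> : (M%:R * aperture_cst KD (p / q) * A `^ p)%:E = (\sum_(k < M) (aperture_cst KD (p / q) * A `^ p)%:E)%E.
  by rewrite sumEFin sumr_const card_ord -[in RHS]mulr_natl mulrA.
apply: lee_sum => k _.
have ap := @aperture _ T R mu _ G (D (B_ k)) vG vD KD gG (gD (B_ k)) nG (@nD (B_ k)) (@rGD (B_ k)) vDG (p / q) N (fun i y => s i y `^ q) th0.
apply: le_trans (ap _ _ _) _.
- by move=> i; exact: bq.
- by move=> i y y' yy'; rewrite (ds.2 i y y').
- by move=> i; apply: fins_Int; apply: fins_pow => //; exact: ds.1.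
rewrite EFinM; apply: lee_wpmul2l; first by rewrite lee_fin ltW// (aperture_cst_gt0 gG (gD (B_ 0)) vDG th0).
exact: hs.
Qed.

Lemma upper_infty_infty : dnorm_le mu G vG N +oo%E +oo%E s A -> (tnorm +oo%E +oo%E g <= (CU * A)%:E)%E.
Proof.
move=> hs; apply: esssup_le_sup => -[y t] /= t0; apply: (@g_le y t y A) => //; first by rewrite edistxx.
by move=> i b z iN _ _; exact: hs.
Qed.

Let br i : bnd (rmax s i) := fins_bnd (fins_rmax i ds.1).

(** The p-th power of the running maximum is a sum of adapted increments h_k. Their coarse averages
    dominate, up to [KD], its value anywhere in the coarse cell, and they have the same integrals as
    the h_k. This gives the maximal bound for every p > 0, by linearity alone. *)
Lemma upper_fin_infty p : 0 < p -> dnorm_le mu G vG N p%:E +oo%E s A ->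
  (tnorm p%:E +oo%E g <= (CU * (KD * M%:R) `^ p^-1 * A)%:E)%E.
Proof.
move=> p0 hs; apply: le_powR_root => //.
- by rewrite !mulr_ge0 ?powR_ge0// ltW.
- by apply: iint_ge0 => x; exact: poweR_ge0.
pose h k x := rmax s k.+1 x `^ p - rmax s k x `^ p.
have h0 k x : 0 <= h k x.
  by rewrite subr_ge0 ge0_ler_powR ?nnegrE ?(ltW p0) ?rmax_ge0// rmaxS le_max lexx.
have brp k : bnd (fun x => rmax s k x `^ p) by exact: bnd_pow (ltW p0) (br k).
have bh k : bnd (h k).
  split; first by apply: measurable_funB; exact: bnd_m.
  have [_ [c hc]] := brp k.+1; exists c => x; rewrite h0/= /h.
  case/andP: (hc x) => _ h1; apply: le_trans h1; rewrite lerBlDr lerDl; exact: powR_ge0.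
have ah k : adapted (G k) (h k).
  move=> x y xy; rewrite /h (adapted_rmax nG ds xy); congr (_ - _ `^ p).
  case: k xy => [|k] xy //; exact: (adapted_rmax nG ds (nG xy)).
have ph k x : psum (h ^~ x) k = rmax s k.+1 x `^ p.
  by rewrite /psum /h; elim: k => [|k IH]; rewrite big_ord_recr/= ?big_ord0 ?IH; rewrite ?powR0 ?gt_eqF//; ring.
have sh x : \sum_(k < N) h k x = rmax s N x `^ p.
  by case: (N) => [|m]; [rewrite big_ord0 /= powR0 ?gt_eqF|exact: ph].
pose av j k x := avg mu (D (B_ j) k) (vD k) (h k) x.
have bav' j k : bnd (av j k) by exact: (bnd_avg (gD _ _) (bh k)).
pose X j x := \sum_(k < N) av j k x.
have bX j : bnd (X j) by exact: (@bnd_sum _ _ _ N (av j) (bav' j)).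
pose Z x := \sum_(j < M) X j x.
have bZ : bnd Z by exact: (@bnd_sum _ _ _ M X bX).
have Z0 x : 0 <= KD * Z x := mulr_ge0 (ltW KD0) (bnd_ge0 x bZ).
have gZ x : (ereal_sup [set g z | z in cone x] <= (CU * (KD * Z x) `^ p^-1)%:E)%E.
  apply: ub_ereal_sup => _ [[y t] [/= t0 yx] <-]; apply: (@g_le y t x) => //; first exact: powR_ge0.
  move=> i b z iN _ zx; rewrite -[leLHS](powRr1 (si0 i z)) -(mulfV (lt0r_neq0 p0)) powRrM.
  apply: ge0_ler_powR; rewrite ?nnegrE ?invr_ge0 ?powR_ge0 ?(ltW p0)//.
  apply: (@le_trans _ _ (psum (h ^~ z) i)).
    rewrite ph; apply: ge0_ler_powR; rewrite ?nnegrE ?rmax_ge0 ?(ltW p0)//.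
    by rewrite rmaxS le_max lexx orbT.
  apply: le_trans (@incr_le_avg _ T R mu _ G (D b) vG vD KD gG (gD b) (@nD b) (@rGD b) vDG h N i x z bh ah iN zx) _.
  rewrite ler_pM2l//.
  apply: (le_shift_sum (X := fun b => \sum_(k < N) avg mu (D b k) (vD k) (h k) x)) => b'.
  by apply: sumr_ge0 => k _; exact: (avg_ge0 (gD _ _)).
have sup0 x : (0 <= ereal_sup [set g z | z in cone x])%E.
  apply: (@le_trans _ _ (g (x, 1))); last first.
    by apply: ereal_sup_ubound; exists (x, 1) => //; split => //=; rewrite edistxx.
  by apply: WR_ge0 => // z; rewrite lee_fin bnd_ge0.
apply: (@le_trans _ _ (iint (fun x => (CU `^ p * (KD * Z x))%:E))).
  apply: le_iint => x; first exact: poweR_ge0.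
  have -> : CU `^ p * (KD * Z x) = (CU * (KD * Z x) `^ p^-1) `^ p.
    by rewrite powRM ?powR_ge0 ?(ltW CU0)// -powRrM mulVf ?gt_eqF// powRr1.
  by rewrite -poweR_EFin; apply: le_poweR; [exact: ltW|exact: sup0|exact: gZ].
have bKZ : bnd (fun x => KD * Z x) by apply: bnd_scale => //; exact: ltW.
rewrite iintE; last 2 first.
- apply/(@measurable_EFinP _ _ _ _ (fun x => CU `^ p * (KD * Z x))).
  by apply: bnd_m; exact: bnd_scale (powR_ge0 _ _) bKZ.
- by move=> x; rewrite lee_fin mulr_ge0 ?powR_ge0.
rewrite -[X in (X <= _)%E]/(intR mu (fun x => CU `^ p * (KD * Z x))).
rewrite (Int_scale mu (powR_ge0 _ _) bKZ) Int_scale ?(ltW KD0)//.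
have kM : 0 <= KD * M%:R by rewrite mulr_ge0// ltW.
rewrite powRM ?mulr_ge0 ?powR_ge0 ?(ltW CU0)// powRM ?powR_ge0 ?(ltW CU0)// -powRrM mulVf ?gt_eqF// powRr1//.
rewrite -!mulrA EFinM; apply: lee_wpmul2l; first by rewrite lee_fin powR_ge0.
rewrite EFinM; apply: lee_wpmul2l; first by rewrite lee_fin ltW.
rewrite /Z (@Int_sum _ _ _ _ M X bX).
have -> : (M%:R * A `^ p)%:E = (\sum_(k < M) (A `^ p)%:E)%E.
  by rewrite sumEFin sumr_const card_ord -[in RHS]mulr_natl.
apply: lee_sum => j _.
rewrite /X (@Int_sum _ _ _ _ N (av j) (bav' j)).
apply: le_trans hs.
have -> : (fun x => rmax s N x `^ p) = fun x => \sum_(k < N) h k x by apply/funext => x; rewrite sh.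
rewrite (@Int_sum _ _ _ _ N h bh); apply: lee_sum => k _.
by rewrite (Int_avg (gD _ _) (bh k)).
Qed.

Let Int_cube_avg b i (c : T) R0 u : bnd u ->
  (intR mu (fun y => (\1_(cube c R0) y : R) * avg mu (D b i) (vD i) u y)%R <=
   intR mu (fun y => (\1_(cube c (R0 + KK * eps * scale i)) y : R) * u y)%R)%E.
Proof.
move=> bu; set C' := cube c (R0 + _).
have bu' : bnd (fun y => (\1_C' y : R) * u y) by apply: bnd_mul => //; apply: bnd_indic; exact: measurable_cube.
rewrite -[leRHS](Int_avg (gD b i) bu'); apply: le_Int => y.
  by rewrite mulr_ge0 ?indicE// bnd_ge0//; exact: (bnd_avg (gD b i)).
rewrite indicE; case: (boolP (y \in _)) => [/set_mem yc|_]; last first.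
  by rewrite mul0r; apply: (avg_ge0 (gD b i)) => z; rewrite mulr_ge0 ?indicE// bnd_ge0.
rewrite mul1r -[leRHS]mul1r; apply: (avg_le (gD b i)) => // z zy.
rewrite mul1r indicE mem_set ?mul1r//.
exact: cube_trans yc (D_dist n0 a10 a12 a21 s00 (esym zy)).
Qed.

Let scale_le i j : (i <= j)%N -> scale j <= scale i.
Proof.
move=> ij; rewrite -(subnK ij); elim: (j - i)%N => [//|m IH].
by rewrite addSn; exact: le_trans (scaleS_le a10 a12 a21 s00 _) IH.
Qed.

Let hat_height (c : T) rad (z : P) : 0 < rad -> tent_hat c rad z -> cube c rad z.1 /\ z.2 < 3 * n%:R * rad.
Proof.
move=> rad0 [z0 hz]; split.
  by apply: edist_le_cube; apply: hz; rewrite /ball_n/= edistxx.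
rewrite ltNge; apply/negP => hle.
(* Displacing z by 2 rad in every coordinate leaves the ball of radius rad, although the
   displacement is shorter than 3 n rad; a greater height would put this point into the ball. *)
pose w : T := [tuple tnth z.1 j + 2 * rad | j < n].
have hw : edist w c < rad.
  apply: hz; rewrite /ball_n /=; apply: lt_le_trans hle.
  rewrite (_ : 3 * n%:R * rad = n%:R * (3 * rad)); last by ring.
  apply: edist_lt => // j; rewrite tnth_mktuple addrAC subrr add0r ger0_norm; last by rewrite mulr_ge0// ltW.
  by rewrite ltr_pM2r// ltr_nat.
have hy : edist z.1 c < rad by apply: hz; rewrite /ball_n/= edistxx.
have h1 := edist_le_cube hw (Ordinal n0); have h2 := edist_le_cube hy (Ordinal n0).
rewrite tnth_mktuple in h1; move: h1 h2; rewrite !ltr_norml => /andP[_ h1] /andP[h2 _].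
by move: h1 h2; set d1 := tnth _ _; set d2 := tnth _ _; lra.
Qed.

(** The dilation that makes room for a coarse cell ([KK * eps]) and a fine cell ([a1]) at any level
    whose scale is below [tau rad]. *)
Definition kappa := 1 + (KK * eps + a1) * (a2 * (3 * n%:R)).
Let kappa_ge0 : 0 <= kappa.
Proof.
have h1 := mulr_ge0 (ltW KK0) (ltW e0); have h2 : 0 <= n%:R :> R by [].
apply: addr_ge0 => //; apply: mulr_ge0; first by apply: addr_ge0 => //; exact: ltW.
by rewrite mulr_ge0 ?(ltW a20)// mulr_ge0.
Qed.

Let tau rad := a2 * (3 * n%:R * rad).

(** The union [V] of the cells of level i0 meeting the cube is adapted to that level. The tail can
    therefore be replaced by its averages, each at most A^q, and [V] lies in the dilated cube. *)
Let tail_cover q (c : T) rad i0 : 0 < q -> 0 < rad -> (i0 < N)%N -> scale i0 < tau rad ->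
  dnorm_le mu G vG N +oo%E q%:E s A ->
  (intR mu (fun y => (\1_(cube c (rad + KK * eps * tau rad)) y : R) * tailsum N q s i0 y)%R <=
   (A `^ q * (2 * (kappa * rad)) ^+ n)%:E)%E.
Proof.
move=> q0 rad0 iN sr hs; set C := cube c _.
have bt : bnd (tailsum N q s i0).
  apply: (@bnd_sum _ _ _ N (fun k x => if (i0 <= k)%N then s k x `^ q else 0)) => k.
  by case: leqP => // _; [exact: bq|exact: bnd_cst].
pose V : set T := [set y | exists2 z, C z & G i0 z = G i0 y].
have aV : adapted (G i0) (\1_V : T -> R).
  move=> y y' yy'; rewrite !indicE; congr (nat_of_bool _)%:R.
  by apply/idP/idP => /set_mem [z Cz zy]; apply/mem_set; exists z; rewrite // zy ?yy'.
have mV1 : measurable_fun setT (\1_V : T -> R).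
  by have [_ h _] := gG i0; exact: adapted_measurable h aV.
have bV : bnd (\1_V : T -> R).
  by split => //; exists 1 => y; rewrite indicE; case: (_ \in _); rewrite ?lexx ?ler01.
have mV : measurable V.
  have := mset_le (measurable_cst (1 : R)) mV1; congr (measurable _); apply/seteqP; split => y /=.
    by rewrite indicE; case: (boolP (y \in V)) => [/set_mem//|_]; rewrite ler10.
  by move=> Vy; rewrite indicE mem_set.
have CV' : C `<=` V by move=> y Cy; exists y.
apply: (@le_trans _ _ (intR mu (fun y => tailsum N q s i0 y * (\1_V y : R)))).
  apply: le_Int => y; first by rewrite mulr_ge0 ?indicE// bnd_ge0.
  by rewrite mulrC; apply: ler_wpM2l; [exact: bnd_ge0|apply: le_indic; exact: CV'].
rewrite -(Int_avgM (gG i0) bt bV aV).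
apply: (@le_trans _ _ (intR mu (fun y => A `^ q * (\1_V y : R)))).
  apply: le_Int => y; first by rewrite mulr_ge0 ?indicE// (avg_ge0 (gG i0))// => z; exact: bnd_ge0.
  by apply: ler_wpM2r; [rewrite indicE|exact: hs].
rewrite (Int_scale mu (powR_ge0 _ _) bV) Int_indic// EFinM.
apply: lee_wpmul2l; first by rewrite lee_fin powR_ge0.
have kr : 0 <= kappa * rad by rewrite mulr_ge0// ltW.
rewrite -(leb_cube c kr); apply: le_measure; rewrite ?inE//; first exact: measurable_cube.
move=> y [z Cz zy] j.
have h := cube_trans Cz (edist_le_cube (G_dist n0 a10 a12 a21 s00 zy)) j.
apply: lt_le_trans h _.
have : a1 * scale i0 <= a1 * tau rad by rewrite ler_pM2l// ltW.
by rewrite /kappa /tau; set X := KK * eps; move: (n%:R : R) => m; set Y := a1 * scale i0; lra.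
Qed.

Definition upper_cst' q := CU `^ q * a2 ^+ 3 * (KD * M%:R) * (kappa * n%:R) ^+ n.

Let upper_cst'_ge0 q : 0 <= upper_cst' q.
Proof.
have h : 0 <= kappa * n%:R by rewrite mulr_ge0.
rewrite mulr_ge0 ?exprn_ge0// mulr_ge0//; first by rewrite mulr_ge0 ?powR_ge0// exprn_ge0// ltW.
by rewrite mulr_ge0// ltW.
Qed.

Lemma hat_upper q (c : T) rad : 0 < q -> 0 < rad -> dnorm_le mu G vG N +oo%E q%:E s A ->
  (sint (tent_hat c rad) (fun z => g z `^ q * (z.2^-1)%R%:E) <=
   (CU `^ q * a2 ^+ 3 * (KD * M%:R) * (A `^ q * (2 * (kappa * rad)) ^+ n))%:E)%E.
Proof.
move=> q0 rad0 hs.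
(* The coarsest level whose scale is below [tau rad]. If no such level occurs among the first [N],
   no level is near a height in the tent and the Whitney averages vanish there. *)
have [[i0 i0N /= [i0s i0min]]|noi] := pselect (exists2 i0, (i0 < N)%N & scale i0 < tau rad /\
    forall i, scale i < tau rad -> (i0 <= i)%N); last first.
  apply: (@le_trans _ _ 0%E); last first.
    rewrite lee_fin mulr_ge0//; last by rewrite mulr_ge0 ?powR_ge0// exprn_ge0// mulr_ge0// mulr_ge0// ltW.
    by rewrite mulr_ge0//; [rewrite mulr_ge0 ?powR_ge0// exprn_ge0// ltW|rewrite mulr_ge0// ltW].
  have h0 : (fint (fun _ : P => 0%E) = 0 :> \bar R)%E.
    by rewrite fintE// integral0.
  rewrite -h0; apply: le_fint => z.
    rewrite /restr; case: asboolP => // -[z0 _]; apply: mule_ge0; first exact: poweR_ge0.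
    by rewrite lee_fin invr_ge0 ltW.
  rewrite /restr; case: asboolP => // hz; have [h1 h2] := hat_height rad0 hz; have z0 : 0 < z.2 := hz.1.
  have := @g_pow_le q z.1 z.2 z.1 q0 z0; rewrite edistxx -surjective_pairing => /(_ z0).
  rewrite /near_sum big1 => [|i _]; last first.
    case: ifP => // /andP[ni _]; exfalso; apply: noi.
    have hi : scale i < tau rad by apply: lt_trans ni _; rewrite ltr_pM2l.
    have ex : exists i, scale i < tau rad by exists (i : nat).
    have [m hm mmin] := ex_minnP ex; exists m => //.
    by apply: leq_ltn_trans (mmin _ hi) (ltn_ord i).
  rewrite mulr0 => h; have -> : (g z `^ q = 0)%E by apply/eqP; rewrite eq_le h poweR_ge0.
  by rewrite mul0e.
pose cc i : R := (if (i0 <= i)%N then 1 else 0) * (CU `^ q * (a2 / scale i)).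
have cc0 i : 0 <= cc i.
  rewrite mulr_ge0//; first by case: leqP.
  by rewrite mulr_ge0 ?powR_ge0// divr_ge0// ltW.
pose u i y := cc i * ((\1_(cube c rad) y : R) * dav q i y).
have bc R0 : bnd (\1_(cube c R0) : T -> R) by apply: bnd_indic; exact: measurable_cube.
have bu i : bnd (u i) by apply: bnd_scale => //; apply: bnd_mul => //; exact: bnd_dav.
apply: (@le_trans _ _ (fint (fun z : P => (\sum_(i < N) (\1_(B i) z.2 : R) * u i z.1)%:E))).
  apply: le_fint => z.
    rewrite /restr; case: asboolP => // -[z0 _]; apply: mule_ge0; first exact: poweR_ge0.
    by rewrite lee_fin invr_ge0 ltW.
  have m0 : 0 <= \sum_(i < N) (\1_(B i) z.2 : R) * u i z.1.
    by apply: sumr_ge0 => i _; rewrite mulr_ge0 ?indicE// bnd_ge0.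
  rewrite /restr; case: asboolP => // hz; have [h1 h2] := hat_height rad0 hz; have z0 : 0 < z.2 := hz.1.
  have := @g_pow_le q z.1 z.2 z.1 q0 z0; rewrite edistxx -surjective_pairing => /(_ z0) h.
  have z20 : (0 <= (z.2^-1)%:E)%E by rewrite lee_fin invr_ge0 ltW.
  apply: le_trans (lee_wpmul2r z20 h) _; rewrite -EFinM lee_fin.
  rewrite /near_sum mulr_sumr mulr_suml; apply: ler_sum => i _.
  have [ni|_] := boolP (near_level z.2 i); last first.
    by rewrite mulr0 mul0r mulr_ge0 ?indicE// bnd_ge0.
  rewrite indicE mem_set ?mul1r; last exact: nearB.
  rewrite /u indicE mem_set ?mul1r//.
  rewrite /cc; have -> : (i0 <= i)%N.
    by apply: i0min; case/andP: ni => ni _; apply: lt_trans ni _; rewrite ltr_pM2l.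
  rewrite mul1r mulrAC; apply: ler_wpM2r; first exact: dav_ge0.
  apply: ler_wpM2l; first exact: powR_ge0.
  rewrite -[a2 / _]invf_div lef_pV2 ?posrE; [|exact: z0|exact: divr_gt0].
  by case/andP: (nearB ni) => /ltW.
rewrite (@fint_slabs R n N B lB u mB lamB bu).
pose C1 := cube c (rad + KK * eps * tau rad).
pose w i y : R := (\1_C1 y : R) * (if (i0 <= i)%N then s i y `^ q else 0).
have bw i : bnd (w i).
  by apply: bnd_mul; [exact: bc|case: leqP => // _; [exact: bq|exact: bnd_cst]].
apply: (@le_trans _ _ (\sum_(i < N) ((CU `^ q * a2 ^+ 3 * (KD * M%:R))%:E * intR mu (w i)))%E); last first.
  have k0 : 0 <= CU `^ q * a2 ^+ 3 * (KD * M%:R).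
    by rewrite mulr_ge0//; [rewrite mulr_ge0 ?powR_ge0// exprn_ge0// ltW|rewrite mulr_ge0// ltW].
  rewrite -ge0_sume_distrr; last by move=> k _; apply: Int_ge0 => y; exact: bnd_ge0.
  rewrite [leRHS]EFinM; apply: lee_wpmul2l; first by rewrite lee_fin.
  rewrite -(@Int_sum _ _ _ _ N w bw); apply: le_trans (@tail_cover q c rad i0 q0 rad0 i0N i0s hs).
  by apply: le_Int => y; [apply: sumr_ge0 => i _; exact: bnd_ge0|rewrite /w -mulr_sumr].
apply: lee_sum => i _.
have [ii|ii] := leqP i0 i; last first.
  have -> : u i = fun=> 0 by apply/funext => y; rewrite /u /cc leqNgt ii !mul0r.
  rewrite /intR integral0 mule0; apply: mule_ge0; last by apply: Int_ge0 => y; exact: bnd_ge0.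
  by rewrite lee_fin mulr_ge0//; [rewrite mulr_ge0 ?powR_ge0// exprn_ge0// ltW|rewrite mulr_ge0// ltW].
have bav' k : bnd (avg mu (D (B_ k) i) (vD i) (fun y => s i y `^ q)) by exact: (bnd_avg (gD _ _) (bq i q0)).
pose h k y : R := (\1_(cube c rad) y : R) * avg mu (D (B_ k) i) (vD i) (fun y => s i y `^ q) y.
have bh k : bnd (h k) by exact: bnd_mul.
have wE : w i = fun y => (\1_C1 y : R) * s i y `^ q by apply/funext => y; rewrite /w ii.
have hk k : (intR mu (h k) <= intR mu (w i))%E.
  apply: le_trans (@Int_cube_avg (B_ k) i c rad _ (bq i q0)) _; rewrite wE; apply: le_Int => y.
    by rewrite mulr_ge0 ?indicE// powR_ge0.
  apply: ler_wpM2r; first exact: powR_ge0.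
  apply: le_indic => yc j; apply: lt_le_trans (yc j) _; rewrite lerD2l.
  by apply: ler_wpM2l; [exact: mulr_ge0 (ltW KK0) (ltW e0)|apply: le_trans (scale_le ii) _; exact: ltW].
have -> : u i = fun y => (cc i * KD) * \sum_(k < M) h k y.
  apply/funext => y; rewrite /u /dav /h -[in RHS]mulr_sumr.
  by move: (\sum_(k < M) _) (\1_(cube c rad) y : R) (cc i) => X1 X2 X3; ring.
rewrite Int_scale; last exact: (@bnd_sum _ _ _ M h bh); last by rewrite mulr_ge0// ltW.
rewrite (@Int_sum _ _ _ _ M h bh) muleA -EFinM.
have lc : lB i * (cc i * KD) <= CU `^ q * a2 ^+ 3 * KD.
  apply: (@le_trans _ _ (a2 ^+ 2 * scale i * (cc i * KD))).
    by apply: ler_wpM2r => //; rewrite mulr_ge0// ltW.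
  rewrite /cc ii mul1r le_eqVlt; apply/orP; left; apply/eqP.
  by have := sgt i; move: (scale i) (CU `^ q) => s' c1 s'0; field; rewrite gt_eqF.
have i0' : (0 <= intR mu (w i))%E by apply: Int_ge0 => y; exact: bnd_ge0.
have sum_le : (\sum_(k < M) intR mu (h k) <= M%:R%:E * intR mu (w i))%E.
  apply: (@le_trans _ _ (\sum_(k < M) intR mu (w i))%E); first by apply: lee_sum => k _; exact: hk.
  have -> : M%:R%:E = (\sum_(k < M) 1%:E)%E :> \bar R by rewrite sumEFin sumr_const card_ord.
  by rewrite ge0_sume_distrl//; apply: lee_sum => k _; rewrite mul1e.
rewrite mulrA [X in (_ <= X * _)%E]EFinM -muleA; apply: lee_pmul => //.
  by rewrite lee_fin mulr_ge0// mulr_ge0// ltW.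
by apply: sume_ge0 => k _; apply: Int_ge0 => y; exact: bnd_ge0.
Qed.

Lemma upper_infty_fin q : 0 < q -> dnorm_le mu G vG N +oo%E q%:E s A ->
  (tnorm +oo%E q%:E g <= (upper_cst' q `^ q^-1 * A)%:E)%E.
Proof.
move=> q0 hs; apply: ub_ereal_sup => _ [x [c [rad [rad0 [_ ->]]]]].
have vol_le := mu_ball_le c (ltW rad0); have vol_ge := mu_ball_ge c n0 (ltW rad0).
have vfin : mu (ball_n c rad) \is a fin_num by rewrite ge0_fin_numE// (le_lt_trans vol_le)// ltry.
have vE := fineK vfin; set v := fine _ in vE; rewrite -vE lee_fin in vol_ge.
have nR : 0 < n%:R :> R by rewrite ltr0n.
have v0 : 0 < v.
  by apply: lt_le_trans vol_ge; apply: exprn_gt0; apply: divr_gt0 => //; exact: mulr_gt0.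
rewrite volnE; last exact: measurable_ball_n.
rewrite -vE poweR_EFin powRN muleC lee_pdivrMr ?powR_gt0// -EFinM.
apply: le_powR_root => //.
- by rewrite !mulr_ge0 ?powR_ge0.
- apply: integral_ge0 => t _; apply: iint_ge0 => y; rewrite /restr; case: asboolP => // -[/= t0 _].
  by apply: mule_ge0; rewrite ?poweR_ge0// lee_fin invr_ge0 ltW.
apply: le_trans (hat_upper c q0 rad0 hs) _; rewrite lee_fin.
have -> : (upper_cst' q `^ q^-1 * A * v `^ q^-1) `^ q = upper_cst' q * A `^ q * v.
  rewrite powRM ?mulr_ge0 ?powR_ge0// powRM ?powR_ge0// -!powRrM mulVf ?gt_eqF//.
  by rewrite !powRr1// ltW.
have -> : (2 * (kappa * rad)) ^+ n = (kappa * n%:R) ^+ n * (2 * rad / n%:R) ^+ n.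
  by rewrite -exprMn; congr (_ ^+ _); field; rewrite gt_eqF.
rewrite /upper_cst'; set c1 := _ * (KD * _); set c2 := (kappa * _) ^+ n.
have c10 : 0 <= c1 * (A `^ q * c2).
  rewrite mulr_ge0//; first by rewrite mulr_ge0//; [rewrite mulr_ge0 ?powR_ge0// exprn_ge0// ltW|rewrite mulr_ge0// ltW].
  by rewrite mulr_ge0 ?powR_ge0// exprn_ge0// mulr_ge0// ltW.
rewrite mulrA mulrA -[c1 * _ * _]mulrA (_ : c1 * c2 * A `^ q = c1 * (A `^ q * c2)); last by ring.
exact: ler_wpM2l.
Qed.

End upper_bounds.

(** * Compactly supported functions *)

Lemma mct_le d (T : measurableType d) (R : realType) (m : {measure set T -> \bar R})
    (f : nat -> T -> \bar R) (g : T -> \bar R) (C : \bar R) :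
  (forall k, measurable_fun setT (f k)) -> (forall k x, (0 <= f k x)%E) ->
  (forall k x, (f k x <= f k.+1 x)%E) -> (forall x, (0 <= g x)%E) ->
  (forall x, (g x <= ereal_sup (range (f ^~ x)))%E) ->
  (forall k, (\int[m]_x f k x <= C)%E) -> (\int[m]_x g x <= C)%E.
Proof.
move=> mf f0 fS g0 gf hC.
have nd x : {homo f ^~ x : k l / (k <= l)%N >-> (k <= l)%E}.
  by apply/nondecreasing_seqP => k; exact: fS.
apply: (@le_trans _ _ (\int[m]_x limn (f ^~ x))%E).
  apply: le_int0 => // x; apply: le_trans (gf x) _.
  by have /cvg_lim -> := ereal_nondecreasing_cvgn (nd x).
rewrite monotone_convergence//.
apply: lime_le; last by apply: nearW.
apply: ereal_nondecreasing_is_cvgn => k l kl; apply: ge0_le_integral => //.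
by move=> x _; exact: nd.
Qed.

Lemma bernoulli_le (R : realType) (e : R) k : 0 <= e -> 1 + k%:R * e <= (1 + e) ^+ k.
Proof.
move=> e0; elim: k => [|k IH]; first by rewrite mul0r addr0 expr0.
rewrite exprS; apply: (@le_trans _ _ ((1 + e) * (1 + k%:R * e))); last by rewrite ler_wpM2l// addr_ge0.
by rewrite -natr1; have : 0 <= k%:R * e * e; [rewrite !mulr_ge0|lra].
Qed.

Section dual_tests.
Variables (R : realType) (n : nat) (a1 a2 : R).
Hypotheses (n0 : (0 < n)%N) (a10 : 0 < a1) (a12 : a1 < a2^-1) (a21 : a2^-1 < 1).
Local Notation T := (n.-tuple R).
Local Notation P := (pt R n).
Local Notation nu := (leb1 R n).
Local Notation mu := (leb R n).
Let a2gt1 : 1 < a2 := a2_gt1 a10 a12 a21.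
Let a20 : 0 < a2 := lt_trans ltr01 a2gt1.

Definition origin : T := [tuple of nseq n 0].

Definition exhaust (k : nat) : set P :=
  [set z | cube origin k.+1%:R z.1 /\ k.+1%:R^-1 < z.2 < k.+1%:R].

Lemma exhaust_gt0 k z : exhaust k z -> 0 < z.2.
Proof. by move=> [_ /andP[h _]]; apply: lt_trans h; rewrite invr_gt0. Qed.

Lemma exhaust_levels k : exists s0 N, 0 < s0 /\ forall z, exhaust k z -> exists2 i, (i < N)%N & slab a2 s0 i z.2.
Proof.
pose K : R := k.+1%:R; have K0 : 0 < K by [].
have d0 : 0 < a2 - 1 by rewrite subr_gt0.
(* Bernoulli's inequality makes a2^N exceed K^2, so that the levels starting from height K descend
   at least to 1/K. *)
pose N := Num.bound (K ^+ 2 / (a2 - 1)).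
have hN : K ^+ 2 <= a2 ^+ N.
  have h : K ^+ 2 / (a2 - 1) <= N%:R by apply: ltW; apply: archi_boundP; rewrite divr_ge0 ?exprn_ge0// ltW.
  rewrite ler_pdivrMr// in h; apply: le_trans h _.
  by have := bernoulli_le N (ltW d0); rewrite addrCA subrr addr0; lra.
exists K, N.+1; split => // z [_ /andP[h1 h2]].
have lo : scale a2 K N <= z.2.
  rewrite /scale ler_pdivrMr ?exprn_gt0//; apply: le_trans (ler_wpM2r (exprn_ge0 _ (ltW a20)) (ltW h1)).
  by rewrite -/K ler_pdivlMl// -expr2.
have hi : z.2 < a2 * K by apply: lt_trans h2 _; rewrite ltr_pMl.
elim: N lo {hN} => [|N IH] lo.
  exists 0%N => //; apply/andP; split => //.
  by rewrite /scale expr0 divr1.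
have [h|h] := leP (scale a2 K N) z.2; first by have [i iN zi] := IH h; exists i => //; rewrite ltnS ltnW.
by exists N.+1 => //; apply/andP; split => //; rewrite (scaleS a10 a12 a21).
Qed.

(** One constant serves all top heights and numbers of levels, which are chosen only afterwards,
    from the support of the function. *)
Lemma tnorm_lower (PP Q : \bar R) : (1 <= PP)%E -> (1 <= Q)%E -> exists2 C, 0 < C &
  forall s0, 0 < s0 -> forall (r : \bar R) (F : P -> R) N B, (1 <= r)%E -> bnd F -> 0 <= B ->
  (tnorm PP Q (WR a1 a2 r (EFin \o F)) <= B%:E)%E ->
  dnorm_le mu (G a1 a2 s0) (vG n a1 a2 s0) N PP Q (bav a1 a2 s0 r F) (C * B).
Proof.
case: PP => [p| |]; case: Q => [q| |] //; rewrite ?lee_fin => p1 q1;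
  try have p0 := lt_le_trans ltr01 p1; try have q0 := lt_le_trans ltr01 q1.
- exists (lower_cst n a1 a2 q `^ (- q^-1)).
    by apply: powR_gt0; exact: lower_cst_gt0 n0 a10 a12 a21 q.
  move=> s0 s00 r F N B r1 bF B0; exact: lower_fin_fin.
- exists (CV n a2); first exact: lt_le_trans ltr01 (CV_ge1 n0 a10 a12 a21).
  move=> s0 s00 r F N B r1 bF B0; exact: lower_fin_infty.
- exists (lower_cst' n a1 a2 q `^ q^-1).
    by apply: powR_gt0; exact: lower_cst'_gt0 n0 a10 a12 a21 q.
  move=> s0 s00 r F N B r1 bF B0; exact: lower_infty_fin.
- exists (CV n a2); first exact: lt_le_trans ltr01 (CV_ge1 n0 a10 a12 a21).
  move=> s0 s00 r F N B r1 bF B0; exact: lower_infty_infty.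
Qed.

(** The bound is in terms of a majorant [s] of the box averages, because the test functions
    constructed below are controlled only through such a majorant. *)
Lemma tnorm_upper (PP Q : \bar R) : (1 <= PP)%E -> (1 <= Q)%E -> exists2 C, 0 < C &
  forall s0, 0 < s0 -> forall (r : \bar R) (F : P -> R) N s B, (1 <= r)%E -> bnd F -> 0 <= B ->
  (forall z, F z != 0 -> exists2 i, (i < N)%N & slab a2 s0 i z.2) ->
  dseq mu (G a1 a2 s0) s -> (forall i x, (i < N)%N -> bav a1 a2 s0 r F i x <= s i x) ->
  dnorm_le mu (G a1 a2 s0) (vG n a1 a2 s0) N PP Q s B ->
  (tnorm PP Q (WR a1 a2 r (EFin \o F)) <= (C * B)%:E)%E.
Proof.
move=> p1 q1.
suff [C hC] : exists C, forall s0, 0 < s0 -> forall (r : \bar R) (F : P -> R) N s B, (1 <= r)%E -> bnd F -> 0 <= B ->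
  (forall z, F z != 0 -> exists2 i, (i < N)%N & slab a2 s0 i z.2) ->
  dseq mu (G a1 a2 s0) s -> (forall i x, (i < N)%N -> bav a1 a2 s0 r F i x <= s i x) ->
  dnorm_le mu (G a1 a2 s0) (vG n a1 a2 s0) N PP Q s B ->
  (tnorm PP Q (WR a1 a2 r (EFin \o F)) <= (C * B)%:E)%E.
  exists (Num.max C 1); first by rewrite lt_max ltr01 orbT.
  move=> s0 s00 r F N s B r1 bF B0 FN ds bs hs.
  apply: le_trans (hC s0 s00 r F N s B r1 bF B0 FN ds bs hs) _.
  by rewrite lee_fin ler_wpM2r// le_max lexx.
move: p1 q1; case: PP => [p| |]; case: Q => [q| |] //; rewrite ?lee_fin => p1 q1;
  try have p0 := lt_le_trans ltr01 p1; try have q0 := lt_le_trans ltr01 q1.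
- eexists => s0 s00 r F N s B r1 bF B0 FN ds bs hs.
  exact: (upper_fin_fin n0 a10 a12 a21 s00 r1 bF FN ds bs B0 p0 q0 hs).
- eexists => s0 s00 r F N s B r1 bF B0 FN ds bs hs.
  exact: (upper_fin_infty n0 a10 a12 a21 s00 r1 bF FN ds bs B0 p0 hs).
- eexists => s0 s00 r F N s B r1 bF B0 FN ds bs hs.
  exact: (upper_infty_fin n0 a10 a12 a21 s00 r1 bF FN ds bs B0 q0 hs).
- eexists => s0 s00 r F N s B r1 bF B0 FN ds bs hs.
  exact: (upper_infty_infty n0 a10 a12 a21 s00 r1 bF FN bs B0 hs).
Qed.

Lemma conj_exp_ge1 (p : R) : 1 <= p -> (1 <= conj_exp p)%E.
Proof.
rewrite le_eqVlt => /predU1P[<-|p1]; first by rewrite conj_exp1 leey.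
by rewrite conj_expE// lee_fin ltW// conj_fin_gt1.
Qed.

(** * Pairings and test functions on a fixed grid *)

Section fixed_scale.
Variables (s0 : R) (N : nat).
Hypothesis s00 : 0 < s0.
Local Notation scale := (scale a2 s0).
Local Notation slab := (slab a2 s0).
Local Notation slen := (len a2 s0).
Local Notation box := (@box R n a1 a2 s0).
Local Notation G := (@G R n a1 a2 s0).
Local Notation vG := (vG n a1 a2 s0).
Local Notation boxav := (@bav R n a1 a2 s0).
Local Notation BA := (@BA R n a1 a2 s0).
Let sgt i : 0 < scale i := scale_gt0 a10 a12 a21 s00 i.
Let gG i := gridG n a1 a2 s0 i.
Let vg i : 0 < vG i := vG_gt0 n a1 a2 s0 i.
Let lg i : 0 < slen i := len_gt0 a10 a12 a21 s00 i.
Let bBA i g : bnd g -> bnd (BA i g) := @bnd_BA R n a1 a2 a10 a12 a21 s0 s00 i g.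

(** For r = 1 the essential supremum is exceeded only on the null set [Z], absorbed by a term c 1_Z
    of zero integral. For r > 1 [Int_hoelder] is applied on the box with strict majorants of both
    averages. *)
Lemma box_hoelder (r : R) (F H : P -> R) i x : 1 <= r -> bnd F -> bnd H ->
  BA i (fun z => F z * H z) x <= boxav r%:E F i x * boxav (conj_exp r) H i x.
Proof.
move=> r1 bF bH.
have mbx := @measurable_box R n a1 a2 s0 i x.
have bI : bnd (\1_(box i x) : P -> R) by exact: bnd_indic.
have bFH : bnd (fun z => F z * H z) by exact: bnd_mul.
have lv : 0 < slen i * vG i by rewrite mulr_gt0.
have B0 g y : bnd g -> 0 <= BA i g y by move=> bg; exact: bnd_ge0 (bBA i bg).
move: r1; rewrite le_eqVlt => /predU1P[rE|r1].
  rewrite -rE conj_exp1; set e := boxav +oo%E H i x.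
  have e0 : 0 <= e by apply: (bav_ge0 a10 a12 a21 s00 _ i x bH); rewrite leey.
  have eE : esssup (box i x) (EFin \o H) = e%:E by rewrite (bavP_infty a10 a12 a21 s00 i x bH).
  clearbody e.
  have bF1 : BA i (fun z => F z `^ 1) x = BA i F x.
    by congr (BA i _ x); apply/funext => z; rewrite powRr1// bnd_ge0.
  rewrite /bav bF1 invr1 powRr1 ?B0//.
  have bFe : bnd (fun z => e * F z) by exact: bnd_scale.
  rewrite -(ler_pM2l lv) -lee_fin -(int_box a10 a12 a21 s00 i x bFH).
  have -> : (slen i * vG i * (BA i F x * e))%:E = intR nu (fun z => e * ((\1_(box i x) z : R) * F z)).
    rewrite (Int_scale nu e0 (bnd_mul bI bF)).
    by rewrite (int_box a10 a12 a21 s00 i x bF) -EFinM mulrA mulrC.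
  pose Z : set P := [set z | box i x z /\ e < H z].
  have mZ : measurable Z.
    by apply: measurableI; [exact: mbx|exact: (mset_lt (measurable_cst e) (bnd_m bH))].
  have nZ : nu Z = 0%E.
    by apply/(null_measurable mZ); apply: esssup_null; rewrite eE.
  have [_ [c hc]] := bFH.
  have c0 : 0 <= c by have /andP[h1 h2] := hc (x, 0); exact: le_trans h2.
  apply: (@le_trans _ _ (intR nu (fun z => e * ((\1_(box i x) z : R) * F z) + c * (\1_Z z : R)))).
    apply: le_Int => z; first exact: (bnd_ge0 _ (bnd_mul bI bFH)).
    rewrite indicE; case: (boolP (z \in box i x)) => [/set_mem bz|_]; last first.
      by rewrite !mul0r mulr0 add0r mulr_ge0// indicE.
    rewrite !mul1r; have [h|h] := leP (H z) e.
      rewrite -[leLHS]addr0; apply: lerD; last by rewrite mulr_ge0// indicE.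
      by rewrite mulrC ler_wpM2r// bnd_ge0.
    have -> : \1_Z z = 1 :> R by rewrite indicE mem_set.
    rewrite mulr1; apply: (@le_trans _ _ c); first by case/andP: (hc z).
    by rewrite lerDr; apply: mulr_ge0 e0 (bnd_ge0 z bF).
  rewrite (Int_add nu (bnd_scale e0 (bnd_mul bI bF)) (bnd_scale c0 (bnd_indic R mZ))).
  by rewrite (Int_scale nu c0 (bnd_indic R mZ)) (Int_indic nu mZ) nZ mule0 adde0.
have r0 : 0 < r by rewrite (lt_trans ltr01).
rewrite conj_expE//; set r' := conj_fin r.
have r'0 : 0 < r' by rewrite (lt_trans ltr01)// conj_fin_gt1.
suff main c e : boxav r%:E F i x < c -> boxav r'%:E H i x < e -> BA i (fun z => F z * H z) x <= c * e.
  apply: le_mul_eps; [exact: powR_ge0|exact: powR_ge0|move=> del del0].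
  by apply: main; rewrite ltrDl.
move=> cX eY.
have c0 : 0 < c by rewrite (le_lt_trans _ cX)// powR_ge0.
have e0 : 0 < e by rewrite (le_lt_trans _ eY)// powR_ge0.
pose X z := (\1_(box i x) z : R) * F z; pose Y z := (\1_(box i x) z : R) * H z.
pose l := slen i * vG i.
have key (t : R) (K : P -> R) u : 0 < t -> bnd K -> 0 < u -> boxav t%:E K i x < u ->
   (intR nu (fun z => ((\1_(box i x) z : R) * K z) `^ t)%R <= ((u * l `^ t^-1) `^ t)%:E)%E.
  move=> t0 bK u0 hu; have bKt : bnd (fun z => K z `^ t) by exact: bnd_pow (ltW t0) bK.
  have -> : (fun z => ((\1_(box i x) z : R) * K z) `^ t) = fun z => (\1_(box i x) z : R) * K z `^ t.
    apply/funext => z; rewrite indicE; case: (_ \in _); rewrite ?mul1r// !mul0r.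
    by rewrite powR0// gt_eqF.
  rewrite (int_box a10 a12 a21 s00 i x bKt) lee_fin.
  rewrite powRM ?(ltW u0) ?powR_ge0// -powRrM mulVf ?gt_eqF// powRr1 ?(ltW lv)//.
  rewrite mulrC; apply: ler_wpM2r; first exact: ltW.
  have Kt0 := B0 _ x bKt.
  rewrite -[leLHS](powRr1 Kt0) -(mulVf (lt0r_neq0 t0)) powRrM.
  by apply: ge0_ler_powR; rewrite ?nnegrE ?powR_ge0 ?(ltW t0) ?(ltW u0) ?(ltW hu).
have hX := key r F c r0 bF c0 cX.
have hY := key r' H e r'0 bH e0 eY.
have l0 : 0 < l by [].
have h := @Int_hoelder _ _ _ nu r r' (c * l `^ r^-1) (e * l `^ r'^-1) X Y r0 r'0 (conj_fin_inv r1)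
  (mulr_gt0 c0 (powR_gt0 _ l0)) (mulr_gt0 e0 (powR_gt0 _ l0)) (bnd_mul bI bF) (bnd_mul bI bH) hX hY.
have E : (fun z => X z * Y z) = fun z => (\1_(box i x) z : R) * (F z * H z).
  by apply/funext => z; rewrite /X /Y indicE; case: (_ \in _); rewrite ?mul1r ?mul0r.
move: h; rewrite E (int_box a10 a12 a21 s00 i x bFH) lee_fin (mulrACA c) -powRD; last first.
  by rewrite (conj_fin_inv r1) oner_eq0.
by rewrite (conj_fin_inv r1) powRr1 ?(ltW l0)// mulrC ler_pM2r.
Qed.

Lemma Int_slab_adapted i (chi : T -> R) (g : P -> R) : bnd chi -> bnd g -> adapted (G i) chi ->
  intR nu (fun z => chi z.1 * ((\1_(slab i) z.2 : R) * g z)) =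
  ((slen i)%:E * intR mu (fun y => chi y * BA i g y)%R)%E.
Proof.
move=> bc bg ac; have [-> bS] := int_slab a10 a12 a21 s00 i bc bg.
congr (_ * _)%E.
transitivity (intR mu (fun y => SM a2 s0 i g y * chi y)).
  by congr (intR mu); apply/funext => y; rewrite mulrC.
rewrite -(Int_avgM (gG i) bS bc ac).
by congr (intR mu); apply/funext => y; rewrite mulrC.
Qed.

Let bIslab i : bnd (fun z : P => \1_(slab i) z.2 : R).
Proof.
split; first exact: (measurable_comp_snd (measurable_indic (measurable_slab a2 s0 i))).
by exists 1 => z; rewrite indicE; case: (_ \in _); rewrite ?lexx ?ler01.
Qed.

(** On slab i the weight 1/t is at most 1/[scale i], and [len i] divided by [scale i] is a2 - 1. In
    the converse below 1/t exceeds 1/(a2 [scale i]), which costs a further factor a2. *)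
Lemma pairing_le_levels (r : R) (F H : P -> R) : 1 <= r -> bnd F -> bnd H ->
  (forall z, F z != 0 -> exists2 i, (i < N)%N & slab i z.2) ->
  (intR nu (fun z => F z * H z / z.2)%R <=
   (a2 - 1)%:E * intR mu (fun x => \sum_(i < N) boxav r%:E F i x * boxav (conj_exp r) H i x)%R)%E.
Proof.
move=> r1 bF bH FN; have bFH : bnd (fun z => F z * H z) by exact: bnd_mul.
pose w i z : R := (scale i)^-1 * ((\1_(slab i) z.2 : R) * (F z * H z)).
have si0 i : 0 <= (scale i)^-1 by rewrite invr_ge0 ltW.
have bsl i : bnd (fun z : P => (\1_(slab i) z.2 : R) * (F z * H z)) by exact: bnd_mul.
have bw i : bnd (w i) by exact: bnd_scale.
have r1E : (1 <= r%:E)%E by rewrite lee_fin.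
have bv i : bnd (fun x => boxav r%:E F i x * boxav (conj_exp r) H i x).
  apply: bnd_mul; first exact: (bnd_bav a10 a12 a21 s00 r1E i bF).
  exact: (bnd_bav a10 a12 a21 s00 (conj_exp_ge1 r1) i bH).
apply: (@le_trans _ _ (intR nu (fun z => \sum_(i < N) w i z))).
  have z20 z : F z != 0 -> 0 < z.2.
    by move=> /FN[i _ /andP[h _]]; exact: lt_le_trans h.
  apply: le_Int => z; first have [->|/z20 h] := eqVneq (F z) 0; rewrite ?mul0r//.
    by rewrite divr_ge0 ?(ltW h)// mulr_ge0// bnd_ge0.
  have sum0 : 0 <= \sum_(i < N) w i z by apply: sumr_ge0 => i _; exact: (bnd_ge0 _ (bw i)).
  have [->|Fz] := eqVneq (F z) 0; first by rewrite !mul0r.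
  have [i iN zi] := FN z Fz.
  rewrite (bigD1 (Ordinal iN))//= -[leLHS]addr0; apply: lerD; last first.
    by apply: sumr_ge0 => j _; exact: (bnd_ge0 _ (bw j)).
  rewrite /w indicE mem_set// mul1r mulrC; apply: ler_wpM2r; first by rewrite mulr_ge0 ?bnd_ge0.
  by rewrite lef_pV2 ?posrE ?z20//; case/andP: zi.
rewrite (@Int_sum _ _ _ _ N w bw) (@Int_sum _ _ _ _ N (fun i x => boxav r%:E F i x * boxav (conj_exp r) H i x) bv).
rewrite ge0_sume_distrr; last by move=> i _; apply: Int_ge0 => x; exact: (bnd_ge0 _ (bv i)).
apply: lee_sum => i _; rewrite (Int_scale nu (si0 i) (bsl i)).
rewrite (int_slab_BA a10 a12 a21 s00 i bFH) muleA -EFinM.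
have -> : (scale i)^-1 * slen i = a2 - 1.
  by rewrite /len mulrC -mulrA mulfV ?mulr1// gt_eqF.
apply: lee_wpmul2l; first by rewrite lee_fin subr_ge0 ltW.
by apply: le_Int => x; [exact: (bnd_ge0 _ (bBA i bFH))|exact: box_hoelder].
Qed.

Lemma pairing_ge_levels (chi : nat -> T -> R) (g : nat -> P -> R) (H : P -> R) :
  (forall i, bnd (chi i)) -> (forall i, adapted (G i) (chi i)) -> (forall i, bnd (g i)) -> bnd H ->
  (((a2 - 1) / a2)%:E * intR mu (fun x => \sum_(i < N) chi i x * BA i (fun z => g i z * H z) x)%R <=
   intR nu (fun z => (\sum_(i < N) chi i z.1 * ((\1_(slab i) z.2 : R) * g i z)) * H z / z.2)%R)%E.
Proof.
move=> bc ac bg bH; have bgH i : bnd (fun z => g i z * H z) by exact: bnd_mul.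
pose w i z : R := (a2 * scale i)^-1 * (chi i z.1 * ((\1_(slab i) z.2 : R) * (g i z * H z))).
have as0 i : 0 < a2 * scale i by rewrite mulr_gt0.
have bc1 i : bnd (fun z : P => chi i z.1).
  by split; [exact: (measurable_comp_fst (bnd_m (bc i)))|have [_ [c hc]] := bc i; exists c].
have bsl i : bnd (fun z : P => chi i z.1 * ((\1_(slab i) z.2 : R) * (g i z * H z))).
  by apply: bnd_mul => //; exact: bnd_mul.
have ai0 i : 0 <= (a2 * scale i)^-1 by rewrite invr_ge0 ltW.
have bw i : bnd (w i) by exact: bnd_scale.
have bv i : bnd (fun x => chi i x * BA i (fun z => g i z * H z) x) by apply: bnd_mul => //; exact: bBA.
apply: (@le_trans _ _ (intR nu (fun z => \sum_(i < N) w i z))); last first.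
  apply: le_Int => z; first by apply: sumr_ge0 => i _; exact: (bnd_ge0 _ (bw i)).
  rewrite !mulr_suml; apply: ler_sum => i _; rewrite /w indicE.
  case: (boolP (z.2 \in _)) => [/set_mem /andP[h1 h2]|_]; last by rewrite !(mul0r,mulr0).
  rewrite !mul1r mulrC mulrA; apply: ler_wpM2l; first by rewrite !mulr_ge0 ?bnd_ge0.
  by rewrite lef_pV2 ?posrE ?(ltW h2)// (lt_le_trans (sgt i) h1).
rewrite (@Int_sum _ _ _ _ N w bw) (@Int_sum _ _ _ _ N (fun i x => chi i x * BA i (fun z => g i z * H z) x) bv).
rewrite ge0_sume_distrr; last by move=> i _; apply: Int_ge0 => x; exact: (bnd_ge0 _ (bv i)).
apply: lee_sum => i _; rewrite (Int_scale nu (ai0 i) (bsl i)).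
rewrite (Int_slab_adapted (bc i) (bgH i) (ac i)) muleA -EFinM.
rewrite (_ : (a2 * scale i)^-1 * slen i = (a2 - 1) / a2)//.
by rewrite /len; have := sgt i; move: (scale i) => s' s'0; field; rewrite !gt_eqF.
Qed.

Lemma bav_mono (r : R) F F' i x : 1 <= r -> bnd F -> bnd F' -> (forall z, box i x z -> F z <= F' z) ->
  boxav r%:E F i x <= boxav r%:E F' i x.
Proof.
move=> r1 bF bF' FF'; have r0 : 0 < r := lt_le_trans ltr01 r1.
have b1 := bnd_pow (ltW r0) bF; have b2 := bnd_pow (ltW r0) bF'.
have key : BA i (fun z => F z `^ r) x <= 1 * BA i (fun z => F' z `^ r) x.
  apply: (BA_le a10 a12 a21 s00 ler01 b1 b2) => z bz; rewrite mul1r.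
  by apply: ge0_ler_powR; rewrite ?nnegrE ?(ltW r0) ?bnd_ge0//; exact: FF'.
have i0 : 0 <= r^-1 by rewrite invr_ge0 ltW.
rewrite mul1r in key.
exact: (ge0_ler_powR i0 (bnd_ge0 x (bBA i b1)) (bnd_ge0 x (bBA i b2)) key).
Qed.

Lemma bav_scale (r c : R) F i x : 1 <= r -> 0 <= c -> bnd F ->
  boxav r%:E (fun z => c * F z) i x <= c * boxav r%:E F i x.
Proof.
move=> r1 c0 bF; have r0 : 0 < r := lt_le_trans ltr01 r1.
have b1 := bnd_pow (ltW r0) bF; have b2 := bnd_pow (ltW r0) (bnd_scale c0 bF).
have cE : c = (c `^ r) `^ r^-1 by rewrite -powRrM mulfV ?gt_eqF// powRr1.
rewrite [in leRHS]cE /bav -powRM ?powR_ge0 ?(bnd_ge0 _ (bBA i b1))//.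
apply: ge0_ler_powR; rewrite ?nnegrE ?invr_ge0 ?(ltW r0) ?(bnd_ge0 _ (bBA i b2))//.
  by apply: mulr_ge0; [exact: powR_ge0|exact: (bnd_ge0 _ (bBA i b1))].
apply: (BA_le a10 a12 a21 s00) => //; first exact: powR_ge0.
by move=> z _; rewrite powRM// bnd_ge0.
Qed.

Definition above (w : nat -> T -> R) (del : R) i x : R := if del < w i x then 1 else 0.

(** Duality of L^r inside each box: g is extremal for H, and chi rescales it so that its average is
    at most s_i while its pairing with H is at least s_i b_i/2. The rescaling divides by an average
    that may be arbitrarily small; restricting to the set where w > del keeps chi bounded, and w > 0
    wherever b > 0 ensures that nothing is lost as del tends to 0. *)
Lemma test_levels (r : R) (H : P -> R) (s : nat -> T -> R) : 1 <= r -> bnd H -> dseq mu G s ->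
  let b := boxav (conj_exp r) H in
  exists w : nat -> T -> R, [/\ (forall i, adapted (G i) (w i)), (forall i x, 0 < b i x -> 0 < w i x) &
   forall del, 0 < del -> exists chi g,
    [/\ (forall i, bnd (chi i)), (forall i, adapted (G i) (chi i)), (forall i, bnd (g i)) /\ (forall i z, g i z != 0 -> H z != 0),
     (forall i x, boxav r%:E (fun z => chi i x * g i z) i x <= s i x) &
     (forall i x, above w del i x * s i x * b i x / 2 <= chi i x * BA i (fun z => g i z * H z) x)]].
Proof.
move=> r1 bH ds b; have r1' := conj_exp_ge1 r1.
have bb i : bnd (b i) := bnd_bav a10 a12 a21 s00 r1' i bH.
have ab i : adapted (G i) (b i) by exact: bav_adapted.
have bs i : bnd (s i) := fins_bnd (ds.1 i).
have as_ i : adapted (G i) (s i) := ds.2 i.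
have r0 : 0 < r := lt_le_trans ltr01 r1.
have bchi w e del i : 0 < del -> (forall x, 0 <= e x) -> (forall x, del < w i x -> del <= e x) ->
    adapted (G i) (w i) -> adapted (G i) e ->
    bnd (fun x => above w del i x * s i x / e x) /\ adapted (G i) (fun x => above w del i x * s i x / e x).
  move=> del0 e0 we aw ae.
  have ac : adapted (G i) (fun x => above w del i x * s i x / e x).
    by move=> x y xy; rewrite /above (aw _ _ xy) (as_ _ _ _ xy) (ae _ _ xy).
  split => //; split; first by have [_ h _] := gG i; exact: adapted_measurable h ac.
  have [_ [c hc]] := bs i; exists (c / del) => x; have /andP[h1 h2] := hc x.
  have c0 : 0 <= c := le_trans h1 h2.
  rewrite /above; case: ltP => [/we h|_]; last by rewrite !mul0r lexx divr_ge0// ltW.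
  rewrite mul1r divr_ge0//=; apply: ler_pM => //; first by rewrite invr_ge0.
  by rewrite lef_pV2 ?posrE// (lt_le_trans del0).
move: (r1); rewrite le_eqVlt => /predU1P[rE|rgt].
  (* For r = 1, g is the indicator of the set where H exceeds half its essential supremum over the
     box. Its density e in the box is positive where b > 0, and dividing by e normalises its
     average; here the loss of the factor 2 occurs. *)
  pose g i (z : P) : R := \1_[set z | b i z.1 / 2 < H z] z.
  have bg i : bnd (g i).
    apply: bnd_indic; apply: (mset_lt _ (bnd_m bH)).
    by apply: measurable_funM => //; exact: (measurable_comp_fst (bnd_m (bb i))).
  pose e i := BA i (g i).
  have be i : bnd (e i) by exact: bBA.
  have ae i : adapted (G i) (e i) by exact: adapted_BA.
  pose w i x := Num.min (b i x) (e i x).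
  have aw i : adapted (G i) (w i) by move=> x y xy; rewrite /w (ab _ _ _ xy) (ae _ _ _ xy).
  exists w; split => //.
    move=> i x b0; rewrite lt_min b0/= lt0r (bnd_ge0 _ (be i)) andbT; apply/eqP => e0.
    have mbx := @measurable_box R n a1 a2 s0 i x.
    pose Z : set P := [set z | box i x z /\ b i x / 2 < H z].
    have mZ : measurable Z by apply: measurableI; [exact: mbx|exact: (mset_lt (measurable_cst _) (bnd_m bH))].
    have nZ : null Z.
      apply/(null_measurable mZ); rewrite -(Int_indic nu mZ).
      have := int_box a10 a12 a21 s00 i x (bg i); rewrite -/(e i x) e0 mulr0 => h0.
      apply: eq_trans h0; congr (intR nu); apply/funext => z; rewrite /g !indicE -natrM mulnb; congr (nat_of_bool _)%:R.
      apply/idP/andP => [/set_mem[h1 h2]|[/set_mem h1 /set_mem h2]].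
        by split; apply: mem_set => //=; rewrite (ab _ _ _ h1.1).
      by apply: mem_set; split => //; move: h2 => /=; rewrite (ab _ _ _ h1.1).
    have : ((b i x)%:E <= (b i x / 2)%:E)%E.
      rewrite /b -rE conj_exp1 /= -(bavP_infty a10 a12 a21 s00 i x bH).
      by apply: esssup_le; move: nZ; rewrite /Z /b -rE conj_exp1.
    by rewrite lee_fin; move: b0; lra.
  move=> del del0; exists (fun i x => above w del i x * s i x / e i x), g.
  have wl i x : del < w i x -> del <= e i x by rewrite lt_min => /andP[_ /ltW].
  have hch i := bchi w (e i) del i del0 (fun x => bnd_ge0 x (be i)) (wl i) (aw i) (ae i).
  split.
  - by move=> i; have [] := hch i.
  - by move=> i; have [] := hch i.
  - split => // i z; rewrite /g indicE; case: (boolP (z \in _)) => [/set_mem h _|_]; last by rewrite eqxx.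
    by rewrite gt_eqF// (le_lt_trans _ h)// divr_ge0// bnd_ge0.
  - move=> i x; have c0 : 0 <= above w del i x * s i x / e i x by have [bc _] := hch i; exact: (bnd_ge0 x bc).
    apply: le_trans (@bav_scale r _ (g i) i x r1 c0 (bg i)) _.
    rewrite /bav -rE invr1 powRr1 ?(bnd_ge0 _ (bBA i (bnd_pow ler01 (bg i))))//.
    rewrite (_ : (fun z => g i z `^ 1) = g i); last by apply/funext => z; rewrite powRr1// bnd_ge0.
    rewrite -/(e i x) /above; case: ltP => [/wl h|_]; last by rewrite !mul0r bnd_ge0.
    by rewrite mul1r divfK// gt_eqF// (lt_le_trans del0).
  move=> i x; rewrite /above; case: ltP => [wx|_]; last by rewrite !mul0r.
  have b0 : 0 < b i x by move: wx; rewrite lt_min => /andP[h _]; exact: lt_trans h.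
  have ex := lt_le_trans del0 (wl i x wx).
  have bgH : bnd (fun z => g i z * H z) by exact: bnd_mul.
  have h : e i x <= (2 / b i x) * BA i (fun z => g i z * H z) x.
    apply: (BA_le a10 a12 a21 s00) => //; first by rewrite divr_ge0// ltW.
    move=> z bz; rewrite /g indicE; case: (boolP (z \in _)) => [/set_mem /= hz|_]; last by rewrite mul0r mulr0.
    rewrite mul1r mulrAC ler_pdivlMr// mul1r; move: hz; rewrite (ab _ _ _ bz.1); lra.
  move: (bnd_ge0 x (bs i)) b0 ex h.
  move: (s i x) (b i x) (e i x) (BA i (fun z => g i z * H z) x) => s' b' e' t' s'0 b'0 e'0 h.
  have h' : b' * e' <= 2 * t' by move: h; rewrite mulrAC ler_pdivlMr// mulrC.
  rewrite !mul1r [leRHS]mulrAC ler_pdivlMr//; have := ler_wpM2l s'0 h'; lra.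
rewrite -/b; set r' := conj_fin r.
have r'1 : 1 < r' by exact: conj_fin_gt1.
have r'0 : 0 < r' by exact: lt_trans r'1.
have bE i x : b i x = (BA i (fun z => H z `^ r') x) `^ r'^-1 by rewrite /b conj_expE.
have bHr : bnd (fun z => H z `^ r') by exact: bnd_pow (ltW r'0) bH.
have bp i x : b i x `^ r' = BA i (fun z => H z `^ r') x.
  by rewrite bE -powRrM mulVf ?gt_eqF// powRr1// (bnd_ge0 _ (bBA i bHr)).
have sub0 : 0 < r' - 1 by rewrite subr_gt0.
exists b; split => // del del0.
(* For r > 1, the equality case of Hoelder's inequality: the L^r average of H^(r'-1) is b^(r'-1),
   since r'/r = r' - 1, and its pairing with H averages to b^r'. *)
pose g (i : nat) (z : P) := H z `^ (r' - 1).
have bg i : bnd (g i) by exact: bnd_pow (ltW sub0) bH.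
pose e i x := b i x `^ (r' - 1).
pose w i x := b i x.
have ae i : adapted (G i) (e i) by move=> x y xy; rewrite /e (ab _ _ _ xy).
have hch i : bnd (fun x => above b del i x * s i x / e i x) /\ adapted (G i) (fun x => above b del i x * s i x / e i x).
  have ac : adapted (G i) (fun x => above b del i x * s i x / e i x).
    by move=> x y xy; rewrite /above (ab _ _ _ xy) (as_ _ _ _ xy) (ae _ _ _ xy).
  split => //; split; first by have [_ h _] := gG i; exact: adapted_measurable h ac.
  have [_ [c hc]] := bs i; exists (c / del `^ (r' - 1)) => x; have /andP[h1 h2] := hc x.
  have c0 : 0 <= c := le_trans h1 h2.
  rewrite /above; case: ltP => [h|_]; last by rewrite !mul0r lexx divr_ge0// powR_ge0.
  have d0 := powR_gt0 (r' - 1) del0.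
  have de : del `^ (r' - 1) <= e i x.
    by apply: ge0_ler_powR; rewrite ?nnegrE ?(ltW sub0) ?(ltW del0) ?(ltW h) ?bnd_ge0.
  rewrite mul1r divr_ge0 ?powR_ge0//=; apply: ler_pM => //; first by rewrite invr_ge0 powR_ge0.
  by rewrite lef_pV2 ?posrE// (lt_le_trans d0).
exists (fun i x => above b del i x * s i x / e i x), g; split.
- by move=> i; have [] := hch i.
- by move=> i; have [] := hch i.
- by split => // i z; apply: contraNneq => Hz; rewrite /g Hz powR0 ?eqxx// gt_eqF.
- move=> i x; have c0 : 0 <= above b del i x * s i x / e i x by have [bc _] := hch i; exact: (bnd_ge0 x bc).
  apply: le_trans (@bav_scale r _ (g i) i x r1 c0 (bg i)) _.
  have -> : boxav r%:E (g i) i x = b i x `^ (r' / r).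
    rewrite /bav (_ : (fun z => g i z `^ r) = fun z => H z `^ r'); last first.
      by apply/funext => z; rewrite /g -powRrM conj_fin_sub1.
    by rewrite -bp -powRrM.
  have -> : r' / r = r' - 1.
    by apply: (mulIf (lt0r_neq0 r0)); rewrite divfK ?gt_eqF// conj_fin_sub1.
  rewrite -/(e i x) /above; case: ltP => [h|_]; last by rewrite !mul0r bnd_ge0.
  by rewrite mul1r divfK// gt_eqF// powR_gt0// (lt_trans del0).
move=> i x; rewrite /above; case: ltP => [h|_]; last by rewrite !mul0r.
have b0 : 0 < b i x := lt_trans del0 h.
have E : (fun z => g i z * H z) = fun z => H z `^ r'.
  apply/funext => z; rewrite /g -[X in _ * X]powRr1 ?bnd_ge0// -powRD ?subrK//.
  by rewrite gt_eqF.
rewrite E -bp !mul1r -[X in X <= _]mulrA -mulrA; apply: ler_wpM2l; first exact: bnd_ge0.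
rewrite /e -powRN -powRD; last by rewrite (lt0r_neq0 b0) implybT.
rewrite (_ : - (r' - 1) + r' = 1); last by ring.
rewrite powRr1 ?(ltW b0)//; lra.
Qed.

End fixed_scale.

Definition csupp (k : nat) (F : P -> R) := bnd F /\ forall z, F z != 0 -> exhaust k z.

Lemma dseq_bav s0 (r : \bar R) F k : 0 < s0 -> (1 <= r)%E -> csupp k F ->
  dseq mu (G a1 a2 s0) (bav a1 a2 s0 r F).
Proof.
move=> s00 r1 [bF Fk]; split => i; last exact: bav_adapted.
by apply: (fins_bav a10 a12 a21 s00 r1 i bF (L := k.+1%:R)) => z /Fk [].
Qed.

Lemma csupp_hoelder (p q r : R) : 1 <= p -> 1 <= q -> 1 <= r -> exists2 C, 0 < C &
  forall k (F H : P -> R) A B, csupp k F -> csupp k H -> 0 < A -> 0 < B ->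
  (tnorm p%:E q%:E (WR a1 a2 r%:E (EFin \o F)) <= A%:E)%E ->
  (tnorm (conj_exp p) (conj_exp q) (WR a1 a2 (conj_exp r) (EFin \o H)) <= B%:E)%E ->
  (intR nu (fun z => F z * H z / z.2)%R <= (C * (A * B))%:E)%E.
Proof.
move=> p1 q1 r1.
have [c1 c10 h1] := @tnorm_lower p%:E q%:E p1 q1.
have [c2 c20 h2] := tnorm_lower (conj_exp_ge1 p1) (conj_exp_ge1 q1).
have a21' : 0 < a2 - 1 by rewrite subr_gt0.
exists ((a2 - 1) * (2 * (c1 * c2))); first by rewrite !mulr_gt0.
move=> k F H A B cF cH A0 B0 hF hH; have [bF Fk] := cF; have [bH Hk] := cH.
have [s0 [N [s00 hN]]] := exhaust_levels k.
have FN z : F z != 0 -> exists2 i, (i < N)%N & slab a2 s0 i z.2 by move=> /Fk/hN.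
apply: le_trans (pairing_le_levels s00 r1 bF bH FN) _.
rewrite -[(a2 - 1) * _ * _]mulrA EFinM; apply: lee_wpmul2l; first by rewrite lee_fin ltW.
rewrite (_ : 2 * (c1 * c2) * (A * B) = 2 * (c1 * A * (c2 * B))); last by ring.
have r1E : (1 <= r%:E)%E by rewrite lee_fin.
apply: (discrete_hoelder (gridG n a1 a2 s0) (@nestG R n a1 a2 n0 a10 a12 a21 s0 s00) p1 q1).
- exact: mulr_gt0.
- exact: mulr_gt0.
- exact: dseq_bav cF.
- exact: dseq_bav (conj_exp_ge1 r1) cH.
- exact: (h1 s0 s00 r%:E F N A r1E bF (ltW A0) hF).
- exact: (h2 s0 s00 (conj_exp r) H N B (conj_exp_ge1 r1) bH (ltW B0) hH).
Qed.

(** At a given point only finitely many levels matter, so for some k the cut changes nothing;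
    monotone convergence then applies. *)
Lemma above_limit (w : nat -> T -> R) N x (u : nat -> R) : (forall i, 0 <= u i) ->
  (forall i, 0 < u i -> 0 < w i x) ->
  exists k, \sum_(i < N) u i = \sum_(i < N) above w k.+1%:R^-1 i x * u i.
Proof.
move=> u0 uw; suff [k hk] : exists k, forall i, (i < N)%N -> 0 < u i -> k.+1%:R^-1 < w i x.
  exists k; apply: eq_bigr => i _; rewrite /above.
  have := u0 i; rewrite le_eqVlt => /predU1P[<-|/(hk i (ltn_ord i)) ->]; rewrite ?mulr0// mul1r//.
elim: N => [|N [k hk]]; first by exists 0%N.
have [uN|uN] := ltP 0 (u N); last first.
  exists k => i; rewrite ltnS leq_eqVlt => /predU1P[->|iN]; last exact: hk.
  by rewrite ltNge uN.
have w0 := uw N uN; pose l := Num.bound (w N x)^-1.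
have hl : l.+1%:R^-1 < w N x.
  rewrite -[ltRHS]invrK ltf_pV2 ?posrE ?invr_gt0//.
  apply: lt_le_trans (archi_boundP (_ : 0 <= _)) _; first by rewrite invr_ge0 ltW.
  by rewrite ler_nat.
exists (maxn k l) => i; rewrite ltnS leq_eqVlt => /predU1P[->|iN] ui.
  by apply: le_lt_trans hl; rewrite lef_pV2 ?posrE// ler_nat ltnS leq_maxr.
by apply: le_lt_trans (hk i iN ui); rewrite lef_pV2 ?posrE// ler_nat ltnS leq_maxl.
Qed.

(** A test sequence s for [discrete_norming] is realised by a function F that on each box is the
    extremal function of [test_levels]. By [tnorm_upper] its norm is at most c1 A, and [K]
    compensates the factor 1/2 of the tests and the factor (a2 - 1)/a2 of the pairing. *)
Lemma csupp_norming (p q r : R) : 1 <= p -> 1 <= q -> 1 <= r -> exists2 C, 0 < C &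
  forall k (H : P -> R) M, csupp k H -> 0 < M ->
  (forall F A, csupp k F -> 0 < A -> (tnorm p%:E q%:E (WR a1 a2 r%:E (EFin \o F)) <= A%:E)%E ->
    (intR nu (fun z => F z * H z / z.2)%R <= (M * A)%:E)%E) ->
  (tnorm (conj_exp p) (conj_exp q) (WR a1 a2 (conj_exp r) (EFin \o H)) <= (C * M)%:E)%E.
Proof.
move=> p1 q1 r1.
have [c1 c10 h1] := @tnorm_upper p%:E q%:E p1 q1.
have [c2 c20 h2] := tnorm_upper (conj_exp_ge1 p1) (conj_exp_ge1 q1).
have a21' : 0 < a2 - 1 by rewrite subr_gt0.
pose K := 2 * a2 / (a2 - 1) * c1.
have K0 : 0 < K by rewrite mulr_gt0// divr_gt0// mulr_gt0.
have nc := norming_cst_gt0 q p1.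
exists (c2 * (norming_cst p q * K)); first by apply: mulr_gt0 => //; exact: mulr_gt0.
move=> k H M cH M0 hyp; have [bH Hk] := cH.
have [s0 [N [s00 hN]]] := exhaust_levels k.
have r1E : (1 <= r%:E)%E by rewrite lee_fin.
have r1' := conj_exp_ge1 r1.
have gG i := gridG n a1 a2 s0 i.
have nG i x y := @nestG R n a1 a2 n0 a10 a12 a21 s0 s00 i x y.
have db := dseq_bav s00 r1' cH; set b := bav a1 a2 s0 (conj_exp r) H in db.
have bb i : bnd (b i) := fins_bnd (db.1 i).
have HN z : H z != 0 -> exists2 i, (i < N)%N & slab a2 s0 i z.2 by move=> /Hk/hN.
have KM0 : 0 < K * M by exact: mulr_gt0.
suff hs s A : 0 < A -> dseq mu (G a1 a2 s0) s -> dnorm_le mu (G a1 a2 s0) (vG n a1 a2 s0) N p%:E q%:E s A ->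
    (intR mu (fun x => \sum_(i < N) s i x * b i x)%R <= (K * M * A)%:E)%E.
  have hd := discrete_norming gG nG p1 q1 KM0 db hs.
  rewrite (_ : c2 * (norming_cst p q * K) * M = c2 * (norming_cst p q * (K * M))); last by ring.
  have B0 : 0 <= norming_cst p q * (K * M) by rewrite mulr_ge0// ltW.
  exact: (h2 s0 s00 (conj_exp r) H N b _ r1' bH B0 HN db (fun i x _ => lexx _) hd).
move=> A0 ds hs; have bs i : bnd (s i) := fins_bnd (ds.1 i).
have [w [aw wb hw]] := test_levels s00 r1 bH ds.
pose X (j : nat) x := \sum_(i < N) above w j.+1%:R^-1 i x * (s i x * b i x).
have bX1 j i : bnd (fun x => above w j.+1%:R^-1 i x * (s i x * b i x)).
  apply: bnd_mul; last exact: bnd_mul.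
  split; last by exists 1 => x; rewrite /above; case: ifP; rewrite ?ler01 ?lexx.
  have [_ h _] := gG i; apply: adapted_measurable h _.
  by move=> x y xy; rewrite /above (aw _ _ _ xy).
have bX j : bnd (X j) by exact: (@bnd_sum _ _ _ N (fun i x => above w j.+1%:R^-1 i x * (s i x * b i x)) (bX1 j)).
have sb0 i x : 0 <= s i x * b i x by rewrite mulr_ge0 ?bnd_ge0.
apply: (@mct_le _ _ _ mu (fun j x => (X j x)%:E)).
- by move=> j; apply/(@measurable_EFinP _ _ _ _ (X j)); exact: bnd_m.
- by move=> j x; rewrite lee_fin bnd_ge0.
- move=> j x; rewrite lee_fin; apply: ler_sum => i _; apply: ler_wpM2r => //.
  rewrite /above; case: (ltP j.+1%:R^-1) => [h|_]; last by case: ifP.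
  by rewrite (lt_trans _ h)// ltf_pV2 ?posrE// ltr_nat.
- by move=> x; rewrite lee_fin; apply: sumr_ge0.
- move=> x; have [//||j hj] := @above_limit w N x (fun i => s i x * b i x).
    move=> i h; apply: wb; rewrite lt_neqAle bnd_ge0// andbT eq_sym.
    by apply/eqP => e0; move: h; rewrite /b e0 mulr0 ltxx.
  by rewrite hj; apply: ereal_sup_ubound; exists j.
move=> j; have [|chi [g [bc ac [bg gH] le_s ge_b]]] := hw j.+1%:R^-1; first by rewrite invr_gt0.
pose F z := \sum_(i < N) chi i z.1 * ((\1_(slab a2 s0 i) z.2 : R) * g i z).
have Fterm z i : (i < N)%N -> slab a2 s0 i z.2 -> F z = chi i z.1 * g i z.
  move=> iN zi; rewrite /F (@single_term R N (fun i => chi i z.1 * ((\1_(slab a2 s0 i) z.2 : R) * g i z)) i)//.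
    by rewrite indicE mem_set// mul1r.
  move=> l li; rewrite indicE memNset ?mul0r ?mulr0// => zl.
  by move: li; rewrite (slab_disj a10 a12 a21 s00 zi zl) eqxx.
have Fnot z : ~ (exists2 i, (i < N)%N & slab a2 s0 i z.2) -> F z = 0.
  move=> h; rewrite /F big1// => i _; rewrite indicE memNset ?mul0r ?mulr0// => zi.
  by apply: h; exists i.
have bF : bnd F.
  apply: (@bnd_sum _ _ _ N (fun i z => chi i z.1 * ((\1_(slab a2 s0 i) z.2 : R) * g i z))) => i.
  apply: bnd_mul; last apply: bnd_mul => //.
    by split; [exact: (measurable_comp_fst (bnd_m (bc i)))|have [_ [c hc]] := bc i; exists c].
  split; first exact: (measurable_comp_snd (measurable_indic (measurable_slab a2 s0 i))).
  by exists 1 => z; rewrite indicE; case: (_ \in _); rewrite ?lexx ?ler01.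
have FH z : F z != 0 -> H z != 0.
  move=> Fz; have [[i iN zi]|h] := pselect (exists2 i, (i < N)%N & slab a2 s0 i z.2); last first.
    by move: Fz; rewrite Fnot// eqxx.
  by apply: (gH i); apply: contraNneq Fz => gz; rewrite (Fterm z i iN zi) gz mulr0.
have cF : csupp k F by split => // z /FH/Hk.
have FN z : F z != 0 -> exists2 i, (i < N)%N & slab a2 s0 i z.2 by move=> /FH/HN.
have bvF i x : (i < N)%N -> bav a1 a2 s0 r%:E F i x <= s i x.
  move=> iN; apply: le_trans (le_s i x).
  have bcg : bnd (fun z => chi i x * g i z) by apply: bnd_scale => //; exact: bnd_ge0.
  apply: (bav_mono s00 r1 bF bcg) => z [zx zi].
  by rewrite (Fterm z i iN zi) (ac _ _ _ zx).
have c1A : 0 < c1 * A by exact: mulr_gt0.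
have := hyp F (c1 * A) cF c1A (h1 s0 s00 r%:E F N s A r1E bF (ltW A0) FN ds bvF hs).
move=> /(le_trans (pairing_ge_levels N s00 bc ac bg bH)) hF.
have d0 : 0 < (a2 - 1) / a2 by rewrite divr_gt0.
rewrite -lee_pdivlMl// in hF; rewrite -[X in (X <= _)%E]/(intR mu (X j)).
apply: (@le_trans _ _ (intR mu (fun x => 2 * \sum_(i < N) chi i x * BA a1 a2 s0 i (fun z => g i z * H z) x))).
  apply: le_Int => x; first exact: bnd_ge0.
  rewrite mulr_sumr; apply: ler_sum => i _; have := ge_b i x; rewrite -/b; set u := chi i x * _; lra.
rewrite Int_scale//; last first.
  apply: (@bnd_sum _ _ _ N (fun i x => chi i x * BA a1 a2 s0 i (fun z => g i z * H z) x)) => i.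
  by apply: bnd_mul => //; apply: (bnd_BA a10 a12 a21 s00); exact: bnd_mul.
apply: le_trans (lee_wpmul2l _ hF) _; first by rewrite lee_fin.
rewrite -!EFinM lee_fin le_eqVlt; apply/orP; left; apply/eqP; rewrite /K; field.
by rewrite !gt_eqF.
Qed.

End dual_tests.

(** * Monotone limits and tent norms *)

Section decreasing.
Context d (T : measurableType d) (R : realType) (m : {measure set T -> \bar R}).

(** Dominated convergence with the first term as majorant. Pointwise smallness is asked only where
    this term is finite, which is almost everywhere. *)
Lemma integral_decreasing0 (f : nat -> T -> \bar R) (e : R) :
  (forall k, measurable_fun setT (f k)) -> (forall k x, (0 <= f k x)%E) ->
  (forall k x, (f k.+1 x <= f k x)%E) -> (\int[m]_x f 0%N x < +oo)%E ->
  (forall x (e : R), (f 0%N x < +oo)%E -> 0 < e -> exists k, (f k x <= e%:E)%E) ->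
  0 < e -> exists k, (\int[m]_x f k x <= e%:E)%E.
Proof.
move=> mf f0 fS If fe e0.
have nd x k l : (k <= l)%N -> (f l x <= f k x)%E.
  by move=> kl; rewrite -(subnK kl); elim: (l - k)%N => [//|i IH]; rewrite addSn; exact: le_trans (fS _ _) IH.
have ig : m.-integrable setT (f 0%N).
  by apply/integrableP; split => //; under eq_integral do rewrite gee0_abs//.
have ae1 : {ae m, forall x, setT x -> f ^~ x @ \oo --> (cst 0%E : T -> \bar R) x}.
  have := integrable_ae measurableT ig; apply: filterS => x /= h _.
  have fx : (f 0%N x < +oo)%E by have := h Logic.I; rewrite ge0_fin_numE.
  have fk k : f k x = (fine (f k x))%:E.
    by rewrite fineK// ge0_fin_numE// (le_lt_trans _ fx)// nd.
  apply/fine_cvgP; split.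
    by apply: nearW => k; rewrite fk.
  apply/cvgrPdist_le => eps eps0.
  have [k hk] := fe x eps fx eps0; exists k => // l /= kl.
  rewrite sub0r normrN ger0_norm ?fine_ge0// -lee_fin -fk.
  exact: le_trans (nd _ _ _ kl) hk.
have ae2 : {ae m, forall x k, setT x -> (`|f k x| <= f 0%N x)%E}.
  by apply: aeW => x k _; rewrite gee0_abs// nd.
have [_ _] := dominated_convergence measurableT mf (measurable_cst _) ae1 ig ae2.
rewrite integral0 => hcvg.
have : \forall k \near \oo, (\int[m]_x f k x < e%:E)%E.
  apply: (hcvg [set u | (u < e%:E)%E]); apply: open_nbhs_nbhs; split; first exact: open_ereal_lt_ereal.
  by rewrite /= lte_fin.
by case=> k _ hk; exists k; apply: ltW; exact: (hk k (leqnn k)).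
Qed.

End decreasing.

(** * Measurability of inversion and of open sets *)

Section measurability.
Variables (R : realType) (n : nat).
Hypothesis n0 : (0 < n)%N.
Local Notation T := (n.-tuple R).
Local Notation P := (pt R n).
Local Notation nu := (leb1 R n).
Local Notation mu := (leb R n).

(** Inversion is the difference of the powers of exponent -1 of the positive and negative parts,
    because such a power of 0 is 0. *)
Lemma measurable_invr : measurable_fun setT (fun t : R => t^-1).
Proof.
rewrite (_ : (fun t => t^-1) = fun t => (Num.max t 0) `^ (-1) - (Num.max (- t) 0) `^ (-1)).
  apply: measurable_funB; apply: (measurableT_comp (measurable_powR _)).
    by apply: measurable_maxr.
  by apply: measurable_maxr => //; apply: (measurable_funN (@measurable_id _ _ setT)).
apply/funext => t; have z : (0 : R) `^ (-1) = 0 by rewrite powR0// oppr_eq0 oner_eq0.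
have [t0|t0] := leP 0 t.
  have -> : Num.max (- t) 0 = 0 :> R by apply/max_idPr; rewrite oppr_le0.
  by rewrite z subr0 powR_inv1.
have -> : Num.max (- t) 0 = - t :> R by apply/max_idPl; rewrite oppr_ge0 ltW.
by rewrite z sub0r powR_inv1 ?oppr_ge0 ?(ltW t0)// invrN opprK.
Qed.

Lemma edist_shift (w y y' : T) del : cube y del y' -> edist w y' <= edist w y + n%:R * del.
Proof.
move=> hy; have d0 : 0 <= edist w y by exact: sqrtr_ge0.
have del0 : 0 < del by exact: le_lt_trans (normr_ge0 _) (hy (Ordinal n0)).
have nd0 : 0 <= n%:R * del by rewrite mulr_ge0// ltW.
have s0 : 0 <= edist w y + n%:R * del by rewrite addr_ge0.
rewrite -[leRHS]ger0_norm// -sqrtr_sqr ler_wsqrtr//.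
have h1 : edist w y ^+ 2 = \sum_(j < n) (tnth w j - tnth y j) ^+ 2.
  by rewrite sqr_sqrtr// sumr_ge0// => j _; exact: sqr_ge0.
rewrite sqrrD h1.
apply: (@le_trans _ _ (\sum_(j < n) ((tnth w j - tnth y j) ^+ 2 + (2 * edist w y * del + del ^+ 2)))).
  apply: ler_sum => j _; have e1 := edist_ge w y j; have e2 := ltW (hy j).
  rewrite (_ : tnth w j - tnth y' j = (tnth w j - tnth y j) - (tnth y' j - tnth y j)); last by ring.
  move: e1 e2; set a := tnth w j - tnth y j; set c := tnth y' j - tnth y j => e1 e2; clearbody a c.
  have hac : `|a * c| <= edist w y * del by rewrite normrM ler_pM.
  have hc : c ^+ 2 <= del ^+ 2 by rewrite -(real_normK (num_real c)) lerXn2r ?nnegrE// ltW.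
  have := ler_norm (- (a * c)); rewrite normrN; move: hac hc; rewrite sqrrB -mulr_natl; lra.
rewrite big_split/= -addrA lerD2l sumr_const card_ord -[leLHS]mulr_natl.
rewrite -[X in _ <= X + _]mulr_natl; have n1 : 1 <= n%:R :> R by rewrite ler1n.
move: n1; move: (n%:R) (edist w y) => m' d' n1.
have : 0 <= (m' - 1) * m' * del ^+ 2.
  by rewrite mulr_ge0 ?sqr_ge0// mulr_ge0 ?subr_ge0// (le_trans ler01).
lra.
Qed.

(** Openness is expressed with cubes. The set is the union of the boxes it contains, taken over all
    meshes 1/(k+1) and all integer positions, hence a countable union. *)
Lemma measurable_open_set (U : set P) :
  (forall z, U z -> exists2 del, 0 < del & forall z', cube z.1 del z'.1 -> `|z'.2 - z.2| < del -> U z') ->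
  measurable U.
Proof.
move=> hU.
pose l (k : nat) : R := k.+1%:R^-1.
have l0 k : 0 < l k by rewrite invr_gt0.
pose C k (x : n.-tuple int) (m : int) : set P :=
  [set z | gix (l k) (fun=> 0) z.1 = x /\ Num.floor (z.2 / l k) = m].
have mC k x m : measurable (C k x m).
  have [_ h _] := @gix_grid R n (l k) (fun=> 0) (l0 k).
  apply: (@measurable_prodset R n (gix (l k) (fun=> 0) @^-1` [set x]) [set t | Num.floor (t / l k) = m] (h x)).
  have -> : [set t | Num.floor (t / l k) = m] = `[m%:~R * l k, (m + 1)%:~R * l k[%classic.
    apply/seteqP; split => t /=; rewrite in_itv/= -ler_pdivlMr// -ltr_pdivrMr//.
      by move=> <-; rewrite floor_le_tmp/= floorD1_gt.
    by move=> /andP[h1 h2]; apply/floor_def; rewrite h1.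
  exact: measurable_itv.
have -> : U = \bigcup_k \bigcup_x \bigcup_m (if `[< C k x m `<=` U >] then C k x m else set0).
  apply/seteqP; split => [z Uz|z [k _ [x _ [m _]]]]; last by case: asboolP => // h /h.
  have [del del0 hdel] := hU z Uz.
  have [k _ hk] := near_infty_natSinv_lt (PosNum del0).
  have lk : l k < del by exact: (hk k (leqnn k)).
  exists k => //; exists (gix (l k) (fun=> 0) z.1) => //; exists (Num.floor (z.2 / l k)) => //.
  case: asboolP => // -[]; move=> z' [h1 h2]; apply: hdel.
    by move=> j; exact: lt_trans (gix_dist (l0 k) (esym h1) j) lk.
  apply: lt_trans lk; have e1 := floor_itv (z.2 / l k); have e2 := floor_itv (z'.2 / l k).
  rewrite h2 in e2; move: e1 e2; set u := z.2 / l k; set u' := z'.2 / l k.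
  have -> : z.2 = u * l k by rewrite divfK// gt_eqF.
  have -> : z'.2 = u' * l k by rewrite divfK// gt_eqF.
  rewrite intrD -mulrBl normrM (gtr0_norm (l0 k)) => /andP[a1 a2'] /andP[a3 a4].
  rewrite gtr_pMl// ltr_norml; apply/andP; split; lra.
apply: bigcupT_measurable => k; apply: countable_bigcupT_measurable => // x.
apply: countable_bigcupT_measurable => // m.
by case: asboolP.
Qed.

Lemma measurable_open_setT (U : set T) :
  (forall y, U y -> exists2 del, 0 < del & forall y', cube y del y' -> U y') -> measurable U.
Proof.
move=> hU; have mU : measurable [set z : P | U z.1].
  by apply: measurable_open_set => z /hU[del del0 h]; exists del => // z' /h.
by have := measurable_pair2 (0 : R) measurableT mU; rewrite setTI.
Qed.

End measurability.

(** * Measurability and monotone limits of Whitney averages and tent norms *)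

Section families.
Variables (R : realType) (n : nat) (a1 a2 : R).
Hypotheses (n0 : (0 < n)%N) (a10 : 0 < a1) (a12 : a1 < a2^-1) (a21 : a2^-1 < 1).
Local Notation T := (n.-tuple R).
Local Notation P := (pt R n).
Local Notation nu := (leb1 R n).
Local Notation mu := (leb R n).

Lemma restr_ge0 (S : set P) (G : P -> \bar R) z : S `<=` @upper R n ->
  (forall z, upper z -> (0 <= G z)%E) -> (0 <= restr S G z)%E.
Proof. by move=> Su G0; rewrite /restr; case: asboolP => // /Su/G0. Qed.

Lemma sint_ge0 (S : set P) (G : P -> \bar R) : S `<=` @upper R n ->
  (forall z, upper z -> (0 <= G z)%E) -> (0 <= sint S G)%E.
Proof.
by move=> Su G0; apply: integral_ge0 => t _; apply: iint_ge0 => y; exact: restr_ge0.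
Qed.

Lemma le_sint (S : set P) (G G' : P -> \bar R) : S `<=` @upper R n ->
  (forall z, upper z -> (0 <= G z)%E) -> (forall z, S z -> (G z <= G' z)%E) -> (sint S G <= sint S G')%E.
Proof.
move=> Su G0 GG'; apply: le_fint => z; first exact: restr_ge0.
by rewrite /restr; case: asboolP => // /GG'.
Qed.

Section one_family.
Context d (T1 : measurableType d) (S : T1 -> set P) (G : P -> \bar R).
Hypotheses (mS : measurable [set w : T1 * P | S w.1 w.2]) (mG : measurable_fun setT G).
Hypotheses (Su : forall x, S x `<=` @upper R n) (G0 : forall z, upper z -> (0 <= G z)%E).

Let K (w : T1 * P) := restr (S w.1) G w.2.

Let mK : measurable_fun setT K.
Proof.
have -> : K = fun w => (((\1_[set w : T1 * P | S w.1 w.2] w : R)%:E) * G w.2)%E.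
  apply/funext => w; rewrite /K /restr indicE; case: asboolP => h.
    by rewrite mem_set// mul1e.
  by rewrite memNset// mul0e.
apply: emeasurable_funM; first exact/measurable_EFinP/measurable_indic.
exact: (measurableT_comp mG measurable_snd).
Qed.

Lemma sint_integral x : sint (S x) G = (\int[nu]_z restr (S x) G z)%E.
Proof.
rewrite /sint fintE//; last by move=> z; exact: restr_ge0.
exact: (measurableT_comp mK (measurable_pair1 x)).
Qed.

Lemma measurable_restr x : measurable_fun setT (restr (S x) G).
Proof. exact: (measurableT_comp mK (measurable_pair1 x)). Qed.

Lemma measurable_sint : measurable_fun setT (fun x => sint (S x) G).
Proof.
under eq_fun do rewrite sint_integral.
apply: (@measurable_int1 _ _ _ _ _ nu K mK) => w; exact: restr_ge0.
Qed.

End one_family.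

Lemma measurable_whitney_family : measurable [set w : P * P | whitney a1 a2 w.1 w.2].
Proof.
rewrite (_ : [set _ | _] = [set w : P * P | edist w.2.1 w.1.1 < a1 * w.1.2] `&`
   ([set w : P * P | a2^-1 * w.1.2 < w.2.2] `&` [set w : P * P | w.2.2 < a2 * w.1.2])); last first.
  by apply/seteqP; split => w /=; [case=> ? /andP[]|case=> ? [? ?]; split=> //; apply/andP].
have m1 : measurable_fun setT (fun w : P * P => w.1.2) by exact: (measurableT_comp measurable_snd measurable_fst).
have m2 : measurable_fun setT (fun w : P * P => w.2.2) by exact: (measurableT_comp measurable_snd measurable_snd).
have m3 : measurable_fun setT (fun w : P * P => w.1.1) by exact: (measurableT_comp measurable_fst measurable_fst).
have m4 : measurable_fun setT (fun w : P * P => w.2.1) by exact: (measurableT_comp measurable_fst measurable_snd).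
apply: measurableI; first by apply: mset_lt; [exact: measurable_edist|exact: measurable_funM].
by apply: measurableI; apply: mset_lt => //; exact: measurable_funM.
Qed.

(** For nonpositive height of z the two bounds on the height of w are incompatible, and the region
    is empty. *)
Lemma whitney_upper (z : P) : whitney a1 a2 z `<=` @upper R n.
Proof.
move=> w [_ /andP[h1 h2]]; have a20 := lt_trans ltr01 (a2_gt1 a10 a12 a21).
have i0 : 0 < a2^-1 by rewrite invr_gt0.
have z0 : 0 < z.2.
  have h := lt_trans h1 h2; rewrite -subr_gt0 -mulrBl pmulr_rgt0// in h.
  by rewrite subr_gt0 (lt_trans a21)// (a2_gt1 a10 a12 a21).
by rewrite /upper /=; apply: lt_trans h1; rewrite mulr_gt0.
Qed.

Lemma measurable_cone_family : measurable [set w : T * P | cone w.1 w.2].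
Proof.
have m1 : measurable_fun setT (fun w : T * P => w.2.2) by exact: (measurableT_comp measurable_snd measurable_snd).
have m2 : measurable_fun setT (fun w : T * P => w.2.1) by exact: (measurableT_comp measurable_fst measurable_snd).
apply: (@measurableI _ _ [set w : T * P | 0 < w.2.2] [set w : T * P | edist w.2.1 w.1 < w.2.2]).
  exact: mset_lt.
by apply: mset_lt => //; apply: measurable_edist.
Qed.

(** The rest of the half space is cut out by an open condition: a point w in the ball around z but
    outside the target ball remains one for all nearby z. *)
Lemma measurable_tent_hat (c : T) rho : measurable (tent_hat c rho : set P).
Proof.
have -> : tent_hat c rho = @upper R n `\` [set z : P | exists2 w : T, edist w z.1 < z.2 & ~ edist w c < rho].
  apply/seteqP; split => z [z0 hz]; split => //.
    by move=> [w wz]; apply; exact: hz.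
  by move=> w wz; apply: contrapT => h; apply: hz; exists w.
apply: measurableD; first by apply: mset_lt => //; exact: measurable_snd.
apply: measurable_open_set => z [w wz wc].
have n2 : 0 < n.+2%:R :> R by [].
(* Of the n + 2 parts of the margin, n absorb the horizontal change, one the vertical change, and
   one keeps the inequality strict. *)
exists ((z.2 - edist w z.1) / n.+2%:R); first by rewrite divr_gt0// subr_gt0.
move=> z' h1 h2; exists w => //; apply: le_lt_trans (edist_shift n0 w h1) _.
set del := _ / _ in h2 *; have E : n.+2%:R * del = z.2 - edist w z.1 by rewrite mulrC divfK// gt_eqF.
have del0 : 0 < del by rewrite divr_gt0// subr_gt0.
have N2 : n.+2%:R = n%:R + 2 :> R by rewrite -addn2 natrD.
move: h2 E; rewrite N2 ltr_norml => /andP[h2 _]; clearbody del; lra.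
Qed.

(** A point of the open cone at x belongs to the cones at all nearby points, so the supremum is
    lower semicontinuous in x, whatever [g] is. *)
Lemma measurable_sup_cone (g : P -> \bar R) : measurable_fun setT (fun x : T => ereal_sup [set g z | z in cone x]).
Proof.
have ho (y : \bar R) : measurable [set x : T | (y < ereal_sup [set g z | z in cone x])%E].
  apply: measurable_open_setT => x /= /ereal_sup_gt[_ [z [z0 zx] <-] yg].
  have n1 : 0 < n.+1%:R :> R by [].
  exists ((z.2 - edist z.1 x) / n.+1%:R); first by rewrite divr_gt0// subr_gt0.
  move=> y' hy; apply: lt_le_trans yg _; apply: ereal_sup_ubound; exists z => //; split => //.
  apply: le_lt_trans (edist_shift n0 z.1 hy) _.
  set del := _ / _; have E : n.+1%:R * del = z.2 - edist z.1 x by rewrite mulrC divfK// gt_eqF.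
  have del0 : 0 < del by rewrite divr_gt0// subr_gt0.
  have N2 : n.+1%:R = n%:R + 1 :> R by rewrite -addn1 natrD.
  by move: E; rewrite N2; clearbody del; lra.
apply: (measurability _ (ErealGenOInfty.measurableE R)) => _ [_ [y ->] <-].
by rewrite setTI (_ : _ @^-1` _ = [set x : T | (y%:E < ereal_sup [set g z | z in cone x])%E])//;
  apply/seteqP; split => x /=; rewrite in_itv/= andbT.
Qed.

Lemma WR_mono (r : \bar R) (F F' : P -> \bar R) z : (1 <= r)%E -> (forall w, upper w -> (0 <= F w)%E) ->
  (forall w, upper w -> (F w <= F' w)%E) -> (WR a1 a2 r F z <= WR a1 a2 r F' z)%E.
Proof.
move=> r1 F0 FF.
apply: (ge1_case r1 (Q := fun r => (WR a1 a2 r F z <= WR a1 a2 r F' z)%E)) => [r' r'1|].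
  have r'0 : 0 < r' := lt_le_trans ltr01 r'1.
  have ri : 0 <= r'^-1 by rewrite invr_ge0 ltW.
  have I0 : (0 <= sint (whitney a1 a2 z) (fun w => F w `^ r'))%E.
    by apply: sint_ge0; [exact: whitney_upper|move=> w _; exact: poweR_ge0].
  apply: lee_wpmul2l; first exact: poweR_ge0.
  apply: (le_poweR ri I0); apply: le_sint.
  - exact: whitney_upper.
  - by move=> w _; exact: poweR_ge0.
  - by move=> w /whitney_upper wu; apply: (le_poweR (ltW r'0) (F0 w wu) (FF w wu)).
by apply: esssup_mono => // w /whitney_upper; exact: FF.
Qed.

Definition nng (F : P -> R) := measurable_fun setT F /\ forall z, 0 <= F z.

Lemma measurable_vol_whitney : measurable_fun setT (fun z : P => vol (whitney a1 a2 z)).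
Proof.
by apply: (measurable_sint measurable_whitney_family); [exact: measurable_cst|exact: whitney_upper|].
Qed.

Lemma nng_pow (F : P -> R) r : nng F -> measurable_fun setT (fun w => ((EFin \o F) w `^ r)%E).
Proof.
by move=> [mF _]; apply: (measurableT_comp (measurable_poweR r)); exact/measurable_EFinP.
Qed.

(** For r = oo: the essential supremum exceeds c exactly when the part of the region where F > c has
    positive measure, and this measure depends measurably on z by Tonelli. *)
Lemma measurable_WR (r : \bar R) (F : P -> R) : (1 <= r)%E -> nng F ->
  measurable_fun setT (WR a1 a2 r (EFin \o F)).
Proof.
move=> r1 nF; have [mF F0] := nF.
apply: (ge1_case r1 (Q := fun r => measurable_fun setT (WR a1 a2 r (EFin \o F)))) => [r' r'1|].
  apply: emeasurable_funM; first exact: (measurableT_comp (measurable_poweR _) measurable_vol_whitney).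
  apply: (measurableT_comp (measurable_poweR _)).
  apply: (measurable_sint measurable_whitney_family); [exact: nng_pow|exact: whitney_upper|].
  by move=> z _; exact: poweR_ge0.
have ho (c : R) : measurable [set z : P | (c%:E < esssup (whitney a1 a2 z) (EFin \o F))%E].
  pose S (z : P) : set P := [set w | whitney a1 a2 z w /\ c < F w].
  have mS : measurable [set w : P * P | S w.1 w.2].
    apply: (measurableI _ _ measurable_whitney_family).
    by apply: mset_lt => //; exact: (measurableT_comp mF measurable_snd).
  have Su z : S z `<=` @upper R n by move=> w [/whitney_upper].
  have mSz z : measurable (S z).
    by have := measurable_pair1 z measurableT mS; rewrite setTI.
  have m1 : measurable_fun setT (fun z => sint (S z) (fun=> 1%E)).
    by apply: (measurable_sint mS).
  have := emeasurable_fun_o_infty measurableT m1 0%E; rewrite setTI; congr (measurable _).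
  apply/seteqP; split => z /=.
    move=> h; rewrite ltNge; apply/negP => /esssup_null /(null_measurable (mSz z)) h0.
    by move: h; rewrite -[sint _ _]/(vol (S z)) volE// h0 ltxx.
  move=> h; rewrite -[sint _ _]/(vol (S z)) volE// lt0e measure_ge0 andbT.
  apply: contraTneq h => /(null_measurable (mSz z)) h0.
  by rewrite -leNgt; exact: esssup_le.
apply: (measurability _ (ErealGenOInfty.measurableE R)) => _ [_ [y ->] <-].
rewrite setTI (_ : _ @^-1` _ = [set z : P | (y%:E < esssup (whitney a1 a2 z) (EFin \o F))%E])//.
by apply/seteqP; split => x /=; rewrite in_itv/= andbT.
Qed.

Lemma poweR_sup (t : R) (u_ : nat -> \bar R) u : 0 < t -> (forall k, 0 <= u_ k)%E -> (0 <= u)%E ->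
  (u <= ereal_sup (range u_))%E -> (u `^ t <= ereal_sup (range (fun k => u_ k `^ t)))%E.
Proof.
move=> t0 u_0 u0 hu; set M := ereal_sup (range _).
have hM k : (u_ k `^ t <= M)%E by apply: ereal_sup_ubound; exists k.
have M0 : (0 <= M)%E := le_trans (poweR_ge0 _ _) (hM 0%N).
rewrite -(poweRVK t0 M0); apply: le_poweR => //; first exact: ltW.
apply: le_trans hu _; apply: ub_ereal_sup => _ [k _ <-].
by rewrite -(poweRKV t0 (u_0 k)); apply: le_poweR; [rewrite invr_ge0 ltW|exact: poweR_ge0|exact: hM].
Qed.

Lemma mule_sup (c : R) (u_ : nat -> \bar R) u : 0 < c ->
  (u <= ereal_sup (range u_))%E -> (u * c%:E <= ereal_sup (range (fun k => u_ k * c%:E)))%E.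
Proof.
move=> c0 hu; set M := ereal_sup (range _).
have hM k : (u_ k * c%:E <= M)%E by apply: ereal_sup_ubound; exists k.
rewrite muleC -lee_pdivlMl//; apply: le_trans hu _; apply: ub_ereal_sup => _ [k _ <-].
by rewrite lee_pdivlMl// muleC.
Qed.

Let mconst (S : set P) : measurable S -> measurable [set w : T * P | S w.2].
Proof. by move=> mS; have := (measurable_snd : measurable_fun setT (snd : T * P -> P)) measurableT S mS; rewrite setTI. Qed.

Lemma sint_mct (S : set P) (G_ : nat -> P -> \bar R) G C : measurable S -> S `<=` @upper R n ->
  (forall k, measurable_fun setT (G_ k)) -> measurable_fun setT G ->
  (forall k z, upper z -> (0 <= G_ k z)%E) -> (forall z, upper z -> (0 <= G z)%E) ->
  (forall k z, upper z -> (G_ k z <= G_ k.+1 z)%E) ->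
  (forall z, upper z -> (G z <= ereal_sup (range (G_ ^~ z)))%E) ->
  (forall k, (sint S (G_ k) <= C)%E) -> (sint S G <= C)%E.
Proof.
move=> mS Su mG_ mG G_0 G0 GS hG hC.
pose o : T := origin R n.
rewrite (sint_integral (mconst mS) mG (fun _ => Su) G0 o).
apply: (@mct_le _ _ _ nu (fun k => restr S (G_ k))).
- by move=> k; exact: (measurable_restr (mconst mS) (mG_ k) o).
- by move=> k z; apply: restr_ge0 => //; exact: G_0.
- by move=> k z; rewrite /restr; case: asboolP => // /Su/GS.
- by move=> z; exact: restr_ge0.
- move=> z; rewrite {1}/restr; case: asboolP => Sz.
    apply: le_trans (hG z (Su z Sz)) _; apply: ub_ereal_sup => _ [k _ <-].
    by apply: ereal_sup_ubound; exists k => //; rewrite /restr; case: asboolP.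
  by apply: ereal_sup_ubound; exists 0%N => //; rewrite /restr; case: asboolP.
- by move=> k; rewrite -(sint_integral (mconst mS) (mG_ k) (fun _ => Su) (G_0 k) o).
Qed.

Lemma iint_mct (f_ : nat -> T -> \bar R) f C : (forall k, measurable_fun setT (f_ k)) ->
  measurable_fun setT f -> (forall k x, (0 <= f_ k x)%E) -> (forall x, (0 <= f x)%E) ->
  (forall k x, (f_ k x <= f_ k.+1 x)%E) -> (forall x, (f x <= ereal_sup (range (f_ ^~ x)))%E) ->
  (forall k, (iint (f_ k) <= C)%E) -> (iint f <= C)%E.
Proof.
move=> mf_ mf f_0 f0 fS hf hC; rewrite iintE//; apply: (mct_le mf_ f_0 fS f0 hf) => k.
by rewrite -iintE.
Qed.

Lemma esssup_null_ereal (A : set P) (g : P -> \bar R) (e : R) : (esssup A g <= e%:E)%E ->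
  null [set z | A z /\ (e%:E < g z)%E].
Proof.
move=> h; apply: (@nullS _ _ _ (\bigcup_k [set z | A z /\ ((e + k.+1%:R^-1)%:E < g z)%E])).
  move=> z [Az]; case gz: (g z) => [u| |] //; last first.
    by move=> _; exists 0%N => //; split => //; rewrite gz ltry.
  rewrite lte_fin -subr_gt0 => u0; have [k _ hk] := near_infty_natSinv_lt (PosNum u0).
  exists k => //=; split => //; rewrite gz lte_fin -ltrBrDl.
  by have := hk k (leqnn _).
apply: null_bigcup => k; apply: esssupP; apply: (le_lt_trans h).
by rewrite lte_fin ltrDl invr_gt0.
Qed.

(** For finite r, monotone convergence inside the region. For r = oo, the set where F exceeds the
    bound is covered by the countably many null sets where some F_k does. *)
Lemma WR_fatou (r : \bar R) (F_ : nat -> P -> R) F z : (1 <= r)%E -> (forall k, nng (F_ k)) -> nng F ->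
  (forall k z, F_ k z <= F_ k.+1 z) -> (forall z, upper z -> exists k, F z <= F_ k z) -> upper z ->
  (WR a1 a2 r (EFin \o F) z <= ereal_sup (range (fun k => WR a1 a2 r (EFin \o F_ k) z)))%E.
Proof.
move=> r1 nF_ nF FS hF zu.
have WR0 F' : nng F' -> (0 <= WR a1 a2 r (EFin \o F') z)%E.
  by move=> [_ F'0]; apply: (WR_ge0 n0 a10 a12 a21 r1) => // w; rewrite lee_fin.
set M := ereal_sup _.
have hM k : (WR a1 a2 r (EFin \o F_ k) z <= M)%E by apply: ereal_sup_ubound; exists k.
have M0 : (0 <= M)%E := le_trans (WR0 _ (nF_ 0%N)) (hM 0%N).
case: M M0 hM => [m| |] // m0 hM; last by rewrite leey.
rewrite lee_fin in m0; move: hM.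
apply: (ge1_case r1 (Q := fun r => (forall k, WR a1 a2 r (EFin \o F_ k) z <= m%:E)%E -> (WR a1 a2 r (EFin \o F) z <= m%:E)%E)).
  move=> r' r'1 hM; have r'0 : 0 < r' := lt_le_trans ltr01 r'1.
  have mW := measurable_whitney a1 a2 z.
  have vle := nu_whitney_le a10 a12 a21 zu; have vge := nu_whitney_ge n0 a10 a12 a21 zu.
  have vfin : nu (whitney a1 a2 z) \is a fin_num by rewrite ge0_fin_numE// (le_lt_trans vle)// ltry.
  have vE := fineK vfin; set v := fine _ in vE; rewrite -vE lee_fin in vge.
  have v0 : 0 < v.
    apply: lt_le_trans vge; apply: mulr_gt0.
      by apply: exprn_gt0; apply: mulr_gt0 => //; apply: mulr_gt0 => //; exact: eps_gt0 n0 a10.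
    by apply: mulr_gt0 => //; rewrite subr_gt0 (lt_trans a21)// (a2_gt1 a10 a12 a21).
  have iff (X : \bar R) : (vol (whitney a1 a2 z) `^ (- r'^-1) * X <= m%:E)%E = (X <= (m * v `^ r'^-1)%:E)%E.
    by rewrite volE// -vE poweR_EFin powRN muleC lee_pdivrMr ?powR_gt0.
  have mv0 : 0 <= m * v `^ r'^-1 by rewrite mulr_ge0 ?powR_ge0.
  have S0 F' : (0 <= sint (whitney a1 a2 z) (fun w => (EFin \o F') w `^ r'))%E.
    by apply: sint_ge0; [exact: whitney_upper|move=> w _; exact: poweR_ge0].
  rewrite /WR iff; apply: le_powR_root => //.
  apply: (@sint_mct _ (fun k w => ((EFin \o F_ k) w `^ r')%E)) => //.
  - exact: whitney_upper.
  - by move=> k; exact: nng_pow.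
  - exact: nng_pow.
  - by move=> k w _; exact: poweR_ge0.
  - by move=> w _; exact: poweR_ge0.
  - by move=> k w _; apply: le_poweR; [exact: ltW|rewrite lee_fin; exact: (nF_ k).2|rewrite lee_fin].
  - move=> w /hF[k Fk]; apply: le_trans (_ : _ <= (EFin \o F_ k) w `^ r')%E _.
      by apply: le_poweR; [exact: ltW|rewrite lee_fin; exact: nF.2|rewrite lee_fin].
    by apply: ereal_sup_ubound; exists k.
  - by move=> k; apply: root_le_powR => //; rewrite -iff; exact: hM.
move=> hM; apply: esssup_le.
apply: (@nullS _ _ _ (\bigcup_k [set w | whitney a1 a2 z w /\ m < F_ k w])).
  move=> w [Ww /=]; rewrite lte_fin => mF; have [k Fk] := hF w (whitney_upper Ww).
  by exists k => //; split => //; exact: lt_le_trans Fk.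
by apply: null_bigcup => k; apply: esssup_null; exact: hM.
Qed.

Let tpow (q : R) (k : nat) (g : P -> \bar R) : measurable_fun setT g ->
  measurable_fun setT (fun z => g z `^ q * ((z.2 ^+ k)^-1)%R%:E)%E.
Proof.
move=> mg; apply: emeasurable_funM; first exact: (measurableT_comp (measurable_poweR q) mg).
apply/(@measurable_EFinP _ _ _ _ (fun z : P => (z.2 ^+ k)^-1)).
exact: (measurableT_comp (@measurable_invr R) (measurable_funX k measurable_snd)).
Qed.

Let tpow0 (q : R) (k : nat) (g : P -> \bar R) z : upper z -> (0 <= g z `^ q * ((z.2 ^+ k)^-1)%R%:E)%E.
Proof. by move=> z0; apply: mule_ge0; [exact: poweR_ge0|rewrite lee_fin invr_ge0 exprn_ge0// ltW]. Qed.

Let tpow_le (q : R) (k : nat) (g g' : P -> \bar R) z : 0 <= q -> upper z -> (0 <= g z)%E -> (g z <= g' z)%E ->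
  (g z `^ q * ((z.2 ^+ k)^-1)%R%:E <= g' z `^ q * ((z.2 ^+ k)^-1)%R%:E)%E.
Proof.
move=> q0 z0 g0 gg; apply: lee_wpmul2r; first by rewrite lee_fin invr_ge0 exprn_ge0// ltW.
exact: le_poweR.
Qed.

Let cone_upper' (x : T) : cone x `<=` @upper R n. Proof. by move=> z []. Qed.
Let hat_upper' (c : T) rad : tent_hat c rad `<=` @upper R n. Proof. by move=> z []. Qed.

Lemma tnorm_mono (PP Q : \bar R) (g g' : P -> \bar R) : (1 <= PP)%E -> (1 <= Q)%E ->
  (forall z, upper z -> (0 <= g z)%E) -> (forall z, upper z -> (g z <= g' z)%E) ->
  (tnorm PP Q g <= tnorm PP Q g')%E.
Proof.
move=> p1 q1 g0 gg.
have sup0 (x : T) : (0 <= ereal_sup [set g z | z in cone x])%E.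
  apply: le_trans (g0 (x, 1) _) _; first exact: ltr01.
  by apply: ereal_sup_ubound; exists (x, 1) => //; split => //=; rewrite edistxx.
case: PP p1 => [p| |] //; rewrite ?lee_fin => p1; case: Q q1 => [q| |] //; rewrite ?lee_fin => q1.
- have p0 := ltW (lt_le_trans ltr01 p1); have q0 := ltW (lt_le_trans ltr01 q1).
  apply: le_poweR; [by rewrite invr_ge0|by apply: iint_ge0 => x; exact: poweR_ge0|].
  apply: le_iint => x; first exact: poweR_ge0.
  apply: le_poweR => //; first exact: poweR_ge0.
  apply: le_poweR; [by rewrite invr_ge0|by apply: sint_ge0 => // z; exact: tpow0|].
  apply: le_sint => // z; first exact: tpow0.
  by move=> /cone_upper' zu; apply: tpow_le => //; [exact: g0|exact: gg].
- have p0 := ltW (lt_le_trans ltr01 p1).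
  apply: le_poweR; [by rewrite invr_ge0|by apply: iint_ge0 => x; exact: poweR_ge0|].
  apply: le_iint => x; first exact: poweR_ge0.
  apply: le_poweR => //; apply: ub_ereal_sup => _ [z zx <-].
  by apply: le_trans (gg z (cone_upper' zx)) _; apply: ereal_sup_ubound; exists z.
- have q0 := ltW (lt_le_trans ltr01 q1).
  apply: ub_ereal_sup => _ [x [c [rad [r0 [bx ->]]]]].
  apply: le_trans (_ : _ <= voln (ball_n c rad) `^ (- q^-1) *
       (sint (tent_hat c rad) (fun z => g' z `^ q * (z.2^-1)%R%:E)) `^ (q^-1))%E _; last first.
    by apply: ereal_sup_ubound; exists x, c, rad.
  apply: lee_wpmul2l; first exact: poweR_ge0.
  apply: le_poweR; first by rewrite invr_ge0.
    by apply: sint_ge0 => // z zu; have := @tpow0 q 1 g z zu; rewrite expr1.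
  apply: le_sint => // z zu; first by have := @tpow0 q 1 g z zu; rewrite expr1.
  have {}zu := hat_upper' zu.
  by have := @tpow_le q 1 g g' z q0 zu (g0 z zu) (gg z zu); rewrite expr1.
- exact: esssup_mono.
Qed.

(** Monotone convergence from the inside out for finite exponents. Suprema commute with the limit,
    the Carleson norm is treated ball by ball, and the uniform norm needs only a countable union of
    null sets. *)
Lemma tnorm_fatou (PP Q : \bar R) (g_ : nat -> P -> \bar R) (g : P -> \bar R) B : (1 <= PP)%E -> (1 <= Q)%E ->
  (forall k, measurable_fun setT (g_ k)) -> measurable_fun setT g ->
  (forall k z, upper z -> (0 <= g_ k z)%E) -> (forall z, upper z -> (0 <= g z)%E) ->
  (forall k z, upper z -> (g_ k z <= g_ k.+1 z)%E) ->
  (forall z, upper z -> (g z <= ereal_sup (range (g_ ^~ z)))%E) ->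
  0 <= B -> (forall k, (tnorm PP Q (g_ k) <= B%:E)%E) -> (tnorm PP Q g <= B%:E)%E.
Proof.
move=> p1 q1 mg_ mg g_0 g0 gS hg B0.
have supg (q : R) k z : 0 < q -> upper z -> (g z `^ q * ((z.2 ^+ k)^-1)%R%:E <=
    ereal_sup (range (fun l => g_ l z `^ q * ((z.2 ^+ k)^-1)%R%:E)))%E.
  move=> q0 zu; apply: mule_sup; first by rewrite invr_gt0 exprn_gt0.
  by apply: poweR_sup => //; [move=> l; exact: g_0|exact: g0|exact: hg].
case: PP p1 => [p| |] //; rewrite ?lee_fin => p1; case: Q q1 => [q| |] //; rewrite ?lee_fin => q1.
- have p0 := lt_le_trans ltr01 p1; have q0 := lt_le_trans ltr01 q1 => hB.
  have qi0 : 0 < q^-1 by rewrite invr_gt0.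
  pose S (g : P -> \bar R) x := sint (cone x) (fun z => g z `^ q * ((z.2 ^+ n.+1)^-1)%R%:E)%E.
  have S0 g' x : (0 <= S g' x)%E by apply: sint_ge0 => // z; exact: tpow0.
  have mS g' : measurable_fun setT g' -> measurable_fun setT (S g').
    by move=> mg'; apply: (measurable_sint measurable_cone_family); [exact: tpow|exact: cone_upper'|exact: tpow0].
  have mSp g' : measurable_fun setT g' -> measurable_fun setT (fun x => (S g' x `^ q^-1 `^ p)%E).
    move=> mg'; apply: (measurableT_comp (measurable_poweR p)); apply: (measurableT_comp (measurable_poweR _)).
    exact: mS.
  have SS k x : (S (g_ k) x <= S (g_ k.+1) x)%E.
    apply: le_sint => // z; first exact: tpow0.
    by move=> /cone_upper' zu; apply: tpow_le; [exact: ltW|exact: zu|exact: g_0|exact: gS].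
  apply: le_powR_root => //; first by apply: iint_ge0 => x; exact: poweR_ge0.
  apply: (@iint_mct (fun k x => (S (g_ k) x `^ q^-1 `^ p)%E)).
  - by move=> k; exact: mSp.
  - exact: mSp.
  - by move=> k x; exact: poweR_ge0.
  - by move=> x; exact: poweR_ge0.
  - move=> k x; apply: le_poweR; [exact: ltW|exact: poweR_ge0|].
    by apply: le_poweR; [exact: ltW|exact: S0|exact: SS].
  - move=> x; apply: poweR_sup => //; [by move=> k; exact: poweR_ge0|exact: poweR_ge0|].
    apply: (poweR_sup qi0 (fun k => S0 (g_ k) x) (S0 g x)).
    have mcx : measurable (cone x : set P).
      by have := measurable_pair1 x measurableT measurable_cone_family; rewrite setTI.
    apply: (@sint_mct _ (fun k z => g_ k z `^ q * ((z.2 ^+ n.+1)^-1)%R%:E)%E) => //.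
    + by move=> k; exact: tpow.
    + exact: tpow.
    + by move=> k z; exact: tpow0.
    + by move=> z; exact: tpow0.
    + by move=> k z zu; apply: tpow_le; [exact: ltW|exact: zu|exact: g_0|exact: gS].
    + by move=> z; exact: supg.
    + by move=> k; apply: ereal_sup_ubound; exists k.
  - move=> k; apply: root_le_powR => //; last exact: hB.
    by apply: iint_ge0 => x; exact: poweR_ge0.
- have p0 := lt_le_trans ltr01 p1 => hB.
  have sup0 (g' : P -> \bar R) (x : T) : (forall z, upper z -> (0 <= g' z)%E) -> (0 <= ereal_sup [set g' z | z in cone x])%E.
    move=> g'0; apply: le_trans (g'0 (x, 1) _) _; first exact: ltr01.
    by apply: ereal_sup_ubound; exists (x, 1) => //; split => //=; rewrite edistxx.
  apply: le_powR_root => //; first by apply: iint_ge0 => x; exact: poweR_ge0.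
  apply: (@iint_mct (fun k x => (ereal_sup [set g_ k z | z in cone x] `^ p)%E)).
  - by move=> k; apply: (measurableT_comp (measurable_poweR p)); exact: measurable_sup_cone.
  - by apply: (measurableT_comp (measurable_poweR p)); exact: measurable_sup_cone.
  - by move=> k x; exact: poweR_ge0.
  - by move=> x; exact: poweR_ge0.
  - move=> k x; apply: le_poweR; [exact: ltW|by apply: sup0; exact: g_0|].
    apply: ub_ereal_sup => _ [z zx <-]; apply: le_trans (gS k z (cone_upper' zx)) _.
    by apply: ereal_sup_ubound; exists z.
  - move=> x; apply: poweR_sup => //; [by move=> k; apply: sup0; exact: g_0|exact: sup0|].
    apply: ub_ereal_sup => _ [z zx <-]; apply: le_trans (hg z (cone_upper' zx)) _.
    apply: ub_ereal_sup => _ [k _ <-]; apply: (@le_trans _ _ (ereal_sup [set g_ k z | z in cone x])).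
      by apply: ereal_sup_ubound; exists z.
    by apply: ereal_sup_ubound; exists k.
  - move=> k; apply: root_le_powR => //; last exact: hB.
    by apply: iint_ge0 => x; exact: poweR_ge0.
- have q0 := lt_le_trans ltr01 q1 => hB.
  apply: ub_ereal_sup => _ [x [c [rad [rad0 [bx ->]]]]].
  have vle := mu_ball_le c (ltW rad0); have vge := mu_ball_ge c n0 (ltW rad0).
  have vfin : mu (ball_n c rad) \is a fin_num by rewrite ge0_fin_numE// (le_lt_trans vle)// ltry.
  have vE := fineK vfin; set v := fine _ in vE; rewrite -vE lee_fin in vge.
  have v0 : 0 < v.
    by apply: lt_le_trans vge; apply: exprn_gt0; apply: divr_gt0; [exact: mulr_gt0|rewrite ltr0n].
  have iff (X : \bar R) : (voln (ball_n c rad) `^ (- q^-1) * X <= B%:E)%E = (X <= (B * v `^ q^-1)%:E)%E.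
    rewrite volnE; last exact: measurable_ball_n.
    by rewrite -vE poweR_EFin powRN muleC lee_pdivrMr ?powR_gt0.
  have S0 (g' : P -> \bar R) : (0 <= sint (tent_hat c rad) (fun z => g' z `^ q * (z.2^-1)%R%:E))%E.
    by apply: sint_ge0 => // z zu; have := @tpow0 q 1 g' z zu; rewrite expr1.
  rewrite iff; apply: le_powR_root => //; first by rewrite mulr_ge0 ?powR_ge0.
  have E1 (g' : P -> \bar R) : (fun z : P => g' z `^ q * (z.2^-1)%:E)%E = fun z => (g' z `^ q * ((z.2 ^+ 1)^-1)%R%:E)%E.
    by apply/funext => z; rewrite expr1.
  rewrite E1; apply: (@sint_mct _ (fun k z => g_ k z `^ q * ((z.2 ^+ 1)^-1)%R%:E)%E) => //.
  + exact: measurable_tent_hat.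
  + by move=> k; exact: tpow.
  + exact: tpow.
  + by move=> k z; exact: tpow0.
  + by move=> z; exact: tpow0.
  + by move=> k z zu; apply: tpow_le; [exact: ltW|exact: zu|exact: g_0|exact: gS].
  + by move=> z; exact: supg.
  + move=> k; rewrite -E1; apply: root_le_powR => //; rewrite -iff; apply: le_trans (hB k).
    by apply: ereal_sup_ubound; exists x, c, rad.
- move=> hB; apply: esssup_le.
  apply: (@nullS _ _ _ (\bigcup_k [set z | upper z /\ (B%:E < g_ k z)%E])).
    move=> z [zu Bg]; have := lt_le_trans Bg (hg z zu) => /ereal_sup_gt[_ [k _ <-] hk].
    by exists k.
  by apply: null_bigcup => k; apply: esssup_null_ereal; exact: hB.
Qed.

Let pow_small (t c e : R) : 0 < t -> 0 <= c -> 0 < e -> exists2 e', 0 < e' &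
  forall u, (0 <= u)%E -> (u <= e'%:E)%E -> (u `^ t * c%:E <= e%:E)%E.
Proof.
move=> t0 c0 e0; have d0 : 0 < e / (c + 1) by rewrite divr_gt0// ltr_wpDl.
exists ((e / (c + 1)) `^ t^-1); first exact: powR_gt0.
move=> u u0 hu; have h : (u `^ t <= (e / (c + 1))%:E)%E.
  have -> : (e / (c + 1))%:E = ((((e / (c + 1)) `^ t^-1)%:E) `^ t)%E.
    by rewrite poweR_EFin -powRrM mulVf ?gt_eqF// powRr1// ltW.
  by apply: le_poweR => //; exact: ltW.
have c0' : (0 <= c%:E)%E by rewrite lee_fin.
apply: le_trans (lee_wpmul2r c0' h) _; rewrite -EFinM lee_fin.
by rewrite mulrAC ler_pdivrMr ?ltr_wpDl// mulrDr mulr1 lerDl ltW.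
Qed.

(** Dominated convergence applied in turn in the Whitney region, in the cone and in x; the
    finiteness of p, q and r is essential. Finiteness of the whole norm yields finiteness of the
    inner integrals only almost everywhere, which is all that [integral_decreasing0] asks for. *)
Lemma tent_order_continuous (p q r : R) (F : P -> R) (B : nat -> set P) (e : R) : 1 <= p -> 1 <= q -> 1 <= r ->
  nng F -> (forall j, measurable (B j)) -> (forall j, B j.+1 `<=` B j) ->
  (forall z, upper z -> exists j, ~ B j z) -> (tnorm p%:E q%:E (WR a1 a2 r%:E (EFin \o F)) < +oo)%E -> 0 < e ->
  exists j, (tnorm p%:E q%:E (WR a1 a2 r%:E (EFin \o (fun z => F z * (\1_(B j) z : R))%R)) <= e%:E)%E.
Proof.
move=> p1 q1 r1 nF mB BS B0 NF e0.
have p0 := lt_le_trans ltr01 p1; have q0 := lt_le_trans ltr01 q1; have r0 := lt_le_trans ltr01 r1.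
pose F_ j z := F z * (\1_(B j) z : R).
have nF_ j : nng (F_ j).
  split; first by apply: measurable_funM; [exact: nF.1|exact: measurable_indic].
  by move=> z; rewrite mulr_ge0 ?indicE// nF.2.
have FS j z : F_ j.+1 z <= F_ j z.
  by apply: ler_wpM2l; [exact: nF.2|apply: le_indic; exact: BS].
have F0F z : F_ 0%N z <= F z.
  by rewrite ler_piMr ?nF.2// indicE; case: (_ \in _); rewrite ?lexx ?ler01.
have Fz z : upper z -> exists j, F_ j z = 0.
  by move=> /B0[j Bj]; exists j; rewrite /F_ indicE memNset// mulr0.
pose g j := WR a1 a2 r%:E (EFin \o F_ j).
have mg j : measurable_fun setT (g j) by apply: measurable_WR => //; rewrite lee_fin.
have r1E : (1 <= r%:E)%E by rewrite lee_fin.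
have g0 j z : upper z -> (0 <= g j z)%E.
  by move=> zu; apply: (WR_ge0 n0 a10 a12 a21 r1E) => // w; rewrite lee_fin; exact: (nF_ j).2.
pose I j z := sint (whitney a1 a2 z) (fun w => ((EFin \o F_ j) w `^ r)%E).
have I0 j z : (0 <= I j z)%E by apply: sint_ge0; [exact: whitney_upper|move=> w _; exact: poweR_ge0].
have gS j z : (g j.+1 z <= g j z)%E.
  by apply: WR_mono => // w _; rewrite lee_fin; [exact: (nF_ _).2|exact: FS].
have g0F z : (g 0%N z <= WR a1 a2 r%:E (EFin \o F) z)%E.
  by apply: WR_mono => // w _; rewrite lee_fin; [exact: (nF_ _).2|exact: F0F].
have step1 z (d : R) : upper z -> (g 0%N z < +oo)%E -> 0 < d -> exists j, (g j z <= d%:E)%E.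
  move=> zu gz d0.
  have vle := nu_whitney_le a10 a12 a21 zu; have vge := nu_whitney_ge n0 a10 a12 a21 zu.
  have mW := measurable_whitney a1 a2 z.
  have vfin : nu (whitney a1 a2 z) \is a fin_num by rewrite ge0_fin_numE// (le_lt_trans vle)// ltry.
  have vE := fineK vfin; set v := fine _ in vE; rewrite -vE lee_fin in vge.
  have v0 : 0 < v.
    apply: lt_le_trans vge; apply: mulr_gt0.
      by apply: exprn_gt0; apply: mulr_gt0 => //; apply: mulr_gt0 => //; exact: eps_gt0 n0 a10.
    by apply: mulr_gt0 => //; rewrite subr_gt0 (lt_trans a21)// (a2_gt1 a10 a12 a21).
  have gE j : g j z = (I j z `^ r^-1 * (v `^ (- r^-1))%:E)%E.
    by rewrite /g /WR volE// -vE poweR_EFin muleC.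
  have Ifin : (I 0%N z < +oo)%E.
    move: gz; rewrite gE; case: (I 0%N z) (I0 0%N z) => [u| |] // _; first by move=> *; rewrite ltry.
    by rewrite poweRyr ?invr_eq0 ?gt_eqF// gt0_mulye ?ltxx// lte_fin powR_gt0.
  have ri : 0 < r^-1 by rewrite invr_gt0.
  have [e' e'0 he'] := pow_small ri (powR_ge0 v (- r^-1)) d0.
  have [|||j hj] := @integral_decreasing0 _ _ _ nu (fun j => restr (whitney a1 a2 z) (fun w => ((EFin \o F_ j) w `^ r)%E)) e'
    (fun j => measurable_restr measurable_whitney_family (nng_pow r (nF_ j)) z)
    (fun j w => restr_ge0 w (@whitney_upper z) (fun w _ => poweR_ge0 _ _)) _ _ _ e'0; last first.
  - exists j; rewrite gE; apply: he' => //; apply: le_trans hj.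
    by rewrite /I (sint_integral measurable_whitney_family (nng_pow r (nF_ j)) whitney_upper (fun w _ => poweR_ge0 _ _)).
  - move=> w d' _ d'0; rewrite /restr; case: (asboolP (whitney a1 a2 z w)) => Ww; last by exists 0%N; rewrite lee_fin ltW.
    have [j hj] := Fz w (whitney_upper Ww); exists j.
    by rewrite /= hj powR0 ?gt_eqF// lee_fin ltW.
  - by rewrite -(sint_integral measurable_whitney_family (nng_pow r (nF_ 0%N)) whitney_upper (fun w _ => poweR_ge0 _ _)).
  - move=> j w; rewrite /restr; case: asboolP => // _.
    by apply: le_poweR; [exact: ltW|rewrite lee_fin; exact: (nF_ _).2|rewrite lee_fin].
pose Gx j z := (g j z `^ q * ((z.2 ^+ n.+1)^-1)%R%:E)%E.
have mGx j : measurable_fun setT (Gx j) by exact: tpow.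
pose S j x := sint (cone x) (Gx j).
have S0 j x : (0 <= S j x)%E by apply: sint_ge0 => // z; exact: tpow0.
have GS j z : upper z -> (Gx j.+1 z <= Gx j z)%E.
  by move=> zu; apply: tpow_le; [exact: ltW|exact: zu|exact: g0|exact: gS].
have SS j x : (S j.+1 x <= S j x)%E.
  exact: (le_sint (@cone_upper' x) (fun z => @tpow0 q n.+1 (g j.+1) z) (fun z zx => GS j z (cone_upper' zx))).
have mS j : measurable_fun setT (S j).
  by apply: (measurable_sint measurable_cone_family); [exact: mGx|exact: cone_upper'|exact: tpow0].
have step2 x (d : R) : (S 0%N x < +oo)%E -> 0 < d -> exists j, (S j x <= d%:E)%E.
  move=> Sx d0.
  have [|||j hj] := @integral_decreasing0 _ _ _ nu (fun j => restr (cone x) (Gx j)) d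
    (fun j => measurable_restr measurable_cone_family (mGx j) x)
    (fun j w => restr_ge0 w (@cone_upper' x) (fun w => @tpow0 q n.+1 (g j) w)) _ _ _ d0; last first.
  - by exists j; rewrite /S (sint_integral measurable_cone_family (mGx j) cone_upper' (fun w => @tpow0 q n.+1 (g j) w)).
  - move=> z d'; rewrite /restr; case: asboolP => xz; last by move=> _ d'0; exists 0%N; rewrite lee_fin ltW.
    have zu := cone_upper' xz => Gz d'0.
    have t0 : 0 < (z.2 ^+ n.+1)^-1 by rewrite invr_gt0 exprn_gt0.
    have gz : (g 0%N z < +oo)%E.
      move: Gz; rewrite /Gx; case: (g 0%N z) (g0 0%N z zu) => [u| |] // _; first by move=> *; rewrite ltry.
      by rewrite poweRyr ?gt_eqF// gt0_mulye ?ltxx// lte_fin.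
    have [e' e'0 he'] := pow_small q0 (ltW t0) d'0.
    have [j hj] := step1 z e' zu gz e'0.
    by exists j; apply: he' => //; exact: g0.
  - by rewrite -(sint_integral measurable_cone_family (mGx 0%N) cone_upper' (fun w => @tpow0 q n.+1 (g 0%N) w)).
  - by move=> j z; rewrite /restr; case: asboolP => xz; [exact: (GS j z (cone_upper' xz))|exact: lexx].
pose f j x := (S j x `^ q^-1 `^ p)%E.
have qi : 0 < q^-1 by rewrite invr_gt0.
have f0 j x : (0 <= f j x)%E by exact: poweR_ge0.
have mf j : measurable_fun setT (f j).
  by apply: (measurableT_comp (measurable_poweR p)); exact: (measurableT_comp (measurable_poweR _) (mS j)).
have fS j x : (f j.+1 x <= f j x)%E.
  by apply: le_poweR; [exact: ltW|exact: poweR_ge0|apply: le_poweR; [exact: ltW|exact: S0|exact: SS]].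
have If : (\int[mu]_x f 0%N x < +oo)%E.
  rewrite -iintE//; have : (tnorm p%:E q%:E (g 0%N) < +oo)%E.
    apply: le_lt_trans NF; apply: (@tnorm_mono p%:E q%:E _ _ p1 q1 (fun z zu => g0 0%N z zu)) => z _; exact: g0F.
  rewrite /tnorm -/(f 0%N); have i0 : (0 <= iint (f 0%N))%E by exact: iint_ge0.
  case: (iint (f 0%N)) i0 => [u| |] // _; first by move=> *; rewrite ltry.
  by rewrite poweRyr ?ltxx// invr_eq0 gt_eqF.
have ep0 : 0 < e `^ p by exact: powR_gt0.
have [|j hj] := integral_decreasing0 mf f0 fS If _ ep0; last first.
  exists j; apply: le_powR_root => //; first exact: ltW.
    by apply: iint_ge0 => x; exact: poweR_ge0.
  by rewrite -[X in (X <= _)%E]/(iint (f j)) iintE.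
move=> x d fx d0.
have Sx : (S 0%N x < +oo)%E.
  move: fx; rewrite /f; case: (S 0%N x) (S0 0%N x) => [u| |] // _; first by move=> *; rewrite ltry.
  by rewrite !poweRyr ?invr_eq0 ?gt_eqF// ltxx.
have [e1 e10 h1] := pow_small p0 ler01 d0.
have [e2 e20 h2] := pow_small qi ler01 e10.
have [j hj] := step2 x e2 Sx e20; exists j.
have := h2 _ (S0 j x) hj; rewrite mule1 => h3.
by have := h1 _ (poweR_ge0 _ _) h3; rewrite mule1.
Qed.

End families.

(** * Pairings of nonnegative functions *)

Section general_duality.
Variables (R : realType) (n : nat) (a1 a2 p q r : R).
Hypotheses (n0 : (0 < n)%N) (a10 : 0 < a1) (a12 : a1 < a2^-1) (a21 : a2^-1 < 1).
Hypotheses (p1 : 1 <= p) (q1 : 1 <= q) (r1 : 1 <= r).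
Local Notation T := (n.-tuple R).
Local Notation P := (pt R n).
Local Notation nu := (leb1 R n).
Local Notation mu := (leb R n).
Implicit Types (F H : P -> R).
Local Notation NX F := (@tnorm R n p%:E q%:E (WR a1 a2 r%:E (EFin \o F))).
Local Notation NY H := (@tnorm R n (conj_exp p) (conj_exp q) (WR a1 a2 (conj_exp r) (EFin \o H))).
Let p0 : 0 < p := lt_le_trans ltr01 p1.
Let q0 : 0 < q := lt_le_trans ltr01 q1.
Let r0 : 0 < r := lt_le_trans ltr01 r1.
Let p1E : (1 <= p%:E)%E. Proof. by rewrite lee_fin. Qed.
Let q1E : (1 <= q%:E)%E. Proof. by rewrite lee_fin. Qed.
Let r1E : (1 <= r%:E)%E. Proof. by rewrite lee_fin. Qed.
Let cp := conj_exp_ge1 p1.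
Let cq := conj_exp_ge1 q1.
Let cr := conj_exp_ge1 r1.
Local Notation exhaust := (@exhaust R n).
Local Notation csupp := (@csupp R n).

Lemma measurable_upper : measurable (@upper R n).
Proof. by apply: mset_lt => //; exact: measurable_snd. Qed.

Lemma measurable_exhaust k : measurable (exhaust k).
Proof.
apply: (@measurable_prodset R n _ [set t | k.+1%:R^-1 < t < k.+1%:R]); first exact: measurable_cube.
by rewrite (_ : [set _ | _] = `]k.+1%:R^-1, k.+1%:R[%classic).
Qed.

Lemma exhaustS k l : (k <= l)%N -> exhaust k `<=` exhaust l.
Proof.
move=> kl z [h1 /andP[h2 h3]]; have kl' : k.+1%:R <= l.+1%:R :> R by rewrite ler_nat ltnS.
split; first by move=> j; exact: lt_le_trans (h1 j) kl'.
apply/andP; split; last exact: lt_le_trans kl'.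
by apply: le_lt_trans h2; rewrite lef_pV2 ?posrE.
Qed.

Lemma exhaust_cover (z : P) : upper z -> exists k, exhaust k z.
Proof.
move=> z0; pose S : R := \sum_(j < n) `|tnth z.1 j| + z.2 + z.2^-1.
have zi : 0 < z.2^-1 by rewrite invr_gt0.
have s0 : 0 <= \sum_(j < n) `|tnth z.1 j| by apply: sumr_ge0.
have S0 : 0 <= S by rewrite !addr_ge0// ltW.
exists (Num.bound S); have hS := archi_boundP S0; set k := Num.bound S in hS *.
have kS : k%:R < k.+1%:R :> R by rewrite ltr_nat.
have hz : z.2 < k.+1%:R by apply: lt_trans kS; apply: le_lt_trans hS; rewrite /S; lra.
split; last first.
  apply/andP; split => //; rewrite -[ltRHS]invrK ltf_pV2 ?posrE//.
  by apply: lt_trans kS; apply: le_lt_trans hS; rewrite /S; move: zi z0 s0; rewrite /upper/=; set u := z.2^-1; lra.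
move=> j; rewrite tnth_nseq subr0; apply: lt_trans kS; apply: le_lt_trans hS.
have h : `|tnth z.1 j| <= \sum_(j < n) `|tnth z.1 j| by rewrite (bigD1 j)//= lerDl sumr_ge0.
by rewrite /S; move: z0; rewrite /upper/=; lra.
Qed.

Definition cutoff (F : P -> R) k : set P := exhaust k `&` [set z | F z <= k%:R].

Lemma measurable_cutoff F k : measurable_fun setT F -> measurable (cutoff F k).
Proof. by move=> mF; apply: measurableI; [exact: measurable_exhaust|apply: mset_le]. Qed.

Lemma cutoffS F k : cutoff F k `<=` cutoff F k.+1.
Proof.
move=> z [h1 h2]; split; first exact: exhaustS h1.
by apply: le_trans h2 _; rewrite ler_nat.
Qed.

Lemma cutoff_cover F z : 0 <= F z -> upper z -> exists k, cutoff F k z.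
Proof.
move=> F0 /exhaust_cover[k hk]; exists (maxn k (Num.bound (F z))); split.
  by apply: exhaustS hk; exact: leq_maxl.
apply: ltW; apply: lt_le_trans (archi_boundP F0) _; rewrite ler_nat; exact: leq_maxr.
Qed.

Definition trunc (F : P -> R) k (z : P) : R := F z * \1_(cutoff F k) z.

Lemma csupp_trunc F k : nng F -> csupp k (trunc F k).
Proof.
move=> [mF F0]; split; last first.
  by move=> z; rewrite /trunc indicE; case: (boolP (z \in _)) => [/set_mem[]//|_]; rewrite mulr0 eqxx.
split; first exact: (measurable_funM mF (measurable_indic (measurable_cutoff k mF))).
exists k%:R => z; rewrite /trunc indicE; case: (boolP (z \in _)) => [/set_mem[_ /= h]|_].
  by rewrite mulr1 F0.
by rewrite mulr0 lexx ler0n.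
Qed.

Lemma csupp_nng k F : csupp k F -> nng F.
Proof. by move=> [bF _]; split; [exact: bnd_m|move=> z; exact: bnd_ge0]. Qed.

Lemma truncS F k z : nng F -> trunc F k z <= trunc F k.+1 z.
Proof. by move=> [_ F0]; apply: ler_wpM2l => //; apply: le_indic; exact: cutoffS. Qed.

Lemma trunc_le F k z : nng F -> trunc F k z <= F z.
Proof. by move=> [_ F0]; rewrite ler_piMr// indicE; case: (_ \in _); rewrite ?lexx ?ler01. Qed.

Lemma trunc_cover F z : nng F -> upper z -> exists k, F z <= trunc F k z.
Proof.
move=> [_ F0] /(cutoff_cover (F0 z))[k hk]; exists k.
by rewrite /trunc indicE mem_set// mulr1.
Qed.

Let WR0 (t : \bar R) F z : (1 <= t)%E -> nng F -> upper z -> (0 <= WR a1 a2 t (EFin \o F) z)%E.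
Proof. by move=> t1 [_ F0] zu; apply: (WR_ge0 n0 a10 a12 a21 t1 _ zu) => w; rewrite lee_fin. Qed.

Let WR_le (t : \bar R) F F' z : (1 <= t)%E -> nng F -> (forall z, upper z -> F z <= F' z) ->
  (WR a1 a2 t (EFin \o F) z <= WR a1 a2 t (EFin \o F') z)%E.
Proof.
move=> t1 [_ F0] FF; apply: (WR_mono a10 a12 a21 z t1) => w wu; rewrite lee_fin//.
exact: FF.
Qed.

Lemma NX_mono F F' : nng F -> (forall z, upper z -> F z <= F' z) -> (NX F <= NX F')%E.
Proof.
by move=> nF FF; apply: (tnorm_mono p1E q1E (fun z => WR0 r1E nF) (fun z _ => WR_le z r1E nF FF)).
Qed.

Lemma NY_mono F F' : nng F -> (forall z, upper z -> F z <= F' z) -> (NY F <= NY F')%E.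
Proof.
by move=> nF FF; apply: (tnorm_mono cp cq (fun z => WR0 cr nF) (fun z _ => WR_le z cr nF FF)).
Qed.

Definition dpair (F H : P -> R) : \bar R := sint (@upper R n) (fun z => (F z * H z / z.2)%:E).

Lemma measurable_dpair F H : nng F -> nng H -> measurable_fun setT (fun z => (F z * H z / z.2)%:E).
Proof.
move=> [mF _] [mH _]; apply/(@measurable_EFinP _ _ _ _ (fun z : P => F z * H z / z.2)).
apply: measurable_funM; first exact: measurable_funM.
exact: (measurableT_comp (@measurable_invr R) measurable_snd).
Qed.

Let dp0 F H z : nng F -> nng H -> upper z -> (0 <= (F z * H z / z.2)%:E)%E.
Proof. by move=> [_ F0] [_ H0] z0; rewrite lee_fin divr_ge0 ?mulr_ge0// ltW. Qed.

Let mup : measurable [set w : T * P | @upper R n w.2].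
Proof.
by have := (measurable_snd : measurable_fun setT (snd : T * P -> P)) measurableT _ measurable_upper; rewrite setTI.
Qed.

Lemma dpairE F H k : nng F -> nng H -> csupp k F -> dpair F H = intR nu (fun z => F z * H z / z.2).
Proof.
move=> nF nH cF.
rewrite /dpair (@sint_integral R n _ T (fun=> @upper R n) _ mup (measurable_dpair nF nH) (fun _ => @subset_refl _ _) (fun z => @dp0 F H z nF nH) (origin R n)).
apply: eq_integral => z _; rewrite /restr; case: asboolP => // nz.
suff -> : F z = 0 by rewrite !mul0r.
by apply/eqP; apply: contrapT => /negP/cF.2/exhaust_gt0.
Qed.

Lemma dpair_mono F F' H H' : nng F -> nng H -> (forall z, upper z -> F z * H z <= F' z * H' z) -> (dpair F H <= dpair F' H')%E.
Proof.
move=> nF nH h; apply: le_sint => // z; first by move=> zu; exact: dp0.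
by move=> zu; rewrite lee_fin ler_wpM2r ?invr_ge0 ?(ltW zu)// h.
Qed.

Lemma dpair_csupp F H k : csupp k F -> csupp k H -> dpair F H = intR nu (fun z => F z * H z / z.2).
Proof. by move=> cF cH; apply: (dpairE (csupp_nng cF) (csupp_nng cH) cF). Qed.

Lemma tent_hoelder : exists2 C, 0 < C & forall F H A B, nng F -> nng H -> 0 < A -> 0 < B ->
  (NX F <= A%:E)%E -> (NY H <= B%:E)%E -> (dpair F H <= (C * (A * B))%:E)%E.
Proof.
have [C C0 hC] := csupp_hoelder n0 a10 a12 a21 p1 q1 r1; exists C => // F H A B nF nH A0 B0 hF hH.
apply: (@sint_mct _ _ (@upper R n) (fun k z => (trunc F k z * trunc H k z / z.2)%:E)) => //.
- exact: measurable_upper.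
- by move=> k; apply: measurable_dpair; apply: csupp_nng; exact: csupp_trunc.
- exact: measurable_dpair.
- by move=> k z; apply: dp0; apply: csupp_nng; exact: csupp_trunc.
- by move=> z; exact: dp0.
- move=> k z zu; rewrite lee_fin ler_wpM2r ?invr_ge0 ?(ltW zu)//.
  have nF' := csupp_nng (csupp_trunc k nF); have nH' := csupp_nng (csupp_trunc k nH).
  by apply: ler_pM; [exact: nF'.2|exact: nH'.2|exact: truncS|exact: truncS].
- move=> z zu; have [k hk] := cutoff_cover (nF.2 z) zu; have [l hl] := cutoff_cover (nH.2 z) zu.
  have mono F' m m' : (m <= m')%N -> cutoff F' m z -> cutoff F' m' z.
    by move=> mm; rewrite -(subnK mm); elim: (m' - m)%N => [//|i IH] /IH; rewrite addSn; exact: cutoffS.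
  apply: ereal_sup_ubound; exists (maxn k l) => //.
  by rewrite /trunc !indicE !mem_set ?mulr1//; [apply: mono hl; exact: leq_maxr|apply: mono hk; exact: leq_maxl].
- move=> k; have cF := csupp_trunc k nF; have cH := csupp_trunc k nH.
  rewrite -[X in (X <= _)%E]/(dpair (trunc F k) (trunc H k)) (dpair_csupp cF cH).
  have hF' := le_trans (NX_mono (csupp_nng cF) (fun z _ => trunc_le k z nF)) hF.
  have hH' := le_trans (NY_mono (csupp_nng cH) (fun z _ => trunc_le k z nH)) hH.
  exact: (hC k _ _ A B cF cH A0 B0 hF' hH').
Qed.

(** Since F >= 0, the tests against H also bound those against its truncations, with the same M; the
    Fatou property then removes the truncation. *)
Lemma tent_norming : exists2 C, 0 < C & forall H M, nng H -> 0 < M ->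
  (forall k F A, csupp k F -> 0 < A -> (NX F <= A%:E)%E -> (dpair F H <= (M * A)%:E)%E) ->
  (NY H <= (C * M)%:E)%E.
Proof.
have [C C0 hC] := csupp_norming n0 a10 a12 a21 p1 q1 r1; exists C => // H M nH M0 hyp.
have cH k := csupp_trunc k nH; have nHk k := csupp_nng (cH k).
have CM : 0 <= C * M by rewrite mulr_ge0// ltW.
have mk k := measurable_WR a10 a12 a21 cr (nHk k); have mH := measurable_WR a10 a12 a21 cr nH.
have gS k z : upper z -> (WR a1 a2 (conj_exp r) (EFin \o trunc H k) z <= WR a1 a2 (conj_exp r) (EFin \o trunc H k.+1) z)%E.
  by move=> _; exact: (WR_le z cr (nHk k) (fun w _ => truncS k w nH)).
have gsup z (zu : upper z) := WR_fatou n0 a10 a12 a21 cr nHk nH (fun k w => truncS k w nH) (fun w => trunc_cover nH) zu.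
apply: (tnorm_fatou n0 cp cq mk mH (fun k z => WR0 cr (nHk k)) (fun z => WR0 cr nH) gS gsup CM) => k.
apply: (hC k _ M (cH k) M0) => F A cF A0 hF.
rewrite -(dpair_csupp cF (cH k)); apply: le_trans (hyp k F A cF A0 hF).
apply: dpair_mono; [exact: csupp_nng cF|exact: nHk|move=> z _].
by apply: ler_wpM2l; [exact: (csupp_nng cF).2|exact: trunc_le].
Qed.

(** Only finitely many levels are involved, and at each of them the box averages are bounded with
    support in a cube, so the discrete norm is finite. *)
Lemma csupp_finite k F : csupp k F -> (NX F < +oo)%E.
Proof.
move=> cF; have [bF Fk] := cF.
have [C C0 hC] := tnorm_upper n0 a10 a12 a21 p1E q1E.
have [s0 [N [s00 hN]]] := exhaust_levels n a10 a12 a21 k.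
have ds := dseq_bav a10 a12 a21 s00 r1E cF; set s := bav a1 a2 s0 r%:E F in ds.
pose X x := (\sum_(i < N) s i x `^ q) `^ (p / q).
have fX : fins mu X.
  apply: fins_pow; first exact: divr_gt0.
  by apply: (@fins_sum _ _ _ mu N (fun i x => s i x `^ q)) => i; apply: fins_pow => //; exact: ds.1.
have X0 : (0 <= intR mu X)%E by apply: Int_ge0 => x; exact: powR_ge0.
have XE := fineK (_ : intR mu X \is a fin_num); rewrite ge0_fin_numE// in XE.
pose B := (fine (intR mu X)) `^ p^-1.
apply: le_lt_trans (hC s0 s00 r%:E F N s B r1E bF (powR_ge0 _ _) _ ds (fun i x _ => lexx _) _) _.
- by move=> z /Fk/hN.
- rewrite /dnorm_le -/X /B -powRrM mulVf ?gt_eqF// powRr1 ?fine_ge0//.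
  by rewrite XE//; exact: fins_Int.
- by rewrite ltry.
Qed.

Let sint_scale (S : set P) (G : P -> \bar R) (c : R) : 0 <= c -> measurable S -> S `<=` @upper R n ->
  measurable_fun setT G -> (forall z, upper z -> (0 <= G z)%E) ->
  sint S (fun z => c%:E * G z)%E = (c%:E * sint S G)%E.
Proof.
move=> c0 mS Su mG G0.
have mS' : measurable [set w : T * P | S w.2].
  by have := (measurable_snd : measurable_fun setT (snd : T * P -> P)) measurableT _ mS; rewrite setTI.
have mcG : measurable_fun setT (fun z => c%:E * G z)%E by apply: emeasurable_funM => //; exact: measurable_cst.
rewrite (@sint_integral R n _ T (fun=> S) _ mS' mcG (fun _ => Su) _ (origin R n)); last first.
  by move=> z zu; apply: mule_ge0; [rewrite lee_fin|exact: G0].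
rewrite (@sint_integral R n _ T (fun=> S) _ mS' mG (fun _ => Su) G0 (origin R n)).
rewrite -ge0_integralZl//.
- by apply: eq_integral => z _; rewrite /restr; case: asboolP => //; rewrite mule0.
- exact: (measurable_restr mS' mG (origin R n)).
- by move=> z _; exact: restr_ge0.
Qed.

Lemma NX_scale c F : 0 < c -> nng F -> NX (fun z => c * F z) = (c%:E * NX F)%E.
Proof.
move=> c0 nF; have [mF F0] := nF.
have cpow (t : R) : 0 < t -> ((c `^ t)%:E `^ t^-1 = c%:E)%E.
  by move=> t0; rewrite poweR_EFin -powRrM mulfV ?gt_eqF// powRr1// ltW.
have nF' : nng (fun z => c * F z).
  by split; [exact: measurable_funM|move=> z; rewrite mulr_ge0// ltW].
pose g := WR a1 a2 r%:E (EFin \o F).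
have g0 z : upper z -> (0 <= g z)%E by move=> zu; apply: (WR_ge0 n0 a10 a12 a21 r1E) => // w; rewrite lee_fin.
have mg : measurable_fun setT g by exact: measurable_WR.
have gE z : WR a1 a2 r%:E (EFin \o (fun z => c * F z)) z = (c%:E * g z)%E.
  rewrite /g /WR muleCA; congr (_ * _)%E.
  have -> : (fun w : P => ((EFin \o (fun z => (c * F z)%R)) w `^ r)%E) = fun w => ((c `^ r)%:E * ((EFin \o F) w `^ r))%E.
    by apply/funext => w; rewrite /= powRM// ltW.
  have I0 : (0 <= sint (whitney a1 a2 z) (fun w => (EFin \o F) w `^ r))%E.
    by apply: sint_ge0; [exact: whitney_upper|move=> w _; exact: poweR_ge0].
  rewrite sint_scale ?powR_ge0//.
  - by rewrite poweRM// ?lee_fin ?powR_ge0// cpow.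
  - exact: measurable_whitney.
  - exact: whitney_upper.
  - exact: nng_pow.
  - by move=> w _; exact: poweR_ge0.
have -> : WR a1 a2 r%:E (EFin \o (fun z => c * F z)) = fun z => (c%:E * g z)%E by apply/funext.
pose G z := (g z `^ q * ((z.2 ^+ n.+1)^-1)%R%:E)%E.
have G0 z : upper z -> (0 <= G z)%E.
  by move=> z0; apply: mule_ge0; [exact: poweR_ge0|rewrite lee_fin invr_ge0 exprn_ge0// ltW].
have mG : measurable_fun setT G.
  apply: emeasurable_funM; first exact: (measurableT_comp (measurable_poweR q) mg).
  apply/(@measurable_EFinP _ _ _ _ (fun z : P => (z.2 ^+ n.+1)^-1)).
  exact: (measurableT_comp (@measurable_invr R) (measurable_funX n.+1 measurable_snd)).
have coneu (x : T) : cone x `<=` @upper R n by move=> z [].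
have mcone (x : T) : measurable (cone x).
  by have := measurable_pair1 x measurableT (@measurable_cone_family R n); rewrite setTI.
rewrite /tnorm.
have S0 x : (0 <= sint (cone x) G)%E by apply: sint_ge0; [exact: coneu|exact: G0].
have SE x : sint (cone x) (fun z => (c%:E * g z) `^ q * ((z.2 ^+ n.+1)^-1)%R%:E)%E = ((c `^ q)%:E * sint (cone x) G)%E.
  rewrite -(sint_scale (powR_ge0 c q) (mcone x) (coneu x) mG G0).
  congr fint; apply/funext => z; rewrite /restr; case: asboolP => // xz.
  by rewrite poweRM ?lee_fin ?(ltW c0) ?g0//; [rewrite muleA|exact: coneu xz].
have fE x : ((sint (cone x) (fun z => (c%:E * g z) `^ q * ((z.2 ^+ n.+1)^-1)%R%:E)%E `^ q^-1) `^ p =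
    (c `^ p)%:E * ((sint (cone x) G `^ q^-1) `^ p))%E.
  by rewrite SE poweRM ?lee_fin ?powR_ge0// cpow// poweRM ?lee_fin ?(ltW c0) ?poweR_ge0// poweR_EFin.
have -> : (fun x : T => ((sint (cone x) (fun z => (c%:E * g z) `^ q * ((z.2 ^+ n.+1)^-1)%R%:E)%E `^ q^-1) `^ p)%E) =
    fun x => ((c `^ p)%:E * ((sint (cone x) G `^ q^-1) `^ p))%E by apply/funext.
have mf : measurable_fun setT (fun x : T => ((sint (cone x) G `^ q^-1) `^ p)%E).
  apply: (measurableT_comp (measurable_poweR p)); apply: (measurableT_comp (measurable_poweR _)).
  by apply: (measurable_sint (@measurable_cone_family R n)) => //.
have f0 x : (0 <= (sint (cone x) G `^ q^-1) `^ p)%E by exact: poweR_ge0.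
rewrite iintE; last 2 first.
- by apply: emeasurable_funM => //; exact: measurable_cst.
- by move=> x; apply: mule_ge0; rewrite ?lee_fin ?powR_ge0.
rewrite ge0_integralZl//; last by rewrite lee_fin powR_ge0.
rewrite -iintE// poweRM ?lee_fin ?powR_ge0//; first by rewrite cpow.
exact: iint_ge0.
Qed.

End general_duality.

(** * Iterated integrals of integrable functions *)

Lemma integral_lam_signed (R : realType) (F : R -> \bar R) : measurable_fun setT F ->
  (\int[@lebesgue_measure R]_x F x = \int[lam R]_x F x)%E.
Proof.
move=> mF; rewrite integralE [RHS]integralE; congr (_ - _)%E; apply: integral_lam => //.
- exact: measurable_funepos.
- exact: measurable_funeneg.
Qed.

(** The integral of a signed function is by definition the difference of the integrals of its two
    parts, and each of these is measurable in the parameter by Tonelli. *)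
Lemma measurable_iint (R : realType) n d (T1 : measurableType d) (F : T1 * n.-tuple R -> \bar R) :
  measurable_fun setT F -> measurable_fun setT (fun x => iint (fun y => F (x, y))).
Proof.
elim: n d T1 F => [|n IH] d T1 F mF /=.
  exact: (measurableT_comp mF (measurable_pair2 _)).
pose psi (w : T1 * R) := iint (fun y => F (w.1, [tuple of w.2 :: y])).
have mpsi : measurable_fun setT psi.
  apply: (IH _ _ (fun u : (T1 * R) * n.-tuple R => F (u.1.1, [tuple of u.1.2 :: u.2]))).
  apply: (measurableT_comp mF); apply: measurable_fun_pair; first exact: (measurableT_comp measurable_fst measurable_fst).
  apply: (@measurable_cons _ _ _ _ (fun u : (T1 * R) * n.-tuple R => u.1.2) n (fun u => u.2)).
    exact: (measurableT_comp measurable_snd measurable_fst).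
  exact: measurable_snd.
rewrite (_ : (fun x => _) = fun x => (\int[lam R]_a (psi^\+ (x, a)) - \int[lam R]_a (psi^\- (x, a)))%E); last first.
  apply/funext => x; rewrite integral_lam_signed; last exact: (measurableT_comp mpsi (measurable_pair1 x)).
  rewrite integralE; congr (_ - _)%E; apply: eq_integral => a _; first by rewrite !funeposE.
  by rewrite !funenegE.
apply: emeasurable_funB.
- by apply: (@measurable_int1 _ _ _ _ _ (lam R) (psi^\+)%E); [exact: measurable_funepos|move=> w; exact: funepos_ge0].
- by apply: (@measurable_int1 _ _ _ _ _ (lam R) (psi^\-)%E); [exact: measurable_funeneg|move=> w; exact: funeneg_ge0].
Qed.

Section iterated.
Context (R : realType) d1 d2 (T1 : measurableType d1) (T2 : measurableType d2).
Variables (m1 : {sigma_finite_measure set T1 -> \bar R}) (M : {sigma_finite_measure set T2 -> \bar R}).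
Variables (s : R * T1 -> T2) (J : (T1 -> \bar R) -> \bar R).
Hypotheses (ms : measurable_fun setT s)
  (tonelli : forall G : T2 -> \bar R, measurable_fun setT G -> (forall x, 0 <= G x)%E ->
     (\int[M]_z G z = \int[lam R]_x \int[m1]_y G (s (x, y)))%E)
  (JE : forall f : T1 -> \bar R, m1.-integrable setT f -> J f = (\int[m1]_y f y)%E).

(** One step of Fubini's theorem. The inner functional [J] is known to be an integral only on
    integrable slices, that is for almost every x. The map [s] stands either for [tcons] or for an
    exchange of the factors. *)
Lemma iterated_integrable (F : T2 -> \bar R) : M.-integrable setT F ->
  measurable_fun setT (fun x => J (fun y => F (s (x, y)))) ->
  (\int[lam R]_x J (fun y => F (s (x, y))) = \int[M]_z F z)%E.
Proof.
move=> iF mJ; have mF := measurable_int M iF.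
have mp := measurable_funepos mF; have mn := measurable_funeneg mF.
pose A x := (\int[m1]_y F^\+ (s (x, y)))%E; pose B x := (\int[m1]_y F^\- (s (x, y)))%E.
have mA : measurable_fun setT A.
  by apply: (@measurable_int1 _ _ _ _ _ m1 (fun w => F^\+ (s w))%E); [exact: measurableT_comp|move=> w; exact: funepos_ge0].
have mB : measurable_fun setT B.
  by apply: (@measurable_int1 _ _ _ _ _ m1 (fun w => F^\- (s w))%E); [exact: measurableT_comp|move=> w; exact: funeneg_ge0].
have A0 x : (0 <= A x)%E by apply: integral_ge0 => y _; exact: funepos_ge0.
have B0 x : (0 <= B x)%E by apply: integral_ge0 => y _; exact: funeneg_ge0.
have AE : (\int[lam R]_x A x = \int[M]_z F^\+ z)%E by rewrite tonelli.
have BE : (\int[lam R]_x B x = \int[M]_z F^\- z)%E by rewrite tonelli.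
have /integrableP[_ hp] := integrable_funepos measurableT iF.
have /integrableP[_ hn] := integrable_funeneg measurableT iF.
have iA : (lam R).-integrable setT A.
  apply/integrableP; split => //; under eq_integral do rewrite gee0_abs//.
  by rewrite AE; apply: le_lt_trans hp; apply: le_int0 => z; rewrite ?gee0_abs// funepos_ge0.
have iB : (lam R).-integrable setT B.
  apply/integrableP; split => //; under eq_integral do rewrite gee0_abs//.
  by rewrite BE; apply: le_lt_trans hn; apply: le_int0 => z; rewrite ?gee0_abs// funeneg_ge0.
rewrite [RHS]integralE -AE -BE -integralB//.
apply: ae_eq_integral => //; first exact: emeasurable_funB.
have aA := integrable_ae measurableT iA; have aB := integrable_ae measurableT iB.
near=> x => _.
have Ax : A x \is a fin_num by near: x; apply: filterS aA => x; exact.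
have Bx : B x \is a fin_num by near: x; apply: filterS aB => x; exact.
have mFx : measurable_fun setT (fun y => F (s (x, y))).
  exact: (measurableT_comp mF (measurableT_comp ms (measurable_pair1 x))).
rewrite JE.
  rewrite integralE; congr (_ - _)%E; apply: eq_integral => y _; first by rewrite !funeposE.
  by rewrite !funenegE.
apply/integrableP; split => //.
have -> : (\int[m1]_y `|F (s (x, y))| = A x + B x)%E.
  rewrite /A /B -ge0_integralD//.
  - by apply: eq_integral => y _; rewrite -[LHS]/((abse \o F) (s (x, y))) fune_abse.
  - exact: (measurableT_comp mp (measurableT_comp ms (measurable_pair1 x))).
  - exact: (measurableT_comp mn (measurableT_comp ms (measurable_pair1 x))).
by rewrite ltey_eq fin_numD Ax Bx.
Unshelve. all: by end_near. Qed.

End iterated.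

Section signed_integrals.
Variable R : realType.

Lemma iint_integrable n (F : n.-tuple R -> \bar R) : (leb R n).-integrable setT F ->
  iint F = (\int[leb R n]_y F y)%E.
Proof.
elim: n F => [|n IH] F iF.
  have mF := measurable_int _ iF.
  rewrite integralE -!iintE.
  - by rewrite /= {1}(funeposneg F).
  - exact: measurable_funeneg.
  - by move=> x; exact: funeneg_ge0.
  - exact: measurable_funepos.
  - by move=> x; exact: funepos_ge0.
have mF := measurable_int _ iF.
have mJ : measurable_fun setT (fun x => iint (fun y => F (tcons (x, y)))).
  by apply: (@measurable_iint R n _ R (fun w => F (tcons w))); exact: (measurableT_comp mF (@measurable_tcons R n)).
rewrite /= integral_lam_signed//.
apply: (iterated_integrable (@measurable_tcons R n) _ IH iF mJ) => G mG G0.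
have mGt : measurable_fun setT (fun w : R * n.-tuple R => G (tcons w)).
  exact: (measurableT_comp mG (@measurable_tcons R n)).
rewrite -iintE//= integral_lam_signed.
  apply: eq_integral => x _; rewrite iintE//.
  exact: (measurableT_comp mGt (measurable_pair1 x)).
exact: (@measurable_iint R n _ R (fun w => G (tcons w))).
Qed.

Lemma fint_integrable n (F : pt R n -> \bar R) : (leb1 R n).-integrable setT F ->
  fint F = (\int[leb1 R n]_z F z)%E.
Proof.
move=> iF; have mF := measurable_int _ iF.
pose sw (w : R * n.-tuple R) : pt R n := (w.2, w.1).
have msw : measurable_fun setT sw by apply: measurable_fun_pair; [exact: measurable_snd|exact: measurable_fst].
have mJ : measurable_fun setT (fun x => iint (fun y => F (sw (x, y)))).
  by apply: (@measurable_iint R n _ R (fun w => F (sw w))); exact: (measurableT_comp mF msw).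
rewrite /fint integral_lam_signed//.
apply: (iterated_integrable msw _ (@iint_integrable n) iF mJ) => G mG G0.
have mGt : measurable_fun setT (fun w => G (sw w)) by exact: (measurableT_comp mG msw).
rewrite -fintE// /fint integral_lam_signed.
  apply: eq_integral => x _; rewrite iintE//.
  exact: (measurableT_comp mGt (measurable_pair1 x)).
exact: (@measurable_iint R n _ R (fun w => G (sw w))).
Qed.

End signed_integrals.

Section signed_set_integrals.
Variables (R : realType) (n : nat).
Local Notation P := (pt R n).
Local Notation nu := (leb1 R n).
Implicit Types (S : set P) (g : P -> R).

Lemma sint_integrable S (G : P -> \bar R) : nu.-integrable setT (restr S G) -> sint S G = (\int[nu]_z restr S G z)%E.
Proof. exact: fint_integrable. Qed.

End signed_set_integrals.

(** * Densities of bounded functionals *)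

Section representation.
Context d (T : measurableType d) (R : realType) (m : {sigma_finite_measure set T -> \bar R}).
Variable E : nat -> set T.
Hypotheses (mE : forall k, measurable (E k)) (ES : forall k, E k `<=` E k.+1).
Implicit Types (u v : T -> R) (A : set T).

Definition bsupp k u := [/\ measurable_fun setT u, exists c, forall x, `|u x| <= c & forall x, u x != 0 -> E k x].

Lemma bsupp_indic k A : measurable A -> A `<=` E k -> bsupp k (\1_A).
Proof.
move=> mA AE; split; first exact: measurable_indic.
  by exists 1 => x; rewrite indicE; case: (_ \in _); rewrite ?normr1 ?normr0 ?ler01.
by move=> x; rewrite indicE; case: (boolP (x \in A)) => [/set_mem/AE//|_]; rewrite eqxx.
Qed.

Lemma bsupp_lin k u v a b : bsupp k u -> bsupp k v -> bsupp k (fun x => a * u x + b * v x).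
Proof.
move=> [mu [c hc] uE] [mv [c' hc'] vE]; split.
- by apply: measurable_funD; exact: measurable_funM.
- exists (`|a| * c + `|b| * c') => x; apply: le_trans (ler_normD _ _) _.
  by rewrite !normrM lerD// ler_wpM2l.
- move=> x; case: (eqVneq (u x) 0) => [->|/uE//]; rewrite mulr0 add0r.
  by case: (eqVneq (v x) 0) => [->|/vE//]; rewrite mulr0 eqxx.
Qed.

Let Ele k j : (k <= j)%N -> E k `<=` E j.
Proof. by move=> kj x Ex; rewrite -(subnK kj); elim: (j - k)%N => [//|i IH]; rewrite addSn; exact: ES. Qed.

Variable l : (T -> R) -> R.
Hypotheses (lin : forall k u v a b, bsupp k u -> bsupp k v -> l (fun x => a * u x + b * v x) = a * l u + b * l v)
  (bd : forall k, exists M, forall u c, 0 < c -> bsupp k u -> (forall x, `|u x| <= c) -> `|l u| <= M * c)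
  (oc : forall k (B : nat -> set T) e, (forall j, measurable (B j)) -> (forall j, B j.+1 `<=` B j) ->
    (forall x, exists j, ~ B j x) -> 0 < e ->
    exists j, forall A, measurable A -> A `<=` E k `&` B j -> `|l (\1_A)| <= e)
  (ac : forall k A, measurable A -> A `<=` E k -> m A = 0%E -> l (\1_A) = 0).

Let l0 : l (\1_set0) = 0.
Proof. by apply: (@ac 0%N) => //; rewrite measure0. Qed.

Let lU k A B : measurable A -> measurable B -> A `<=` E k -> B `<=` E k -> A `&` B = set0 ->
  l (\1_(A `|` B)) = l (\1_A) + l (\1_B).
Proof.
move=> mA mB AE BE AB; rewrite -[l \1_A]mul1r -[l \1_B]mul1r -(@lin k).
- congr l; apply/funext => x; rewrite !mul1r !indicE in_setU.
  case: (boolP (x \in A)) => [/set_mem xA|_]; case: (boolP (x \in B)) => [/set_mem xB|_]; rewrite ?addr0 ?add0r//.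
  by have : set0 x by rewrite -AB.
- exact: bsupp_indic.
- exact: bsupp_indic.
Qed.

Section charge_of_layer.
Variable k : nat.

(** The real-valued set function given by [l] on subsets of [E k]. Order continuity makes it a
    charge, to which the Radon-Nikodym theorem applies. *)
Definition layer_charge A : \bar R := (l (\1_(A `&` E k)))%:E.

Let charge0 : layer_charge set0 = 0%E. Proof. by rewrite /layer_charge set0I l0. Qed.

Let charge_fin A : measurable A -> layer_charge A \is a fin_num. Proof. by []. Qed.

Let charge_additive : semi_sigma_additive layer_charge.
Proof.
move=> F mF tF mUF.
(* The tails of the union decrease to the empty set, and by finite additivity the error of a partial
   sum is [l] of the tail, which is small by [oc]. *)
pose B j := \bigcup_(i in [set i | (j <= i)%N]) F i.
have mB j : measurable (B j) by apply: bigcup_measurable => i _.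
have split j : \bigcup_i F i = \big[setU/set0]_(i < j) F i `|` B j.
  rewrite -bigcup_mkord; apply/seteqP; split => x.
    by move=> [i _ Fx]; case: (ltnP i j) => ij; [left|right]; exists i.
  by move=> [[i _ Fx]|[i _ Fx]]; exists i.
have disj j : (\big[setU/set0]_(i < j) F i) `&` B j = set0.
  rewrite -bigcup_mkord -subset0 => x [[i /= ij Fi] [i' /= ij' Fi']].
  have e := tF i i' I I (ex_intro _ x (conj Fi Fi')).
  by rewrite e ltnNge ij' in ij.
have mU j : measurable (\big[setU/set0]_(i < j) F i) by apply: bigsetU_measurable.
have sumE j : (\sum_(0 <= i < j) layer_charge (F i) = layer_charge (\big[setU/set0]_(i < j) F i))%E.
  elim: j => [|j IH]; first by rewrite big_nil big_ord0 charge0.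
  rewrite big_nat_recr//= IH big_ord_recr /= /layer_charge setIUl (@lU k)//.
  - exact: measurableI (mU j) (mE k).
  - exact: measurableI.
  - rewrite setIACA setIid (_ : _ `&` F j = set0) ?set0I//.
    by apply/seteqP; split => // x [hx Fx]; have : set0 x by rewrite -(disj j); split => //; exists j => /=.
apply/fine_cvgP; split; first by apply: nearW => j; rewrite sumE.
apply/cvgrPdist_le => /= e e0.
have [|||j hj] := @oc k B e _ _ _ e0.
- exact: mB.
- by move=> i x [i' /= h Fx]; exists i' => //=; exact: ltnW.
- move=> x; have [[i Fx]|h] := pselect (exists i, F i x).
    exists i.+1 => -[i' /= ii' Fx']; have e1 := tF i i' I I (ex_intro _ x (conj Fx Fx')).
    by rewrite e1 ltnn in ii'.
  by exists 0%N => -[i _ Fx]; apply: h; exists i.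
exists j => // i /= ji; rewrite sumE /= /layer_charge (split i) setIUl (@lU k).
- rewrite addrAC subrr add0r; apply: hj; first exact: measurableI.
  by move=> x [[i' /= h Fx] Ex]; split => //; exists i' => //=; exact: leq_trans h.
- exact: measurableI.
- exact: measurableI.
- by [].
- by [].
- by rewrite setIACA disj set0I.
Qed.

HB.instance Definition _ := isCharge.Build _ _ _ layer_charge charge0 charge_fin charge_additive.

Lemma layer_density : exists g : T -> R, m.-integrable setT (EFin \o g) /\
  forall A, measurable A -> A `<=` E k -> (l (\1_A))%:E = (\int[m]_(x in A) (g x)%:E)%E.
Proof.
have dom : layer_charge `<< m.
  move=> N nN A mA AN; rewrite /layer_charge (@ac k) => //; first exact: measurableI.
  by apply: nN; [exact: measurableI|move=> x [/AN]].
pose f := Radon_Nikodym layer_charge m.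
have fE : EFin \o (fine \o f) = f by apply/funext => x /=; rewrite fineK// Radon_Nikodym_fin_num.
exists (fine \o f); rewrite fE; split; first exact: Radon_Nikodym_integrable.
move=> A mA AE; under eq_integral => x _ do rewrite /= fineK ?Radon_Nikodym_fin_num//.
rewrite -Radon_Nikodym_integral// /layer_charge; congr (l (\1__))%:E.
by apply/seteqP; split => x; [move=> Ax; split => //; exact: AE|case].
Qed.

End charge_of_layer.

Let dens k : T -> R := sval (cid (layer_density k)).
Let dens_int k : m.-integrable setT (EFin \o dens k).
Proof. exact: (svalP (cid (layer_density k))).1. Qed.
Let densE k A : measurable A -> A `<=` E k -> (l (\1_A))%:E = (\int[m]_(x in A) (dens k x)%:E)%E.
Proof. exact: (svalP (cid (layer_density k))).2. Qed.

(** The earlier density is kept on [E j]. Successive densities thus agree everywhere on earlier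
    layers, not merely almost everywhere, and a pointwise limit exists. *)
Fixpoint glue k (x : T) : R :=
  if k is j.+1 then if x \in E j then glue j x else dens k x else dens 0 x.

Let glueS k x : E k x -> glue k.+1 x = glue k x.
Proof. by move=> Ex; rewrite /= mem_set. Qed.

Let glue_stable k j x : (k <= j)%N -> E k x -> glue j x = glue k x.
Proof.
move=> kj Ex; rewrite -(subnK kj); elim: (j - k)%N => [//|i IH]; rewrite addSn glueS//.
exact: Ele (leq_addl _ _) _ Ex.
Qed.

Let glue_split k : glue k.+1 = fun x => \1_(E k) x * glue k x + \1_(~` E k) x * dens k.+1 x.
Proof.
apply/funext => x; rewrite /= !indicE in_setC.
by case: (x \in E k); rewrite /= ?mul1r ?mul0r ?add0r ?addr0.
Qed.

Let int_indic A (g : T -> R) : measurable A -> m.-integrable setT (EFin \o g) ->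
  m.-integrable setT (EFin \o (fun x => \1_A x * g x)).
Proof.
move=> mA ig; apply: (le_integrable measurableT _ _ ig).
  apply/(@measurable_EFinP _ _ _ _ (fun x => \1_A x * g x)); apply: measurable_funM; first exact: measurable_indic.
  by have /measurable_EFinP := measurable_int _ ig.
by move=> x _; rewrite /= lee_fin normrM indicE; case: (_ \in _); rewrite ?normr1 ?normr0 ?mul1r ?mul0r.
Qed.

Let glue_int k : m.-integrable setT (EFin \o glue k).
Proof.
elim: k => [|k IH]; first exact: dens_int.
rewrite glue_split.
apply: (@eq_integrable _ _ _ m setT measurableT ((EFin \o (fun x => \1_(E k) x * glue k x)%R) \+ (EFin \o (fun x => \1_(~` E k) x * dens k.+1 x)%R))%E).
  by move=> x _; rewrite /= EFinD.
by apply: integrableD => //; [exact: int_indic|apply: int_indic; [exact: measurableC|exact: dens_int]].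
Qed.

Let glueE k A : measurable A -> A `<=` E k -> (l (\1_A))%:E = (\int[m]_(x in A) (glue k x)%:E)%E.
Proof.
elim: k A => [|k IH] A mA AE; first exact: densE.
have AU : A = (A `&` E k) `|` (A `\` E k) by rewrite setUIDK.
have mI : measurable (A `&` E k) by exact: measurableI.
have mD : measurable (A `\` E k) by exact: measurableD.
have dj : (A `&` E k) `&` (A `\` E k) = set0 by rewrite -subset0 => x [[_ h] [_ /(_ h)]].
rewrite AU (@lU k.+1)//; last 2 first.
- by move=> x [/AE].
- by move=> x [/AE].
rewrite integral_setU//; last 2 first.
- by apply: measurable_funTS; exact: measurable_int (glue_int k.+1).
- by apply/disj_setPS; rewrite dj.
rewrite EFinD IH//.
rewrite (@densE k.+1)//; last by move=> x [/AE].
congr (_ + _)%E; apply: eq_integral => x /set_mem[_ h].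
  by rewrite glueS.
by rewrite /= memNset.
Qed.

Let level x : nat := xget 0%N [set k | E k x].
Let h x : R := if pselect (exists k, E k x) then glue (level x) x else 0.

Let hE k x : E k x -> h x = glue k x.
Proof.
move=> Ex; rewrite /h; case: pselect => [ex|]; last by case; exists k.
have El : E (level x) x by exact: (@xgetI _ 0%N [set j | E j x] k Ex).
have [le|/ltnW le] := leqP k (level x); last by rewrite -(glue_stable le).
exact: glue_stable.
Qed.

Let mh : measurable_fun setT h.
Proof.
apply: (@measurable_fun_cvg _ _ _ _ (fun k x => \1_(E k) x * glue k x)) => //.
  move=> k; apply: measurable_funM; first exact: measurable_indic.
  by have /measurable_EFinP := measurable_int _ (glue_int k).
move=> x _; have [[k Ex]|nE] := pselect (exists k, E k x).
  apply/cvgrPdist_le => e e0; exists k => // j /= kj.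
  have Ej : E j x by exact: Ele Ex.
  by rewrite indicE mem_set// mul1r (hE Ej) subrr normr0 ltW.
apply/cvgrPdist_le => e e0; apply: nearW => j.
rewrite indicE memNset ?mul0r; last by move=> Ex; apply: nE; exists j.
by rewrite /h; case: pselect => //= _; rewrite subrr normr0 ltW.
Qed.

Let bounded_int k u : bsupp k u -> m.-integrable setT (EFin \o (fun x => u x * glue k x)).
Proof.
move=> [mu [c hc] _]; have c0 x : 0 <= c := le_trans (normr_ge0 (u x)) (hc x).
apply: (le_integrable measurableT _ _ (integrableZl measurableT c (glue_int k))).
  apply/(@measurable_EFinP _ _ _ _ (fun x => u x * glue k x)); apply: measurable_funM => //.
  by have /measurable_EFinP := measurable_int _ (glue_int k).
move=> x _; rewrite /= lee_fin !normrM ler_wpM2r//.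
by rewrite (ger0_norm (c0 x)).
Qed.

Let bounded_hE k u : bsupp k u -> (fun x => u x * h x) = (fun x => u x * glue k x).
Proof.
move=> [_ _ uE]; apply/funext => x; case: (eqVneq (u x) 0) => [->|/uE Ex]; first by rewrite !mul0r.
by rewrite (hE Ex).
Qed.
Let defect k u := l u - \int[m]_x (u x * glue k x).

Let defect_lin k u v a b : bsupp k u -> bsupp k v ->
  defect k (fun x => a * u x + b * v x) = a * defect k u + b * defect k v.
Proof.
move=> bu bv; rewrite /defect (@lin k)//.
have iu := bounded_int bu; have iv := bounded_int bv.
have ia w c : bsupp k w -> m.-integrable setT (EFin \o (fun x => c * (w x * glue k x))).
  move=> bw; apply: (@eq_integrable _ _ _ m setT measurableT (fun x => c%:E * (w x * glue k x)%R%:E)%E) => //.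
  exact: (integrableZl measurableT c (bounded_int bw)).
have -> : \int[m]_x ((a * u x + b * v x) * glue k x) =
    \int[m]_x (a * (u x * glue k x) + b * (v x * glue k x)).
  by apply: eq_Rintegral => x _; rewrite mulrDl !mulrA.
rewrite RintegralD//; [|exact: ia|exact: ia].
by rewrite !RintegralZl//; ring.
Qed.

Let defect_indic k A : measurable A -> A `<=` E k -> defect k (\1_A) = 0.
Proof.
move=> mA AE; rewrite /defect; apply/eqP; rewrite subr_eq0; apply/eqP.
rewrite -[LHS]/(fine (l \1_A)%:E) (glueE mA AE) /Rintegral; congr fine.
rewrite [LHS]integral_mkcond; apply: eq_integral => x _.
by rewrite patchE /= indicE; case: (_ \in _); rewrite ?mul1r ?mul0r.
Qed.

Let defect_bound k : exists2 M, 0 <= M & forall u c, 0 < c -> bsupp k u -> (forall x, `|u x| <= c) -> `|defect k u| <= M * c.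
Proof.
have [M hM] := bd k; pose J := \int[m]_x `|glue k x|.
have J0 : 0 <= J by apply: Rintegral_ge0.
have Jc u c : 0 < c -> bsupp k u -> (forall x, `|u x| <= c) -> `|\int[m]_x (u x * glue k x)| <= J * c.
  move=> c0 bu hc; apply: le_trans (le_normr_Rintegral measurableT (bounded_int bu)) _.
  rewrite mulrC -RintegralZl//; last exact: (integrable_abse (glue_int k)).
  apply: le_Rintegral => //.
  - exact: (integrable_abse (bounded_int bu)).
  - apply: (@eq_integrable _ _ _ m setT measurableT (fun x => c%:E * (`|glue k x|)%:E)%E) => //.
    exact: (integrableZl measurableT c (integrable_abse (glue_int k))).
  - by move=> x _; rewrite normrM ler_wpM2r.
exists (`|M| + J); first by rewrite addr_ge0.
move=> u c c0 bu hc; rewrite /defect mulrDl; apply: le_trans (ler_normB _ _) _; apply: lerD; last exact: Jc.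
by apply: le_trans (hM u c c0 bu hc) _; apply: ler_wpM2r; [exact: ltW|exact: ler_norm].
Qed.

(* Removing [c/2] times the indicator of [u >= c/2] halves the bound of [u] without
   changing the defect, which is therefore zero. *)
Let defect_halving k i u c : bsupp k u -> (forall x, 0 <= u x <= c) ->
  exists2 v, bsupp k v & (forall x, 0 <= v x <= c / 2 ^+ i) /\ defect k u = defect k v.
Proof.
move=> bu; elim: i => [|i IH] hu; first by exists u => //; rewrite expr0 divr1.
have [v bv [hv ->]] := IH hu; set c' := c / 2 ^+ i in hv.
pose A := [set x | E k x /\ c' / 2 <= v x].
have mA : measurable A.
  apply: measurableI => //; rewrite -[X in measurable X]setTI.
  by case: bv => mv _ _; apply: (@measurable_fun_le _ _ _ setT (cst (c' / 2)) v).
have AE : A `<=` E k by move=> x [].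
have bA := bsupp_indic mA AE.
exists (fun x => 1 * v x + (- (c' / 2)) * \1_A x); first exact: bsupp_lin.
split; last by rewrite defect_lin// defect_indic// mulr0 addr0 mul1r.
move=> x; have /andP[v0 vc] := hv x.
have -> : c / 2 ^+ i.+1 = c' / 2 by rewrite exprSr invfM mulrA.
rewrite indicE mul1r; case: (boolP (x \in A)) => [/set_mem[_ h1]|/negP nA].
  by rewrite mulr1; apply/andP; split; lra.
rewrite mulr0 addr0 v0 /=; apply: contrapT => /negP; rewrite -ltNge => h1.
apply: nA; apply/mem_set; split; last exact: ltW.
by case: bv => _ _; apply; apply: contraTneq h1 => ->; rewrite -leNgt divr_ge0// (le_trans v0).
Qed.

Let defect0 k u c : 0 < c -> bsupp k u -> (forall x, 0 <= u x <= c) -> defect k u = 0.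
Proof.
move=> c0 bu hu; have [M M0 hM] := defect_bound k.
apply/eqP; rewrite -normr_eq0 eq_le normr_ge0 andbT; apply/ler_addgt0Pl => e e0; rewrite addr0.
pose i := Num.bound (M * c / e).
have [v bv [hv ->]] := defect_halving i bu hu.
have hv' y : `|v y| <= c / 2 ^+ i by have /andP[h1 h2] := hv y; rewrite ger0_norm.
apply: le_trans (hM v _ _ bv hv') _; first by rewrite divr_gt0.
have i2 : 0 < 2 ^+ i :> R by rewrite exprn_gt0.
rewrite mulrA ler_pdivrMr//.
have := archi_boundP (_ : 0 <= M * c / e); rewrite divr_ge0 ?mulr_ge0 ?(ltW e0) ?(ltW c0)// => /(_ isT).
rewrite ltr_pdivrMr// => h1; apply: le_trans (ltW h1) _; rewrite mulrC ler_wpM2l ?(ltW e0)//.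
by rewrite -natrX ler_nat ltnW// ltn_expl.
Qed.

(** Here [oc] gives countable additivity on each layer, [ac] the density, and [bd] the passage from
    indicators to bounded functions. The sign of u is removed by splitting it into positive and
    negative parts. *)
Lemma bounded_functional_density : exists2 h : T -> R, measurable_fun setT h & forall k u, bsupp k u ->
  m.-integrable setT (EFin \o (fun x => u x * h x)) /\ l u = \int[m]_x (u x * h x).
Proof.
exists h; [exact: mh|move=> k u bu]; rewrite (bounded_hE bu); split; first exact: bounded_int.
apply/eqP; rewrite -subr_eq0; apply/eqP; rewrite -/(defect k u).
have [mu [c0 hc0] uE] := bu; pose c := `|c0| + 1; have cp : 0 < c by rewrite ltr_wpDl.
have hc x : `|u x| <= c := le_trans (hc0 x) (le_trans (ler_norm c0) (ler_wpDr ler01 (lexx _))).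
have pos (s : R) : `|s| = 1 -> exists2 v, bsupp k v /\ (forall x, 0 <= v x <= c) & forall x, v x = Num.max (s * u x) 0.
  move=> s1; exists (fun x => Num.max (s * u x) 0) => //.
  have hv x : 0 <= Num.max (s * u x) 0 <= c.
    rewrite le_max lexx orbT ge_max (ltW cp) andbT /=.
    by apply: le_trans (hc x); apply: le_trans (ler_norm _) _; rewrite normrM s1 mul1r.
  split => //; split.
  - by apply: measurable_maxr => //; apply: measurable_funM.
  - by exists c => x; have /andP[h1 h2] := hv x; rewrite ger0_norm.
  - by move=> x; case: (eqVneq (u x) 0) => [->|/uE//]; rewrite mulr0 maxxx eqxx.
have [v [bv hv] vE] := pos 1 (normr1 _); have [w [bw hw] wE] := pos (-1) (normrN1 _).
have -> : u = fun x => 1 * v x + (-1) * w x.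
  apply/funext => x; rewrite vE wE !mul1r !mulN1r.
  by have [h1|h1] := leP (u x) 0; have [h2|h2] := leP (- u x) 0; lra.
by rewrite defect_lin// (defect0 cp bv hv) (defect0 cp bw hw) !mulr0 addr0.
Qed.

End representation.

(** * Complex integrals *)

Section complex_modulus.
Variable R : realType.
Implicit Types (z w : R[i]) (x : R).

Lemma cabsE z : `|z| = (cabs z)%:C%C. Proof. by case: z. Qed.

Lemma cabs_ge0 z : 0 <= cabs z. Proof. exact: sqrtr_ge0. Qed.

Lemma cabsM z w : cabs (z * w) = cabs z * cabs w.
Proof. by apply: complexI; rewrite -cabsE normrM !cabsE rmorphM. Qed.

Lemma cabsD z w : cabs (z + w) <= cabs z + cabs w.
Proof. by rewrite -lecR rmorphD /= -!cabsE; exact: ler_normD. Qed.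

Lemma cabs_real x : cabs x%:C%C = `|x|.
Proof. by rewrite /cabs /= expr0n /= addr0 sqrtr_sqr. Qed.

Lemma cabs_eq0 z : cabs z = 0 -> z = 0.
Proof. by move=> z0; apply/eqP; rewrite -normr_eq0 cabsE z0. Qed.

Lemma cabs0 : cabs (0 : R[i]) = 0.
Proof. by rewrite -[RHS](normr0 R) -cabs_real. Qed.

Lemma cabs_Re z : `|complex.Re z| <= cabs z.
Proof. by rewrite -sqrtr_sqr /cabs ler_wsqrtr// lerDl sqr_ge0. Qed.

Lemma cabs_Im z : `|complex.Im z| <= cabs z.
Proof. by rewrite -sqrtr_sqr /cabs ler_wsqrtr// lerDr sqr_ge0. Qed.

Lemma cabs_le z : cabs z <= `|complex.Re z| + `|complex.Im z|.
Proof.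
rewrite -[leRHS]ger0_norm ?addr_ge0// -sqrtr_sqr /cabs ler_wsqrtr//.
have h (x : R) : x ^+ 2 = `|x| ^+ 2 by rewrite real_normK ?num_real.
rewrite (h (complex.Re z)) (h (complex.Im z)).
by have := mulr_ge0 (normr_ge0 (complex.Re z)) (normr_ge0 (complex.Im z)); nra.
Qed.

Lemma Re_mul z w : complex.Re (z * w) = complex.Re z * complex.Re w - complex.Im z * complex.Im w.
Proof. by case: z; case: w. Qed.

Lemma Im_mul z w : complex.Im (z * w) = complex.Re z * complex.Im w + complex.Im z * complex.Re w.
Proof. by case: z; case: w. Qed.

Lemma Re_add z w : complex.Re (z + w) = complex.Re z + complex.Re w.
Proof. by case: z; case: w. Qed.

Lemma Im_add z w : complex.Im (z + w) = complex.Im z + complex.Im w.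
Proof. by case: z; case: w. Qed.

Lemma complex_ext z w : complex.Re z = complex.Re w -> complex.Im z = complex.Im w -> z = w.
Proof. by case: z; case: w => a b c e /= -> ->. Qed.

(* The conjugate phase, with value 0 at 0 because [0^-1 = 0]. *)
Definition phase z : R[i] := (z^*)%C * (cabs z)^-1%:C%C.

Lemma phaseM z : phase z * z = (cabs z)%:C%C.
Proof.
rewrite /phase; case: (eqVneq (cabs z) 0) => [z0|z0].
  by rewrite (cabs_eq0 z0) mulr0 cabs0.
have h : (z^*)%C * z = (cabs z ^+ 2)%:C%C by rewrite mulrC -sqr_normc cabsE rmorphXn.
by rewrite mulrAC h -rmorphM /= expr2 mulfK.
Qed.

Lemma cabs_phase z : cabs (phase z) <= 1.
Proof.
rewrite /phase cabsM cabs_real ger0_norm ?invr_ge0 ?cabs_ge0//.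
have -> : cabs (z^*)%C = cabs z by apply: complexI; rewrite -!cabsE normcJ.
by case: (eqVneq (cabs z) 0) => [->|z0]; [rewrite mul0r|rewrite mulfV].
Qed.

End complex_modulus.

Section complex_integral.
Variables (R : realType) (n : nat).
Local Notation P := (pt R n).
Local Notation nu := (leb1 R n).
Local Notation up := (@upper R n).
Implicit Types (F G : P -> R[i]) (g : P -> R).

Lemma cmeasurable_real g : measurable_fun setT g -> cmeasurable (fun z => (g z)%:C%C).
Proof. by move=> mg; split => //; exact: measurable_cst. Qed.

Lemma cmeasurableM F G : cmeasurable F -> cmeasurable G -> cmeasurable (fun z => F z * G z).
Proof.
move=> [m1 m2] [m3 m4]; split.
  rewrite (_ : (fun z => _) = fun z => complex.Re (F z) * complex.Re (G z) - complex.Im (F z) * complex.Im (G z)).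
    by apply: measurable_funB; exact: measurable_funM.
  by apply/funext => z; rewrite Re_mul.
rewrite (_ : (fun z => _) = fun z => complex.Re (F z) * complex.Im (G z) + complex.Im (F z) * complex.Re (G z)).
  by apply: measurable_funD; exact: measurable_funM.
by apply/funext => z; rewrite Im_mul.
Qed.

Lemma cmeasurable_cst (a : R[i]) : cmeasurable (fun _ : P => a).
Proof. by split; exact: measurable_cst. Qed.

Lemma cmeasurable_lin (a b : R[i]) F G : cmeasurable F -> cmeasurable G -> cmeasurable (fun z => a * F z + b * G z).
Proof.
move=> /(cmeasurableM (cmeasurable_cst a))[m1 m2] /(cmeasurableM (cmeasurable_cst b))[m3 m4].
split; [rewrite (_ : (fun z => _) = fun z => complex.Re (a * F z) + complex.Re (b * G z))|
        rewrite (_ : (fun z => _) = fun z => complex.Im (a * F z) + complex.Im (b * G z))].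
- exact: measurable_funD.
- by apply/funext => z; rewrite Re_add.
- exact: measurable_funD.
- by apply/funext => z; rewrite Im_add.
Qed.

Lemma measurable_cabs F : cmeasurable F -> measurable_fun setT (fun z => cabs (F z)).
Proof.
move=> [m1 m2]; rewrite (_ : (fun z => _) = fun z => (complex.Re (F z) ^+ 2 + complex.Im (F z) ^+ 2) `^ 2^-1).
  apply: (measurableT_comp (measurable_powR _)).
  by apply: measurable_funD; exact: measurable_funX.
by apply/funext => z; rewrite powR12_sqrt// addr_ge0// sqr_ge0.
Qed.

Lemma cmeasurable_phase F : cmeasurable F -> cmeasurable (fun z => phase (F z)).
Proof.
move=> mF; apply: cmeasurableM.
  case: mF => m1 m2; split.
    by rewrite (_ : (fun z => _) = fun z => complex.Re (F z))//; apply/funext => z; case: (F z).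
  rewrite (_ : (fun z => _) = fun z => - complex.Im (F z)); first exact: measurable_funN.
  by apply/funext => z; case: (F z).
apply: cmeasurable_real; exact: (measurableT_comp (@measurable_invr R) (measurable_cabs mF)).
Qed.

Lemma eq_sint (S : set P) (g g' : P -> \bar R) : (forall z, S z -> g z = g' z) -> sint S g = sint S g'.
Proof. by move=> h; congr fint; apply/funext => z; rewrite /restr; case: asboolP => // /h. Qed.

Lemma sint0 (S : set P) : sint S (fun=> 0%E) = 0%E.
Proof.
rewrite /sint (_ : restr S _ = fun=> 0%E); last by apply/funext => z; rewrite /restr; case: asboolP.
by rewrite fintE// integral0.
Qed.

Local Notation on_upper g := (fun z : P => (\1_up z : R) * g z).

Let mon_upper g : measurable_fun setT g -> measurable_fun setT (on_upper g).
Proof. by move=> mg; apply: measurable_funM => //; apply: measurable_indic; exact: measurable_upper. Qed.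

Lemma sint_upper g : (forall z, 0 <= g z) -> measurable_fun setT g ->
  sint up (fun z => (g z)%:E) = (\int[nu]_z (on_upper g z)%:E)%E.
Proof. by move=> g0 mg; rewrite (sint_real (@measurable_upper R n) mg g0). Qed.

Lemma fine_sint g : nu.-integrable setT (EFin \o on_upper g) ->
  fine (sint up (fun z => (g z)%:E)) = \int[nu]_z (on_upper g z).
Proof.
have e : restr up (fun z => (g z)%:E) = EFin \o on_upper g by apply/funext => z; rewrite restr_indic.
by move=> ig; rewrite sint_integrable e.
Qed.

Lemma hintegrableP F : cmeasurable F -> hintegrable F <->
  nu.-integrable setT (EFin \o on_upper (fun z => complex.Re (F z))) /\
  nu.-integrable setT (EFin \o on_upper (fun z => complex.Im (F z))).
Proof.
move=> mF; have mc := measurable_cabs mF; have [m1 m2] := mF.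
have i1 z : `|(\1_up z : R)| = \1_up z by rewrite ger0_norm// indicE.
split=> [[_]|[/integrableP[_ h1] /integrableP[_ h2]]].
  rewrite sint_upper//; last by move=> z; exact: cabs_ge0.
  move=> hF; have ic : nu.-integrable setT (EFin \o on_upper (fun z => cabs (F z))).
    apply/integrableP; split; first by apply/measurable_EFinP; exact: mon_upper.
    under eq_integral => z _ do rewrite /= ger0_norm ?mulr_ge0 ?cabs_ge0//.
    exact: hF.
  split; apply: (le_integrable measurableT _ _ ic).
  - by apply/measurable_EFinP; exact: mon_upper.
  - by move=> z _; rewrite /= lee_fin !normrM ler_wpM2l// (ger0_norm (cabs_ge0 _)) cabs_Re.
  - by apply/measurable_EFinP; exact: mon_upper.
  - by move=> z _; rewrite /= lee_fin !normrM ler_wpM2l// (ger0_norm (cabs_ge0 _)) cabs_Im.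
split => //; rewrite sint_upper//; last by move=> z; exact: cabs_ge0.
apply: (@le_lt_trans _ _ (\int[nu]_z (`|(on_upper (fun z => complex.Re (F z)) z)%:E| + `|(on_upper (fun z => complex.Im (F z)) z)%:E|))%E).
  apply: le_int0 => z; first by rewrite lee_fin mulr_ge0 ?cabs_ge0.
  by rewrite /= -EFinD lee_fin !normrM i1 -mulrDr ler_wpM2l ?cabs_le// indicE.
rewrite ge0_integralD//.
- by rewrite lte_add_pinfty.
- by apply: measurableT_comp => //; apply/measurable_EFinP; exact: mon_upper.
- by apply: measurableT_comp => //; apply/measurable_EFinP; exact: mon_upper.
Qed.

Local Notation Iu g := (\int[nu]_z (on_upper g z)).

Lemma hint_cE F : hintegrable F ->
  hint_c F = (Iu (fun z => complex.Re (F z)) +i* Iu (fun z => complex.Im (F z)))%C.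
Proof. by move=> iF; have [h1 h2] := (hintegrableP iF.1).1 iF; rewrite /hint_c !fine_sint. Qed.

Let Iu_lin (a b : R) g g' : nu.-integrable setT (EFin \o on_upper g) -> nu.-integrable setT (EFin \o on_upper g') ->
  nu.-integrable setT (EFin \o on_upper (fun z => a * g z + b * g' z)) /\
  Iu (fun z => a * g z + b * g' z) = a * Iu g + b * Iu g'.
Proof.
move=> ig ig'.
have iZ c h : nu.-integrable setT (EFin \o on_upper h) -> nu.-integrable setT (EFin \o (fun z => c * on_upper h z)).
  move=> ih; apply: (@eq_integrable _ _ _ nu setT measurableT (fun z => c%:E * (on_upper h z)%:E)%E) => //.
  exact: (integrableZl measurableT c ih).
have e : on_upper (fun z => a * g z + b * g' z) = fun z => a * on_upper g z + b * on_upper g' z.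
  by apply/funext => z; ring.
rewrite e; split.
  apply: (@eq_integrable _ _ _ nu setT measurableT ((EFin \o (fun z => a * on_upper g z)%R) \+ (EFin \o (fun z => b * on_upper g' z)%R))%E) => //.
  by apply: integrableD => //; exact: iZ.
rewrite RintegralD//; [|exact: iZ|exact: iZ].
by rewrite !RintegralZl.
Qed.

Lemma hintegrable_lin (a b : R[i]) F G : hintegrable F -> hintegrable G ->
  hintegrable (fun z => a * F z + b * G z) /\
  hint_c (fun z => a * F z + b * G z) = a * hint_c F + b * hint_c G.
Proof.
move=> iF iG; have mF := iF.1; have mG := iG.1.
have [/(_ iF)[F1 F2] _] := hintegrableP mF; have [/(_ iG)[G1 G2] _] := hintegrableP mG.
have [f1 e1] := Iu_lin (complex.Re a) (- complex.Im a) F1 F2.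
have [f2 e2] := Iu_lin (complex.Re a) (complex.Im a) F2 F1.
have [g1 e3] := Iu_lin (complex.Re b) (- complex.Im b) G1 G2.
have [g2 e4] := Iu_lin (complex.Re b) (complex.Im b) G2 G1.
have [h1 e5] := Iu_lin 1 1 f1 g1; have [h2 e6] := Iu_lin 1 1 f2 g2.
have mH := cmeasurable_lin a b mF mG.
have E1 : (fun z => complex.Re (a * F z + b * G z)) = (fun z => 1 * (complex.Re a * complex.Re (F z) + - complex.Im a * complex.Im (F z)) +
    1 * (complex.Re b * complex.Re (G z) + - complex.Im b * complex.Im (G z))).
  by apply/funext => z; rewrite Re_add !Re_mul; ring.
have E2 : (fun z => complex.Im (a * F z + b * G z)) = (fun z => 1 * (complex.Re a * complex.Im (F z) + complex.Im a * complex.Re (F z)) +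
    1 * (complex.Re b * complex.Im (G z) + complex.Im b * complex.Re (G z))).
  by apply/funext => z; rewrite Im_add !Im_mul; ring.
have iH : hintegrable (fun z => a * F z + b * G z).
  have K g g' : g = g' -> nu.-integrable setT (EFin \o on_upper g) -> nu.-integrable setT (EFin \o on_upper g') by move=> ->.
  by apply/(hintegrableP mH); split; [exact: K (esym E1) h1|exact: K (esym E2) h2].
have e5' := etrans (congr1 (fun g => Iu g) E1) e5; have e6' := etrans (congr1 (fun g => Iu g) E2) e6.
split => //; rewrite !hint_cE//; apply: complex_ext; rewrite ?Re_add ?Im_add ?Re_mul ?Im_mul /=.
  by apply: (etrans e5'); rewrite e1 e3; ring.
by apply: (etrans e6'); rewrite e2 e4; ring.
Qed.

(** The real and imaginary parts are bounded separately, which costs a factor 2 and is harmless for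
    equivalence of norms. *)
Lemma cabs_hint F c : hintegrable F -> (sint up (fun z => (cabs (F z))%:E) <= c%:E)%E -> cabs (hint_c F) <= c + c.
Proof.
move=> iF hc; have [/(_ iF)[F1 F2] _] := hintegrableP iF.1.
have mc := measurable_cabs iF.1.
have half g : nu.-integrable setT (EFin \o on_upper g) -> (forall z, `|g z| <= cabs (F z)) -> `|Iu g| <= c.
  move=> ig gF; rewrite -lee_fin EFin_normr_Rintegral//.
  apply: (le_trans (le_abse_integral _ measurableT _)); first exact: measurable_int ig.
  apply: le_trans hc; rewrite sint_upper//; last by move=> z; exact: cabs_ge0.
  by apply: le_int0 => z //; rewrite /= lee_fin normrM ger0_norm ?indicE// ler_wpM2l.
rewrite hint_cE//; apply: le_trans (cabs_le _) _ => /=.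
by apply: lerD; apply: half => // z; [exact: cabs_Re|exact: cabs_Im].
Qed.

End complex_integral.

(** * Duality of tent spaces *)

Section tent_duality.
Variables (R : realType) (n : nat) (a1 a2 p q r beta beta0 : R).
Hypotheses (n0 : (0 < n)%N) (a10 : 0 < a1) (a12 : a1 < a2^-1) (a21 : a2^-1 < 1).
Hypotheses (p1 : 1 <= p) (q1 : 1 <= q) (r1 : 1 <= r).
Local Notation P := (pt R n).
Local Notation nu := (leb1 R n).
Local Notation up := (@upper R n).
Implicit Types (F H : P -> R) (f h : P -> R[i]).
Local Notation NX F := (@tnorm R n p%:E q%:E (WR a1 a2 r%:E (EFin \o F))).
Local Notation NY H := (@tnorm R n (conj_exp p) (conj_exp q) (WR a1 a2 (conj_exp r) (EFin \o H))).
Local Notation X := (@inTent R n a1 a2 p%:E q%:E r%:E beta).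
Local Notation nX := (@tent_norm R n a1 a2 p%:E q%:E r%:E beta).
Local Notation Y := (@inTent R n a1 a2 (conj_exp p) (conj_exp q) (conj_exp r) (beta0 - beta)).
Local Notation nY := (@tent_norm R n a1 a2 (conj_exp p) (conj_exp q) (conj_exp r) (beta0 - beta)).
Local Notation exhaust := (@exhaust R n).
Local Notation csupp := (@csupp R n).

Definition wmod (b : R) f (z : P) : R := cabs (wt b f z).

Lemma nXE f : nX f = NX (wmod beta f). Proof. by []. Qed.

Lemma nYE h : nY h = NY (wmod (beta0 - beta) h). Proof. by []. Qed.

Lemma wmodE b f z : wmod b f z = cabs (f z) * z.2 `^ (- b).
Proof. by rewrite /wmod /wt cabsM cabs_real ger0_norm// powR_ge0. Qed.

Lemma measurable_height c : measurable_fun setT (fun z : P => z.2 `^ c).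
Proof. exact: (measurableT_comp (measurable_powR c) measurable_snd). Qed.

Lemma nng_wmod b f : cmeasurable f -> nng (wmod b f).
Proof.
move=> mf; split; last by move=> z; exact: cabs_ge0.
apply: measurable_cabs; apply: cmeasurableM => //; apply: cmeasurable_real; exact: measurable_height.
Qed.

Lemma cmeasurable_pair f h : cmeasurable f -> cmeasurable h -> cmeasurable (pair_integrand beta0 f h).
Proof.
move=> mf mh; apply: cmeasurableM; first exact: cmeasurableM.
by apply: cmeasurable_real; exact: measurable_height.
Qed.

Let height_split (t : R) : 0 < t -> t `^ (- beta0 - 1) = t `^ (- beta) * t `^ (- (beta0 - beta)) / t.
Proof.
move=> t0; have tn0 : t != 0 by rewrite gt_eqF.
rewrite -powRD ?tn0 ?implybT// -(powR_inv1 (ltW t0)) -powRD ?tn0 ?implybT//.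
by congr (_ `^ _); ring.
Qed.

Lemma cabs_pair f h z : up z ->
  cabs (pair_integrand beta0 f h z) = wmod beta f z * wmod (beta0 - beta) h z / z.2.
Proof.
move=> z0; rewrite /pair_integrand !cabsM cabs_real ger0_norm ?powR_ge0// height_split// !wmodE.
by rewrite !mulrA; congr (_ * _ / _); rewrite -!mulrA; congr (_ * _); exact: mulrC.
Qed.

Lemma sint_pair f h :
  sint up (fun z => (cabs (pair_integrand beta0 f h z))%:E) = dpair (wmod beta f) (wmod (beta0 - beta) h).
Proof. by apply: eq_sint => z /cabs_pair ->. Qed.

Lemma pairing_bound : exists2 C, 0 < C & forall f h A B, cmeasurable f -> cmeasurable h -> 0 < A -> 0 < B ->
  (nX f <= A%:E)%E -> (nY h <= B%:E)%E ->
  hintegrable (pair_integrand beta0 f h) /\ cabs (pairing beta0 f h) <= C * (A * B).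
Proof.
have [C C0 hC] := tent_hoelder n0 a10 a12 a21 p1 q1 r1.
exists (C + C); first exact: addr_gt0.
move=> f h A B mf mh A0 B0 hf hh.
have hd := hC _ _ A B (nng_wmod beta mf) (nng_wmod (beta0 - beta) mh) A0 B0 hf hh.
have ih : hintegrable (pair_integrand beta0 f h).
  by split; [exact: cmeasurable_pair|rewrite sint_pair (le_lt_trans hd)// ltry].
split => //; rewrite mulrDl; apply: cabs_hint => //; by rewrite sint_pair.
Qed.

(** Turns an estimate stated for all positive majorants A of a norm into one with the norm itself, a
    vanishing norm included. *)
Lemma le_homogeneous (N : \bar R) (x c : R) : (0 <= N)%E -> (N < +oo)%E -> 0 <= c ->
  (forall A, 0 < A -> (N <= A%:E)%E -> x <= c * A) -> (x%:E <= c%:E * N)%E.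
Proof.
case: N => [N| |]//; rewrite lee_fin => N0 _ c0 h; rewrite -EFinM lee_fin.
apply/ler_addgt0Pl => e e0; have c1 : 0 < c + 1 by rewrite ltr_wpDl.
have d0 : 0 < e / (c + 1) by exact: divr_gt0.
apply: le_trans (h (N + e / (c + 1)) _ _) _.
- by rewrite ltr_wpDl.
- by rewrite lee_fin lerDl ltW.
- rewrite mulrDr addrC lerD2r mulrA ler_pdivrMr// [c * e]mulrC; apply: ler_wpM2l; first exact: ltW.
  by rewrite lerDl.
Qed.

Lemma nX_ge0 f : cmeasurable f -> (0 <= nX f)%E.
Proof. by move=> _; exact: poweR_ge0. Qed.

Lemma nX_le f F : cmeasurable f -> (forall z, up z -> wmod beta f z <= F z) -> (nX f <= NX F)%E.
Proof. by move=> mf fF; apply: (NX_mono n0 a10 a12 a21 p1 q1 r1 (nng_wmod beta mf)). Qed.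

Lemma X_le f F : cmeasurable f -> (forall z, up z -> wmod beta f z <= F z) -> (NX F < +oo)%E -> X f.
Proof. by move=> mf fF hF; split; [exact: mf|exact: (le_lt_trans (nX_le mf fF) hF)]. Qed.

Lemma small_multiple (N : \bar R) (A : R) : (0 <= N)%E -> (N < +oo)%E -> 0 < A ->
  exists2 c : R, 0 < c & (c%:E * N <= A%:E)%E.
Proof.
case: N => [N| |]//; rewrite lee_fin => N0 _ A0.
have d0 : 0 < A / (N + 1) by rewrite divr_gt0// ltr_wpDl.
exists (A / (N + 1)) => //.
by rewrite -EFinM lee_fin mulrAC ler_pdivrMr ?ltr_wpDl// ler_wpM2l ?(ltW A0)// lerDl.
Qed.

Lemma NX_small k F (A : R) : csupp k F -> 0 < A -> exists2 c : R, 0 < c & (NX (fun z => (c * F z)%R) <= A%:E)%E.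
Proof.
move=> cF A0; have hF := csupp_finite n0 a10 a12 a21 p1 q1 r1 cF.
have hF0 : (0 <= NX F)%E by exact: poweR_ge0.
have [c c0 hc] := small_multiple hF0 hF A0; exists c; first exact: c0.
by rewrite (NX_scale n0 a10 a12 a21 p1 q1 r1 c0 (csupp_nng cF)); exact: hc.
Qed.

Lemma csupp_scale k F c : 0 <= c -> csupp k F -> csupp k (fun z => c * F z).
Proof.
move=> c0 [bF Fk]; split; first exact: bnd_scale.
by move=> z; rewrite mulf_eq0 negb_or => /andP[_ /Fk].
Qed.

Lemma csupp_exhaust k : csupp k (\1_(exhaust k) : P -> R).
Proof.
split; first by apply: bnd_indic; exact: measurable_exhaust.
by move=> z; rewrite indicE; case: (boolP (z \in _)) => [/set_mem//|_]; rewrite eqxx.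
Qed.

(** The Whitney averages of F vanish identically on the half space, so F is dominated there by any
    multiple of the indicator of a compact piece, and such a multiple can have norm as small as
    desired. *)
Lemma NX_null F (A : R) : nng F -> nu [set z | F z != 0] = 0%E -> 0 < A -> (NX F <= A%:E)%E.
Proof.
move=> nF F0 A0; have [c c0 hc] := NX_small (csupp_exhaust 0) A0; apply: le_trans hc.
have rE : (1 <= r%:E)%E by rewrite lee_fin.
have WF0 z : up z -> WR a1 a2 r%:E (EFin \o F) z = 0%E.
  move=> zu; rewrite /WR.
  rewrite (@sint_integral R n _ P (whitney a1 a2) (fun w => (EFin \o F) w `^ r)%E (@measurable_whitney_family R n a1 a2) (nng_pow r nF)); last 2 first.
  - by move=> w; exact: (whitney_upper a10 a12 a21).
  - by move=> w _; exact: poweR_ge0.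
  rewrite (_ : \int[nu]_w _ = 0)%E ?poweR0r ?mule0//; last 2 first.
    by rewrite gt_eqF// invr_gt0 (lt_le_trans ltr01 r1).
  have mg := measurable_restr (@measurable_whitney_family R n a1 a2) (nng_pow r nF) z.
  rewrite -[RHS](@integral0 _ _ _ nu setT); apply: ae_eq_integral => //.
  have mN : measurable [set z | F z != 0].
    rewrite (_ : [set z | _] = ~` (F @^-1` [set 0])).
      by apply: measurableC; rewrite -[X in measurable X]setTI; exact: nF.1.
    by apply/seteqP; split => w /= /eqP.
  exists [set z | F z != 0]; split => // w /= hw; apply/negP => /eqP Fw; apply: hw => _.
  by rewrite /restr; case: asboolP => //= _; rewrite Fw powR0// gt_eqF// (lt_le_trans ltr01 r1).
have pE : (1 <= p%:E)%E by rewrite lee_fin.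
have qE : (1 <= q%:E)%E by rewrite lee_fin.
apply: (tnorm_mono pE qE) => z zu; first by rewrite WF0.
rewrite WF0//; apply: (WR_ge0 n0 a10 a12 a21 rE _ zu) => w.
by rewrite lee_fin indicE; apply: mulr_ge0; [exact: ltW|exact: ler0n].
Qed.

(** The phase opposite to that of h makes the pairing with h the integral of the moduli, at no cost
    in norm. The weight t^beta cancels the one in the definition of the tent space. *)
Definition test_fun F h (z : P) : R[i] := (F z * z.2 `^ beta)%:C%C * phase (h z).

Lemma cmeasurable_test F h : measurable_fun setT F -> cmeasurable h -> cmeasurable (test_fun F h).
Proof.
move=> mF mh; apply: cmeasurableM; last exact: cmeasurable_phase.
by apply: cmeasurable_real; apply: measurable_funM => //; exact: measurable_height.
Qed.

Let heightK (t : R) : 0 < t -> t `^ beta * t `^ (- beta) = 1.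
Proof. by move=> t0; rewrite -powRD ?subrr ?powRr0// [t == 0]gt_eqF// implybT. Qed.

Lemma wmod_test F h z : nng F -> up z -> wmod beta (test_fun F h) z <= F z.
Proof.
move=> [_ F0] zu; rewrite wmodE /test_fun cabsM cabs_real ger0_norm ?mulr_ge0 ?powR_ge0//.
rewrite -mulrA mulrCA -mulrA heightK// mulr1 mulrC; apply: ler_piMr => //; exact: cabs_phase.
Qed.

Lemma pairing_test F h : nng F ->
  pairing beta0 (test_fun F h) h = (fine (dpair F (wmod (beta0 - beta) h)))%:C%C.
Proof.
move=> nF; have e z : up z -> pair_integrand beta0 (test_fun F h) h z = (F z * wmod (beta0 - beta) h z / z.2)%:C%C.
  move=> zu; rewrite /pair_integrand /test_fun -[_ * phase _ * _]mulrA phaseM -!rmorphM /=; congr (_ %:C)%C.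
  rewrite wmodE height_split//.
  rewrite (_ : _ * _ * cabs (h z) * _ = F z * (cabs (h z) * z.2 `^ (- (beta0 - beta))) / z.2 * (z.2 `^ beta * z.2 `^ (- beta))); last by ring.
  by rewrite heightK// mulr1.
rewrite /pairing /hint_c; congr (fine _ +i* _)%C.
  by apply: eq_sint => z /e ->.
rewrite -[RHS]/(fine 0%E); congr fine; rewrite -[RHS](@sint0 R n up).
by apply: eq_sint => z /e ->.
Qed.

(** Where h vanishes the test function vanishes too, so its modulus equals F only where h is
    nonzero; this is enough, since h is a factor of the integrand. *)
Lemma dpair_test F h : nng F -> cmeasurable h ->
  hintegrable (pair_integrand beta0 (test_fun F h) h) -> dpair F (wmod (beta0 - beta) h) \is a fin_num.
Proof.
move=> nF mh [_]; rewrite sint_pair => h1.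
have e : dpair F (wmod (beta0 - beta) h) = dpair (wmod beta (test_fun F h)) (wmod (beta0 - beta) h).
  apply: eq_sint => z zu; congr (_ / _)%:E; rewrite !wmodE /test_fun cabsM cabs_real ger0_norm; last first.
    by rewrite mulr_ge0 ?powR_ge0//; exact: nF.2.
  rewrite [RHS](_ : _ = F z * (cabs (phase (h z)) * cabs (h z) * z.2 `^ (- (beta0 - beta))) * (z.2 `^ beta * z.2 `^ (- beta))); last by ring.
  by rewrite heightK// mulr1 -cabsM phaseM cabs_real (ger0_norm (cabs_ge0 _)).
rewrite e ge0_fin_numE//.
apply: sint_ge0; first exact: subset_refl.
by move=> z zu; rewrite lee_fin; apply: divr_ge0; [apply: mulr_ge0; exact: cabs_ge0|exact: ltW].
Qed.

Lemma lt_pinfty_le (N : \bar R) : (N < +oo)%E -> exists2 A : R, 0 < A & (N <= A%:E)%E.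
Proof.
case: N => [N| |]// _; last by exists 1; rewrite ?leNye.
by exists (`|N| + 1); rewrite ?ltr_wpDl// lee_fin (le_trans (ler_norm N))// lerDl.
Qed.

Lemma tnorm_ge0 (PP Q : \bar R) (g : P -> \bar R) : (1 <= PP)%E -> (1 <= Q)%E ->
  (forall z, up z -> (0 <= g z)%E) -> (0 <= tnorm PP Q g)%E.
Proof.
case: PP => [s| |]//; case: Q => [t| |]// _ _ g0; [exact: poweR_ge0|exact: poweR_ge0| |].
  pose v := (voln (ball_n (origin R n) 1) `^ (- t^-1) *
    sint (tent_hat (origin R n) 1) (fun z => g z `^ t * (z.2^-1)%:E) `^ t^-1)%E.
  apply: (@le_trans _ _ v); first by apply: mule_ge0; exact: poweR_ge0.
  apply: ereal_sup_ubound; exists (origin R n), (origin R n), 1; split; first exact: ltr01.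
  by split => //; rewrite /ball_n/= edistxx ltr01.
apply: le_ereal_inf_tmp => M hM; rewrite leNgt; apply/negP => M0.
pose w : P := (origin R n, 1); have w0 : 0 < w.2 by exact: ltr01.
have := nu_whitney_ge n0 a10 a12 a21 w0.
have -> : nu (whitney a1 a2 w) = 0%E.
  apply/(null_measurable (measurable_whitney a1 a2 w)); apply: nullS hM => z /(whitney_upper a10 a12 a21) zu.
  by split => //; exact: lt_le_trans (g0 z zu).
rewrite lee_fin leNgt => /negP; apply; apply: mulr_gt0.
  by apply: exprn_gt0; apply: mulr_gt0 => //; apply: mulr_gt0 => //; exact: eps_gt0 n0 a10.
by apply: mulr_gt0 => //; rewrite subr_gt0 (lt_trans a21)// (a2_gt1 a10 a12 a21).
Qed.

Lemma nY_ge0 h : cmeasurable h -> (0 <= nY h)%E.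
Proof.
move=> mh; apply: (tnorm_ge0 (conj_exp_ge1 p1) (conj_exp_ge1 q1)) => z zu.
by apply: (WR_ge0 n0 a10 a12 a21 (conj_exp_ge1 r1) _ zu) => w; rewrite lee_fin; exact: cabs_ge0.
Qed.

Lemma pairing_hintegrable f h : X f -> Y h -> hintegrable (pair_integrand beta0 f h).
Proof.
move=> [mf hf] [mh hh]; have [C C0 hC] := pairing_bound.
have [A A0 hA] := lt_pinfty_le hf; have [B B0 hB] := lt_pinfty_le hh.
by have [] := hC f h A B mf mh A0 B0 hA hB.
Qed.

Lemma pairing_lin f g h (a b : R[i]) : X f -> X g -> Y h ->
  pairing beta0 (fun z => a * f z + b * g z) h = a * pairing beta0 f h + b * pairing beta0 g h.
Proof.
move=> Xf Xg Yh; have [_ <-] := hintegrable_lin a b (pairing_hintegrable Xf Yh) (pairing_hintegrable Xg Yh).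
by congr hint_c; apply/funext => z; rewrite /pair_integrand; ring.
Qed.

Lemma pairing_linr f g h (a b : R[i]) : X f -> Y g -> Y h ->
  hintegrable (pair_integrand beta0 f (fun z => a * g z + b * h z)) /\
  pairing beta0 f (fun z => a * g z + b * h z) = a * pairing beta0 f g + b * pairing beta0 f h.
Proof.
move=> Xf Yg Yh; have [h1 h2] := hintegrable_lin a b (pairing_hintegrable Xf Yg) (pairing_hintegrable Xf Yh).
have e : pair_integrand beta0 f (fun z => a * g z + b * h z) =
    fun z => a * pair_integrand beta0 f g z + b * pair_integrand beta0 f h z.
  by apply/funext => z; rewrite /pair_integrand; ring.
by split; [rewrite e|rewrite /pairing e].
Qed.

Lemma pairing_continuous : exists2 C : R, 0 < C & forall h B, Y h -> 0 < B -> (nY h <= B%:E)%E ->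
  forall f, X f -> ((cabs (pairing beta0 f h))%:E <= (C * B)%:E * nX f)%E.
Proof.
have [C C0 hC] := pairing_bound; exists C => // h B [mh hh] B0 hB f [mf hf].
apply: le_homogeneous.
- exact: nX_ge0.
- exact: hf.
- exact: ltW (mulr_gt0 C0 B0).
move=> A A0 hA; have [_ h1] := hC f h A B mf mh A0 B0 hA hB.
by rewrite -mulrA [B * A]mulrC.
Qed.

(** Finiteness of [dpair] is required beforehand: the pairing sees only its [fine] part, which is 0
    for an infinite value. *)
Lemma norming_pairing : exists2 C : R, 0 < C & forall h M, cmeasurable h -> 0 < M ->
  (forall k F, csupp k F -> dpair F (wmod (beta0 - beta) h) \is a fin_num) ->
  (forall k F A, csupp k F -> 0 < A -> (NX F <= A%:E)%E -> cabs (pairing beta0 (test_fun F h) h) <= M * A) ->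
  (nY h <= (C * M)%:E)%E.
Proof.
have [C C0 hC] := tent_norming n0 a10 a12 a21 p1 q1 r1; exists C => // h M mh M0 fin hM.
rewrite nYE; apply: (hC _ M (nng_wmod _ mh) M0) => k F A cF A0 hF.
rewrite -(fineK (fin k F cF)) lee_fin; apply: le_trans (hM k F A cF A0 hF).
by rewrite pairing_test ?cabs_real ?ler_norm//; exact: csupp_nng cF.
Qed.

Lemma X_test k F h : csupp k F -> cmeasurable h -> X (test_fun F h) /\ (nX (test_fun F h) <= NX F)%E.
Proof.
move=> cF mh; have nF := csupp_nng cF; have mt := cmeasurable_test nF.1 mh.
have le z (zu : up z) := wmod_test h nF zu.
split; last exact: nX_le.
by apply: (X_le mt le); exact: (csupp_finite n0 a10 a12 a21 p1 q1 r1 cF).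
Qed.

Lemma test_funZ c F h : test_fun (fun z => c * F z) h = fun z => c%:C%C * test_fun F h z + 0 * test_fun F h z.
Proof. by apply/funext => z; rewrite /test_fun mul0r addr0 mulrA -rmorphM /= !mulrA. Qed.

Lemma null_nonzero g : cmeasurable g ->
  (forall k, dpair (\1_(exhaust k)) (wmod (beta0 - beta) g) = 0%E) -> null [set z | up z /\ g z <> 0].
Proof.
move=> mg h0; have mcg := measurable_cabs mg.
have mA k : measurable [set z | exhaust k z /\ cabs (g z) != 0].
  apply: measurableI; first exact: measurable_exhaust.
  rewrite [X in measurable X](_ : _ = ~` ((fun z => cabs (g z)) @^-1` [set 0])); last first.
    by apply/seteqP; split => w /= /eqP.
  by apply: measurableC; rewrite -[X in measurable X]setTI; exact: mcg.
apply: (@nullS _ _ _ (\bigcup_k [set z | exhaust k z /\ cabs (g z) != 0])).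
  by move=> z [/exhaust_cover[k hk] /eqP gz]; exists k => //; split => //; apply: contra gz => /eqP/cabs_eq0 ->.
apply: null_bigcup => k; apply/(null_measurable (mA k)).
have ck := csupp_exhaust k; have nk := csupp_nng ck; have nw := nng_wmod (beta0 - beta) mg.
have mf := measurable_dpair nk nw.
have := h0 k; rewrite (dpairE nk nw ck) => hI.
have : (\int[nu]_z `|((\1_(exhaust k) z : R) * wmod (beta0 - beta) g z / z.2)%:E|)%E = 0%E.
  rewrite -[RHS]hI; apply: eq_integral => z _; rewrite gee0_abs// lee_fin.
  rewrite indicE; case: (boolP (z \in exhaust k)) => [/set_mem/exhaust_gt0 z0|_]; last by rewrite !mul0r.
  by rewrite mul1r; apply: divr_ge0; [exact: cabs_ge0|exact: ltW].
move=> /(ae_eq_integral_abs nu measurableT mf)[N [mN N0 hN]].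
apply/eqP; rewrite eq_le measure_ge0 andbT -N0; apply: le_measure; [by rewrite inE; exact: mA|by rewrite inE|].
move=> z [/= zk gz]; apply: hN => /= /(_ I).
have z0 := exhaust_gt0 zk; rewrite indicE mem_set// mul1r wmodE => -[] /eqP.
by rewrite !mulf_eq0 (negbTE gz) invr_eq0 (gt_eqF z0) orbF /= gt_eqF// powR_gt0.
Qed.

(** The difference g pairs to 0 with its own test functions on every compact piece; the integral of
    its weighted modulus over each piece is therefore 0. *)
Lemma null_separated h h' : Y h -> Y h' -> (forall f, X f -> pairing beta0 f h' = pairing beta0 f h) ->
  null [set z | up z /\ h' z <> h z].
Proof.
move=> Yh Yh' hh; pose g z := 1 * h' z + (-1) * h z.
have mg : cmeasurable g by apply: cmeasurable_lin; [exact: Yh'.1|exact: Yh.1].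
apply: (@nullS _ _ _ [set z | up z /\ g z <> 0]).
  by move=> z [zu ne]; split => // /eqP; rewrite /g mul1r mulN1r subr_eq0 => /eqP.
apply: null_nonzero => // k; have ck := csupp_exhaust k; have nk := csupp_nng ck.
have [Xt _] := X_test ck mg.
have [ih e] := pairing_linr 1 (-1) Xt Yh' Yh.
have fin := dpair_test nk mg ih; rewrite -(fineK fin); congr EFin.
apply: (@complexI R); rewrite -(pairing_test g nk) e (hh _ Xt); ring.
Qed.

(** The upper bound is the boundedness of the pairing on the unit ball. For the lower one, test
    functions are rescaled to norm at most 1, so that any majorant of the supremum can serve as the
    constant M of [norming_pairing]. *)
Lemma opnorm_equiv : exists c C : R, 0 < c /\ 0 < C /\ forall h, Y h ->
  (c%:E * nY h <= ereal_sup [set (cabs (pairing beta0 f h))%:E | f in [set f | X f /\ (nX f <= 1)%E]])%E /\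
  (ereal_sup [set (cabs (pairing beta0 f h))%:E | f in [set f | X f /\ (nX f <= 1)%E]] <= C%:E * nY h)%E.
Proof.
have [C C0 hC] := pairing_bound; have [D D0 hD] := norming_pairing.
exists D^-1, C; split; first by rewrite invr_gt0.
split => // h Yh; have [mh hh] := Yh; set o := ereal_sup _; split; last first.
  apply: ge_ereal_sup => _ [f [[mf hf] f1] <-]; apply: le_homogeneous => //.
  - exact: nY_ge0.
  - exact: ltW.
  - by move=> B B0 hB; have [_] := hC f h 1 B mf mh ltr01 B0 f1 hB; rewrite mul1r.
have o0 : (0 <= o)%E.
  have [c c0 hc] := NX_small (csupp_exhaust 0) (@ltr01 R).
  have [Xt nt] := X_test (csupp_scale (ltW c0) (csupp_exhaust 0)) mh.
  apply: (@le_trans _ _ (cabs (pairing beta0 (test_fun (fun z => c * \1_(exhaust 0) z) h) h))%:E).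
    by rewrite lee_fin cabs_ge0.
  apply: ereal_sup_ubound; exists (test_fun (fun z => c * \1_(exhaust 0) z) h); last by [].
  by split; [exact: Xt|exact: (le_trans nt hc)].
have fin k F : csupp k F -> dpair F (wmod (beta0 - beta) h) \is a fin_num.
  move=> cF; have [Xt _] := X_test cF mh.
  by apply: dpair_test (pairing_hintegrable Xt Yh) => //; exact: csupp_nng cF.
have key M : 0 < M -> (o <= M%:E)%E -> (nY h <= (D * M)%:E)%E.
  move=> M0 oM; apply: hD => // k F A cF A0 hF; have nF := csupp_nng cF.
  have Ai : 0 < A^-1 by rewrite invr_gt0.
  pose F' z := A^-1 * F z.
  have cF' : csupp k F' by exact: csupp_scale (ltW Ai) cF.
  have nF' : (NX F' <= 1)%E.
    rewrite (NX_scale n0 a10 a12 a21 p1 q1 r1 Ai nF).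
    apply: (@le_trans _ _ (A^-1%:E * A%:E)%E); last by rewrite -EFinM mulVf// gt_eqF.
    by apply: lee_wpmul2l => //; rewrite lee_fin ltW.
  have [Xt nt] := X_test cF' mh.
  have : ((cabs (pairing beta0 (test_fun F' h) h))%:E <= M%:E)%E.
    apply: le_trans oM; apply: ereal_sup_ubound; exists (test_fun F' h); last by [].
    split; [exact: Xt|exact: (le_trans nt nF')].
  rewrite lee_fin.
  have -> : pairing beta0 (test_fun F' h) h = A^-1%:C%C * pairing beta0 (test_fun F h) h + 0 * pairing beta0 (test_fun F h) h.
    have [Xt' _] := X_test cF mh.
    by rewrite test_funZ (pairing_lin _ _ Xt' Xt' Yh).
  by rewrite mul0r addr0 cabsM cabs_real gtr0_norm// ler_pdivrMl// mulrC.
have [lo|lo] := ltP o (+oo)%E; last by apply: le_trans lo; rewrite leey.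
rewrite lee_pdivrMl//.
have nYf : nY h \is a fin_num by rewrite ge0_fin_numE ?nY_ge0.
rewrite -(fineK nYf); apply: (le_homogeneous o0 lo (ltW D0)) => A A0 hA.
by rewrite -lee_fin (fineK nYf); exact: key.
Qed.

(** * Bounded functionals as pairings *)

Section representation.
Variables (L : (P -> R[i]) -> R[i]) (K : R).
Hypotheses (linL : forall f g a b, X f -> X g -> L (fun z => a * f z + b * g z) = a * L f + b * L g)
  (K0 : 0 < K) (boundL : forall f A, X f -> 0 < A -> (nX f <= A%:E)%E -> cabs (L f) <= K * A).
Local Notation bsupp := (@bsupp _ P R exhaust).

Definition weighted (u : P -> R[i]) (z : P) : R[i] := u z * (z.2 `^ beta)%:C%C.

Lemma wmod_weighted u z : up z -> wmod beta (weighted u) z = cabs (u z).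
Proof. by move=> zu; rewrite wmodE /weighted cabsM cabs_real ger0_norm ?powR_ge0// -mulrA heightK// mulr1. Qed.

Lemma cmeasurable_weighted u : cmeasurable u -> cmeasurable (weighted u).
Proof. by move=> mu; apply: cmeasurableM => //; apply: cmeasurable_real; exact: measurable_height. Qed.

Local Notation re u := (weighted (fun z => (u z)%:C%C)).

Lemma X_re k u : bsupp k u -> X (re u) /\ (nX (re u) <= NX (fun z => `|u z|%R))%E.
Proof.
move=> [mu [c hc] uE]; have mr := cmeasurable_weighted (cmeasurable_real mu).
have le z : up z -> wmod beta (re u) z <= `|u z| by move=> zu; rewrite wmod_weighted// cabs_real.
have cu : csupp k (fun z => `|u z|).
  split; last by move=> z; rewrite normr_eq0 => /uE.
  split; first exact: measurableT_comp.
  by exists c => z; rewrite normr_ge0 hc.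
split; last exact: nX_le.
by apply: (X_le mr le); exact: (csupp_finite n0 a10 a12 a21 p1 q1 r1 cu).
Qed.

Lemma re_indic_bound k A (e : R) : measurable A -> A `<=` exhaust k -> 0 < e ->
  (NX (\1_A : P -> R) <= e%:E)%E -> cabs (L (re (\1_A))) <= K * e.
Proof.
move=> mA Ak e0 he; have [Xr hr] := X_re (bsupp_indic R mA Ak).
apply: (boundL Xr e0); apply: le_trans hr _.
by rewrite (_ : (fun z => _) = \1_A)//; apply/funext => z; rewrite ger0_norm// indicE ler0n.
Qed.

Section real_part.
Variable part : R[i] -> R.
Hypotheses (partD : forall z w (a b : R), part (a%:C%C * z + b%:C%C * w) = a * part z + b * part w)
  (part_le : forall z, `|part z| <= cabs z).

(** The bound for u supported in a compact piece comes from the finite norm of the indicator of that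
    piece, order continuity from [tent_order_continuous], and absolute continuity from [NX_null].
    Abstracting over [part] treats real and imaginary parts together. *)
Lemma part_density : exists2 h : P -> R, measurable_fun setT h & forall k u, bsupp k u ->
  nu.-integrable setT (EFin \o (fun z => u z * h z)) /\ part (L (re u)) = \int[nu]_z (u z * h z).
Proof.
apply: (@bounded_functional_density _ P R nu exhaust (@measurable_exhaust R n) _ (fun u => part (L (re u)))).
- by move=> k; apply: exhaustS.
- move=> k u v a b bu bv; have [Xu _] := X_re bu; have [Xv _] := X_re bv.
  rewrite -partD -(linL _ _ Xu Xv); congr (part (L _)); apply/funext => z.
  by rewrite /weighted rmorphD !rmorphM /=; ring.
- move=> k; have ck := csupp_exhaust k; have nk := csupp_nng ck.
  have [A A0 hA] := lt_pinfty_le (csupp_finite n0 a10 a12 a21 p1 q1 r1 ck).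
  exists (K * A) => u c c0 bu uc; have [Xu hu] := X_re bu.
  have [mu _ uE] := bu; have nu' : nng (fun z => `|u z|) by split => //; exact: measurableT_comp.
  have h : (NX (fun z => `|u z|%R) <= (A * c)%:E)%E.
    apply: (@le_trans _ _ (NX (fun z => (c * \1_(exhaust k) z)%R))).
      apply: (NX_mono n0 a10 a12 a21 p1 q1 r1 nu') => z _; rewrite indicE.
      case: (boolP (z \in _)) => [_|/negP zk]; first by rewrite mulr1.
      rewrite mulr0 normr_le0; apply: contrapT => /negP /uE zk'; apply: zk; exact: mem_set.
    rewrite (NX_scale n0 a10 a12 a21 p1 q1 r1 c0 nk) mulrC EFinM; apply: lee_wpmul2l => //.
    by rewrite lee_fin ltW.
  apply: le_trans (part_le _) _; rewrite -mulrA; exact: (boundL Xu (mulr_gt0 A0 c0) (le_trans hu h)).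
- move=> k B e mB BS B0 e0; have ck := csupp_exhaust k; have nk := csupp_nng ck.
  have eK : 0 < e / K by exact: divr_gt0.
  have [j hj] := tent_order_continuous n0 a10 a12 a21 p1 q1 r1 nk mB BS (fun z _ => B0 z) (csupp_finite n0 a10 a12 a21 p1 q1 r1 ck) eK.
  exists j => A mA AB; apply: le_trans (part_le _) _.
  have -> : e = K * (e / K) by rewrite mulrC divfK// gt_eqF.
  apply: (@re_indic_bound k A (e / K) mA _ eK); first by move=> z /AB[].
  apply: le_trans hj; apply: (NX_mono n0 a10 a12 a21 p1 q1 r1).
    by split; [exact: measurable_indic|move=> z; rewrite indicE ler0n].
  move=> z _; rewrite !indicE; case: (boolP (z \in A)) => [/set_mem/AB[h1 h2]|_]; last by rewrite mulr_ge0 ?ler0n.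
  by rewrite !mem_set// mulr1.
- move=> k A mA Ak A0; apply/eqP; rewrite -normr_eq0 eq_le normr_ge0 andbT.
  apply/ler_addgt0Pl => e e0; rewrite addr0; apply: le_trans (part_le _) _.
  have eK : 0 < e / K by exact: divr_gt0.
  have -> : e = K * (e / K) by rewrite mulrC divfK// gt_eqF.
  apply: (re_indic_bound mA Ak eK); apply: NX_null (eK).
    by split; [exact: measurable_indic|move=> z; rewrite indicE ler0n].
  rewrite (_ : [set z | _] = A); first exact: A0.
  apply/seteqP; split => z /=; rewrite indicE.
    by case: (boolP (z \in A)) => [/set_mem//|_]; rewrite eqxx.
  by move=> /mem_set ->; rewrite oner_eq0.
Qed.

End real_part.

Lemma functional_density : exists h, cmeasurable h /\ forall k u,
  bsupp k (fun z => complex.Re (u z)) -> bsupp k (fun z => complex.Im (u z)) ->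
  hintegrable (pair_integrand beta0 (weighted u) h) /\ L (weighted u) = pairing beta0 (weighted u) h.
Proof.
have [|h1 m1 hh1] := @part_density (@complex.Re R) _ (@cabs_Re R).
  by move=> z w a b; rewrite Re_add !Re_mul /= !mul0r !subr0.
have [|h2 m2 hh2] := @part_density (@complex.Im R) _ (@cabs_Im R).
  by move=> z w a b; rewrite Im_add !Im_mul /= !mul0r !addr0.
(* The exponent beta0 + 1 - beta cancels the t^beta of [weighted] and the t^(-beta0 - 1) of the
   pairing, so that the pairing is the plain integral of u against the two densities. *)
pose h z := (h1 z +i* h2 z)%C * (z.2 `^ (beta0 + 1 - beta))%:C%C.
have mh : cmeasurable h.
  by apply: cmeasurableM; [split|apply: cmeasurable_real; exact: measurable_height].
exists h; split => // k u b1 b2; have [u1 _] := X_re b1; have [u2 _] := X_re b2.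
have mu : cmeasurable u by split; [case: b1|case: b2].
have mp := cmeasurable_pair (cmeasurable_weighted mu) mh.
have e z : up z -> pair_integrand beta0 (weighted u) h z = u z * (h1 z +i* h2 z)%C.
  move=> zu; rewrite /pair_integrand /weighted /h.
  rewrite (_ : _ * _ * _ = u z * (h1 z +i* h2 z)%C * ((z.2 `^ beta)%:C * (z.2 `^ (beta0 + 1 - beta))%:C * (z.2 `^ (- beta0 - 1))%:C)%C); last by ring.
  rewrite -!rmorphM -!powRD ?(gt_eqF zu) ?implybT//.
  by rewrite (_ : _ + _ = 0) ?powRr0 ?mulr1//; ring.
have sup k' v z : bsupp k' v -> (\1_up z : R) * v z = v z.
  move=> [_ _ vE]; case: (eqVneq (v z) 0) => [->|/vE/exhaust_gt0 zu]; first by rewrite mulr0.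
  by rewrite indicE mem_set ?mul1r.
have [i11 e11] := hh1 _ _ b1; have [i21 e21] := hh1 _ _ b2.
have [i12 e12] := hh2 _ _ b1; have [i22 e22] := hh2 _ _ b2.
have r1E : (fun z => (\1_up z : R) * complex.Re (pair_integrand beta0 (weighted u) h z)) =
    fun z => complex.Re (u z) * h1 z - complex.Im (u z) * h2 z.
  apply/funext => z; rewrite -(sup _ _ z b1) -(sup _ _ z b2) indicE.
  case: (boolP (z \in up)) => [/set_mem zu|_]; last by rewrite !mul0r subrr.
  by rewrite !mul1r (e z zu) Re_mul.
have i1E : (fun z => (\1_up z : R) * complex.Im (pair_integrand beta0 (weighted u) h z)) =
    fun z => complex.Re (u z) * h2 z + complex.Im (u z) * h1 z.
  apply/funext => z; rewrite -(sup _ _ z b1) -(sup _ _ z b2) indicE.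
  case: (boolP (z \in up)) => [/set_mem zu|_]; last by rewrite !mul0r addr0.
  by rewrite !mul1r (e z zu) Im_mul.
have ih : hintegrable (pair_integrand beta0 (weighted u) h).
  apply/(hintegrableP mp); rewrite r1E i1E; split.
    apply: (@eq_integrable _ _ _ nu setT measurableT ((EFin \o (fun z => complex.Re (u z) * h1 z)%R) \- (EFin \o (fun z => complex.Im (u z) * h2 z)%R))%E) => //.
    exact: integrableB.
  apply: (@eq_integrable _ _ _ nu setT measurableT ((EFin \o (fun z => complex.Re (u z) * h2 z)%R) \+ (EFin \o (fun z => complex.Im (u z) * h1 z)%R))%E) => //.
  exact: integrableD.
split => //; rewrite /pairing hint_cE// r1E i1E RintegralB// RintegralD// -e11 -e22 -e12 -e21.
have -> : weighted u = fun z => 1 * re (fun z => complex.Re (u z)) z + 'i%C * re (fun z => complex.Im (u z)) z.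
  by apply/funext => z; rewrite /weighted {1}(complexE (u z)); ring.
rewrite (linL _ _ u1 u2).
move: (L _) (L _) => a b; apply: complex_ext; rewrite ?Re_add ?Im_add ?Re_mul ?Im_mul /=; ring.
Qed.

(** The test functions of h are bounded with compact support up to the weight, so L is already known
    to be the pairing on them. The bound on L thus becomes the testing condition that puts h into
    the dual space, and only then is the pairing continuous and density of truncations
    applicable. *)
Lemma functional_representation : exists h, Y h /\ forall f, X f -> L f = pairing beta0 f h.
Proof.
have [h [mh hh]] := functional_density; exists h.
have bs k F (u : P -> R[i]) : csupp k F -> cmeasurable u -> (forall z, cabs (u z) <= F z) ->
    bsupp k (fun z => complex.Re (u z)) /\ bsupp k (fun z => complex.Im (u z)).
  move=> [[mF [c hc]] Fk] [m1 m2] uF.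
  have uk (g : R) z : `|g| <= cabs (u z) -> g != 0 -> exhaust k z.
    move=> gu g0; apply: Fk; rewrite gt_eqF//; apply: lt_le_trans (uF z).
    by apply: lt_le_trans gu; rewrite normr_gt0.
  have uc z : cabs (u z) <= c by apply: le_trans (uF z) _; have /andP[] := hc z.
  split; split => //.
  - by exists c => z; exact: le_trans (cabs_Re _) (uc z).
  - by move=> z; apply: uk; exact: cabs_Re.
  - by exists c => z; exact: le_trans (cabs_Im _) (uc z).
  - by move=> z; apply: uk; exact: cabs_Im.
have [D D0 hD] := norming_pairing.
have testE k F : csupp k F -> hintegrable (pair_integrand beta0 (test_fun F h) h) /\ L (test_fun F h) = pairing beta0 (test_fun F h) h.
  move=> cF; have nF := csupp_nng cF.
  pose u z := (F z)%:C%C * phase (h z).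
  have -> : test_fun F h = weighted u.
    by apply/funext => z; rewrite /test_fun /weighted /u rmorphM /=; ring.
  have [|z|b1 b2] := bs k F u cF.
  - by apply: cmeasurableM; [exact: cmeasurable_real nF.1|exact: cmeasurable_phase].
  - rewrite /u cabsM cabs_real ger0_norm ?nF.2//; apply: ler_piMr; [exact: nF.2|exact: cabs_phase].
  exact: hh b1 b2.
have Yh : Y h.
  split => //; apply: (@le_lt_trans _ _ (D * K)%:E); last by rewrite ltry.
  apply: hD => // [k F cF|k F A cF A0 hF].
    by apply: dpair_test (testE k F cF).1 => //; exact: csupp_nng cF.
  rewrite -(testE k F cF).2; have [Xt nt] := X_test cF mh.
  exact: (boundL Xt A0 (le_trans nt hF)).
split => // f Xf; have [mf hf] := Xf; have nw := nng_wmod beta mf.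
have [C C0 hC] := pairing_continuous; have [B B0 hB] := lt_pinfty_le Yh.2.
have CB : 0 < K + C * B by rewrite addr_gt0// mulr_gt0.
apply/eqP; rewrite -subr_eq0; apply/eqP/cabs_eq0/eqP; rewrite eq_le cabs_ge0 andbT.
apply/ler_addgt0Pl => e e0; rewrite addr0.
(* K bounds L and C B bounds the pairing with h, so a remainder of norm at most d contributes at
   most e to the difference of the two. *)
pose d := e / (K + C * B); have d0 : 0 < d by exact: divr_gt0.
pose S j := cutoff (wmod beta f) j.
have mS j : measurable (S j) by apply: measurable_cutoff; exact: nw.1.
have [j hj] := tent_order_continuous n0 a10 a12 a21 p1 q1 r1 nw (fun j => measurableC (mS j))
  (fun j => subsetC (@cutoffS R n (wmod beta f) j))
  (fun z zu => let: ex_intro k hk := cutoff_cover (nw.2 z) zu in ex_intro _ k (fun nk : ~ S k z => nk hk)) hf d0.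
(* On f1, cut off in support and in size, L is the pairing with h; f2 is the remainder, whose norm
   is at most d by order continuity. *)
pose f1 z := (\1_(S j) z : R)%:C%C * f z; pose f2 z := (\1_(~` S j) z : R)%:C%C * f z.
have mfi (U : set P) : measurable U -> cmeasurable (fun z => (\1_U z : R)%:C%C * f z).
  by move=> mU; apply: cmeasurableM => //; apply: cmeasurable_real; exact: measurable_indic.
have wfi (U : set P) z : wmod beta (fun z => (\1_U z : R)%:C%C * f z) z = wmod beta f z * \1_U z.
  by rewrite !wmodE cabsM cabs_real ger0_norm ?indicE ?ler0n// -mulrA mulrC.
have Xfi (U : set P) : measurable U -> X (fun z => (\1_U z : R)%:C%C * f z).
  move=> mU; apply: (X_le (mfi _ mU) _ hf) => z _; rewrite wfi; apply: ler_piMr; first exact: nw.2.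
  by rewrite indicE; case: (_ \in _); rewrite ?ler01.
have X1 : X f1 by exact: Xfi.
have X2 : X f2 by apply: Xfi; exact: measurableC.
have n2 : (nX f2 <= d%:E)%E by rewrite nXE (_ : wmod beta f2 = fun z => wmod beta f z * \1_(~` S j) z)//; apply/funext => z; exact: wfi.
have fE : f = fun z => 1 * f1 z + 1 * f2 z.
  apply/funext => z; rewrite /f1 /f2 !mul1r -mulrDl -rmorphD /= !indicE in_setC.
  by case: (z \in S j); rewrite /= ?addr0 ?add0r mul1r.
have L1 : L f1 = pairing beta0 f1 h.
  pose u z := (\1_(S j) z : R)%:C%C * wt beta f z.
  have -> : f1 = weighted u.
    apply/funext => z; rewrite /f1 /weighted /u /wt indicE; case: (boolP (z \in S j)) => [/set_mem[zj _]|_]; last by rewrite !mul0r.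
    by rewrite -!mulrA -rmorphM /= [z.2 `^ _ * _]mulrC (heightK (exhaust_gt0 zj)) mulr1.
  have [|z|b1 b2] := bs j (trunc (wmod beta f) j) u (csupp_trunc j nw).
  - by apply: cmeasurableM; [apply: cmeasurable_real; exact: measurable_indic|exact: cmeasurableM mf (cmeasurable_real (measurable_height _))].
  - by rewrite /u cabsM cabs_real ger0_norm ?indicE ?ler0n// mulrC /trunc indicE.
  by have [] := hh j u b1 b2.
have -> : L f - pairing beta0 f h = L f2 - pairing beta0 f2 h.
  by rewrite fE (linL _ _ X1 X2) (pairing_lin _ _ X1 X2 Yh) L1 !mul1r opprD addrACA subrr add0r.
apply: le_trans (cabsD _ _) _.
have -> : cabs (- pairing beta0 f2 h) = cabs (pairing beta0 f2 h).
  by apply: complexI; rewrite -!cabsE normrN.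
have -> : e = K * d + C * B * d by rewrite -mulrDl mulrC divfK// gt_eqF.
apply: lerD; first exact: (boundL X2 d0 n2).
rewrite -lee_fin; apply: le_trans (hC h B Yh B0 hB f2 X2) _.
by rewrite [leRHS]EFinM; apply: lee_wpmul2l; [rewrite lee_fin ltW// mulr_gt0|exact: n2].
Qed.

End representation.

End tent_duality.

Unset Implicit Arguments.

Theorem theorem5p4 (R : realType) (n : nat) (a1 a2 p q r beta beta0 : R) :
  (0 < n)%N -> 0 < a1 -> a1 < a2^-1 -> a2^-1 < 1 ->
  1 <= p -> 1 <= q -> 1 <= r ->
  let X := @inTent R n a1 a2 p%:E q%:E r%:E beta in
  let nX := @tent_norm R n a1 a2 p%:E q%:E r%:E beta in
  let Y := @inTent R n a1 a2 (conj_exp p) (conj_exp q) (conj_exp r) (beta0 - beta) in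
  let nY := @tent_norm R n a1 a2 (conj_exp p) (conj_exp q) (conj_exp r) (beta0 - beta) in
  let opnorm := fun h : pt R n -> R[i] =>
    ereal_sup [set (cabs (pairing beta0 f h))%:E | f in [set f | X f /\ (nX f <= 1)%E]] in
  (* every h in the dual space defines a bounded linear functional *)
  (forall h, Y h ->
     (forall f, X f -> hintegrable (pair_integrand beta0 f h)) /\
     (forall (f g : pt R n -> R[i]) (a b : R[i]), X f -> X g ->
        pairing beta0 (fun z => a * f z + b * g z) h
        = a * pairing beta0 f h + b * pairing beta0 g h) /\
     (exists C : R, forall f, X f ->
        ((cabs (pairing beta0 f h))%:E <= C%:E * nX f)%E)) /\
  (* every bounded linear functional is of this form, for a unique h *)
  (forall L : (pt R n -> R[i]) -> R[i],
     (forall (f g : pt R n -> R[i]) (a b : R[i]), X f -> X g ->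
        L (fun z => a * f z + b * g z) = a * L f + b * L g) ->
     (exists C : R, forall f, X f -> ((cabs (L f))%:E <= C%:E * nX f)%E) ->
     exists h, Y h /\ (forall f, X f -> L f = pairing beta0 f h) /\
       (forall h', Y h' -> (forall f, X f -> L f = pairing beta0 f h') ->
          null [set z | upper z /\ h' z <> h z])) /\
  (* the functional norm is equivalent to the tent-space norm of h *)
  (exists c C : R, 0 < c /\ 0 < C /\
     forall h, Y h -> (c%:E * nY h <= opnorm h)%E /\ (opnorm h <= C%:E * nY h)%E).
Proof.
move=> n0 a10 a12 a21 p1 q1 r1; cbv zeta; split; [|split].
- move=> h Yh; split; first by move=> f Xf; exact: (pairing_hintegrable n0 a10 a12 a21 p1 q1 r1 Xf Yh).
  split; first by move=> f g a b Xf Xg; exact: (pairing_lin n0 a10 a12 a21 p1 q1 r1 a b Xf Xg Yh).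
  have [C C0 hC] := pairing_continuous beta beta0 n0 a10 a12 a21 p1 q1 r1.
  by have [B B0 hB] := lt_pinfty_le Yh.2; exists (C * B); exact: (hC h B Yh B0 hB).
(* The given bound may be nonpositive; enlarging it to a positive K allows the formulation with
   majorants A. *)
- move=> L linL [C hC]; pose K := `|C| + 1; have K0 : 0 < K by rewrite ltr_wpDl.
  have boundL f A : inTent a1 a2 p%:E q%:E r%:E beta f -> 0 < A ->
      (tent_norm a1 a2 p%:E q%:E r%:E beta f <= A%:E)%E -> cabs (L f) <= K * A.
    move=> Xf A0 hA; have N0 := nX_ge0 a1 a2 p q r beta Xf.1.
    rewrite -lee_fin EFinM; apply: le_trans (hC f Xf) _.
    have CK : (C%:E <= K%:E)%E by rewrite lee_fin (le_trans (ler_norm C))// lerDl.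
    apply: le_trans (lee_wpmul2r N0 CK) _; apply: lee_wpmul2l; last exact: hA.
    by rewrite lee_fin ltW.
  have [h [Yh hL]] := functional_representation beta0 n0 a10 a12 a21 p1 q1 r1 linL K0 boundL.
  exists h; split; first exact: Yh.
  split; first exact: hL.
  move=> h' Yh' hL'; apply: (null_separated n0 a10 a12 a21 p1 q1 r1 Yh Yh') => f Xf.
  by rewrite -(hL f Xf) -(hL' f Xf).
- exact: (opnorm_equiv beta beta0 n0 a10 a12 a21 p1 q1 r1).
Qed.
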